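(* Let $t_o\in\Delta\subset T=\mathbb C^n$, let $S_o=S(t_o)$ be its stratum, and let $U$ be a connected open subset of $T$ containing $t_o$ such that (a) $U\cap S_o$ is simply connected, (b) $U$ is star shaped with respect to $U\cap S_o$, (c) for every stratum $S$ such that $\overline S\cap S_o=\emptyset$, one also has $U\cap\overline S=\emptyset$. Let $A_1$ be a constant complex $n\times n$ matrix such that (i) $A_1^{\mathrm{nd}}\in\operatorname{im}\operatorname{ad}(\Lambda(t_o))$, (ii) $A_1^{\mathrm d}$ is partially non-resonant: for all $i,j\in\{1,\dots,n\}$ with $t_{o,i}=t_{o,j}$, one has $(A_1)_{ii}-(A_1)_{jj}\notin\mathbb Z\smallsetminus\{0\}$. Then there exist a holomorphic hypersurface $\Theta$ in $U$ not containing $t_o$ and a holomorphic matrix $F_1^{\mathrm{nd}}(t)$ on $U\smallsetminus\Theta$ with zeros on the diagonal such that the meromorphic connection on the trivial bundle with matrix $$-d(\Lambda(t)/z)+\bigl([\Lambda(t),F_1^{\mathrm{nd}}(t)]+A_1^{\mathrm d}\bigr)\frac{dz}{z}-[d\Lambda(t),F_1^{\mathrm{nd}}(t)]$$ is integrable, restricts at $t=t_o$ to the system with matrix $$\Bigl(\frac{\Lambda(t_o)}{z}+A_1\Bigr)\frac{dz}{z},$$ and is formally equivalent at $z=0$ to the connection with matrix $$-d(\Lambda(t)/z)+A_1^{\mathrm d}\,\frac{dz}{z}.$$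
   Context: Notation. For $t\in T=\mathbb C^n$, $\Lambda(t)=\operatorname{diag}(t_1,\dots,t_n)$. For a square matrix $M$, $M=M^{\mathrm d}+M^{\mathrm{nd}}$ is its decomposition into diagonal and non-diagonal parts. $\operatorname{ad}(\Lambda(t_o))(B)=[\Lambda(t_o),B]$, so that $A\in\operatorname{im}\operatorname{ad}(\Lambda(t_o))$ iff $A_{ij}=0$ whenever $t_{o,i}=t_{o,j}$. Connections are in the variables $(t,z)$; $d$ is the total differential in these variables, and a connection with matrix $M$ is $d+M$ on the trivial bundle of rank $n$. Formally equivalent at $z=0$ means equivalent by a base change that is formal with respect to $z$ and locally holomorphic with respect to $t$. Strata. $\Delta$ is the union of the diagonal hyperplanes $\{t_i=t_j\}$, $i\ne j$. Two points $t,t'$ belong to the same stratum iff, for all $i,j$, $t_i=t_j\Leftrightarrow t'_i=t'_j$; $S(t)$ is the stratum of $t$. The strata of $\Delta$ are those contained in $\Delta$, and $T\smallsetminus\Delta$ is the open stratum. The closure of a stratum is a linear subspace. Star-shapedness. A stratum $S_o$ of $\Delta$ determines a partition $\{1,\dots,n\}=\bigsqcup_{r\in R}I_r$ with $i,j$ in the same $I_r$ iff $t_i=t_j$ on $S_o$. Choose an element of each $I_r$, also denoted $r$, set $I'_r=I_r\smallsetminus\{r\}$, and use the coordinates $(t_r)_{r\in R}$ and $\tau_i^r=t_i-t_r$ ($r\in R$, $i\in I'_r$) to identify $T$ with $\overline{S_o}\times\mathbb C^m$, $m=n-\#R$. Let $p_o$ be the projection forgetting the $\tau$-coordinates, and endow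 $\mathbb C^m$ with its standard Euclidean metric. (If $U$ satisfies (c), then $p_o(U)\subset S_o$.) Then $U$ is star shaped with respect to $U\cap S_o$ if, for every $t\in U$, $U$ contains the Euclidean ball, centered at the origin (that is, at $p_o(t)$) and containing $t$ (i.e. of radius $|\tau(t)|$), of the linear subspace $\overline{S(t)}\cap p_o^{-1}(p_o(t))$ of $p_o^{-1}(p_o(t))\simeq\mathbb C^m$. *)

(* Defs.v *)
From HB Require Import structures.
From mathcomp Require Import all_boot all_order all_algebra.
From mathcomp Require Import complex.
From mathcomp Require Import all_classical all_reals topology normedtype.
From mathcomp Require Import sequences derive.

Set Implicit Arguments.
Unset Strict Implicit.
Unset Printing Implicit Defensive.

Import Order.TTheory GRing.Theory Num.Theory.
Import numFieldNormedType.Exports.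

Local Open Scope classical_set_scope.
Local Open Scope ring_scope.

(* The complex numbers are [R[i]] with [R : realType].  They inherit their
   topology and their normed module structure over themselves from their
   structure of numFieldType; this makes the inheritance available on the type
   [R[i]] itself, as needed for products with [R[i]]. *)
HB.instance Definition _ (R : realType) :=
  NormedModule.copy R[i] (R[i] : numFieldType)^o.

Section SimplyConnected.
Variables (R : realType) (X : topologicalType).

Definition unit_itv : set R := [set s | 0 <= s <= 1].

Definition path_in (A : set X) (g : R -> X) : Prop :=
  {within unit_itv, continuous g} /\ (forall s, unit_itv s -> A (g s)).

Definition path_connected (A : set X) : Prop :=
  forall x y, A x -> A y -> exists g, [/\ path_in A g, g 0 = x & g 1 = y].

Definition null_homotopic (A : set X) (g : R -> X) : Prop :=
  exists H : R * R -> X,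
    [/\ {within unit_itv `*` unit_itv, continuous H},
        (forall r s, unit_itv r -> unit_itv s -> A (H (r, s))),
        (forall s, unit_itv s -> H (0, s) = g s /\ H (1, s) = g 0)
      & (forall r, unit_itv r -> H (r, 0) = g 0 /\ H (r, 1) = g 0)].

Definition simply_connected (A : set X) : Prop :=
  path_connected A /\
  (forall g, path_in A g -> g 0 = g 1 -> null_homotopic A g).

End SimplyConnected.

Section Connections.
Variables (R : realType) (n : nat).

Local Notation C := R[i].
Local Notation T := 'rV[C]_n.

Implicit Types (t s : T) (A B : 'M[C]_n).

Definition lie A B : 'M[C]_n := A *m B - B *m A.

Definition diag_part A : 'M[C]_n := \matrix_(i, j) (if i == j then A i j else 0).

Definition nondiag_part A : 'M[C]_n := A - diag_part A.

(* The matrix Lambda(t) is [diag_mx t]. *)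
Definition im_ad (t : T) : set 'M[C]_n :=
  [set A | exists B, A = lie (diag_mx t) B].

Definition partially_nonresonant (t : T) A : Prop :=
  forall i j, t 0 i = t 0 j -> forall k : int, k != 0 ->
    A i i - A j j != k%:~R.

Definition Delta : set T :=
  [set t | exists i j, i != j /\ t 0 i = t 0 j].

Definition stratum (s : T) : set T :=
  [set t | forall i j, s 0 i = s 0 j <-> t 0 i = t 0 j].

(* The choice of an element in each block of the partition of the indices
   attached to [stratum s]: [rep i] is the element chosen in the block of i. *)
Definition block_choice (s : T) (rep : 'I_n -> 'I_n) : Prop :=
  (forall i, s 0 (rep i) = s 0 i) /\
  (forall i j, s 0 i = s 0 j -> rep i = rep j).

(* The projection p_o: [proj_o rep t] is the point of the closure of the stratum
   having the same coordinates [t_r], r a chosen index, as t. *)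
Definition proj_o (rep : 'I_n -> 'I_n) (t : T) : T := \row_i t 0 (rep i).

(* The coordinates tau_i = t_i - t_(rep i), extended by 0 to the chosen
   indices, which changes neither their Euclidean norm nor their fibers. *)
Definition tau (rep : 'I_n -> 'I_n) (t : T) : T :=
  \row_i (t 0 i - t 0 (rep i)).

Definition euclidean_norm (v : T) : C := sqrtC (\sum_i `|v 0 i| ^+ 2).

Definition star_shaped (rep : 'I_n -> 'I_n) (U : set T) : Prop :=
  forall t, U t -> forall t',
    closure (stratum t) t' -> proj_o rep t' = proj_o rep t ->
    euclidean_norm (tau rep t') <= euclidean_norm (tau rep t) -> U t'.

(* Only used for D open: holomorphic = complex Frechet differentiable. *)
Definition holomorphic_on (V W : normedModType C) (D : set V) (f : V -> W) :
    Prop :=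
  forall x, D x -> differentiable f x.

(* Closed analytic subset of U, of pure codimension 1 or empty. *)
Definition hypersurface (U Theta : set T) : Prop :=
  Theta `<=` U /\
  forall x, U x -> exists (V : set T) (f : T -> C),
    [/\ [/\ open V, connected V, V x & V `<=` U],
        holomorphic_on V f, exists2 y, V y & f y != 0
      & Theta `&` V = [set y | V y /\ f y = 0]].

(* Matrix-valued 1-forms in the variables (t, z): [omega p v] is the value at
   the point p on the tangent vector v, both in C^n * C. *)
Definition mx_form := T * C -> T * C -> 'M[C]_n.

Definition d_of (f : T * C -> 'M[C]_n) : mx_form := fun p v => 'd f p v.

Definition dz_over_z (B : T -> 'M[C]_n) : mx_form :=
  fun p v => (v.2 / p.2) *: B p.1.

(* - d(Lambda(t)/z) + A dz/z *)
Definition diagonal_connection A : mx_form := fun p v =>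
  - d_of (fun q => q.2^-1 *: diag_mx q.1) p v + dz_over_z (fun=> A) p v.

(* - d(Lambda(t)/z) + ([Lambda(t), F(t)] + A) dz/z - [d Lambda(t), F(t)] *)
Definition deformed_connection (F : T -> 'M[C]_n) A : mx_form := fun p v =>
  - d_of (fun q => q.2^-1 *: diag_mx q.1) p v
  + dz_over_z (fun t => lie (diag_mx t) (F t) + A) p v
  - lie (d_of (fun q => diag_mx q.1) p v) (F p.1).

Definition off_pole (W : set T) : set (T * C) :=
  [set p | W p.1 /\ p.2 != 0].

(* (d omega + omega /\ omega)(u, v) at p, for constant vector fields u, v *)
Definition curvature (omega : mx_form) (p u v : T * C) : 'M[C]_n :=
  'd (omega^~ v) p u - 'd (omega^~ u) p v
  + (omega p u *m omega p v - omega p v *m omega p u).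

Definition integrable_connection (W : set T) (omega : mx_form) : Prop :=
  (forall v, holomorphic_on (off_pole W) (omega^~ v)) /\
  (forall p u v, off_pole W p -> curvature omega p u v = 0).

(* The pullback of omega by z |-> (t, z); z is the point, w the tangent
   vector. *)
Definition restrict_at (t : T) (omega : mx_form) (z w : C) : 'M[C]_n :=
  omega (t, z) (0, w).

(* (Lambda(t)/z + A) dz/z *)
Definition system_at (t : T) A (z w : C) : 'M[C]_n :=
  (w / z) *: (z^-1 *: diag_mx t + A).

(* z^m omega has no pole at z = 0 and its expansion there is
   \sum_k z^k (a k). *)
Definition z_expansion (V : set T) (omega : mx_form) (m : nat)
    (a : nat -> T -> T * C -> 'M[C]_n) : Prop :=
  forall t v, V t -> \forall z \near (0 : C)^',
    series (fun k => z ^+ k *: a k t v) @ \oo --> z ^+ m *: omega (t, z) v.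

(* The coefficient of z^k in dG, for the formal series G = \sum_k z^k (G k). *)
Definition formal_d (G : nat -> T -> 'M[C]_n) (k : nat) (t : T) (v : T * C) :
    'M[C]_n :=
  'd (G k) t v.1 + (k.+1%:R * v.2) *: G k.+1 t.

(* d + omega and d + omega' are related, near each point of W, by a base change
   G in GL_n(O(V)[[z]]), that is omega' = G^-1 omega G + G^-1 dG.  The last
   condition is the identity of formal power series in z
   z^m dG + (z^m omega) G = G (z^m omega'). *)
Definition formally_equivalent (W : set T) (omega omega' : mx_form) : Prop :=
  forall x, W x -> exists (V : set T) (G : nat -> T -> 'M[C]_n) (m : nat)
      (a a' : nat -> T -> T * C -> 'M[C]_n),
    [/\ [/\ open V, V x & V `<=` W],
        (forall k, holomorphic_on V (G k)) /\
        (forall t, V t -> G 0%N t \in unitmx),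
        z_expansion V omega m a, z_expansion V omega' m a'
      & forall k t v, V t ->
          (if (m <= k)%N then formal_d G (k - m)%N t v else 0)
          + \sum_(j < k.+1) a j t v *m G (k - j)%N t
          = \sum_(j < k.+1) G (k - j)%N t *m a' j t v].

End Connections.

(* Main.v *)
Require Import Defs.
From HB Require Import structures.
From mathcomp Require Import all_boot all_order all_algebra.
From mathcomp Require Import complex.
From mathcomp Require Import all_classical all_reals topology normedtype.
From mathcomp Require Import sequences derive landau.
From mathcomp Require Import zify ring lra.

Set Implicit Arguments.
Unset Strict Implicit.
Unset Printing Implicit Defensive.

Import Order.TTheory GRing.Theory Num.Theory.
Import numFieldNormedType.Exports.

Local Open Scope classical_set_scope.
Local Open Scope ring_scope.

(* Write the deformed connection as the transform of the diagonal one by a formal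
   base change [\sum_k z^k N_k(t)], [N_0 = 1], with [F_1] the non-diagonal part of
   [- N_1].  It is integrable and formally equivalent to the diagonal one as soon
   as, with [L = diag t] and [V = D + [N_1, L]],
     [L N_(k+1) + V N_k + k N_k = N_(k+1) L + N_k D] and
     [d N_k = [N_1, dL] N_k + [dL, N_(k+1)]];
   flatness follows from these relations for [k <= 2].

   By (c), coordinates which agree at a point q of U agree at t_o, hence (ii)
   holds at q and the first relation is solved there recursively, with [N_k = O(k!
   C^k)] (at t_o, with [V = A_1], using (i)). On the Borel side, with zeta = 1/z,
   transporting this formal solution from q to a nearby t amounts to finding a
   sequence of matrices u such that, after multiplication of [\sum_m u_m zeta^m]
   by the formal solution at q and by [exp (- zeta (diag t - diag q))], the terms
   in [zeta^m], m >= 0, reduce to 1. The Gevrey estimate makes this a Fredholm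
   problem (identity plus a contraction on the tail, and a finite determinant on
   the head), whose determinant f(t) is holomorphic: where f does not vanish the
   solution exists, is unique, and gives the [N_k(t)]; differentiating the problem
   gives the relations above. Conversely, f does not vanish at a point near which
   the [N_k] extend holomorphically, so that the zero loci of the determinants at
   two nearby base points agree and Theta = {f = 0} is well defined.

   The local solutions are continued along U: first along the intersection of U
   with S_o, where there is no monodromy by (a), then from p_o(t) to t along a
   segment, contained in U by (b), whose points other than p_o(t) lie in the
   stratum of t. *)

(** * Norms and uniform limits of polynomials *)

(** Holomorphic functions are handled as uniform limits of polynomials on balls. Cauchy's estimates
    for a polynomial restricted to a complex line follow from averages over roots of unity and pass
    to uniform limits, so that no integral occurs. The Gevrey estimate in k! / r^k is matched by
    sequences with |u_m| <= B rho^m / m!, rho <= r / 4, which makes each coefficient of the products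
    a convergent sum. Multiplying the nonnegative part of the product back by the inverse
    exponential turns the operator into the identity plus O(1 / m): the contraction on the tail
    comes from there. The determinant depends on the base point, so what is continued is a set of
    regular points together with a solution on it, subject to a maximality condition. Continuation
    needs a radius that does not shrink. The radius at q is governed by the distances between its
    distinct coordinates; they degenerate when q tends to a smaller stratum, but are bounded below
    near each point of a fixed stratum. Hence the restriction to paths inside a stratum, the
    construction being restarted at regular points of it. *)

Section Modulus.
Variable R : realType.
Local Notation C := R[i].
Local Notation rc := (real_complex R).
Implicit Types x y : C.

(** The norm of [R[i]] takes its values in [R[i]], which is only partially ordered; its real part
    moves the estimates to the ordered field [R], within the reach of [lra] and [nra]. *)
Definition nm x : R := complex.Re `|x|.

Lemma nmE x : `|x| = rc (nm x).
Proof. by rewrite /nm normc_def. Qed.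

Lemma nm_ge0 x : 0 <= nm x.
Proof. by rewrite -ler0c -nmE normr_ge0. Qed.

Lemma nm0 : nm 0 = 0.
Proof. by rewrite /nm normr0. Qed.

Lemma nm1 : nm 1 = 1.
Proof. by rewrite /nm normr1. Qed.

Lemma nm_eq0 x : nm x = 0 -> x = 0.
Proof. by move=> h; apply/normr0_eq0; rewrite nmE h. Qed.

Lemma nm_gt0 x : (0 < nm x) = (x != 0).
Proof.
rewrite lt_def nm_ge0 andbT; congr negb; apply/eqP/eqP => [/nm_eq0//|->].
exact: nm0.
Qed.

Lemma nmD x y : nm (x + y) <= nm x + nm y.
Proof. by rewrite -lecR rmorphD/= -!nmE ler_normD. Qed.

Lemma nmN x : nm (- x) = nm x.
Proof. by rewrite /nm normrN. Qed.

Lemma nmB x y : nm (x - y) <= nm x + nm y.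
Proof. by rewrite -(nmN y) nmD. Qed.

Lemma nmC x y : nm (x - y) = nm (y - x).
Proof. by rewrite -nmN opprB. Qed.

Lemma nmM x y : nm (x * y) = nm x * nm y.
Proof. by apply: complexI; rewrite rmorphM/= -!nmE normrM. Qed.

Lemma nmX x k : nm (x ^+ k) = nm x ^+ k.
Proof. by apply: complexI; rewrite rmorphXn/= -!nmE normrX. Qed.

Lemma nmV x : nm x^-1 = (nm x)^-1.
Proof. by apply: complexI; rewrite fmorphV/= -!nmE normfV. Qed.

Lemma nmR (a : R) : nm (rc a) = `|a|.
Proof. by rewrite /nm normc_def/= expr0n/= addr0 sqrtr_sqr. Qed.

Lemma nm_nat k : nm k%:R = k%:R.
Proof. by rewrite /nm normr_nat -(rmorph_nat (real_complex R)). Qed.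

Lemma nm_sum (I : Type) (r : seq I) (P : pred I) (F : I -> C) :
  nm (\sum_(i <- r | P i) F i) <= \sum_(i <- r | P i) nm (F i).
Proof.
elim/big_ind2: _ => [|x a y b hx hy|//]; first by rewrite nm0.
by rewrite (le_trans (nmD _ _))// lerD.
Qed.

Lemma nm_tri x y z : nm (x - z) <= nm (x - y) + nm (y - z).
Proof. by have := nmD (x - y) (y - z); rewrite addrA subrK. Qed.

Lemma nm_ge_sub x y : nm x - nm y <= nm (x - y).
Proof. by have := nmD (x - y) y; rewrite subrK; lra. Qed.

Lemma Re_le_nm x : `|complex.Re x| <= nm x.
Proof. by rewrite -lecR -nmE normc_ge_Re. Qed.

Lemma Im_le_nm x : `|complex.Im x| <= nm x.
Proof.
have -> : complex.Im x = - complex.Re (x * 'i%C) by rewrite ReiNIm opprK.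
by rewrite normrN (le_trans (Re_le_nm _))// nmM {2}/nm normc_def/= expr0n/= expr1n add0r sqrtr1 mulr1.
Qed.

End Modulus.

(** * Series of complex numbers and matrices with a geometric majorant *)

Section GeometricSums.
Variable R : realType.
Local Notation C := R[i].
Local Notation rc := (real_complex R).

Lemma half_expn_gt0 (k : nat) : 0 < 2^-1 ^+ k :> R.
Proof. by rewrite exprn_gt0// invr_gt0 ltr0n. Qed.

Lemma half_expn_ge0 (k : nat) : 0 <= 2^-1 ^+ k :> R.
Proof. exact/ltW/half_expn_gt0. Qed.

Lemma half_expn_small (M e : R) : 0 < e -> exists N, forall k, (N <= k)%N ->
  M * 2^-1 ^+ k < e.
Proof.
move=> e0.
have [N hN] : exists N : nat, `|M| / e < N%:R.
  exists (Num.truncn (`|M| / e)).+1.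
  exact: truncnS_gt.
exists N => k Nk.
have h2 : N%:R < 2 ^+ k :> R.
  rewrite (lt_le_trans (y := (2 ^ k)%:R))//; last by rewrite natrX.
  by rewrite ltr_nat (leq_ltn_trans Nk)// ltn_expl.
rewrite exprVn ltr_pdivrMr ?exprn_gt0// (le_lt_trans (ler_norm _))//.
by rewrite -ltr_pdivrMl// mulrC (lt_trans hN).
Qed.

(** The usual way of taking limits below: an error term in [2^-1 ^+ k] is carried through the
    estimates and removed at the end. *)
Lemma le_geo (x y M : R) : (forall k, x <= y + M * 2^-1 ^+ k) -> x <= y.
Proof.
move=> h; rewrite leNgt; apply/negP => xy.
have [N hN] := @half_expn_small M (x - y) ltac:(by rewrite subr_gt0).
by have := hN N (leqnn _); have := h N; lra.
Qed.

(** The ratio 1/2 is fixed once for all; the radii chosen later (r / 8, r / 64, ...) are such that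
    the series to be summed satisfy it. *)
Definition geo (a : nat -> C) (M : R) := forall k, nm (a k) <= M * 2^-1 ^+ k.

Lemma geo_ge0 a M : geo a M -> 0 <= M.
Proof.
by move=> /(_ 0%N); rewrite expr0 mulr1; exact: (le_trans (nm_ge0 _)).
Qed.

Lemma geo_partialC a M : geo a M -> forall N k,
  nm (\sum_(j < N + k) a j - \sum_(j < N) a j) <= 2 * M * 2^-1 ^+ N.
Proof.
move=> h N k; have M0 := geo_ge0 h.
suff : nm (\sum_(j < N + k) a j - \sum_(j < N) a j)
    <= 2 * M * (2^-1 ^+ N - 2^-1 ^+ (N + k)).
  move=> /le_trans; apply; rewrite ler_wpM2l ?mulr_ge0//.
  by rewrite gerBl half_expn_ge0.
elim: k => [|k IH]; first by rewrite addn0 !subrr mulr0 nm0.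
rewrite addnS big_ord_recr/= addrAC (le_trans (nmD _ _))//.
have := h (N + k)%N; rewrite exprSr => h'; set e := _ ^+ (N + k) in IH h' *.
by move: IH h'; set n1 := nm _; set n2 := nm _; set u := _ ^+ N; nra.
Qed.

Lemma real_geo_sum (a : nat -> R) (M : R) :
  (forall k, `|a k| <= M * 2^-1 ^+ k) ->
  exists l, forall N, `|l - \sum_(k < N) a k| <= 2 * M * 2^-1 ^+ N.
Proof.
move=> h.
have M0 : 0 <= M.
  by have := h 0%N; rewrite expr0 mulr1; exact: le_trans.
have cv : cvgn (series a).
  apply: normed_cvg; apply: series_le_cvg (is_cvg_geometric_series (a := M) (z := 2^-1) _).
  - by move=> k; exact: normr_ge0.
  - by move=> k; rewrite /geometric/= mulr_ge0// half_expn_ge0.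
  - by move=> k; exact: h.
  - by rewrite ger0_norm ?invr_ge0// invf_lt1// ltr1n.
exists (limn (series a)) => N.
have cv' : (fun k => `|series a k - \sum_(k < N) a k|) @ \oo -->
    `|limn (series a) - \sum_(k < N) a k|.
  by apply: cvg_norm; apply: cvgB => //; exact: cvg_cst.
rewrite -(cvg_lim _ cv')//; apply: limr_le; first by apply: cvgP cv'.
near=> k.
have -> : series a k = \sum_(j < N + (k - N)) a j.
  rewrite /series/= big_mkord; rewrite subnKC//.
  by near: k; exact: nbhs_infty_ge.
rewrite -nmR rmorphB !rmorph_sum/=.
by apply: (geo_partialC (a := fun k => rc (a k))) => m; rewrite nmR.
Unshelve. all: by end_near. Qed.

(** The rate of convergence is part of the notion: it makes the limit unique, and an identity
    between sums is proved by bounding the errors of the partial sums. *)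
Definition is_csum (a : nat -> C) (l : C) :=
  exists M, forall N, nm (l - \sum_(k < N) a k) <= M * 2^-1 ^+ N.

Definition csum (a : nat -> C) : C := xget 0 (is_csum a).

Lemma is_csum_unique a l l' : is_csum a l -> is_csum a l' -> l = l'.
Proof.
move=> [M h] [M' h']; apply/subr0_eq/nm_eq0/eqP.
rewrite eq_le nm_ge0 andbT; apply: (@le_geo _ _ (M + M')) => k.
rewrite add0r mulrDl; have := nm_tri l (\sum_(j < k) a j) l'.
by rewrite [nm (\sum_(j < k) a j - l')]nmC; have := h k; have := h' k; lra.
Qed.

Lemma csumE a l : is_csum a l -> csum a = l.
Proof.
by move=> h; apply: xget_subset1 => // x y; exact: is_csum_unique.
Qed.

Lemma csum_tail a M : geo a M ->
  forall N, nm (csum a - \sum_(k < N) a k) <= 2 * M * 2^-1 ^+ N.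
Proof.
move=> h.
have [l1 h1] := @real_geo_sum (fun k => complex.Re (a k)) M
  (fun k => le_trans (Re_le_nm _) (h k)).
have [l2 h2] := @real_geo_sum (fun k => complex.Im (a k)) M
  (fun k => le_trans (Im_le_nm _) (h k)).
have key N : nm ((rc l1 + 'i%C * rc l2) - \sum_(k < N) a k) <= 4 * M * 2^-1 ^+ N.
  have -> : \sum_(k < N) a k = rc (\sum_(k < N) complex.Re (a k))
      + 'i%C * rc (\sum_(k < N) complex.Im (a k)).
    rewrite !rmorph_sum mulr_sumr -big_split/=; apply: eq_bigr => k _.
    exact: complexE.
  rewrite opprD addrACA -mulrBr -!rmorphB/= (le_trans (nmD _ _))// nmM.
  have -> : nm 'i%C = 1 :> R.
    by rewrite /nm normc_def/= expr0n/= expr1n add0r sqrtr1.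
  by rewrite mul1r !nmR; have := h1 N; have := h2 N; lra.
have e : csum a = rc l1 + 'i%C * rc l2 by apply: csumE; exists (4 * M).
(* The split into real and imaginary parts has cost a factor 2. Comparison with a later partial sum,
   whose own error tends to 0, restores the constant [2 * M]. *)
move=> N; rewrite e; apply: (@le_geo _ _ (4 * M)) => k.
have := key (N + k)%N; rewrite exprD.
have := nm_tri (rc l1 + 'i%C * rc l2) (\sum_(j < N + k) a j) (\sum_(j < N) a j).
have := geo_partialC h N k.
set A := nm _; set B := nm _; set D := nm _.
have : 0 <= M * 2^-1 ^+ k by rewrite mulr_ge0 ?half_expn_ge0// (geo_ge0 h).
have : 2^-1 ^+ N <= 1 :> R.
  by rewrite exprn_ile1// ?invr_ge0// invf_le1// ler1n.
by have := half_expn_ge0 N; nra.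
Qed.

Lemma csum_le a M : geo a M -> nm (csum a) <= 2 * M.
Proof. by move=> /csum_tail/(_ 0%N); rewrite big_ord0 subr0 expr0 mulr1. Qed.

Lemma csum_recl a M : geo a M -> csum a = a 0%N + csum (fun k => a k.+1).
Proof.
move=> ha; apply: csumE; exists (2 * M) => N.
have hS : geo (fun k => a k.+1) (M / 2).
  by move=> k; have := ha k.+1; rewrite exprS; set e := _ ^+ _; lra.
case: N => [|N].
  rewrite big_ord0 subr0 expr0 mulr1 (le_trans (nmD _ _))//.
  by have := csum_le hS; have := ha 0%N; rewrite expr0; lra.
rewrite big_ord_recl/= opprD addrACA subrr add0r.
have := csum_tail hS N; rewrite exprS.
under [X in nm (_ - X) <= _ -> _]eq_bigr do [].
by move=> /le_trans; apply; have := geo_ge0 ha; have := half_expn_ge0 N; nra.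
Qed.

Lemma csum_finite a K : (forall k, (K <= k)%N -> a k = 0) ->
  csum a = \sum_(k < K) a k.
Proof.
move=> h; apply: csumE.
exists ((\sum_(k < K) nm (a k)) * 2 ^+ K) => N.
have [KN|NK] := leqP K N.
  rewrite (_ : \sum_(k < N) a k = \sum_(k < K) a k) ?subrr ?nm0.
    by rewrite !mulr_ge0 ?half_expn_ge0 ?exprn_ge0// sumr_ge0// => k _; exact: nm_ge0.
  rewrite -(subnKC KN) big_split_ord/= [X in _ + X]big1 ?addr0// => k _.
  by rewrite h// leq_addr.
rewrite -mulrA; have -> : (2 : R) ^+ K * 2^-1 ^+ N = 2 ^+ (K - N).
  rewrite -{1}(subnKC (ltnW NK)) exprD mulrAC -exprMn divff ?expr1n ?mul1r//.
  by rewrite pnatr_eq0.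
move: (K - N)%N (subnKC (ltnW NK)) => d <-.
rewrite !big_split_ord/= addrAC subrr add0r (le_trans (nm_sum _ _ _))//.
have A : 0 <= \sum_(i < N) nm (a i) by apply: sumr_ge0 => k _; exact: nm_ge0.
have B : 0 <= \sum_(i < d) nm (a (N + i)%N).
  by apply: sumr_ge0 => k _; exact: nm_ge0.
have : 1 <= (2 : R) ^+ d by rewrite exprn_ege1// ler1n.
by nra.
Qed.

End GeometricSums.

Section MatrixSums.
Variable R : realType.
Local Notation C := R[i].

Section Norm.
Variables p q : nat.
Implicit Types A B : 'M[C]_(p, q).

(** The entrywise l1 norm is submultiplicative for products of all sizes and bounds each entry with
    constant 1. *)
Definition nmm A : R := \sum_i \sum_j nm (A i j).

Lemma nmm_ge0 A : 0 <= nmm A.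
Proof. by apply: sumr_ge0 => i _; apply: sumr_ge0 => j _; exact: nm_ge0. Qed.

Lemma nm_le_nmm A i j : nm (A i j) <= nmm A.
Proof.
rewrite /nmm (bigD1 i)//= (bigD1 j)//= -addrA lerDl addr_ge0//.
  by apply: sumr_ge0 => k _; exact: nm_ge0.
by apply: sumr_ge0 => k _; apply: sumr_ge0 => l _; exact: nm_ge0.
Qed.

Lemma nmm0 : nmm 0 = 0.
Proof. by rewrite /nmm big1// => i _; rewrite big1// => j _; rewrite mxE nm0. Qed.

Lemma nmm_eq0 A : nmm A = 0 -> A = 0.
Proof.
move=> h; apply/matrixP => i j; rewrite mxE; apply: nm_eq0; apply/eqP.
by rewrite eq_le nm_ge0 andbT -h nm_le_nmm.
Qed.

Lemma nmmD A B : nmm (A + B) <= nmm A + nmm B.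
Proof.
rewrite /nmm -big_split/=; apply: ler_sum => i _.
rewrite -big_split/=; apply: ler_sum => j _.
by rewrite mxE nmD.
Qed.

Lemma nmmN A : nmm (- A) = nmm A.
Proof. by apply: eq_bigr => i _; apply: eq_bigr => j _; rewrite mxE nmN. Qed.

Lemma nmmZ c A : nmm (c *: A) = nm c * nmm A.
Proof.
rewrite /nmm mulr_sumr; apply: eq_bigr => i _.
by rewrite mulr_sumr; apply: eq_bigr => j _; rewrite mxE nmM.
Qed.

Lemma nmm_sum (I : Type) (r : seq I) (P : pred I) (F : I -> 'M[C]_(p, q)) :
  nmm (\sum_(i <- r | P i) F i) <= \sum_(i <- r | P i) nmm (F i).
Proof.
elim/big_ind2: _ => [|x a y b hx hy|//]; first by rewrite nmm0.
by rewrite (le_trans (nmmD _ _))// lerD.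
Qed.

Lemma nmm_tri A B D : nmm (A - D) <= nmm (A - B) + nmm (B - D).
Proof. by have := nmmD (A - B) (B - D); rewrite addrA subrK. Qed.

End Norm.

Lemma nmm_mul p q r (A : 'M[C]_(p, q)) (B : 'M[C]_(q, r)) :
  nmm (A *m B) <= nmm A * nmm B.
Proof.
rewrite {1}/nmm {1}/nmm mulr_suml; apply: ler_sum => i _.
apply: (@le_trans _ _ (\sum_j \sum_k nm (A i k) * nm (B k j))).
  apply: ler_sum => j _; rewrite mxE (le_trans (nm_sum _ _ _))//.
  by apply: ler_sum => k _; rewrite nmM.
rewrite exchange_big/= mulr_suml; apply: ler_sum => k _.
rewrite -mulr_sumr ler_wpM2l ?nm_ge0// /nmm (bigD1 k)//= lerDl.
by apply: sumr_ge0 => l _; apply: sumr_ge0 => j _; exact: nm_ge0.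
Qed.

Section Sum.
Variables p q : nat.
Implicit Types a b : nat -> 'M[C]_(p, q).

Definition msum a : 'M[C]_(p, q) := \matrix_(i, j) csum (fun k => a k i j).

Definition mgeo a (M : R) := forall k, nmm (a k) <= M * 2^-1 ^+ k.

Lemma mgeo_entry a M i j : mgeo a M -> geo (fun k => a k i j) M.
Proof. by move=> h k; exact: le_trans (nm_le_nmm _ _ _) (h k). Qed.

Lemma mgeo_ge0 a M : mgeo a M -> 0 <= M.
Proof. by move=> /(_ 0%N); rewrite expr0 mulr1; exact: (le_trans (nmm_ge0 _)). Qed.

Lemma msumE a l M : (forall N, nmm (l - \sum_(k < N) a k) <= M * 2^-1 ^+ N) ->
  msum a = l.
Proof.
move=> h; apply/matrixP => i j; rewrite mxE; apply: csumE; exists M => N.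
apply: le_trans (h N); rewrite (le_trans _ (nm_le_nmm _ i j))//.
by rewrite !mxE summxE.
Qed.

Lemma msum_tail a M : mgeo a M ->
  forall N, nmm (msum a - \sum_(k < N) a k) <= 2 * M * 2^-1 ^+ N.
Proof.
move=> h N.
have tl i j m : nm (msum a i j - \sum_(k < m) a k i j) <= 2 * M * 2^-1 ^+ m.
  by rewrite mxE; apply: (csum_tail (mgeo_entry i j h)).
have crude m : nmm (msum a - \sum_(k < m) a k) <=
    (p * q)%:R * (2 * M) * 2^-1 ^+ m.
  rewrite /nmm (@le_trans _ _ (\sum_(i < p) \sum_(j < q) 2 * M * 2^-1 ^+ m))//.
    apply: ler_sum => i _; apply: ler_sum => j _.
    by have := tl i j m; rewrite !mxE summxE.
  by rewrite !sumr_const !card_ord -mulrnA -[leLHS]mulr_natl (mulnC q p) -!mulrA.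
have part k : nmm (\sum_(j < N + k) a j - \sum_(j < N) a j) <= 2 * M * 2^-1 ^+ N.
  have M0 := mgeo_ge0 h.
  suff : nmm (\sum_(j < N + k) a j - \sum_(j < N) a j)
      <= 2 * M * (2^-1 ^+ N - 2^-1 ^+ (N + k)).
    move=> /le_trans; apply; rewrite ler_wpM2l ?mulr_ge0//.
    by rewrite gerBl half_expn_ge0.
  elim: k => [|k IH]; first by rewrite addn0 !subrr mulr0 nmm0.
  rewrite addnS big_ord_recr/= addrAC (le_trans (nmmD _ _))//.
  have := h (N + k)%N; rewrite exprSr => h'; set e := _ ^+ (N + k) in IH h' *.
  by move: IH h'; set n1 := nmm _; set n2 := nmm _; set u := _ ^+ N; nra.
(* Entrywise summation only gives [crude], with the number of entries as a factor; letting the later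
   partial sums converge leaves the constant of [part], independent of the size. *)
apply: (@le_geo _ _ _ ((p * q)%:R * (2 * M))) => k.
have := nmm_tri (msum a) (\sum_(j < N + k) a j) (\sum_(j < N) a j).
have := crude (N + k)%N; have := part k.
rewrite exprD.
have M0 := mgeo_ge0 h.
have : 0 <= (p * q)%:R * (2 * M) * 2^-1 ^+ k.
  by rewrite !mulr_ge0 ?half_expn_ge0.
have : 2^-1 ^+ N <= 1 :> R.
  by rewrite exprn_ile1// ?invr_ge0// invf_le1// ler1n.
by have := half_expn_ge0 R N; set X := _%:R * (2 * M); nra.
Qed.

Lemma msum_le a M : mgeo a M -> nmm (msum a) <= 2 * M.
Proof. by move=> /msum_tail/(_ 0%N); rewrite big_ord0 subr0 expr0 mulr1. Qed.

Lemma msumD a b M M' : mgeo a M -> mgeo b M' ->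
  msum (fun k => a k + b k) = msum a + msum b.
Proof.
move=> ha hb; apply: (@msumE _ _ (2 * M + 2 * M')) => N.
rewrite big_split/= opprD addrACA (le_trans (nmmD _ _))// mulrDl lerD//.
  exact: msum_tail.
exact: msum_tail.
Qed.

Lemma msumN a M : mgeo a M -> msum (fun k => - a k) = - msum a.
Proof.
move=> ha; apply: (@msumE _ _ (2 * M)) => N.
by rewrite sumrN -opprD nmmN msum_tail.
Qed.

Lemma msumZ c a M : mgeo a M -> msum (fun k => c *: a k) = c *: msum a.
Proof.
move=> ha; apply: (@msumE _ _ (nm c * (2 * M))) => N.
by rewrite -scaler_sumr -scalerBr nmmZ -mulrA ler_wpM2l ?nm_ge0// msum_tail.
Qed.

Lemma mgeoS a M : mgeo a M -> mgeo (fun k => a k.+1) (M / 2).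
Proof. by move=> h k; have := h k.+1; rewrite exprS; set e := _ ^+ _; lra. Qed.

Lemma msum_recl a M : mgeo a M -> msum a = a 0%N + msum (fun k => a k.+1).
Proof.
move=> h; apply/matrixP => i j; rewrite !mxE.
exact: csum_recl (mgeo_entry i j h).
Qed.

Lemma msum_finite a K : (forall k, (K <= k)%N -> a k = 0) ->
  msum a = \sum_(k < K) a k.
Proof.
move=> h; apply/matrixP => i j; rewrite mxE (@csum_finite _ _ K) ?summxE//.
by move=> k Kk; rewrite h// mxE.
Qed.

Lemma eq_msum a b : (forall k, a k = b k) -> msum a = msum b.
Proof. by move=> h; congr msum; apply/funext. Qed.

Lemma mgeoD a b M M' : mgeo a M -> mgeo b M' -> mgeo (fun k => a k + b k) (M + M').
Proof. by move=> h h' k; rewrite (le_trans (nmmD _ _))// mulrDl lerD. Qed.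

Lemma msum_split a M N : mgeo a M ->
  msum a = \sum_(k < N) a k + msum (fun k => a (N + k)%N).
Proof.
move=> h; elim: N a M h => [|N IH] a M h; first by rewrite big_ord0 add0r.
rewrite (msum_recl h) (IH _ _ (mgeoS h)) big_ord_recl addrA.
by congr (_ + _ + _); apply: eq_msum => k; rewrite addSn.
Qed.

End Sum.

Lemma msum_mulmxl p q r (c : 'M[C]_(p, q)) (a : nat -> 'M[C]_(q, r)) M :
  mgeo a M -> msum (fun k => c *m a k) = c *m msum a.
Proof.
move=> ha; apply: (@msumE _ _ _ _ (nmm c * (2 * M))) => N.
rewrite -mulmx_sumr -mulmxBr (le_trans (nmm_mul _ _))// -mulrA.
by rewrite ler_wpM2l ?nmm_ge0// msum_tail.
Qed.

Lemma msum_mulmxr p q r (c : 'M[C]_(q, r)) (a : nat -> 'M[C]_(p, q)) M :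
  mgeo a M -> msum (fun k => a k *m c) = msum a *m c.
Proof.
move=> ha; apply: (@msumE _ _ _ _ ((2 * M) * nmm c)) => N.
rewrite -mulmx_suml -mulmxBl (le_trans (nmm_mul _ _))// mulrAC.
by rewrite ler_wpM2r ?nmm_ge0// msum_tail.
Qed.

End MatrixSums.

(** * Real-valued norms, balls and a criterion of differentiability *)

Section VectorNorm.
Variable R : realType.
Local Notation C := R[i].
Local Notation rc := (real_complex R).

Section Generic.
Variable V : normedModType C.
Implicit Types x y h : V.

Definition nv h : R := complex.Re `|h|.

Lemma nvE h : `|h| = rc (nv h).
Proof. by rewrite /nv RRe_real// realE normr_ge0. Qed.

Lemma nv_ge0 h : 0 <= nv h.
Proof. by rewrite -ler0c -nvE normr_ge0. Qed.

Lemma nv0 : nv 0 = 0.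
Proof. by rewrite /nv normr0. Qed.

Lemma nvD x y : nv (x + y) <= nv x + nv y.
Proof. by rewrite -lecR rmorphD/= -!nvE ler_normD. Qed.

Lemma nvN x : nv (- x) = nv x.
Proof. by rewrite /nv normrN. Qed.

Lemma nvC x y : nv (x - y) = nv (y - x).
Proof. by rewrite -nvN opprB. Qed.

Lemma nv_tri x y z : nv (x - z) <= nv (x - y) + nv (y - z).
Proof. by have := nvD (x - y) (y - z); rewrite addrA subrK. Qed.

Lemma nvZ (a : C) x : nv (a *: x) = nm a * nv x.
Proof. by apply: complexI; rewrite rmorphM/= -nmE -!nvE normrZ. Qed.

Lemma nv_eq0 h : nv h = 0 -> h = 0.
Proof. by move=> h0; apply/normr0_eq0; rewrite nvE h0. Qed.

Lemma nv_gt0 h : h != 0 -> 0 < nv h.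
Proof.
by move=> h0; rewrite lt_def nv_ge0 andbT; apply: contra_neq h0 => /nv_eq0.
Qed.

Definition bal x (r : R) : set V := [set y | nv (y - x) < r].

Lemma bal_center x r : 0 < r -> bal x r x.
Proof. by move=> r0; rewrite /bal/= subrr nv0. Qed.

Lemma bal_ball x r : bal x r = ball x (rc r).
Proof.
apply/seteqP; split => y; rewrite -ball_normE /bal /ball_/=.
  by rewrite distrC nvE ltcR.
by rewrite distrC nvE ltcR.
Qed.

Lemma nbhs_balP x (A : set V) :
  nbhs x A <-> exists2 r : R, 0 < r & bal x r `<=` A.
Proof.
rewrite -nbhs_ballE; split=> [[e /= e0 eA]|[r r0 rA]].
  exists (complex.Re e); first by move: e0; rewrite ltcE => /andP[_].
  rewrite bal_ball RRe_real//; exact: gtr0_real.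
exists (rc r) => /=; first by rewrite ltcR.
by rewrite -bal_ball.
Qed.

Lemma open_bal x r : open (bal x r).
Proof.
rewrite openE => y; rewrite /bal/= => h; apply/nbhs_balP.
exists (r - nv (y - x)); first by rewrite subr_gt0.
by move=> z; rewrite /bal/= => hz; have := nv_tri z y x; lra.
Qed.

Lemma bal_subset x y r s : nv (y - x) + s <= r -> bal y s `<=` bal x r.
Proof. by move=> h z; rewrite /bal/= => hz; have := nv_tri z y x; lra. Qed.

Lemma bal_le x r s : s <= r -> bal x s `<=` bal x r.
Proof. by move=> h; apply: bal_subset; rewrite subrr nv0 add0r. Qed.

Lemma openP (A : set V) :
  open A <-> forall x, A x -> exists2 r : R, 0 < r & bal x r `<=` A.
Proof.
rewrite openE; split=> h x Ax.
  by apply/nbhs_balP; exact: h.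
by apply/nbhs_balP; exact: h.
Qed.

End Generic.

Lemma nv_nm (x : C) : nv x = nm x.
Proof. by []. Qed.

Lemma near_bal (V : normedModType C) (x : V) (r : R) : 0 < r ->
  \forall y \near x, nv (y - x) < r.
Proof. by move=> r0; apply/nbhs_balP; exists r. Qed.

(** A quadratic bound of the remainder replaces the little-o of the definition: Taylor estimates
    provide it directly, and it passes to uniform limits. *)
Lemma diff_crit (V : normedModType C) (f : V -> C) (x : V) (L : {linear V -> C})
  (K r : R) : 0 <= K -> 0 < r ->
  (forall h, nm (L h) <= K * nv h) ->
  (forall h, nv h < r -> nm (f (x + h) - f x - L h) <= K * nv h ^+ 2) ->
  differentiable f x /\ ('d f x = L :> (V -> C)).
Proof.
move=> K0 r0 hL hf.
have K1 : 0 < K + 1 by rewrite ltr_wpDl.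
have toR (e : C) : 0 < e -> e = rc (complex.Re e) /\ 0 < complex.Re e.
  move=> e0; rewrite RRe_real ?gtr0_real//; split=> //.
  by move: e0; rewrite ltcE => /andP[_].
have Lc : continuous L.
  move=> y; apply/cvgrPdist_lt => e /toR[-> e0]; near=> z.
  rewrite -linearB nmE ltcR (le_lt_trans (hL _))//.
  have h : nv (y - z) < complex.Re e / (K + 1).
    rewrite nvC; near: z; apply: near_bal; exact: divr_gt0.
  rewrite (@le_lt_trans _ _ ((K + 1) * nv (y - z)))//.
    by rewrite ler_wpM2r ?nv_ge0// lerDl.
  by rewrite mulrC -ltr_pdivlMr.
have dec : f \o shift x = cst (f x) + L +o_ 0 id.
  apply/eqaddoP => e /toR[-> e0]; near=> h.
  have h1 : nv h < r.
    by rewrite -[h]subr0; near: h; exact: near_bal.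
  have h2 : nv h < complex.Re e / (K + 1).
    by rewrite -[h]subr0; near: h; apply: near_bal; exact: divr_gt0.
  rewrite /= !nvE -[X in _ <= X]rmorphM lecR.
  have -> : nv ((f \o shift x - (cst (f x) + L)) h) = nm (f (x + h) - f x - L h).
    by rewrite nv_nm; congr nm; rewrite [x + h]addrC opprD addrA.
  rewrite (le_trans (hf _ h1))// expr2 mulrA ler_wpM2r ?nv_ge0//.
  rewrite (@le_trans _ _ ((K + 1) * nv h))// ?ler_wpM2r ?nv_ge0 ?lerDl//.
  by rewrite mulrC -ler_pdivlMr// ltW.
have dE := diff_unique Lc dec; split=> //.
by apply/diff_locallyP; rewrite dE.
Unshelve. all: by end_near. Qed.

Section RowVectors.
Variable n : nat.
Local Notation T := 'rV[C]_n.

Lemma nv_ltP (h : T) (r : R) : 0 < r ->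
  (nv h < r) <-> (forall i, nm (h 0 i) < r).
Proof.
move=> r0; have -> : (nv h < r) = (bal 0 r h) :> Prop by rewrite /bal/= subr0.
have rc0 : 0 < rc r by rewrite ltcR.
rewrite bal_ball; split.
  by move=> [_ H] i; have := H 0 i; rewrite -ball_normE /= mxE sub0r normrN nmE ltcR.
move=> H; split=> // i j; rewrite (ord1 i) -ball_normE /= mxE sub0r normrN.
by rewrite nmE ltcR.
Qed.

Lemma nm_le_nv (h : T) i : nm (h 0 i) <= nv h.
Proof.
rewrite leNgt; apply/negP => lt.
have r0 : 0 < nm (h 0 i) by exact: le_lt_trans (nv_ge0 _) lt.
by have /(_ i) := (nv_ltP h r0).1 lt; rewrite ltxx.
Qed.

Lemma nv_le (h : T) (r : R) : 0 <= r -> (forall i, nm (h 0 i) <= r) -> nv h <= r.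
Proof.
move=> r0 hr; rewrite leNgt; apply/negP => lt.
have v0 : 0 < nv h by exact: le_lt_trans lt.
have : nv h < nv h by apply/nv_ltP => // i; exact: le_lt_trans lt.
by rewrite ltxx.
Qed.

End RowVectors.

End VectorNorm.

(** * Cauchy estimates for polynomials in one variable *)

Section Cauchy.
Variable R : realType.
Local Notation C := R[i].
Local Notation rc := (real_complex R).

(** Orders which are powers of 2 are enough for the averages below, and iterated square roots of -1
    provide them: if w^(2^m) = -1, the order of w divides 2^(m+1) but not 2^m. *)
Lemma pow2_prim_root (m : nat) : exists w : C, (2 ^ m.+1).-primitive_root w.
Proof.
have [w hw] : exists w : C, w ^+ (2 ^ m) = -1.
  elim: m => [|m [w hw]]; first by exists (-1); rewrite expn0 expr1.
  by exists (sqrtc w); rewrite expnS exprM sqr_sqrtc.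
exists w.
have w1 : w ^+ (2 ^ m.+1) = 1 by rewrite expnSr exprM hw sqrrN expr1n.
have [d pd dd] := prim_order_exists (ltac:(by rewrite expn_gt0) : (0 < 2 ^ m.+1)%N) w1.
have [j jm dE] := (dvdn_pfactor _ _ (isT : prime 2) : reflect _ _) dd.
move: jm; rewrite leq_eqVlt => /orP[/eqP jE|jm]; first by rewrite -jE -dE.
exfalso; have := prim_expr_order pd; rewrite dE => e.
move: hw; rewrite -(subnKC (jm : (j <= m)%N)) expnD exprM e expr1n => /eqP.
by rewrite -subr_eq0 opprK -(natrD _ 1 1) pnatr_eq0.
Qed.

(* Discrete Cauchy formula: averaging over the roots of unity of an order
   exceeding the degree isolates one coefficient. *)
Lemma cauchy_poly (p : {poly C}) (r S : R) : 0 < r ->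
  (forall l, nm l <= r -> nm p.[l] <= S) -> forall k, nm p`_k * r ^+ k <= S.
Proof.
move=> r0 hp k.
have [m hm] : exists m, (maxn (size p) k.+1 <= 2 ^ m.+1)%N.
  by exists (maxn (size p) k.+1); rewrite ltnW// (leq_trans (ltn_expl _ (isT : 1 < 2)%N))// leq_exp2l.
have [w wp] := pow2_prim_root m.
move: hm wp; set N := (2 ^ m.+1)%N; rewrite geq_max => /andP[sN kN] wp.
have N0 : (0 < N)%N by exact: leq_trans kN.
have nw : nm w = 1.
  apply/eqP; rewrite -(@pexpr_eq1 _ _ N) ?nm_ge0// -nmX (prim_expr_order wp).
  by rewrite nm1.
have geom j : \sum_(i < N) (w ^+ j) ^+ i = if (N %| j)%N then N%:R else 0.
  case: ifPn => [|Nj].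
    rewrite (prim_order_dvd wp) => /eqP->.
    under eq_bigr do rewrite expr1n.
    by rewrite sumr_const card_ord.
  have : (w ^+ j - 1) * \sum_(i < N) (w ^+ j) ^+ i = 0.
    by rewrite -subrX1 -exprM mulnC exprM (prim_expr_order wp) expr1n subrr.
  move/eqP; rewrite mulf_eq0 subr_eq0 => /orP[|/eqP//].
  by rewrite -(prim_order_dvd wp) (negPf Nj).
(* The exponent [N - k] stands for - k, since [w ^+ N] is 1. The sum selects the coefficients whose
   index is congruent to k modulo N, and only k remains, as N exceeds k and the degree. *)
have key : \sum_(i < N) p.[rc r * w ^+ i] * (w ^+ (N - k)) ^+ i
    = N%:R * (p`_k * rc r ^+ k).
  under eq_bigr do rewrite (horner_coef_wide _ sN) mulr_suml.
  rewrite exchange_big/= (bigD1 (Ordinal kN))//= [X in _ + X]big1 ?addr0.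
    transitivity (\sum_(i < N) (p`_k * rc r ^+ k) * (w ^+ N) ^+ i).
      apply: eq_bigr => i _; rewrite exprMn -!exprM !mulrA -mulrA -exprD.
      by rewrite -(mulnC k) -mulnDl subnKC// ltnW.
    by rewrite -mulr_sumr geom dvdnn mulrC.
  move=> j jk.
  transitivity ((p`_j * rc r ^+ j) * \sum_(i < N) (w ^+ (j + (N - k))) ^+ i).
    rewrite mulr_sumr; apply: eq_bigr => i _.
    rewrite exprMn -!exprM !mulrA -mulrA -exprD; congr (_ * _ ^+ _).
    by rewrite mulnDl (mulnC i).
  rewrite geom ifF ?mulr0//; apply/negP => /dvdnP[c hc].
  have jk' : nat_of_ord j <> k by move=> e; case/negP: jk; apply/eqP/val_inj.
  have := ltn_ord j; case: c hc => [|[|c]] hc; nia.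
have : nm (N%:R * (p`_k * rc r ^+ k)) <= N%:R * S.
  rewrite -key (le_trans (nm_sum _ _ _))//.
  rewrite (@le_trans _ _ (\sum_(i < N) S))//; last first.
    by rewrite sumr_const card_ord mulr_natl.
  apply: ler_sum => i _; rewrite nmM !nmX nw !expr1n mulr1 hp//.
  by rewrite nmM nmX nw expr1n mulr1 nmR ger0_norm// ltW.
rewrite nmM nm_nat ler_pM2l ?ltr0n//.
by rewrite nmM nmX nmR ger0_norm// ltW.
Qed.

(** The coefficients are at most S / r^k by [cauchy_poly], and |l| / r <= 1/2 makes the tail a
    geometric sum. *)
Lemma poly_tail (p : {poly C}) (r S : R) : 0 < r ->
  (forall l, nm l <= r -> nm p.[l] <= S) -> forall l, nm l <= r / 2 -> forall N,
  nm (p.[l] - \sum_(k < N) p`_k * l ^+ k) <= 2 * S * (nm l / r) ^+ N.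
Proof.
move=> r0 hp l lr N.
have S0 : 0 <= S by apply: le_trans (nm_ge0 _) (hp 0 _); rewrite nm0 ltW.
set u := nm l / r.
have u0 : 0 <= u by rewrite divr_ge0 ?nm_ge0// ltW.
have u2 : u <= 2^-1 by rewrite ler_pdivrMr// mulrC.
have ck k : nm (p`_k * l ^+ k) <= S * u ^+ k.
  have -> : nm (p`_k * l ^+ k) = nm p`_k * r ^+ k * u ^+ k.
    by rewrite nmM nmX -mulrA -exprMn /u mulrCA divff ?mulr1// gt_eqF.
  by rewrite ler_wpM2r ?exprn_ge0//; exact: cauchy_poly.
have pE : p.[l] = \sum_(k < N + size p) p`_k * l ^+ k.
  by apply: horner_coef_wide; rewrite leq_addl.
rewrite pE big_split_ord/= addrAC subrr add0r (le_trans (nm_sum _ _ _))//.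
suff : forall m, \sum_(i < m) nm (p`_(N + i) * l ^+ (N + i))
    <= 2 * S * (u ^+ N - u ^+ (N + m)).
  move=> /(_ (size p))/le_trans; apply; rewrite ler_wpM2l ?mulr_ge0//.
  by rewrite gerBl exprn_ge0.
elim=> [|m IH]; first by rewrite big_ord0 addn0 subrr mulr0.
rewrite big_ord_recr/= addnS exprSr.
have := ck (N + m)%N; have : 0 <= S * u ^+ (N + m) by rewrite mulr_ge0// exprn_ge0.
by move: IH; set e := u ^+ (N + m); set f := u ^+ N; set a := nm _; set b := \sum_(_ < _) _; nra.
Qed.

End Cauchy.

Section LinearForm.
Variables (R : realType) (n : nat).
Local Notation C := R[i].
Local Notation T := 'rV[C]_n.

Definition linear_form (l : 'I_n -> C) (h : T) : C := \sum_i h 0 i * l i.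

Lemma linear_form_is_linear l : linear (linear_form l).
Proof.
move=> a u v; rewrite /linear_form scaler_sumr -big_split/=.
by apply: eq_bigr => i _; rewrite !mxE mulrDl scalerAl.
Qed.

HB.instance Definition _ l :=
  GRing.isLinear.Build C T C _ (linear_form l) (linear_form_is_linear l).

End LinearForm.

(** * Holomorphic functions of several variables as uniform limits of polynomials *)

Section Analytic.
Variables (R : realType) (n : nat).
Local Notation C := R[i].
Local Notation rc := (real_complex R).
Local Notation T := 'rV[C]_n.

(** A predicate on functions rather than the elements of a polynomial ring: differentiability,
    stability under ['d] and restriction to a line become inductions on the construction. *)
Inductive polf : (T -> C) -> Prop :=
| polf_cst c : polf (fun=> c)
| polf_crd i : polf (fun t => t 0 i)
| polf_add f g : polf f -> polf g -> polf (fun t => f t + g t)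
| polf_mul f g : polf f -> polf g -> polf (fun t => f t * g t).

Lemma polf_scale c f : polf f -> polf (fun t => c * f t).
Proof. by move=> h; apply: polf_mul => //; exact: polf_cst. Qed.

Lemma polf_sub f g : polf f -> polf g -> polf (fun t => f t - g t).
Proof.
move=> hf hg; rewrite (_ : (fun _ => _) = (fun t => f t + -1 * g t)).
  by apply: polf_add => //; exact: polf_scale.
by apply/funext => t; rewrite mulN1r.
Qed.

Lemma polf_differentiable f x : polf f -> differentiable f x.
Proof.
elim=> [c|i|g h _ dg _ dh|g h _ dg _ dh].
- exact: differentiable_cst.
- exact: differentiable_coord.
- exact: differentiableD.
- exact: differentiableM.
Qed.

Lemma diff_coord x h i : 'd (fun t : T => t 0 i : C) x h = h 0 i.
Proof.
have lE k : linear_form (fun j => (j == i)%:R) k = k 0 i.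
  rewrite /linear_form (bigD1 i)//= eqxx mulr1 big1 ?addr0// => j /negPf->.
  by rewrite mulr0.
have [k|k _|_ ->] := @diff_crit R T (fun t => t 0 i) x
  (linear_form (fun j => (j == i)%:R)) 1 1 ler01 ltr01 _ _; last exact: lE.
- by rewrite -[X in nm X <= _]/(linear_form (fun j => (j == i)%:R) k) lE mul1r nm_le_nv.
- rewrite -[X in nm (_ - X) <= _]/(linear_form (fun j => (j == i)%:R) k) lE mxE.
  have -> : x 0 i + k 0 i - x 0 i - k 0 i = 0 by ring.
  by rewrite nm0 mul1r sqr_ge0.
Qed.

Lemma diff_addE (f g : T -> C) x h : differentiable f x -> differentiable g x ->
  'd (fun t => f t + g t) x h = 'd f x h + 'd g x h.
Proof. by move=> df dg; rewrite [LHS](congr1 (@^~ h) (diffD df dg)). Qed.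

Lemma diff_mulE (f g : T -> C) x h : differentiable f x -> differentiable g x ->
  'd (fun t => f t * g t) x h = f x * 'd g x h + 'd f x h * g x.
Proof.
move=> df dg; rewrite [LHS](congr1 (@^~ h) (diffM df dg)).
by rewrite -[LHS]/(f x * 'd g x h + g x * 'd f x h) [g x * _]mulrC.
Qed.

Lemma diff_subE (f g : T -> C) x h : differentiable f x -> differentiable g x ->
  'd (fun t => f t - g t) x h = 'd f x h - 'd g x h.
Proof. by move=> df dg; rewrite [LHS](congr1 (@^~ h) (diffB df dg)). Qed.

Lemma diff_cstE (c : C) (x h : T) : 'd (fun=> c) x h = 0.
Proof. by rewrite [LHS](congr1 (@^~ h) (diff_cst c x)). Qed.

(** Restriction to a complex line is the bridge from several variables to [cauchy_poly] and
    [poly_tail]. *)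
Lemma polf_line f x h : polf f -> exists p : {poly C},
  (forall l, f (x + l *: h) = p.[l]) /\ 'd f x h = p`_1.
Proof.
elim=> [c|i|g k pg [p [hp dp]] pk [q [hq dq]]|g k pg [p [hp dp]] pk [q [hq dq]]].
- exists c%:P; split=> [l|]; first by rewrite hornerC.
  by rewrite diff_cstE coefC.
- exists ((x 0 i)%:P + h 0 i *: 'X); split=> [l|].
    by rewrite !mxE hornerD hornerC hornerZ hornerX mulrC.
  by rewrite diff_coord coefD coefC coefZ coefX add0r mulr1.
- exists (p + q); split=> [l|]; first by rewrite hornerD hp hq.
  rewrite coefD -dp -dq; apply: diff_addE; exact: polf_differentiable.
- exists (p * q); split=> [l|]; first by rewrite hornerM hp hq.
  have p0 : p`_0 = g x by rewrite -horner_coef0 -hp scale0r addr0.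
  have q0 : q`_0 = k x by rewrite -horner_coef0 -hq scale0r addr0.
  rewrite coefM big_ord_recr big_ord1/= p0 q0 -dp -dq [X in _ = _ + X]mulrC.
  rewrite [X in _ = _ + X]mulrC.
  by apply: diff_mulE; exact: polf_differentiable.
Qed.

Lemma polf_ext f g : f =1 g -> polf f -> polf g.
Proof. by move=> /funext ->. Qed.

Lemma polf_diff f h : polf f -> polf (fun x => 'd f x h).
Proof.
elim=> [c|i|g k pg dg pk dk|g k pg dg pk dk].
- under eq_fun do rewrite diff_cstE; exact: polf_cst.
- under eq_fun do rewrite diff_coord; exact: polf_cst.
- have E x := diff_addE h (polf_differentiable x pg) (polf_differentiable x pk).
  exact: polf_ext (fun x => esym (E x)) (polf_add dg dk).
- have E x := diff_mulE h (polf_differentiable x pg) (polf_differentiable x pk).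
  exact: polf_ext (fun x => esym (E x)) (polf_add (polf_mul pg dk) (polf_mul dg pk)).
Qed.

Lemma polf_bounded f x r : polf f -> exists2 S, 0 <= S & forall y, bal x r y -> nm (f y) <= S.
Proof.
elim=> [c|i|g k _ [S S0 hS] _ [S' S'0 hS']|g k _ [S S0 hS] _ [S' S'0 hS']].
- by exists (nm c); rewrite ?nm_ge0.
- exists (nm (x 0 i) + `|r|); rewrite ?addr_ge0 ?nm_ge0// => y; rewrite /bal/= => hy.
  have := nm_le_nv (y - x) i; rewrite !mxE => h.
  have := nm_ge_sub (y 0 i) (x 0 i); have := ler_norm r; lra.
- exists (S + S'); rewrite ?addr_ge0// => y hy.
  by rewrite (le_trans (nmD _ _))// lerD// ?hS ?hS'.
- exists (S * S'); rewrite ?mulr_ge0// => y hy.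
  by rewrite nmM ler_pM ?nm_ge0// ?hS ?hS'.
Qed.

Lemma polf_diff_le f x h r S : 0 < r -> polf f ->
  (forall y, bal x r y -> nm (f y) <= S) -> nm ('d f x h) <= 2 * S * nv h / r.
Proof.
move=> r0 pf hS; have [h0|h0] := eqVneq h 0.
  by rewrite h0 linear0 nm0 nv0 mulr0 mul0r.
have [p [hp ->]] := polf_line x h pf.
have nh := nv_gt0 h0.
(* For l of modulus at most [r / 2 / nv h], the point [x + l *: h] stays within r / 2 of x. *)
have rr : 0 < r / 2 / nv h by rewrite !divr_gt0.
have bp l : nm l <= r / 2 / nv h -> nm p.[l] <= S.
  rewrite ler_pdivlMr// => hl; rewrite -hp hS// /bal/= addrC addKr nvZ; lra.
have := cauchy_poly rr bp 1%N.
rewrite expr1 !mulrA ler_pdivrMr// ler_pdivrMr// => H.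
by rewrite ler_pdivlMr//; lra.
Qed.

Lemma polf_taylor2 f x h r S : 0 < r -> polf f ->
  (forall y, bal x r y -> nm (f y) <= S) -> nv h <= r / 4 ->
  nm (f (x + h) - f x - 'd f x h) <= 8 * S / r ^+ 2 * nv h ^+ 2.
Proof.
move=> r0 pf hS hr; have [h0|h0] := eqVneq h 0.
  by rewrite h0 linear0 addr0 subrr subr0 nm0 nv0 expr0n mulr0.
have [p [hp ->]] := polf_line x h pf.
have nh := nv_gt0 h0.
have rr : 0 < r / 2 / nv h by rewrite !divr_gt0.
have bp l : nm l <= r / 2 / nv h -> nm p.[l] <= S.
  rewrite ler_pdivlMr// => hl; rewrite -hp hS// /bal/= addrC addKr nvZ; lra.
have r1 : nm 1 <= r / 2 / nv h / 2 :> R.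
  rewrite nm1 ler_pdivlMr// ler_pdivlMr//; lra.
have := poly_tail rr bp r1 2%N.
rewrite nm1 -hp scale1r big_ord_recr big_ord1/= !expr1n !mulr1.
rewrite -horner_coef0 -hp scale0r addr0 opprD addrA => /le_trans; apply.
by rewrite mul1r !invfM !invrK !exprMn !exprVn; lra.
Qed.

(** The working notion of holomorphy. On balls it implies differentiability ([unif_diff_taylor]) and
    is stable under products and differentiation; stability under uniform limits is immediate. *)
Definition unif (A : set T) (f : T -> C) := forall e : R, 0 < e ->
  exists2 g, polf g & forall x, A x -> nm (f x - g x) <= e.

Lemma unif_polf A f : polf f -> unif A f.
Proof. by move=> pf e e0; exists f => // x _; rewrite subrr nm0 ltW. Qed.

Lemma unif_cst A c : unif A (fun=> c).
Proof. exact/unif_polf/polf_cst. Qed.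

Lemma unif_subset (A B : set T) f : B `<=` A -> unif A f -> unif B f.
Proof. by move=> BA h e e0; have [g pg hg] := h e e0; exists g => // x /BA/hg. Qed.

Lemma unif_eq (A : set T) f g : (forall x, A x -> f x = g x) -> unif A f -> unif A g.
Proof. by move=> fg h e e0; have [k pk hk] := h e e0; exists k => // x Ax; rewrite -fg// hk. Qed.

Lemma unif_add A f g : unif A f -> unif A g -> unif A (fun x => f x + g x).
Proof.
move=> hf hg e e0; have e2 : 0 < e / 2 by rewrite divr_gt0.
have [f' pf hf'] := hf _ e2; have [g' pg hg'] := hg _ e2.
exists (fun x => f' x + g' x); first exact: polf_add.
move=> x Ax; rewrite opprD addrACA (le_trans (nmD _ _))//.
by have := hf' x Ax; have := hg' x Ax; lra.
Qed.

Lemma unif_bounded x r f : unif (bal x r) f ->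
  exists2 S, 0 <= S & forall y, bal x r y -> nm (f y) <= S.
Proof.
move=> /(_ 1 ltr01)[g pg hg]; have [S S0 hS] := polf_bounded x r pg.
exists (S + 1); first by rewrite addr_ge0.
move=> y hy; have := hg y hy; have := hS y hy.
by have := nm_ge_sub (f y) (g y); lra.
Qed.

Lemma unif_mul x r f g : unif (bal x r) f -> unif (bal x r) g ->
  unif (bal x r) (fun x => f x * g x).
Proof.
move=> hf hg e e0.
have [S S0 hS] := unif_bounded hf; have [S' S'0 hS'] := unif_bounded hg.
(* The cap 1 keeps the approximation [f'] bounded by [S + 1], which the mixed term requires. *)
pose d := Num.min 1 (e / (S + S' + 1)).
have k0 : 0 < S + S' + 1 by rewrite ltr_wpDl// addr_ge0.
have d0 : 0 < d by rewrite lt_min ltr01 divr_gt0.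
have [f' pf hf'] := hf _ d0; have [g' pg hg'] := hg _ d0.
exists (fun x => f' x * g' x); first exact: polf_mul.
move=> y hy.
have -> : f y * g y - f' y * g' y = (f y - f' y) * g y + f' y * (g y - g' y) by ring.
rewrite (le_trans (nmD _ _))// !nmM.
have h1 := hf' y hy; have h2 := hg' y hy; have h3 := hS y hy; have h4 := hS' y hy.
have h5 : nm (f' y) <= S + 1.
  have := nm_ge_sub (f' y) (f y); rewrite nmC => h5.
  have : d <= 1 by rewrite /d ge_min lexx.
  by lra.
have hd : d * (S + S' + 1) <= e.
  by rewrite -ler_pdivlMr// /d ge_min lexx orbT.
have := nm_ge0 (f y - f' y); have := nm_ge0 (g y - g' y).
have := nm_ge0 (g y); have := nm_ge0 (f' y); nra.
Qed.

Lemma unif_lim (A : set T) (f : T -> C) :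
  (forall e : R, 0 < e -> exists2 g, unif A g & forall x, A x -> nm (f x - g x) <= e) ->
  unif A f.
Proof.
move=> H e e0; have e2 : 0 < e / 2 by rewrite divr_gt0.
have [g ug hg] := H _ e2; have [k pk hk] := ug _ e2; exists k => // x Ax.
by have := nm_tri (f x) (g x) (k x); have := hg x Ax; have := hk x Ax; lra.
Qed.

Lemma unif_scale A c f : unif A f -> unif A (fun x => c * f x).
Proof.
move=> hf e e0; have c0 : 0 < nm c + 1 by rewrite ltr_wpDl ?nm_ge0.
have [g pg hg] := hf (e / (nm c + 1)) ltac:(by rewrite divr_gt0).
exists (fun x => c * g x); first exact: polf_scale.
move=> x Ax; rewrite -mulrBr nmM; have := hg x Ax; rewrite ler_pdivlMr//.
by have := nm_ge0 (f x - g x); lra.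
Qed.

Lemma unif_opp A f : unif A f -> unif A (fun x => - f x).
Proof.
move=> /(unif_scale (-1)); apply: unif_eq => x _; exact: mulN1r.
Qed.

Lemma unif_sub A f g : unif A f -> unif A g -> unif A (fun x => f x - g x).
Proof. by move=> hf /unif_opp; exact: unif_add. Qed.

Lemma unif_sum A (I : Type) (s : seq I) (P : pred I) (f : I -> T -> C) :
  (forall i, P i -> unif A (f i)) -> unif A (fun x => \sum_(i <- s | P i) f i x).
Proof.
move=> h; elim: s => [|i s IH].
  by apply: unif_eq (unif_cst A 0) => x _; rewrite big_nil.
have [Pi|Pi] := boolP (P i).
  by apply: unif_eq (unif_add (h i Pi) IH) => x _; rewrite big_cons Pi.
by apply: unif_eq IH => x _; rewrite big_cons (negPf Pi).
Qed.

Lemma unif_prod x r (I : Type) (s : seq I) (P : pred I) (f : I -> T -> C) :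
  (forall i, P i -> unif (bal x r) (f i)) ->
  unif (bal x r) (fun x => \prod_(i <- s | P i) f i x).
Proof.
move=> h; elim: s => [|i s IH].
  by apply: unif_eq (unif_cst _ 1) => y _; rewrite big_nil.
have [Pi|Pi] := boolP (P i).
  by apply: unif_eq (unif_mul (h i Pi) IH) => y _; rewrite big_cons Pi.
by apply: unif_eq IH => y _; rewrite big_cons (negPf Pi).
Qed.

Lemma unif_pow2 A f : unif A f -> exists g : nat -> T -> C,
  (forall j, polf (g j)) /\ forall j x, A x -> nm (f x - g j x) <= 2^-1 ^+ j.
Proof.
move=> hf.
have H j : exists g, polf g /\ forall x, A x -> nm (f x - g x) <= 2^-1 ^+ j.
  by have [g pg hg] := hf _ (half_expn_gt0 R j); exists g.
by have [g hg] := choice H; exists g; split=> j; case: (hg j).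
Qed.

Lemma csum_telescope (u : nat -> C) (M : R) :
  (forall j, nm (u j.+1 - u j) <= M * 2^-1 ^+ j) ->
  exists c, forall j, nm (c - u j) <= 2 * M * 2^-1 ^+ j.
Proof.
move=> h; exists (u 0%N + csum (fun j => u j.+1 - u j)) => j.
have -> : u j = u 0%N + \sum_(k < j) (u k.+1 - u k).
  elim: j => [|j IH]; first by rewrite big_ord0 addr0.
  by rewrite big_ord_recr/= addrA -IH addrC subrK.
by rewrite opprD addrACA subrr add0r; exact: csum_tail.
Qed.

Lemma unif_line (f : T -> C) (A : set T) x h r S : 0 < r -> unif A f ->
  (forall l, nm l <= r -> A (x + l *: h)) ->
  (forall l, nm l <= r -> nm (f (x + l *: h)) <= S) ->
  exists c : nat -> C, (forall k, nm (c k) * r ^+ k <= S) /\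
  forall l N, nm l <= r / 2 ->
  nm (f (x + l *: h) - \sum_(k < N) c k * l ^+ k) <= 2 * S * (nm l / r) ^+ N.
Proof.
move=> r0 /unif_pow2[g [pg hg]] hA hS.
have [p hp] : exists p : nat -> {poly C}, forall j l, g j (x + l *: h) = (p j).[l].
  have H j : exists p : {poly C}, forall l, g j (x + l *: h) = p.[l].
    by have [p [hp _]] := polf_line x h (pg j); exists p.
  by have [p hp] := choice H; exists p.
have bp j l : nm l <= r -> nm (p j).[l] <= S + 2^-1 ^+ j.
  move=> lr; rewrite -hp; have := hg j _ (hA l lr); have := hS l lr.
  by rewrite nmC; have := nm_ge_sub (g j (x + l *: h)) (f (x + l *: h)); lra.
have dp k j : nm ((p j.+1)`_k - (p j)`_k) <= 2 / r ^+ k * 2^-1 ^+ j.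
  rewrite -coefB mulrAC ler_pdivlMr ?exprn_gt0//; apply: cauchy_poly => // l lr.
  rewrite hornerD hornerN -!hp.
  have := nm_tri (g j.+1 (x + l *: h)) (f (x + l *: h)) (g j (x + l *: h)).
  rewrite (nmC (g j.+1 _) (f _)).
  have := hg j _ (hA l lr); have := hg j.+1 _ (hA l lr); rewrite exprS.
  by have := half_expn_ge0 R j; lra.
have [c hc] := choice (fun k => csum_telescope (dp k)).
have {}hc k j : nm (c k - (p j)`_k) * r ^+ k <= 4 * 2^-1 ^+ j.
  rewrite -ler_pdivlMr ?exprn_gt0//.
  by apply: le_trans (hc k j) _; rewrite [leRHS]mulrAC; lra.
exists c; split.
  move=> k; apply: (@le_geo _ _ _ 5) => j.
  have h1 := cauchy_poly r0 (bp j) k.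
  have := hc k j; have := nm_ge_sub (c k) ((p j)`_k).
  have := exprn_gt0 k r0; nra.
move=> l N lr; set u := nm l / r.
have u0 : 0 <= u by rewrite divr_ge0 ?nm_ge0// ltW.
have u1 : u <= 1 by rewrite ler_pdivrMr// mul1r; have := nm_ge0 l; lra.
have lr' : nm l <= r by lra.
apply: (@le_geo _ _ _ (3 + 4 * N%:R)) => j.
have h1 := poly_tail r0 (bp j) lr N.
have h2 := hg j _ (hA l lr').
have h3 : nm (\sum_(k < N) (p j)`_k * l ^+ k - \sum_(k < N) c k * l ^+ k)
    <= 4 * N%:R * 2^-1 ^+ j.
  rewrite -sumrB (le_trans (nm_sum _ _ _))//.
  rewrite (@le_trans _ _ (\sum_(k < N) 4 * 2^-1 ^+ j))//; last first.
    by rewrite sumr_const card_ord -mulr_natl; lra.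
  apply: ler_sum => k _; rewrite -mulrBl nmM nmC nmX.
  have -> : nm l ^+ k = r ^+ k * u ^+ k by rewrite -exprMn /u mulrCA divff ?mulr1// gt_eqF.
  rewrite mulrA -[leRHS]mulr1 ler_pM ?hc ?exprn_ile1// ?exprn_ge0//.
  by rewrite mulr_ge0 ?nm_ge0// exprn_ge0// ltW.
have := nm_tri (f (x + l *: h)) (p j).[l] (\sum_(k < N) c k * l ^+ k).
have := nm_tri (p j).[l] (\sum_(k < N) (p j)`_k * l ^+ k) (\sum_(k < N) c k * l ^+ k).
rewrite -hp in h1 *.
have : 2^-1 ^+ j * u ^+ N <= 2^-1 ^+ j by rewrite ler_piMr ?half_expn_ge0// exprn_ile1.
by move: h1; rewrite -/u; lra.
Qed.

Lemma unif_diff_taylor x r S f : 0 < r -> unif (bal x r) f ->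
  (forall y, bal x r y -> nm (f y) <= S) ->
  [/\ differentiable f x, forall h, nm ('d f x h) <= 2 * S * nv h / r
   & forall h, nv h <= r / 4 ->
     nm (f (x + h) - f x - 'd f x h) <= 8 * S / r ^+ 2 * nv h ^+ 2].
Proof.
move=> r0 /unif_pow2[g [pg hg]] hS.
have gS j y : bal x r y -> nm (g j y) <= S + 2^-1 ^+ j.
  move=> hy; have := hg j y hy; have := hS y hy; rewrite nmC.
  by have := nm_ge_sub (g j y) (f y); lra.
have dg h j : nm ('d (g j.+1) x h - 'd (g j) x h) <= 4 * nv h / r * 2^-1 ^+ j.
  have <- := diff_subE h (polf_differentiable x (pg j.+1)) (polf_differentiable x (pg j)).
  apply: le_trans (@polf_diff_le _ x h r (2 * 2^-1 ^+ j) r0 _ _) _; last by lra.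
  - exact: polf_sub.
  - move=> y hy; have := nm_tri (g j.+1 y) (f y) (g j y).
    rewrite (nmC (g j.+1 _) (f _)); have := hg j y hy; have := hg j.+1 y hy.
    by rewrite exprS; have := half_expn_ge0 R j; lra.
(* The differential is the limit of those of the approximations. The limit is taken on the basis
   vectors only and extended by [linear_form], so that linearity holds by construction. *)
have [l hl] := choice (fun i : 'I_n => csum_telescope (dg (delta_mx 0 i))).
pose L := linear_form l.
have dE j h : 'd (g j) x h = \sum_i h 0 i * 'd (g j) x (delta_mx 0 i).
  rewrite {1}(row_sum_delta h) linear_sum; apply: eq_bigr => i _.
  by rewrite linearZ.
have Lh h : exists2 M, 0 <= M & forall j, nm (L h - 'd (g j) x h) <= M * 2^-1 ^+ j.
  exists (\sum_(i < n) nm (h 0 i) * (2 * (4 * nv (delta_mx 0 i : T) / r))).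
    by apply: sumr_ge0 => i _; rewrite !(mulr_ge0, nm_ge0, nv_ge0)// invr_ge0 ltW.
  move=> j; rewrite dE -sumrB (le_trans (nm_sum _ _ _))// mulr_suml.
  apply: ler_sum => i _; rewrite -mulrBr nmM -[leRHS]mulrA ler_wpM2l ?nm_ge0//; exact: hl.
have LS h : nm (L h) <= 2 * S * nv h / r.
  have [M M0 hM] := Lh h.
  apply: (@le_geo _ _ _ (M + 2 * nv h / r)) => j.
  have := polf_diff_le h r0 (pg j) (gS j).
  by have := hM j; have := nm_ge_sub (L h) ('d (g j) x h); lra.
have S0 : 0 <= S by apply: le_trans (hS x _); rewrite ?nm_ge0//; exact: bal_center.
have L2 h : nv h <= r / 4 ->
    nm (f (x + h) - f x - L h) <= 8 * S / r ^+ 2 * nv h ^+ 2.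
  move=> hr; have [M M0 hM] := Lh h.
  apply: (@le_geo _ _ _ (2 + M + 8 / r ^+ 2 * nv h ^+ 2)) => j.
  have h1 := polf_taylor2 r0 (pg j) (gS j) hr.
  have bxh : bal x r (x + h) by rewrite /bal/= addrC addKr; lra.
  have h2 := hg j _ bxh; have h3 := hg j x (bal_center x r0).
  have h4 := hM j.
  have -> : f (x + h) - f x - L h = (f (x + h) - g j (x + h)) - (f x - g j x)
     - (L h - 'd (g j) x h) + (g j (x + h) - g j x - 'd (g j) x h) by ring.
  set A := _ - g j (x + h); set B := _ - g j x; set D := L h - _; set E := _ - 'd _ _ _.
  have := nmD (A - B - D) E; have := nmB (A - B) D; have := nmB A B.
  rewrite -/A in h2; rewrite -/B in h3; rewrite -/D in h4; rewrite -/E in h1.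
  by lra.
have K1 : 0 <= 2 * S / r by rewrite !mulr_ge0// invr_ge0 ltW.
have K2 : 0 <= 8 * S / r ^+ 2 by rewrite !mulr_ge0// invr_ge0 exprn_ge0 ?ltW.
have LK h : nm (L h) <= (2 * S / r + 8 * S / r ^+ 2) * nv h.
  apply: le_trans (LS h) _; rewrite mulrAC ler_wpM2r ?nv_ge0//; lra.
have LK2 h : nv h < r / 4 ->
    nm (f (x + h) - f x - L h) <= (2 * S / r + 8 * S / r ^+ 2) * nv h ^+ 2.
  move=> hr; apply: le_trans (L2 _ (ltW hr)) _.
  by rewrite ler_wpM2r ?exprn_ge0 ?nv_ge0// lerDr.
have [df dfE] := diff_crit (addr_ge0 K1 K2) (divr_gt0 r0 (ltr0n _ 4)) LK LK2.
by split=> // h; rewrite dfE; [exact: LS|exact: L2].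
Qed.

End Analytic.

(** * Taylor expansions in one variable and isolation of zeros *)

Section Taylor.
Variable R : realType.
Local Notation C := R[i].
Local Notation rc := (real_complex R).
Implicit Types (phi psi : C -> C) (c : nat -> C).

(** An expansion is recorded by estimates of its remainders at all orders, on the half disc, with no
    reference to a convergent series; they determine the coefficients ([tay_unique]) and are enough
    to recognize the zero function ([tay_zero]). *)
Definition tay phi (r : R) c := exists2 M, 0 <= M & forall l N, nm l <= r / 2 ->
  nm (phi l - \sum_(k < N) c k * l ^+ k) <= M * (nm l / r) ^+ N.

Lemma le0_small (a K d : R) : 0 < d ->
  (forall s, 0 < s -> s <= d -> a <= K * s) -> a <= 0.
Proof.
move=> d0 h; rewrite leNgt; apply/negP => a0.
have K0 : 0 < K.
  by have := h d d0 (lexx d) => /(lt_le_trans a0); rewrite pmulr_lgt0.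
pose s := Num.min d (a / (2 * K)).
have s0 : 0 < s by rewrite lt_min d0 divr_gt0// mulr_gt0.
have := h s s0 ltac:(by rewrite ge_min lexx).
have : K * s <= a / 2.
  rewrite mulrC -ler_pdivlMr// /s ge_min; apply/orP; right.
  by rewrite -mulrA -invfM mulrC.
lra.
Qed.

Lemma tay_leading phi r c k : 0 < r -> tay phi r c -> (forall j, (j < k)%N -> c j = 0) ->
  exists2 K, 0 <= K & forall l, nm l <= r / 2 ->
    nm (phi l - c k * l ^+ k) <= K * nm l ^+ k.+1.
Proof.
move=> r0 [M M0 h] hc; exists (M / r ^+ k.+1).
  by rewrite divr_ge0// exprn_ge0// ltW.
move=> l lr; have := h l k.+1 lr; rewrite big_ord_recr/= big1 => [|i _].
  by rewrite add0r expr_div_n mulrA mulrAC.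
by rewrite hc ?mul0r.
Qed.

Lemma coef_eq0 (a : C) (K d : R) (k : nat) : 0 < d ->
  (forall l, nm l <= d -> nm (a * l ^+ k) <= K * nm l ^+ k.+1) -> a = 0.
Proof.
move=> d0 h; apply: nm_eq0; apply/eqP; rewrite eq_le nm_ge0 andbT.
apply: (@le0_small _ K d) => // s s0 sd.
have ns : nm (rc s) = s by rewrite nmR gtr0_norm.
have := h (rc s); rewrite ns nmM nmX ns => /(_ sd).
by rewrite exprS mulrA ler_pM2r// exprn_gt0.
Qed.

Lemma tay_unique phi r c c' : 0 < r -> tay phi r c -> tay phi r c' -> c =1 c'.
Proof.
move=> r0 [M M0 h] [M' M'0 h'].
have [K [K0 hK]] : exists K, 0 <= K /\ forall l N, nm l <= r / 2 ->
    nm (\sum_(k < N) (c k - c' k) * l ^+ k) <= K * (nm l / r) ^+ N.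
  exists (M + M'); split=> [|l N lr]; first exact: addr_ge0.
  have -> : \sum_(k < N) (c k - c' k) * l ^+ k =
     \sum_(k < N) c k * l ^+ k - \sum_(k < N) c' k * l ^+ k.
    by rewrite -sumrB; apply: eq_bigr => k _; rewrite mulrBl.
  have := nm_tri (\sum_(k < N) c k * l ^+ k) (phi l) (\sum_(k < N) c' k * l ^+ k).
  rewrite (nmC _ (phi l)); have := h l N lr; have := h' l N lr; lra.
move=> k; have [m] := ubnP k; elim: m k => // m IH k km.
apply/subr0_eq/(@coef_eq0 _ (K / r ^+ k.+1) (r / 2) k); first by rewrite divr_gt0.
move=> l lr; have := hK l k.+1 lr; rewrite big_ord_recr/= big1 ?add0r.
  by rewrite expr_div_n mulrA mulrAC.
by move=> i _; rewrite (IH i) ?subrr ?mul0r//; exact: leq_trans (ltn_ord i) _.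
Qed.

Lemma tay_sub phi psi r c c' : tay phi r c -> tay psi r c' ->
  tay (fun l => phi l - psi l) r (fun k => c k - c' k).
Proof.
move=> [M M0 h] [M' M'0 h']; exists (M + M'); first exact: addr_ge0.
move=> l N lr.
have -> : \sum_(k < N) (c k - c' k) * l ^+ k =
    \sum_(k < N) c k * l ^+ k - \sum_(k < N) c' k * l ^+ k.
  by rewrite -sumrB; apply: eq_bigr => k _; rewrite mulrBl.
set A := \sum_(k < N) c k * l ^+ k; set B := \sum_(k < N) _.
have -> : phi l - psi l - (A - B) = (phi l - A) - (psi l - B) by ring.
by rewrite (le_trans (nmB _ _))// mulrDl lerD ?h ?h'.
Qed.

Lemma tay_zero phi r c : 0 < r -> tay phi r c -> (forall k, c k = 0) ->
  forall l, nm l <= r / 2 -> phi l = 0.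
Proof.
move=> r0 [M M0 h] hc l lr; apply: nm_eq0; apply/eqP; rewrite eq_le nm_ge0 andbT.
apply: (@le_geo _ _ _ M) => k; rewrite add0r.
have := h l k lr; rewrite big1 ?subr0 => [|i _]; last by rewrite hc mul0r.
move=> /le_trans; apply; rewrite ler_wpM2l// lerXn2r ?nnegrE ?invr_ge0//.
  by rewrite divr_ge0 ?nm_ge0// ltW.
by rewrite ler_pdivrMr// mulrC.
Qed.

(** If some coefficient is nonzero, the first such one dominates the remainder near 0. *)
Lemma tay_dichotomy phi r c : 0 < r -> tay phi r c ->
  (forall l, nm l <= r / 2 -> phi l = 0) \/
  exists2 d, 0 < d & forall l, 0 < nm l -> nm l < d -> phi l != 0.
Proof.
move=> r0 tc; have [hc|] := pselect (forall k, c k = 0).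
  by left; exact: tay_zero tc hc.
move=> /existsNP[k0 /eqP ck0]; right.
have [k ck hk] : exists2 k, c k != 0 & forall j, (j < k)%N -> c j = 0.
  case: (ex_minnP (ex_intro (fun k => c k != 0) k0 ck0)) => k ck hk.
  exists k => // j jk; apply/eqP/negPn/negP => /hk.
  by rewrite leqNgt jk.
have [K K0 hK] := tay_leading r0 tc hk.
have nck : 0 < nm (c k) by rewrite nm_gt0.
have K1 : 0 < K + 1 by rewrite ltr_wpDl.
exists (Num.min (r / 2) (nm (c k) / (K + 1))).
  by rewrite lt_min !divr_gt0.
move=> l l0; rewrite lt_min => /andP[lr]; rewrite ltr_pdivlMr// => lk.
apply/eqP => p0; have := hK l (ltW lr); rewrite p0 sub0r nmN nmM nmX exprS mulrA.
by rewrite ler_pM2r ?exprn_gt0//; nra.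
Qed.

End Taylor.

Section Lines.
Variables (R : realType) (n : nat).
Local Notation C := R[i].
Local Notation rc := (real_complex R).
Local Notation T := 'rV[C]_n.

Lemma unif_tay (f : T -> C) x h r s : 0 < s -> s * nv h < r -> unif (bal x r) f ->
  exists c, tay (fun l => f (x + l *: h)) s c.
Proof.
move=> s0 sh uf; have [S S0 hS] := unif_bounded uf.
have hA l : nm l <= s -> bal x r (x + l *: h).
  move=> ls; rewrite /bal/= addrC addKr nvZ (le_lt_trans _ sh)//.
  by rewrite ler_wpM2r ?nv_ge0.
have [c [_ hc]] := unif_line s0 uf hA (fun l ls => hS _ (hA l ls)).
by exists c, (2 * S); [rewrite mulr_ge0|].
Qed.

Lemma unif_tay_approx (f g : T -> C) x h r s c c' e : 0 < s -> s * nv h < r ->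
  unif (bal x r) f -> unif (bal x r) g ->
  (forall y, bal x r y -> nm (f y - g y) <= e) ->
  tay (fun l => f (x + l *: h)) s c -> tay (fun l => g (x + l *: h)) s c' ->
  forall k, nm (c k - c' k) * s ^+ k <= e.
Proof.
move=> s0 sh uf ug he tc tc'.
have hA l : nm l <= s -> bal x r (x + l *: h).
  move=> ls; rewrite /bal/= addrC addKr nvZ (le_lt_trans _ sh)//.
  by rewrite ler_wpM2r ?nv_ge0.
have [b [hb tb]] := unif_line s0 (unif_sub uf ug) hA (fun l ls => he _ (hA l ls)).
have r0 : 0 < r by apply: le_lt_trans sh; rewrite mulr_ge0 ?nv_ge0// ltW.
have e0 : 0 <= e := le_trans (nm_ge0 _) (he x (bal_center x r0)).
have tb' : tay (fun l => f (x + l *: h) - g (x + l *: h)) s b.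
  by exists (2 * e); [rewrite mulr_ge0|].
by move=> k; rewrite -(tay_unique s0 tb' (tay_sub tc tc')).
Qed.

Lemma unif_bal_sub (f : T -> C) x r y s : nv (y - x) + s <= r ->
  unif (bal x r) f -> unif (bal y s) f.
Proof. by move=> h; apply: unif_subset; exact: bal_subset. Qed.

Lemma unif_differentiable (f : T -> C) x r y : unif (bal x r) f -> bal x r y ->
  differentiable f y.
Proof.
rewrite /bal/= => uf yr; have s0 : 0 < r - nv (y - x) by rewrite subr_gt0.
have uy : unif (bal y (r - nv (y - x))) f by apply: unif_bal_sub uf; rewrite addrCA subrr addr0.
have [S _ hS] := unif_bounded uy.
by have [] := unif_diff_taylor s0 uy hS.
Qed.

Lemma unif_diff_le (f : T -> C) x r y s h S : 0 < s -> nv (y - x) + s <= r ->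
  unif (bal x r) f -> (forall z, bal x r z -> nm (f z) <= S) ->
  nm ('d f y h) <= 2 * S * nv h / s.
Proof.
move=> s0 ys uf hS; have uy := unif_bal_sub ys uf.
have hS' z : bal y s z -> nm (f z) <= S by move=> hz; apply: hS; exact: bal_subset hz.
by have [_ + _] := unif_diff_taylor s0 uy hS'; exact.
Qed.

Lemma unif_diff_approx (f g : T -> C) x r y s h e : 0 < s -> nv (y - x) + s <= r ->
  unif (bal x r) f -> unif (bal x r) g ->
  (forall z, bal x r z -> nm (f z - g z) <= e) ->
  nm ('d f y h - 'd g y h) <= 2 * e * nv h / s.
Proof.
move=> s0 ys uf ug he.
have yr : bal x r y by rewrite /bal/=; lra.
have <- := diff_subE h (unif_differentiable uf yr) (unif_differentiable ug yr).
exact: (unif_diff_le _ s0 ys (unif_sub uf ug) he).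
Qed.

Lemma unif_diff (f : T -> C) x r s h : s < r -> unif (bal x r) f ->
  unif (bal x s) (fun y => 'd f y h).
Proof.
move=> sr uf e e0; have d0 : 0 < (r - s) by rewrite subr_gt0.
have v0 : 0 < 2 * nv h + 1 by rewrite ltr_wpDl// mulr_ge0// nv_ge0.
have [g pg hg] := uf (e * (r - s) / (2 * nv h + 1)) ltac:(by rewrite divr_gt0// mulr_gt0).
exists (fun y => 'd g y h); first exact: polf_diff.
move=> y; rewrite /bal/= => ys.
have := @unif_diff_approx f g x r y (r - s) h _ d0 _ uf (unif_polf _ pg) hg.
move=> /(_ ltac:(lra)) /le_trans; apply.
rewrite ler_pdivrMr//; set a := nv h in v0 *; have a0 : 0 <= a := nv_ge0 h.
have -> : 2 * (e * (r - s) / (2 * a + 1)) * a = e * (r - s) * (2 * a / (2 * a + 1)).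
  by ring.
by rewrite ler_piMr ?mulr_ge0 ?ltW// ltr_pdivrMr// mul1r; lra.
Qed.

Lemma poly_tay (phi : C -> C) (r : R) (p : {poly C}) : 0 < r ->
  (forall l, phi l = p.[l]) -> tay phi r (fun k => p`_k).
Proof.
move=> r0 hp; have pb : exists2 S, 0 <= S & forall l, nm l <= r -> nm p.[l] <= S.
  exists (\sum_(k < size p) nm p`_k * r ^+ k).
    by apply: sumr_ge0 => k _; rewrite mulr_ge0 ?nm_ge0// exprn_ge0// ltW.
  move=> l lr; rewrite horner_coef (le_trans (nm_sum _ _ _))//.
  apply: ler_sum => k _; rewrite nmM nmX ler_wpM2l ?nm_ge0//.
  by rewrite lerXn2r ?nnegrE ?nm_ge0// ltW.
have [S S0 hS] := pb; exists (2 * S); first by rewrite mulr_ge0.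
by move=> l N lr; rewrite hp; exact: poly_tail.
Qed.

Lemma polf_line_diff (g : T -> C) x h (p : {poly C}) : polf g ->
  (forall l, g (x + l *: h) = p.[l]) -> forall l, 'd g (x + l *: h) h = p^`().[l].
Proof.
move=> pg hp l; have [q [hq ->]] := polf_line (x + l *: h) h pg.
have qE : q = p \Po ('X + l%:P).
  have e m : (q - (p \Po ('X + l%:P))).[m] = 0.
    rewrite hornerD hornerN horner_comp hornerD hornerX hornerC -hq -hp.
    by rewrite -addrA -scalerDl [l + m]addrC subrr.
  (* The difference vanishes at every point; the integers 0, 1, ..., distinct in characteristic 0,
     would give it more roots than its size allows. *)
  apply/subr0_eq/eqP/negPn/negP => nz.
  pose s := [seq (i%:R : C) | i <- iota 0 (size (q - (p \Po ('X + l%:P))))].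
  have us : uniq s.
    by rewrite map_inj_uniq ?iota_uniq// => i j /eqP; rewrite eqr_nat => /eqP.
  have as_ : all (root (q - (p \Po ('X + l%:P)))) s.
    by apply/allP => m _; rewrite /root e.
  by have := max_poly_roots nz as_ us; rewrite size_map size_iota ltnn.
have -> : q`_1 = q^`()`_0 by rewrite coef_deriv mulr1n.
rewrite -horner_coef0 qE deriv_comp hornerM horner_comp derivD derivX derivC addr0.
by rewrite !hornerE.
Qed.

(* True for polynomials, hence for their uniform limits. *)
Lemma tay_diff (f : T -> C) x h r s c e : 0 < s -> s * nv h < r / 2 -> 0 < r ->
  unif (bal x r) f -> tay (fun l => f (x + l *: h)) s c ->
  tay (fun l => 'd f (x + l *: h) h) s e -> forall k, e k = c k.+1 *+ k.+1.
Proof.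
move=> s0 sh r0 uf tc te k; apply/subr0_eq/nm_eq0/eqP; rewrite eq_le nm_ge0 andbT.
have sh' : s * nv h < r by lra.
have r20 : 0 < r - r / 2 by lra.
have ud : unif (bal x (r / 2)) (fun y => 'd f y h) by apply: unif_diff uf; lra.
apply: (@le0_small _ _ (4 * nv h / r / s ^+ k + k.+1%:R / s ^+ k.+1) 1) => // d d0 _.
have [g pg hg] := uf d d0; have [p [hp _]] := polf_line x h pg.
have ug := unif_polf (bal x r) pg.
have := unif_tay_approx s0 sh' uf ug hg tc (poly_tay s0 hp) k.+1.
have tp : tay (fun l => 'd g (x + l *: h) h) s (fun k => p^`()`_k).
  exact: poly_tay s0 (polf_line_diff pg hp).
have hd y : bal x (r / 2) y -> nm ('d f y h - 'd g y h) <= 2 * d * nv h / (r / 2).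
  rewrite /bal/= => hy; apply: (unif_diff_approx h _ _ uf ug hg); lra.
have := unif_tay_approx s0 sh ud (unif_polf _ (polf_diff h pg)) hd te tp k.
rewrite coef_deriv -!ler_pdivlMr ?exprn_gt0// => h1 h2.
have := nm_tri (e k) (p`_k.+1 *+ k.+1) (c k.+1 *+ k.+1).
rewrite -mulrnBl -(mulr_natl (_ - _)) nmM nm_nat (nmC (p`_k.+1)) => /le_trans; apply.
have h3 : k.+1%:R * nm (c k.+1 - p`_k.+1) <= k.+1%:R * (d / s ^+ k.+1).
  by rewrite ler_wpM2l.
apply: le_trans (lerD h1 h3) _.
rewrite le_eqVlt; apply/orP; left; apply/eqP; field.
by rewrite !gt_eqF ?exprn_gt0.
Qed.

End Lines.

Section MatrixDifferentiable.
Variables (R : realType) (V : normedModType R[i]).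
Local Notation C := R[i].

Lemma mx_differentiable p q (F : V -> 'M[C]_(p, q)) (y : V) :
  (forall i j, differentiable (fun t => F t i j : C) y) ->
  differentiable F y /\
  forall h, 'd F y h = \matrix_(i, j) 'd (fun t => F t i j : C) y h.
Proof.
move=> dF0.
have FE : F = (fun t => \sum_(i < p) \sum_(j < q) F t i j *: delta_mx i j).
  by apply/funext => t; exact: matrix_sum_delta.
have dZ i j : is_diff y (fun t => F t i j *: (delta_mx i j : 'M[C]_(p, q)))
    (fun h => 'd (fun t => F t i j : C) y h *: delta_mx i j).
  by apply: DiffDef; [exact/differentiableZl|rewrite diffZl].
have dS (I : Type) (s : seq I) (g dg : I -> V -> 'M[C]_(p, q)) :
    (forall i, is_diff y (g i) (dg i)) ->
    is_diff y (fun t => \sum_(i <- s) g i t) (fun h => \sum_(i <- s) dg i h).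
  move=> hg; elim: s => [|i s IH].
    rewrite (_ : (fun t => _) = cst 0); last by apply/funext => t; rewrite big_nil.
    rewrite (_ : (fun h => _) = 0 :> (V -> 'M[C]_(p, q))); last by apply/funext => t; rewrite big_nil.
    exact: is_diff_cst.
  have /= := is_diffD (hg i) IH.
  rewrite (_ : g i + _ = (fun t => \sum_(i0 <- i :: s) g i0 t)); last first.
    by apply/funext => t; rewrite big_cons.
  rewrite (_ : dg i + _ = (fun t => \sum_(i0 <- i :: s) dg i0 t))//.
  by apply/funext => t; rewrite big_cons.
have D := dS _ (index_enum 'I_p) _ _ (fun i => dS _ (index_enum 'I_q) _ _ (fun j => dZ i j)).
have [dF dE] : differentiable F y /\
   'd F y = (fun h => \sum_(i < p) \sum_(j < q)
     'd (fun t => F t i j : C) y h *: (delta_mx i j : 'M[C]_(p, q))) :> (V -> _).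
  by case: D => dD eD; split; [rewrite FE; exact: dD|rewrite [in LHS]FE; exact: eD].
split=> // h; rewrite dE.
by rewrite [RHS]matrix_sum_delta; apply: eq_bigr => i _; apply: eq_bigr => j _; rewrite mxE.
Qed.

End MatrixDifferentiable.

(** * Holomorphic matrices and their differentials *)

Section AnalyticMatrices.
Variables (R : realType) (n : nat).
Local Notation C := R[i].
Local Notation rc := (real_complex R).
Local Notation T := 'rV[C]_n.

Lemma unif_continuous (f : T -> C) x r (e : R) : 0 < r -> 0 < e -> unif (bal x r) f ->
  exists2 s, 0 < s & s <= r /\ forall y, bal x s y -> nm (f y - f x) < e.
Proof.
move=> r0 e0 uf.
have df := unif_differentiable uf (bal_center x r0).
have /differentiable_continuous/cvgrPdist_lt/(_ (rc e)) := df.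
rewrite ltcR => /(_ e0)/nbhs_balP[s s0 hs].
exists (Num.min s r); first by rewrite lt_min s0.
split; first by rewrite ge_min lexx orbT.
move=> y hy; have hy' : bal x s y by apply: bal_le hy; rewrite ge_min lexx.
have := hs y hy'; by rewrite /= nmE ltcR nmC.
Qed.

(** With g = 1 - f / f(x), of modulus at most 1/2 near x, the inverse is f(x)^-1 times the geometric
    series of g, whose partial sums converge uniformly. *)
Lemma unif_inv (f : T -> C) x r : 0 < r -> unif (bal x r) f -> f x != 0 ->
  exists2 s, 0 < s & [/\ s <= r, forall y, bal x s y -> f y != 0 &
    unif (bal x s) (fun y => (f y)^-1)].
Proof.
move=> r0 uf fx0; have a0 : 0 < nm (f x) by rewrite nm_gt0.
have [s s0 [sr hs]] := unif_continuous r0 (divr_gt0 a0 (ltr0n R 2)) uf.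
have us := unif_subset (@bal_le _ _ x _ _ sr) uf.
pose g y := 1 - (f x)^-1 * f y.
have ug : unif (bal x s) g by apply: unif_sub; [exact: unif_cst|exact: unif_scale].
have hg y : bal x s y -> nm (g y) <= 2^-1.
  move=> /hs; have -> : f y - f x = - (f x * g y).
    by rewrite /g mulrBr mulr1 mulVKf// opprB.
  by rewrite nmN nmM => h; rewrite -(ler_pM2l a0) ltW.
have f0 y : bal x s y -> f y != 0.
  move=> hy; apply/eqP => fy0; have := hg y hy; rewrite /g fy0 mulr0 subr0 nm1; lra.
have ugk k : unif (bal x s) (fun y => g y ^+ k).
  elim: k => [|k IH].
    by apply: unif_eq (unif_cst _ 1) => y _; rewrite expr0.
  by apply: unif_eq (unif_mul ug IH) => y _; rewrite exprS.
exists s => //; split=> //.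
apply: unif_eq (unif_scale (f x)^-1 (f := fun y => (1 - g y)^-1) _).
  by move=> y _; rewrite /g opprB addrC subrK invfM invrK mulrA mulVf// mul1r.
apply: unif_lim => e e0; have [N hN] := half_expn_small 2 e0.
exists (fun y => \sum_(k < N) g y ^+ k); first by apply: unif_sum => k _; exact: ugk.
move=> y hy; have := hg y hy => gy.
have g1 : 2^-1 <= nm (1 - g y).
  by have := nm_ge_sub 1 (g y); rewrite nm1; lra.
have nz : 1 - g y != 0.
  by apply/eqP => h; move: g1; rewrite h nm0; lra.
have -> : (1 - g y)^-1 - \sum_(k < N) g y ^+ k = g y ^+ N / (1 - g y).
  apply: (mulfI nz); rewrite mulrBr mulfV// mulrCA mulfV// mulr1.
  set S := \sum_(k < N) _; have -> : 1 - (1 - g y) * S = 1 + (g y - 1) * S by ring.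
  by rewrite -subrX1; ring.
rewrite nmM nmX nmV (le_trans _ (ltW (hN N (leqnn _))))//.
rewrite mulrC ler_pM ?invr_ge0 ?nm_ge0 ?exprn_ge0 ?nm_ge0//.
  by rewrite -[leRHS]invrK lef_pV2 ?posrE//; lra.
by rewrite lerXn2r ?nnegrE ?nm_ge0 ?invr_ge0.
Qed.

Lemma eq_diff (f g : T -> C) t h : f =1 g -> 'd f t h = 'd g t h.
Proof. by move=> /funext ->. Qed.

Section Matrices.
Variables p q : nat.
Implicit Types (F G : T -> 'M[C]_(p, q)).

Definition munif (A : set T) F := forall i j, unif A (fun t => F t i j).

Definition md F (t h : T) : 'M[C]_(p, q) :=
  \matrix_(i, j) 'd (fun s => F s i j : C) t h.

Lemma mx_addE (A B : 'M[C]_(p, q)) i j : (A + B) i j = A i j + B i j.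
Proof. by rewrite mxE. Qed.

Lemma mx_subE (A B : 'M[C]_(p, q)) i j : (A - B) i j = A i j - B i j.
Proof. by rewrite !mxE. Qed.

Lemma mdE F t h i j : md F t h i j = 'd (fun s => F s i j : C) t h.
Proof. by rewrite mxE. Qed.

Lemma munif_subset (A B : set T) F : B `<=` A -> munif A F -> munif B F.
Proof. by move=> BA h i j; exact: unif_subset (h i j). Qed.

Lemma munif_eq (A : set T) F G : (forall x, A x -> F x = G x) -> munif A F -> munif A G.
Proof. by move=> FG h i j; apply: unif_eq (h i j) => x Ax; rewrite FG. Qed.

Lemma munif_cst A B : munif A (fun=> B).
Proof. by move=> i j; exact: unif_cst. Qed.

Lemma munif_add A F G : munif A F -> munif A G -> munif A (fun t => F t + G t).
Proof.
by move=> hF hG i j; apply: unif_eq (unif_add (hF i j) (hG i j)) => t _; rewrite mxE.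
Qed.

Lemma munif_opp A F : munif A F -> munif A (fun t => - F t).
Proof.
by move=> hF i j; apply: unif_eq (unif_opp (hF i j)) => t _; rewrite mxE.
Qed.

Lemma munif_sub A F G : munif A F -> munif A G -> munif A (fun t => F t - G t).
Proof. by move=> hF /munif_opp; exact: munif_add. Qed.

Lemma munif_scalef x r (f : T -> C) F : unif (bal x r) f -> munif (bal x r) F ->
  munif (bal x r) (fun t => f t *: F t).
Proof.
by move=> hf hF i j; apply: unif_eq (unif_mul hf (hF i j)) => t _; rewrite mxE.
Qed.

Lemma munif_sum A (I : Type) (s : seq I) (P : pred I) (F : I -> T -> 'M[C]_(p, q)) :
  (forall i, P i -> munif A (F i)) -> munif A (fun t => \sum_(i <- s | P i) F i t).
Proof.
move=> h i j; apply: unif_eq (unif_sum (f := fun k t => F k t i j) s (fun k Pk => h k Pk i j)).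
by move=> t _; rewrite summxE.
Qed.

Lemma munif_lim A F : (forall e : R, 0 < e -> exists2 G, munif A G &
    forall x, A x -> nmm (F x - G x) <= e) -> munif A F.
Proof.
move=> H i j; apply: unif_lim => e e0; have [G uG hG] := H e e0.
exists (fun t => G t i j) => // x Ax; apply: le_trans (hG x Ax).
by have := nm_le_nmm (F x - G x) i j; rewrite !mxE.
Qed.

Lemma munif_msum A (a : nat -> T -> 'M[C]_(p, q)) M : (forall k, munif A (a k)) ->
  (forall t, A t -> mgeo (a^~ t) M) -> munif A (fun t => msum (a^~ t)).
Proof.
move=> ua ga; apply: munif_lim => e e0; have [N hN] := half_expn_small (2 * M) e0.
exists (fun t => \sum_(k < N) a k t); first by apply: munif_sum.
move=> t At; apply: le_trans (ltW (hN N (leqnn _))).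
exact: msum_tail (ga t At) N.
Qed.

Lemma eq_md F G t h : F =1 G -> md F t h = md G t h.
Proof. by move=> /funext ->. Qed.

Lemma md_add F G t h r x : munif (bal x r) F -> munif (bal x r) G -> bal x r t ->
  md (fun t => F t + G t) t h = md F t h + md G t h.
Proof.
move=> hF hG hr; apply/matrixP => i j; apply: etrans (mdE _ t h i j) _.
apply: etrans _ (esym (mx_addE _ _ i j)).
apply: etrans _ (congr2 +%R (esym (mdE F t h i j)) (esym (mdE G t h i j))) => /=.
apply: etrans (eq_diff _ _ _) (diff_addE h (unif_differentiable (hF i j) hr)
  (unif_differentiable (hG i j) hr)).
by move=> y; rewrite mxE.
Qed.

Lemma md_cst B t h : md (fun=> B) t h = 0.
Proof. by apply/matrixP => i j; apply: etrans (mdE _ t h i j) _; rewrite mxE; exact: diff_cstE. Qed.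

Lemma md_sum x r (I : eqType) (s : seq I) (F : I -> T -> 'M[C]_(p, q)) t h :
  (forall i, munif (bal x r) (F i)) -> bal x r t ->
  md (fun t => \sum_(i <- s) F i t) t h = \sum_(i <- s) md (F i) t h.
Proof.
move=> hF hr; elim: s => [|i s IH].
  by rewrite big_nil; apply: etrans (eq_md t h _) (md_cst 0 t h) => y; rewrite big_nil.
rewrite big_cons -IH.
apply: etrans (eq_md t h _) (md_add h (hF i) (munif_sum s (P := xpredT) (fun j _ => hF j)) hr).
by move=> y; rewrite big_cons.
Qed.

Lemma md_le F x r y s h S : 0 < s -> nv (y - x) + s <= r ->
  munif (bal x r) F -> (forall z, bal x r z -> nmm (F z) <= S) ->
  nmm (md F y h) <= (p * q)%:R * (2 * S * nv h / s).
Proof.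
move=> s0 ys uF hS; rewrite /nmm.
rewrite (@le_trans _ _ (\sum_(i < p) \sum_(j < q) (2 * S * nv h / s)))//.
  apply: ler_sum => i _; apply: ler_sum => j _; rewrite mdE.
  apply: (unif_diff_le h s0 ys (uF i j)) => z hz.
  exact: le_trans (nm_le_nmm _ _ _) (hS z hz).
by rewrite !sumr_const !card_ord -mulrnA -[leLHS]mulr_natl (mulnC q p).
Qed.

Lemma md_sub F G t h r x : munif (bal x r) F -> munif (bal x r) G -> bal x r t ->
  md (fun t => F t - G t) t h = md F t h - md G t h.
Proof.
move=> hF hG hr; apply/matrixP => i j; apply: etrans (mdE _ t h i j) _.
apply: etrans _ (esym (mx_subE _ _ i j)).
apply: etrans _ (congr2 (fun a b => a - b) (esym (mdE F t h i j)) (esym (mdE G t h i j))) => /=.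
apply: etrans (eq_diff _ _ _) (diff_subE h (unif_differentiable (hF i j) hr)
  (unif_differentiable (hG i j) hr)).
by move=> y; rewrite !mxE.
Qed.

Lemma md_msum x r (a : nat -> T -> 'M[C]_(p, q)) M t h :
  (forall k, munif (bal x r) (a k)) ->
  (forall t, bal x r t -> mgeo (a^~ t) M) -> bal x r t ->
  md (fun t => msum (a^~ t)) t h = msum (fun k => md (a k) t h).
Proof.
move=> ua ga hr; have s0 : 0 < r - nv (t - x) by rewrite subr_gt0.
apply/esym/(@msumE _ _ _ _ _ ((p * q)%:R * (2 * (2 * M) * nv h / (r - nv (t - x))))) => N.
have us := munif_msum ua ga.
have uf : munif (bal x r) (fun t => \sum_(k < N) a k t) by apply: munif_sum.
have ht : nv (t - x) + (r - nv (t - x)) <= r by lra.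
have := md_le h s0 ht (munif_sub us uf) (fun z hz => msum_tail (ga z hz) N).
have e1 := md_sum (index_enum 'I_N) h (fun k : 'I_N => ua k) hr.
have e2 := md_sub h us uf hr.
have e := etrans e2 (congr1 (fun z => md (fun t => msum (a^~ t)) t h - z) e1).
rewrite e => /le_trans; apply; rewrite le_eqVlt; apply/orP; left; apply/eqP; ring.
Qed.

Lemma munif_bounded F x r : munif (bal x r) F ->
  exists2 S, 0 <= S & forall y, bal x r y -> nmm (F y) <= S.
Proof.
move=> uF.
have H (ij : 'I_p * 'I_q) : exists S, 0 <= S /\
    forall y, bal x r y -> nm (F y ij.1 ij.2) <= S.
  by have [S S0 hS] := unif_bounded (uF ij.1 ij.2); exists S.
have [S hS] := choice H.
exists (\sum_i \sum_j S (i, j)).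
  by apply: sumr_ge0 => i _; apply: sumr_ge0 => j _; case: (hS (i, j)).
by move=> y hy; apply: ler_sum => i _; apply: ler_sum => j _; apply: (hS (i, j)).2.
Qed.

Lemma munif_differentiable F x r y : munif (bal x r) F -> bal x r y ->
  differentiable F y /\ forall h, 'd F y h = md F y h.
Proof. by move=> uF hy; exact: mx_differentiable (fun i j => unif_differentiable (uF i j) hy). Qed.

End Matrices.

Lemma munif_mul p q s x r (F : T -> 'M[C]_(p, q)) (G : T -> 'M[C]_(q, s)) :
  munif (bal x r) F -> munif (bal x r) G -> munif (bal x r) (fun t => F t *m G t).
Proof.
move=> uF uG i j; apply: unif_eq (unif_sum (index_enum 'I_q) (P := xpredT)
  (f := fun k t => F t i k * G t k j) (fun k _ => unif_mul (uF i k) (uG k j))).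
by move=> t _; rewrite mxE.
Qed.

Lemma mx_mulE p q s (A : 'M[C]_(p, q)) (B : 'M[C]_(q, s)) i j :
  (A *m B) i j = \sum_k A i k * B k j.
Proof. by rewrite mxE. Qed.

Lemma md_mul p q s x r (F : T -> 'M[C]_(p, q)) (G : T -> 'M[C]_(q, s)) t h :
  munif (bal x r) F -> munif (bal x r) G -> bal x r t ->
  md (fun t => F t *m G t) t h = F t *m md G t h + md F t h *m G t.
Proof.
move=> uF uG hr; apply/matrixP => i j.
have dF k := unif_differentiable (uF i k) hr.
have dG k := unif_differentiable (uG k j) hr.
(* Each product of two entries is made a 1 x 1 matrix, so that [md_sum] differentiates their sum. *)
pose E k (y : T) : 'M[C]_1 := (F y i k * G y k j)%:M.
have EE k y : E k y 0 0 = F y i k * G y k j by rewrite mxE eqxx mulr1n.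
have uE k : munif (bal x r) (E k).
  move=> a b; rewrite !ord1; apply: unif_eq (unif_mul (uF i k) (uG k j)) => y _.
  by rewrite EE.
have e1 : md (fun y => F y *m G y) t h i j =
    (md (fun y => \sum_(k < q) E k y) t h) 0 0.
  apply: etrans (mdE _ t h i j) _; apply: etrans _ (esym (mdE _ t h 0 0)).
  apply: eq_diff => y; rewrite mx_mulE summxE; apply: eq_bigr => k _.
  by rewrite EE.
apply: etrans e1 _; rewrite (md_sum _ h uE hr) summxE.
apply: etrans _ (esym (mx_addE _ _ i j)).
apply: etrans _ (congr2 +%R (esym (mx_mulE _ _ i j)) (esym (mx_mulE _ _ i j))).
rewrite -big_split/=; apply: eq_bigr => k _.
apply: etrans (mdE _ t h 0 0) _; apply: etrans (eq_diff _ _ (EE k)) _.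
apply: etrans (diff_mulE h (dF k) (dG k)) _.
by f_equal; f_equal; apply: esym; exact: mdE.
Qed.

End AnalyticMatrices.

(** * Formal solutions and their Gevrey estimates *)

Section FormalSolutions.
Variables (R : realType) (n : nat).
Local Notation C := R[i].
Local Notation T := 'rV[C]_n.
Implicit Types (q d : T) (G : nat -> 'M[C]_n).

(** The matrix V of the overview. It is computed from [G1] because, away from t_o, it is not given
    in advance. *)
Definition residue_of q d (G1 : 'M[C]_n) : 'M[C]_n :=
  diag_mx d + (G1 *m diag_mx q - diag_mx q *m G1).

Definition fsol_eq q d G k :=
  diag_mx q *m G k.+1 + residue_of q d (G 1%N) *m G k + k%:R *: G k
  = G k.+1 *m diag_mx q + G k *m diag_mx d.

Definition fsol q d G := G 0%N = 1%:M /\ forall k, fsol_eq q d G k.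

(** Positive k suffice: the quantification over i and j, which may be exchanged, covers the negative
    integers. *)
Definition nonresonant q d := forall i j, q 0 i = q 0 j ->
  forall k, (0 < k)%N -> d 0 j - d 0 i != k%:R.

Lemma diag_mulE q (A : 'M[C]_n) i j : (diag_mx q *m A) i j = q 0 i * A i j.
Proof. by rewrite mul_diag_mx mxE. Qed.

Lemma mul_diagE q (A : 'M[C]_n) i j : (A *m diag_mx q) i j = A i j * q 0 j.
Proof. by rewrite mul_mx_diag mxE. Qed.

Lemma fsol_eqP q d G k : fsol_eq q d G k <-> forall i j,
  (q 0 i - q 0 j) * G k.+1 i j =
  (d 0 j - k%:R) * G k i j - \sum_l residue_of q d (G 1%N) i l * G k l j.
Proof.
rewrite /fsol_eq; split=> [/matrixP e i j|e].
  have := e i j; rewrite !mx_addE diag_mulE !mul_diagE mx_mulE.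
  rewrite (_ : (k%:R *: G k) i j = k%:R * G k i j) ?mxE// => h.
  set S := \sum_(_ < _) _ in h *.
  have -> : (q 0 i - q 0 j) * G k.+1 i j = q 0 i * G k.+1 i j + S + k%:R * G k i j
    - G k.+1 i j * q 0 j - S - k%:R * G k i j by ring.
  by rewrite h; ring.
apply/matrixP => i j; have := e i j; rewrite !mx_addE diag_mulE !mul_diagE mx_mulE.
rewrite (_ : (k%:R *: G k) i j = k%:R * G k i j) ?mxE// => h.
set S := \sum_(_ < _) _ in h *.
have -> : q 0 i * G k.+1 i j = (q 0 i - q 0 j) * G k.+1 i j + q 0 j * G k.+1 i j by ring.
by rewrite h; ring.
Qed.

Section Existence.
Variables (q d : T) (A : 'M[C]_n).
Hypothesis A_block : forall i j, i != j -> q 0 i = q 0 j -> A i j = 0.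
Hypothesis A_diag : forall i, A i i = d 0 i.
Hypothesis q_nonres : nonresonant q d.

(** For q_i <> q_j, the equation of index k gives the entry of [G k.+1] by division by q_i - q_j. *)
Let off k (H : 'M[C]_n) : 'M[C]_n := \matrix_(i, j)
  if q 0 i == q 0 j then 0
  else (H i j * d 0 j - (A *m H) i j - k%:R * H i j) / (q 0 i - q 0 j).

(** When q_i = q_j, the equation of index k does not involve the entry of [G k.+1]. It is found in
    the next equation, where its coefficient d_j - d_i - (k + 1) is nonzero by nonresonance and the
    other terms only involve entries given by [off]. *)
Let step k (H : 'M[C]_n) : 'M[C]_n := \matrix_(i, j)
  if q 0 i == q 0 j then (A *m off k H) i j / (d 0 j - d 0 i - k.+1%:R)
  else off k H i j.

Fixpoint formal_solution k : 'M[C]_n :=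
  if k is k'.+1 then step k' (formal_solution k') else 1%:M.

Let sumA (X : 'M[C]_n) i j : q 0 i = q 0 j ->
  \sum_l A i l * X l j = d 0 i * X i j + \sum_(l | q 0 l != q 0 i) A i l * X l j.
Proof.
move=> qij; rewrite (bigID (fun l => q 0 l == q 0 i))/=; congr (_ + _).
rewrite (bigD1 i)//= A_diag big1 ?addr0// => l /andP[/eqP ql li].
by rewrite A_block ?mul0r// eq_sym.
Qed.

Lemma formal_solution_exists : exists G, fsol q d G /\ residue_of q d (G 1%N) = A.
Proof.
exists formal_solution.
have res : residue_of q d (formal_solution 1) = A.
  apply/matrixP => i j; rewrite /residue_of mx_addE mx_subE mul_diagE diag_mulE.
  have [qij|qij] := eqVneq (q 0 i) (q 0 j).
    rewrite qij [_ * q 0 j]mulrC subrr addr0 !mxE; case: eqVneq => [<-|ij].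
      by rewrite mulr1n A_diag.
    by rewrite mulr0n A_block.
  have -> : formal_solution 1 i j = ((1%:M : 'M[C]_n) i j * d 0 j
      - (A *m 1%:M) i j - 0%:R * (1%:M : 'M[C]_n) i j) / (q 0 i - q 0 j).
    by rewrite [formal_solution 1]/= [step _ _ i j]mxE (negPf qij)
      [off _ _ i j]mxE (negPf qij).
  have z : q 0 i - q 0 j != 0 by rewrite subr_eq0.
  have ij : i == j = false by apply/negP => /eqP e; rewrite e eqxx in qij.
  rewrite mulmx1 (_ : diag_mx d i j = 0) ?mxE ?ij ?mulr0n//.
  by rewrite mulr0 !mul0r sub0r subr0 add0r; field.
split=> //; split=> // k; apply/fsol_eqP => i j; rewrite res.
have [qij|qij] := eqVneq (q 0 i) (q 0 j); last first.
  rewrite [formal_solution _.+1]/= [_ i j]mxE (negPf qij) mxE (negPf qij) mx_mulE.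
  have z : q 0 i - q 0 j != 0 by rewrite subr_eq0.
  by rewrite mulrCA mulfV// mulr1; ring.
rewrite qij subrr mul0r sumA//; apply/esym.
case: k => [|k].
  rewrite [formal_solution 0]/= subr0 [1%:M i j]mxE big1 => [|l li].
    case: eqVneq => [->|_]; first by rewrite !mulr1 addr0 subrr.
    by rewrite !mulr0 addr0 subrr.
  have lj : l != j by apply: contraNneq li => ->; rewrite qij.
  by rewrite mxE (negPf lj) mulr0.
rewrite [formal_solution _]/=.
set H := formal_solution k.
have -> : \sum_(l | q 0 l != q 0 i) A i l * step k H l j =
    (A *m off k H) i j.
  rewrite mx_mulE sumA// [off k H i j]mxE qij eqxx mulr0 add0r.
  by apply: eq_bigr => l ql; rewrite [step _ _ l j]mxE (negPf ql).
have z : d 0 j - d 0 i - k.+1%:R != 0 by rewrite subr_eq0 q_nonres.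
rewrite [step k H i j]mxE qij eqxx.
set X := (A *m off k H) i j.
have -> : (d 0 j - k.+1%:R) * (X / (d 0 j - d 0 i - k.+1%:R)) -
   (d 0 i * (X / (d 0 j - d 0 i - k.+1%:R)) + X) =
   (d 0 j - d 0 i - k.+1%:R) * (X / (d 0 j - d 0 i - k.+1%:R)) - X by ring.
by rewrite mulrCA mulfV// mulr1 subrr.
Qed.

End Existence.

Lemma inv_nat_sub_bounded (a : C) : (forall k, (0 < k)%N -> a != k%:R) ->
  exists2 M : R, 0 <= M & forall k, (0 < k)%N -> nm (a - k%:R)^-1 <= M.
Proof.
move=> ha; have [N hN] : exists N : nat, nm a + 1 < N%:R.
  by exists (Num.truncn (nm a + 1)).+1; exact: truncnS_gt.
exists (1 + \sum_(k < N) nm (a - k%:R)^-1).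
  by rewrite addr_ge0// sumr_ge0// => k _; exact: nm_ge0.
move=> k k0; have [Nk|kN] := leqP N k.
  rewrite nmV (@le_trans _ _ 1)//; last first.
    by rewrite lerDl sumr_ge0// => i _; exact: nm_ge0.
  have Nk' : N%:R <= k%:R :> R by rewrite ler_nat.
  rewrite -[leRHS]invr1 lef_pV2 ?posrE// ?nm_gt0 ?subr_eq0 ?ha//.
  by have := nm_ge_sub k%:R a; rewrite nm_nat nmC; lra.
rewrite (bigD1 (Ordinal kN))//= addrCA lerDl addr_ge0// sumr_ge0// => i _.
exact: nm_ge0.
Qed.

Lemma eventually_decreasing_bounded (s : nat -> R) K : (forall k, 0 <= s k) ->
  (forall k, (K <= k)%N -> s k.+1 <= s k) -> exists2 M, 0 <= M & forall k, s k <= M.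
Proof.
move=> s0 h; exists (\sum_(k < K.+1) s k); first exact: sumr_ge0.
have small k : (k <= K)%N -> s k <= \sum_(k < K.+1) s k.
  move=> kK; rewrite (bigD1 (Ordinal (kK : (k < K.+1)%N)))//= lerDl.
  exact: sumr_ge0.
move=> k; have [/small//|Kk] := leqP k K.
rewrite -(subnKC (ltnW Kk)); elim: (k - K)%N => [|m IH]; first by rewrite addn0 small.
by rewrite addnS (le_trans (h _ (leq_addr _ _))).
Qed.

Section Gevrey.
Variables (q d : T) (G : nat -> 'M[C]_n) (r : R).
Hypothesis r0 : 0 < r.
Hypothesis q_sep : forall i j, q 0 i != q 0 j -> 2 * r <= nm (q 0 i - q 0 j).
Hypothesis q_nonres : nonresonant q d.
Hypothesis G_sol : fsol q d G.

Let V := residue_of q d (G 1%N).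
(** Size of the part off the blocks. For k > 0 it controls the part inside the blocks ([inner_le]),
    because the inverses of d_j - d_i - k are bounded uniformly in k. *)
Let O k : R := \sum_i \sum_(j | q 0 i != q 0 j) nm (G k i j).

Let O_ge0 k : 0 <= O k.
Proof. by apply: sumr_ge0 => i _; apply: sumr_ge0 => j _; exact: nm_ge0. Qed.

Let le_O k i j : q 0 i != q 0 j -> nm (G k i j) <= O k.
Proof.
move=> qij; rewrite /O (bigD1 i)//= (bigD1 j)//= -addrA lerDl addr_ge0//.
  by apply: sumr_ge0 => l _; exact: nm_ge0.
by apply: sumr_ge0 => l _; apply: sumr_ge0 => m _; exact: nm_ge0.
Qed.

Let V_block i j : q 0 i = q 0 j -> V i j = (d 0 i) *+ (i == j).
Proof.
move=> qij; rewrite /V /residue_of mx_addE mx_subE mul_diagE diag_mulE qij.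
by rewrite [_ * q 0 j]mulrC subrr addr0 !mxE; case: eqP => // ->.
Qed.

Let inner_le : exists2 M, 0 <= M & forall k i j, (0 < k)%N -> q 0 i = q 0 j ->
  nm (G k i j) <= M * O k.
Proof.
have H (ij : 'I_n * 'I_n) : exists M : R, 0 <= M /\ forall k, (0 < k)%N ->
    q 0 ij.1 = q 0 ij.2 -> nm (d 0 ij.2 - d 0 ij.1 - k%:R)^-1 <= M.
  have [qij|] := pselect (q 0 ij.1 = q 0 ij.2); last by exists 0.
  by have [M M0 hM] := inv_nat_sub_bounded (q_nonres qij); exists M; split=> // k /hM.
have [M hM] := choice H.
have S0 : 0 <= \sum_ij M ij by apply: sumr_ge0 => ij _; case: (hM ij).
have SM ij : M ij <= \sum_ij M ij.
  by rewrite (bigD1 ij)//= lerDl sumr_ge0// => kl _; case: (hM kl).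
exists ((\sum_ij M ij) * (n%:R * nmm V)); first by rewrite !mulr_ge0 ?nmm_ge0.
move=> k i j k0 qij.
have := (fsol_eqP _ _ _ _).1 (G_sol.2 k) i j; rewrite qij subrr mul0r -/V => /esym.
rewrite (bigID (fun l => q 0 l == q 0 i))/= (bigD1 i)//= [X in _ - (_ + X + _)]big1; last first.
  by move=> l /andP[/eqP ql li]; rewrite V_block// eq_sym (negPf li) mulr0n mul0r.
rewrite addr0 V_block// eqxx mulr1n; set S := \sum_(_ | _) _ => e.
have z : d 0 j - d 0 i - k%:R != 0 by rewrite subr_eq0 q_nonres.
have -> : G k i j = (d 0 j - d 0 i - k%:R)^-1 * S.
  apply: (mulfI z); rewrite mulVKf//; apply/subr0_eq; rewrite -e; ring.
rewrite nmM -mulrA ler_pM ?nm_ge0//.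
  by apply: le_trans (SM (i, j)); case: (hM (i, j)) => _; exact.
rewrite (le_trans (nm_sum _ _ _))//.
rewrite (@le_trans _ _ (\sum_(l < n) nmm V * O k))//; last first.
  by rewrite sumr_const card_ord -[leLHS]mulr_natl -?mulrA.
rewrite [leRHS](bigID (fun l => q 0 l != q 0 i))/= -[leLHS]addr0 lerD//; last first.
  by apply: sumr_ge0 => l _; rewrite mulr_ge0// nmm_ge0.
apply: ler_sum => l ql; rewrite nmM ler_pM ?nm_ge0 ?nm_le_nmm//.
by apply: le_O; rewrite -qij.
Qed.

(** The recursion reads 2 r O_(k+1) <= (k + c) O_k. For k >= c the right factor is at most 2 (k +
    1), and the factor 2 of the separation [2 * r] absorbs the 2, so that O_k r^k / k! is eventually
    decreasing. *)
Lemma gevrey : exists2 K, 0 <= K & forall k, nmm (G k) <= K * k`!%:R / r ^+ k.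
Proof.
have [M M0 hM] := inner_le.
have total k : (0 < k)%N -> nmm (G k) <= (1 + n%:R * (n%:R * M)) * O k.
  move=> k0; rewrite /nmm mulrDl mul1r.
  rewrite (eq_bigr (fun i => \sum_(j | q 0 i != q 0 j) nm (G k i j) +
     \sum_(j | q 0 i == q 0 j) nm (G k i j))); last first.
    by move=> i _; rewrite (bigID (fun j => q 0 i != q 0 j))/=; congr (_ + _);
      apply: eq_bigl => j; rewrite negbK.
  rewrite big_split/= lerD2l.
  rewrite (@le_trans _ _ (\sum_(i < n) n%:R * (M * O k)))//; last first.
    by rewrite sumr_const card_ord -[leLHS]mulr_natl !mulrA.
  apply: ler_sum => i _.
  rewrite (@le_trans _ _ (\sum_(j < n) M * O k))//; last first.
    by rewrite sumr_const card_ord -[leLHS]mulr_natl.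
  rewrite [leRHS](bigID (fun j => q 0 i == q 0 j))/= -[leLHS]addr0 lerD//.
    by apply: ler_sum => j /eqP qij; exact: hM.
  by apply: sumr_ge0 => l _; rewrite mulr_ge0.
pose c := n%:R * (n%:R * ((nv d + nmm V) * (1 + n%:R * (n%:R * M)))) : R.
have c0 : 0 <= c by rewrite !(mulr_ge0, addr_ge0, nv_ge0, nmm_ge0)// mulr_ge0.
have rec k : (0 < k)%N -> 2 * r * O k.+1 <= (k%:R + c) * O k.
  move=> k0; rewrite /O mulr_sumr.
  pose B := (nv d + nmm V) * nmm (G k).
  have B0 : 0 <= B by rewrite mulr_ge0 ?addr_ge0 ?nv_ge0 ?nmm_ge0.
  have ent i j : q 0 i != q 0 j -> 2 * r * nm (G k.+1 i j) <= k%:R * nm (G k i j) + B.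
    move=> qij; rewrite (@le_trans _ _ (nm ((q 0 i - q 0 j) * G k.+1 i j)))//.
      by rewrite nmM ler_wpM2r ?nm_ge0// q_sep.
    have -> := (fsol_eqP _ _ _ _).1 (G_sol.2 k) i j.
    rewrite mulrBl addrAC (le_trans (nmB _ _))// [leLHS]addrC nmM nm_nat lerD2l -/V.
    rewrite (le_trans (nmB _ _))// nmM /B mulrDl lerD//.
      by rewrite ler_pM ?nm_ge0 ?nm_le_nv ?nm_le_nmm.
    rewrite -mx_mulE; apply: le_trans (nm_le_nmm _ _ _) (nmm_mul _ _).
  rewrite (@le_trans _ _ (\sum_i ((\sum_(j | q 0 i != q 0 j) k%:R * nm (G k i j)) + n%:R * B)))//.
    apply: ler_sum => i _; rewrite mulr_sumr.
    rewrite (@le_trans _ _ (\sum_(j | q 0 i != q 0 j) (k%:R * nm (G k i j) + B)))//.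
      by apply: ler_sum => j; exact: ent.
    rewrite big_split/= lerD2l (@le_trans _ _ (\sum_(j < n) B))//.
      by rewrite [leRHS](bigID (fun j => q 0 i != q 0 j))/= lerDl sumr_ge0.
    by rewrite sumr_const card_ord mulr_natl.
  rewrite big_split/= sumr_const card_ord -(mulr_natl (n%:R * B)) mulrDl.
  rewrite lerD//; first by rewrite mulr_sumr; apply: ler_sum => i _; rewrite mulr_sumr.
  rewrite /c /B -!mulrA !ler_wpM2l// ?addr_ge0 ?nv_ge0 ?nmm_ge0//.
  exact: total.
have [K hK] : exists K : nat, c < K%:R.
  by exists (Num.truncn c).+1; exact: truncnS_gt.
have [S S0 hS] : exists2 S, 0 <= S & forall k, O k * r ^+ k / k`!%:R <= S.
  apply: (@eventually_decreasing_bounded _ K.+1) => [k|k Kk].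
    by rewrite !mulr_ge0 ?invr_ge0// exprn_ge0// ltW.
  have k0 : (0 < k)%N by exact: leq_ltn_trans Kk.
  have ck : c <= k%:R by apply: ltW; apply: lt_le_trans hK _; rewrite ler_nat ltnW.
  rewrite ler_pdivrMr ?ltr0n ?fact_gt0// factS natrM mulrCA mulfVK ?pnatr_eq0 -?lt0n ?fact_gt0//.
  rewrite exprS mulrA; have -> : k.+1%:R * (O k * r ^+ k) = (k.+1%:R * O k) * r ^+ k by ring.
  apply: ler_wpM2r; first by rewrite exprn_ge0// ltW.
  have h := ler_wpM2r (O_ge0 k) ck.
  by have := rec k k0; have := O_ge0 k; rewrite -(natr1 k); lra.
have W0 : 0 <= 1 + n%:R * (n%:R * M) by rewrite addr_ge0// !mulr_ge0.
exists ((1 + n%:R * (n%:R * M)) * S + nmm (1%:M : 'M[C]_n)).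
  by rewrite addr_ge0 ?nmm_ge0// mulr_ge0.
case=> [|k]; first by rewrite G_sol.1 fact0 expr0 mulr1 divr1 lerDr mulr_ge0.
apply: le_trans (total k.+1 isT) _.
have := hS k.+1; rewrite ler_pdivrMr ?ltr0n ?fact_gt0// -ler_pdivlMr ?exprn_gt0// => h.
apply: le_trans (ler_wpM2l W0 h) _.
have rk : 0 <= (r ^+ k.+1)^-1 by rewrite invr_ge0 exprn_ge0// ltW.
rewrite !mulrA (ler_wpM2r rk)// ler_wpM2r//.
by rewrite lerDl nmm_ge0.
Qed.

End Gevrey.

End FormalSolutions.

(** * The Fredholm problem for the base change *)

Section FactorialBounds.
Variable R : realType.
Local Notation f := (fun m : nat => (m`!%:R : R)^-1).

Lemma fact_ratio_le m k : k`!%:R * ((m + k)`!%:R)^-1 <= (m`!%:R)^-1 :> R.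
Proof.
rewrite ler_pdivrMr ?ltr0n ?fact_gt0// mulrC ler_pdivlMr ?ltr0n ?fact_gt0//.
rewrite -natrM ler_nat -(bin_fact (leq_addl m k)) addnK.
by rewrite leq_pmull// bin_gt0 leq_addl.
Qed.

(** The gain 1 / (m + 1) over [fact_ratio_le], due to C(m + k, k) >= m + 1 for k > 0, is what makes
    the operator below close to the identity on large indices. *)
Lemma fact_ratio_leS m k : (0 < k)%N ->
  k`!%:R * ((m + k)`!%:R)^-1 <= (m`!%:R)^-1 / m.+1%:R :> R.
Proof.
move=> k0; rewrite -invfM -natrM ler_pdivrMr ?ltr0n ?fact_gt0// mulrC.
rewrite ler_pdivlMr ?ltr0n ?muln_gt0 ?fact_gt0// -natrM ler_nat.
rewrite -(bin_fact (leq_addl m k)) addnK.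
have h : (m.+1 <= 'C(m + k, k))%N.
  rewrite -(bin_sub (leq_addl m k)) addnK -[X in (X <= _)%N](binSn m).
  by apply: leq_bin2l; lia.
by have := leq_mul (leqnn (k`! * m`!)%N) h; nia.
Qed.

Lemma bin_le_exp2 a b : ('C(a, b) <= 2 ^ a)%N.
Proof.
elim: a b => [|a IH] [|b] //; first by rewrite bin0 expn_gt0.
by rewrite binS expnS mul2n -addnn leq_add.
Qed.

Lemma fact_prod_le l j : (l + j)`!%:R * (l`!%:R)^-1 <= 2 ^+ (l + j) * j`!%:R :> R.
Proof.
rewrite ler_pdivrMr ?ltr0n ?fact_gt0// -natrX -!natrM ler_nat.
rewrite -(bin_fact (leq_addl l j)) addnK -mulnA leq_mul2r bin_le_exp2.
by rewrite orbT.
Qed.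

End FactorialBounds.

Lemma subz_subn (m j s : nat) : (j <= s)%N ->
  m%:Z - j%:Z - (s - j)%N%:Z = m%:Z - s%:Z.
Proof. lia. Qed.

Lemma subz_addn (m k : nat) : m%:Z - (m.+1 + k)%N%:Z = - k.+1%:Z.
Proof. lia. Qed.

Lemma sqr_le_exp4 (m : nat) : (m.+1 * m.+1 <= 4 ^ m)%N.
Proof.
elim: m => // -[//|a] IH.
by rewrite expnS (leq_trans _ (leq_mul (leqnn 4) IH))//; lia.
Qed.

Section Operator.
Variables (R : realType) (n : nat).
Local Notation C := R[i].
Local Notation T := 'rV[C]_n.

Section Shift.
Variables p q : nat.

Lemma msum_shift (a : nat -> 'M[C]_(p, q)) M j : mgeo a M ->
  mgeo (fun s => if (s < j)%N then 0 else a (s - j)%N) (M * 2 ^+ j) /\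
  msum (fun s => if (s < j)%N then 0 else a (s - j)%N) = msum a.
Proof.
move=> ga; have M0 := mgeo_ge0 ga.
have g : mgeo (fun s => if (s < j)%N then 0 else a (s - j)%N) (M * 2 ^+ j).
  move=> s; case: ltnP => js.
    by rewrite nmm0 !mulr_ge0 ?half_expn_ge0// exprn_ge0.
  apply: le_trans (ga _) _; rewrite -mulrA ler_wpM2l//.
  by rewrite -{2}(subnKC js) exprD mulrA -exprMn divff ?expr1n ?mul1r// pnatr_eq0.
split=> //; rewrite (msum_split j g) big1 ?add0r => [|i _].
  by apply: eq_msum => k; rewrite ltnNge leq_addr /= addKn.
by rewrite ltn_ord.
Qed.

Lemma msum_sum N (a : 'I_N -> nat -> 'M[C]_(p, q)) (M : 'I_N -> R) :
  (forall j, mgeo (a j) (M j)) ->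
  mgeo (fun s => \sum_j a j s) (\sum_j M j) /\
  msum (fun s => \sum_j a j s) = \sum_j msum (a j).
Proof.
elim: N a M => [|N IH] a M h.
  rewrite !big_ord0; split=> [s|]; first by rewrite big_ord0 nmm0 mul0r.
  rewrite (@msum_finite _ _ _ _ 0) ?big_ord0// => k _; by rewrite big_ord0.
have [g e] := IH _ _ (fun j => h (lift ord0 j)).
have E s : \sum_j a j s = a ord0 s + \sum_j a (lift ord0 j) s by rewrite big_ord_recl.
rewrite !big_ord_recl -e -(msumD (h ord0) g); split; last exact: (eq_msum E).
by move=> s; rewrite E; exact: (mgeoD (h ord0) g s).
Qed.

End Shift.

Variables (q : T) (G : nat -> 'M[C]_n) (K r : R).
Hypothesis r0 : 0 < r.
Hypothesis K0 : 0 <= K.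
Hypothesis G0 : G 0%N = 1%:M.
Hypothesis G_gevrey : forall k, nmm (G k) <= K * k`!%:R / r ^+ k.

(** u is a power series in zeta = 1/z, but its product with the series of the [G k] in 1/zeta has
    coefficients at all integers. *)
Definition ext p (u : nat -> 'M[C]_(p, n)) (m : int) : 'M[C]_(p, n) :=
  if m is Posz k then u k else 0.

(** The coefficient of zeta^m in (sum_j u_j zeta^j) (sum_k G_k zeta^(-k)). *)
Definition Wop p (u : nat -> 'M[C]_(p, n)) (m : int) : 'M[C]_(p, n) :=
  msum (fun k : nat => ext u (m + k%:Z) *m G k).

Definition dexp (t : T) (l : nat) : 'M[C]_n :=
  diag_mx (\row_i ((t 0 i - q 0 i) ^+ l / l`!%:R)).

Definition dexpN (t : T) (l : nat) : 'M[C]_n :=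
  diag_mx (\row_i ((- (t 0 i - q 0 i)) ^+ l / l`!%:R)).

(** The same coefficient after multiplication on the right by exp (- zeta (diag t - diag q)). *)
Definition Zop (t : T) p (u : nat -> 'M[C]_(p, n)) (m : int) : 'M[C]_(p, n) :=
  msum (fun l : nat => Wop u (m - l%:Z) *m dexpN t l).

(** The nonnegative part of the series of [Zop], multiplied back by exp (zeta (diag t - diag q)).
    Requiring that part to be 1 amounts to [TTop u = dexp] (see [TT_of_Z] and [Z_of_TT]); in this
    form the two exponentials nearly cancel and the operator is close to the identity. *)
Definition TTop (t : T) p (u : nat -> 'M[C]_(p, n)) (m : nat) : 'M[C]_(p, n) :=
  \sum_(j < m.+1) Zop t u (m%:Z - j%:Z) *m dexp t j.

(** Growth of the coefficients of an entire function of exponential type rho: the 1 / m! compensates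
    the k! of the Gevrey estimate. Below, rho lies between r / 8 and r / 4: solutions are built at r
    / 8 and uniqueness is proved at r / 4, which leaves room for multiplication by zeta and by the
    degree. *)
Definition bnd (rho B : R) p (u : nat -> 'M[C]_(p, n)) :=
  forall m, nmm (u m) <= B * rho ^+ m / m`!%:R.

Section Bounds.
Variables (rho B : R) (p : nat) (u : nat -> 'M[C]_(p, n)).
Hypothesis rho_le : rho <= r / 4.
Hypothesis rho_ge : r / 8 <= rho.
Hypothesis B0 : 0 <= B.
Hypothesis u_bnd : bnd rho B u.

Let rho0 : 0 < rho.
Proof. by apply: lt_le_trans rho_ge; rewrite divr_gt0. Qed.

Lemma Wterm_pos (m k : nat) :
  nmm (ext u (m%:Z + k%:Z) *m G k) <= B * K * rho ^+ m * 4^-1 ^+ k *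
    (k`!%:R / (m + k)`!%:R).
Proof.
rewrite -PoszD /= (le_trans (nmm_mul _ _))//.
apply: le_trans (ler_pM (nmm_ge0 _) (nmm_ge0 _) (u_bnd _) (G_gevrey _)) _.
have -> : B * rho ^+ (m + k) / (m + k)`!%:R * (K * k`!%:R / r ^+ k) =
  B * K * rho ^+ m * (rho ^+ k / r ^+ k) * (k`!%:R / (m + k)`!%:R).
  by rewrite exprD; ring.
rewrite ler_wpM2r ?divr_ge0// ler_wpM2l ?mulr_ge0 ?exprn_ge0 ?(ltW rho0)//.
rewrite -expr_div_n lerXn2r ?nnegrE ?divr_ge0 ?invr_ge0 ?(ltW rho0) ?(ltW r0)//.
by rewrite ler_pdivrMr// mulrC.
Qed.

Lemma quarter_le (k : nat) : 4^-1 ^+ k <= 2^-1 ^+ k :> R.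
Proof. by rewrite lerXn2r ?nnegrE ?invr_ge0// lef_pV2 ?posrE// ler_nat. Qed.

Lemma W_pos_geo (m : nat) :
  mgeo (fun k => ext u (m%:Z + k%:Z) *m G k) (B * K * rho ^+ m / m`!%:R).
Proof.
move=> k; apply: le_trans (Wterm_pos m k) _.
have a0 : 0 <= B * K * rho ^+ m by rewrite !mulr_ge0// exprn_ge0// ltW.
rewrite -mulrA -[leRHS]mulrA ler_wpM2l// mulrC ler_pM ?divr_ge0 ?exprn_ge0 ?invr_ge0//.
  exact: fact_ratio_le.
exact: quarter_le.
Qed.

Lemma W_pos_le (m : nat) : nmm (Wop u m%:Z) <= 2 * (B * K * rho ^+ m / m`!%:R).
Proof. exact: msum_le (W_pos_geo m). Qed.

Lemma W_sub_le (m : nat) :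
  nmm (Wop u m%:Z - u m) <= 2 * (B * K / m.+1%:R) * rho ^+ m / m`!%:R.
Proof.
rewrite /Wop (msum_recl (W_pos_geo m)) addr0 /= G0 mulmx1 addrC addKr.
have a0 : 0 <= B * K * rho ^+ m by rewrite !mulr_ge0// exprn_ge0// ltW.
have := @msum_le _ _ _ (fun k => ext u (m%:Z + k.+1%:Z) *m G k.+1)
  (B * K * rho ^+ m * ((m`!%:R)^-1 / m.+1%:R)) _.
rewrite (_ : 2 * (B * K / m.+1%:R) * rho ^+ m / m`!%:R =
   2 * (B * K * rho ^+ m * (m`!%:R^-1 / m.+1%:R))); last by ring.
apply => k; apply: le_trans (Wterm_pos m k.+1) _.
rewrite -mulrA -[leRHS]mulrA ler_wpM2l// mulrC ler_pM ?divr_ge0 ?exprn_ge0 ?invr_ge0//.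
  exact: fact_ratio_leS.
apply: le_trans (quarter_le _) _; rewrite exprS ler_piMl ?half_expn_ge0//.
by rewrite invf_le1// ler1n.
Qed.

Lemma W_neg_geo (j : nat) :
  mgeo (fun k => ext u (- j%:Z + k%:Z) *m G k) (B * K * j`!%:R * (4 / r) ^+ j).
Proof.
move=> k; have a0 : 0 <= B * K * j`!%:R * (4 / r) ^+ j.
  by rewrite !mulr_ge0// exprn_ge0// divr_ge0// ltW.
have [kj|jk] := ltnP k j.
  have -> : (- j%:Z + k%:Z) = Negz (j - k).-1.
    by rewrite NegzE prednK ?subn_gt0//; lia.
  by rewrite mul0mx nmm0 mulr_ge0 ?half_expn_ge0.
have -> : (- j%:Z + k%:Z) = (k - j)%N by lia.
set l := (k - j)%N; have {jk} -> : k = (l + j)%N by rewrite /l subnK.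
rewrite /= (le_trans (nmm_mul _ _))//.
apply: le_trans (ler_pM (nmm_ge0 _) (nmm_ge0 _) (u_bnd _) (G_gevrey _)) _.
have -> : B * rho ^+ l / l`!%:R * (K * (l + j)`!%:R / r ^+ (l + j)) =
   B * K * (((l + j)`!%:R / l`!%:R) * (rho ^+ l / r ^+ l) * (r ^+ j)^-1).
  by rewrite exprD invfM; ring.
rewrite -!mulrA ler_wpM2l// ler_wpM2l// !mulrA.
rewrite (@le_trans _ _ (2 ^+ (l + j) * j`!%:R * 4^-1 ^+ l * (r ^+ j)^-1))//.
  rewrite ler_wpM2r ?invr_ge0 ?exprn_ge0 ?(ltW r0)//.
  rewrite -mulrA ler_pM ?divr_ge0 ?exprn_ge0 ?(ltW r0) ?(ltW rho0)//.
    exact: fact_prod_le.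
  rewrite -expr_div_n lerXn2r ?nnegrE ?divr_ge0 ?invr_ge0 ?(ltW rho0) ?(ltW r0)//.
  by rewrite ler_pdivrMr// mulrC.
rewrite le_eqVlt; apply/orP; left; apply/eqP.
have e4 a : (4 : R) ^+ a = 2 ^+ a * 2 ^+ a by rewrite -exprMn -natrM.
rewrite !exprD expr_div_n !exprVn !e4; field.
by rewrite !expf_neq0 ?gt_eqF// pnatr_eq0.
Qed.

Lemma W_neg_le (j : nat) : nmm (Wop u (- j%:Z)) <= 2 * (B * K * j`!%:R * (4 / r) ^+ j).
Proof. exact: msum_le (W_neg_geo j). Qed.

End Bounds.

Lemma nmm_diag (v : T) : nmm (diag_mx v) = \sum_i nm (v 0 i).
Proof.
apply: eq_bigr => i _; rewrite (bigD1 i)//= mxE eqxx mulr1n big1 ?addr0// => j ji.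
by rewrite mxE eq_sym (negPf ji) mulr0n nm0.
Qed.

(** The coefficients of [Wop] of index - j grow like j! (4 / r)^j. With the radius r / 64 the
    exponential contributes (r / 64)^l / l!, and 4 / r times r / 64 is 1/16, small enough to absorb
    the powers of 2 coming from the factorials. *)
Definition near_q (t : T) := forall i, nm (t 0 i - q 0 i) <= r / 64.

Lemma bal_near_q t : bal q (r / 64) t -> near_q t.
Proof.
move=> h i; have := nm_le_nv (t - q) i; rewrite !mxE => h'.
exact: le_trans h' (ltW h).
Qed.

Lemma dexpN_le t l : near_q t -> nmm (dexpN t l) <= n%:R * ((r / 64) ^+ l / l`!%:R).
Proof.
move=> ht; rewrite nmm_diag (@le_trans _ _ (\sum_(i < n) ((r / 64) ^+ l / l`!%:R)))//.
  apply: ler_sum => i _; rewrite mxE nmM nmX nmN nmV nm_nat ler_wpM2r ?invr_ge0//.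
  by rewrite lerXn2r ?nnegrE ?nm_ge0 ?ht ?divr_ge0 ?(ltW r0).
by rewrite sumr_const card_ord -[leLHS]mulr_natl.
Qed.

Lemma W_geo rho B (m : int) : rho <= r / 4 -> r / 8 <= rho -> 0 <= B ->
  exists M, forall p (u : nat -> 'M[C]_(p, n)), bnd rho B u ->
    mgeo (fun k => ext u (m + k%:Z) *m G k) M.
Proof.
move=> h1 h2 B0; case: m => m.
  by exists (B * K * rho ^+ m / m`!%:R) => p u hu; exact: W_pos_geo.
exists (B * K * m.+1`!%:R * (4 / r) ^+ m.+1) => p u hu.
by rewrite NegzE; exact: W_neg_geo hu _.
Qed.

Lemma Z_geo rho B (m : int) : rho <= r / 4 -> r / 8 <= rho -> 0 <= B ->
  exists M, forall p (u : nat -> 'M[C]_(p, n)) t, bnd rho B u -> near_q t ->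
    mgeo (fun l => Wop u (m - l%:Z) *m dexpN t l) M.
Proof.
move=> h1 h2 B0; have rho0 : 0 < rho by apply: lt_le_trans h2; rewrite divr_gt0.
have e16 k : 16^-1 ^+ k <= 2^-1 ^+ k :> R.
  by rewrite lerXn2r ?nnegrE ?invr_ge0// lef_pV2 ?posrE// ler_nat.
have rl l : (r / 64) ^+ l = (r / 4) ^+ l * 16^-1 ^+ l.
  by rewrite -exprMn; congr (_ ^+ l); field.
have r40 l : 0 <= (r / 4) ^+ l by rewrite exprn_ge0// divr_ge0// ltW.
case: m => m.
  exists (2 * B * K * n%:R * (r / 4) ^+ m) => p u t hu ht l.
  rewrite (le_trans (nmm_mul _ _))//.
  have [lm|ml] := leqP l m.
    have -> : m%:Z - l%:Z = (m - l)%N by lia.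
    apply: le_trans (ler_pM (nmm_ge0 _) (nmm_ge0 _) (W_pos_le h1 h2 B0 hu (m - l)) (dexpN_le l ht)) _.
    have -> : 2 * (B * K * rho ^+ (m - l) / (m - l)`!%:R) * (n%:R * ((r / 64) ^+ l / l`!%:R))
       = 2 * B * K * n%:R * ((rho ^+ (m - l) * (r / 64) ^+ l) * ((m - l)`!%:R^-1 * l`!%:R^-1)).
      by ring.
    rewrite -[leRHS]mulrA ler_wpM2l ?mulr_ge0//.
    rewrite -[leRHS]mulr1 ler_pM ?mulr_ge0 ?invr_ge0 ?exprn_ge0 ?divr_ge0 ?(ltW r0) ?(ltW rho0)//.
      have a : rho ^+ (m - l) <= (r / 4) ^+ (m - l).
        by rewrite lerXn2r ?nnegrE ?(ltW rho0)// divr_ge0// ltW.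
      have -> : (r / 4) ^+ m = (r / 4) ^+ (m - l) * (r / 4) ^+ l.
        by rewrite -exprD subnK.
      rewrite rl mulrA ler_pM ?mulr_ge0 ?r40 ?exprn_ge0 ?(ltW rho0) ?invr_ge0//.
      by rewrite ler_wpM2r.
    rewrite -invfM invf_le1 ?mulr_gt0 ?ltr0n ?fact_gt0//.
    by rewrite -natrM ler1n muln_gt0 !fact_gt0.
  have -> : m%:Z - l%:Z = - (l - m)%N%:Z by lia.
  apply: le_trans (ler_pM (nmm_ge0 _) (nmm_ge0 _) (W_neg_le h1 h2 B0 hu (l - m)) (dexpN_le l ht)) _.
  have -> : 2 * (B * K * (l - m)`!%:R * (4 / r) ^+ (l - m)) * (n%:R * ((r / 64) ^+ l / l`!%:R))
     = 2 * B * K * n%:R * (((4 / r) ^+ (l - m) * (r / 64) ^+ l) * ((l - m)`!%:R * l`!%:R^-1)).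
    by ring.
  rewrite -[leRHS]mulrA ler_wpM2l ?mulr_ge0//.
  rewrite -[leRHS]mulr1 ler_pM ?mulr_ge0 ?invr_ge0 ?exprn_ge0 ?divr_ge0 ?(ltW r0)//.
    rewrite rl -{2}(subnK (ltnW ml)) exprD !mulrA -exprMn.
    have -> : 4 / r * (r / 4) = 1 by field; rewrite gt_eqF.
    by rewrite expr1n mul1r ler_wpM2l.
  have := @fact_ratio_le R m (l - m); rewrite (subnKC (ltnW ml)) => /le_trans; apply.
  by rewrite invf_le1 ?ltr0n ?fact_gt0// ler1n fact_gt0.
exists (2 * B * K * n%:R * (m.+1`!%:R * (8 / r) ^+ m.+1)) => p u t hu ht l.
rewrite (le_trans (nmm_mul _ _))//.
have -> : Negz m - l%:Z = - (l + m.+1)%N%:Z by lia.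
apply: le_trans (ler_pM (nmm_ge0 _) (nmm_ge0 _) (W_neg_le h1 h2 B0 hu (l + m.+1)) (dexpN_le l ht)) _.
have -> : 2 * (B * K * (l + m.+1)`!%:R * (4 / r) ^+ (l + m.+1)) * (n%:R * ((r / 64) ^+ l / l`!%:R))
   = 2 * B * K * n%:R * (((4 / r) ^+ (l + m.+1) * (r / 64) ^+ l) * ((l + m.+1)`!%:R * l`!%:R^-1)).
  by ring.
rewrite -[leRHS]mulrA ler_wpM2l ?mulr_ge0//.
have x0 : 0 <= (4 / r) ^+ (l + m.+1) * (r / 64) ^+ l.
  by rewrite !mulr_ge0 ?exprn_ge0 ?divr_ge0 ?(ltW r0).
apply: le_trans (ler_wpM2l x0 (fact_prod_le R l m.+1)) _.
have -> : (r / 64) ^+ l = (4 / r)^-1 ^+ l * 2^-1 ^+ l * (2^-1 ^+ l * 2^-1 ^+ l * 2^-1 ^+ l).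
  rewrite -!exprMn; congr (_ ^+ l); field.
  by rewrite gt_eqF.
have -> : 8 / r = 2 * (4 / r) by field; rewrite gt_eqF.
set x := 4 / r; rewrite !exprD (exprMn _ 2 x); set a := x ^+ m.+1; set b := 2 ^+ m.+1.
have -> : x ^+ l * a * (x^-1 ^+ l * 2^-1 ^+ l * (2^-1 ^+ l * 2^-1 ^+ l * 2^-1 ^+ l)) *
   (2 ^+ l * b * m.+1`!%:R) = (x ^+ l * x^-1 ^+ l) * (2 ^+ l * 2^-1 ^+ l) *
    (m.+1`!%:R * (b * a)) * (2^-1 ^+ l * (2^-1 ^+ l * 2^-1 ^+ l)) by ring.
have e1 : x ^+ l * x^-1 ^+ l = 1.
  by rewrite -exprMn mulfV ?expr1n// gt_eqF// divr_gt0.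
have e2 : 2 ^+ l * 2^-1 ^+ l = 1 :> R by rewrite -exprMn mulfV ?expr1n// pnatr_eq0.
rewrite e1 e2 !mul1r; apply: ler_wpM2l.
  by rewrite !mulr_ge0 ?exprn_ge0 ?divr_ge0 ?(ltW r0).
rewrite ler_piMr ?half_expn_ge0// mulr_ile1 ?half_expn_ge0//;
  by rewrite exprn_ile1 ?invr_ge0// invf_le1// ler1n.
Qed.

(** The coefficient of zeta^s in exp (- a zeta) exp (a zeta) when the second factor is truncated
    after degree m. Up to s = m the truncation is not felt, and the product is 1. *)
Definition ccoef (a : C) (m s : nat) : C :=
  \sum_(j < m.+1) if (s < j)%N then 0
    else (- a) ^+ (s - j) / (s - j)`!%:R * (a ^+ j / j`!%:R).

Lemma ccoef_exp (a : C) m s : (s <= m)%N -> ccoef a m s = (s == 0)%:R.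
Proof.
move=> sm; rewrite /ccoef -(subnKC sm) -addSn big_split_ord/= [X in _ + X]big1 ?addr0; last first.
  by move=> j _; rewrite ltnS leq_addr.
transitivity ((- a + a) ^+ s / s`!%:R).
  rewrite exprDn mulr_suml; apply: eq_bigr => j _.
  rewrite ltnNge -ltnS ltn_ord /=.
  have js : (j <= s)%N by rewrite -ltnS.
  have fN k : (k`!%:R : C) != 0 by rewrite pnatr_eq0 -lt0n fact_gt0.
  have -> : s`!%:R = 'C(s, j)%:R * (j`!%:R * (s - j)`!%:R) :> C.
    by rewrite -!natrM bin_fact.
  have cN : ('C(s, j)%:R : C) != 0 by rewrite pnatr_eq0 -lt0n bin_gt0.
  by rewrite -mulr_natr; field; rewrite !fN cN.
by rewrite addNr; case: s sm => [|s] _; rewrite ?expr0 ?divr1 ?expr0n ?mul0r.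
Qed.

Lemma ccoef_le (a : C) (d : R) m s : nm a <= d ->
  nm (ccoef a m s) <= m.+1%:R * ((2 * d) ^+ s / s`!%:R).
Proof.
move=> ad; have d0 : 0 <= d := le_trans (nm_ge0 _) ad.
have b0 : 0 <= (2 * d) ^+ s / s`!%:R by rewrite divr_ge0// exprn_ge0// mulr_ge0.
rewrite (le_trans (nm_sum _ _ _))//.
rewrite (@le_trans _ _ (\sum_(j < m.+1) (2 * d) ^+ s / s`!%:R))//; last first.
  by rewrite sumr_const card_ord -[leLHS]mulr_natl.
apply: ler_sum => j _; case: ltnP => js; first by rewrite nm0.
rewrite !nmM !nmV !nmX nmN !nm_nat.
have -> : nm a ^+ (s - j) / (s - j)`!%:R * (nm a ^+ j / j`!%:R) =
    nm a ^+ s * ((s - j)`!%:R * j`!%:R)^-1.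
  by rewrite -{3}(subnK js) exprD invfM; ring.
have -> : ((s - j)`!%:R * j`!%:R)^-1 = 'C(s, j)%:R / s`!%:R :> R.
  rewrite -(bin_fact js) !natrM; field.
  by rewrite !pnatr_eq0 -!lt0n !fact_gt0 bin_gt0 js.
rewrite exprMn mulrA ler_wpM2r ?invr_ge0// mulrC ler_pM ?exprn_ge0 ?nm_ge0//.
  by rewrite -natrX ler_nat bin_le_exp2.
by rewrite lerXn2r ?nnegrE ?nm_ge0.
Qed.

Definition cmx (t : T) (m s : nat) : 'M[C]_n := diag_mx (\row_i ccoef (t 0 i - q 0 i) m s).

Lemma mul_diag_diag (u v : T) :
  diag_mx u *m diag_mx v = diag_mx (\row_i (u 0 i * v 0 i)) :> 'M[C]_n.
Proof.
apply/matrixP => i j; rewrite diag_mulE !mxE.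
by case: eqVneq => [->|_]; rewrite ?mulr1n// !mulr0n mulr0.
Qed.

(** Terms are regrouped according to the total degree s taken from the two exponentials. For 0 < s
    <= m they cancel by [ccoef_exp]; s = 0 gives [Wop u m], and s > m only involves coefficients of
    [Wop] of negative index. *)
Lemma TTopE rho B p (u : nat -> 'M[C]_(p, n)) t m :
  rho <= r / 4 -> r / 8 <= rho -> 0 <= B -> bnd rho B u -> near_q t ->
  TTop t u m = Wop u m%:Z +
    msum (fun k => Wop u (- k.+1%:Z) *m cmx t m (m.+1 + k)%N).
Proof.
move=> h1 h2 B0 hu ht.
have [M hM] : exists M : 'I_m.+1 -> R, forall j : 'I_m.+1,
    mgeo (fun l => Wop u (m%:Z - j%:Z - l%:Z) *m dexpN t l *m dexp t j) (M j).
  have H (j : 'I_m.+1) : exists M, 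
    mgeo (fun l => Wop u (m%:Z - j%:Z - l%:Z) *m dexpN t l *m dexp t j) M.
    have [M hM] := Z_geo (m%:Z - j%:Z) h1 h2 B0.
    exists (M * nmm (dexp t j)) => l; rewrite (le_trans (nmm_mul _ _))// mulrAC.
    by rewrite ler_wpM2r ?nmm_ge0//; exact: hM.
  by have [M hM] := choice H; exists M.
have [Mz hMz] : exists M : 'I_m.+1 -> R, forall j : 'I_m.+1,
    mgeo (fun l => Wop u (m%:Z - j%:Z - l%:Z) *m dexpN t l) (M j).
  have H (j : 'I_m.+1) : exists M, mgeo (fun l => Wop u (m%:Z - j%:Z - l%:Z) *m dexpN t l) M.
    by have [M' hM'] := Z_geo (m%:Z - j%:Z) h1 h2 B0; exists M'; exact: hM'.
  by have [M' hM'] := choice H; exists M'.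
have S (j : 'I_m.+1) := msum_shift j (hM j).
have [g e] := msum_sum (fun j => (S j).1).
have -> : TTop t u m = msum (fun s => \sum_(j < m.+1) if (s < j)%N then 0 else
    Wop u (m%:Z - j%:Z - (s - j)%N%:Z) *m dexpN t (s - j) *m dexp t j).
  rewrite e; apply: eq_bigr => j _; rewrite (S j).2.
  by rewrite (msum_mulmxr _ (hMz j)).
have E s : (\sum_(j < m.+1) if (s < j)%N then 0 else
    Wop u (m%:Z - j%:Z - (s - j)%N%:Z) *m dexpN t (s - j) *m dexp t j)
    = Wop u (m%:Z - s%:Z) *m cmx t m s.
  have -> : cmx t m s = \sum_(j < m.+1) if (s < j)%N then 0 else
      dexpN t (s - j) *m dexp t j.
    apply/matrixP => a b; rewrite summxE mxE [X in X *+ _]mxE /ccoef -sumrMnl.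
    apply: eq_bigr => j _; case: ifP => _; first by rewrite mul0rn mxE.
    by rewrite mul_diag_diag !mxE.
  rewrite mulmx_sumr; apply: eq_bigr => j _; case: ltnP => js; first by rewrite mulmx0.
  by rewrite mulmxA subz_subn.
rewrite (msum_split m.+1 g) big_ord_recl E subr0 (_ : cmx t m 0%N = 1%:M); last first.
  apply/matrixP => a b; rewrite mxE [X in X *+ _]mxE ccoef_exp//.
  by rewrite !mxE; case: eqP.
rewrite mulmx1 [X in _ + X + _]big1 ?addr0; last first.
  move=> i _; rewrite E (_ : cmx _ _ _ = 0) ?mulmx0//.
  apply/matrixP => a b; rewrite mxE [X in X *+ _]mxE ccoef_exp; last exact: ltn_ord.
  by rewrite mul0rn mxE.
by congr (_ + _); apply: eq_msum => k; rewrite E subz_addn.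
Qed.

Lemma TTop_sub_le rho B p (u : nat -> 'M[C]_(p, n)) t m :
  rho <= r / 4 -> r / 8 <= rho -> 0 <= B -> bnd rho B u -> near_q t ->
  nmm (TTop t u m - u m) <=
    (2 * K + 4 * K * n%:R) / m.+1%:R * (B * rho ^+ m / m`!%:R).
Proof.
move=> h1 h2 B0 hu ht; have rho0 : 0 < rho by apply: lt_le_trans h2; rewrite divr_gt0.
rewrite (TTopE _ h1 h2 B0 hu ht) addrAC (le_trans (nmmD _ _))//.
have := W_sub_le h1 h2 B0 hu m.
have := @msum_le _ _ _ (fun k => Wop u (- k.+1%:Z) *m cmx t m (m.+1 + k))
   (2 * B * K * n%:R / m.+1%:R * (rho ^+ m / m`!%:R)) _.
set X := nmm (msum _); set Y := nmm _ => H HY.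
rewrite (@le_trans _ _ (2 * (B * K / m.+1%:R) * rho ^+ m / m`!%:R +
  2 * (2 * B * K * n%:R / m.+1%:R * (rho ^+ m / m`!%:R))))//; last first.
  by rewrite le_eqVlt; apply/orP; left; apply/eqP; ring.
apply: lerD => //; apply: H => k.
rewrite (le_trans (nmm_mul _ _))//.
have c_le : nmm (cmx t m (m.+1 + k)) <=
    n%:R * (m.+1%:R * ((2 * (r / 64)) ^+ (m.+1 + k) / (m.+1 + k)`!%:R)).
  rewrite nmm_diag (@le_trans _ _ (\sum_(i < n) (m.+1%:R * ((2 * (r / 64)) ^+ (m.+1 + k) / (m.+1 + k)`!%:R))))//.
    by apply: ler_sum => i _; rewrite mxE; apply: ccoef_le; exact: ht.
  by rewrite sumr_const card_ord -[leLHS]mulr_natl.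
apply: le_trans (ler_pM (nmm_ge0 _) (nmm_ge0 _) (W_neg_le h1 h2 B0 hu k.+1) c_le) _.
have e : (m.+1 + k = m + k.+1)%N by rewrite addSnnS.
rewrite e.
have -> : 2 * (B * K * k.+1`!%:R * (4 / r) ^+ k.+1) *
   (n%:R * (m.+1%:R * ((2 * (r / 64)) ^+ (m + k.+1) / (m + k.+1)`!%:R))) =
   2 * B * K * n%:R * ((m.+1%:R * ((4 / r) ^+ k.+1 * (2 * (r / 64)) ^+ (m + k.+1))) *
   (k.+1`!%:R * ((m + k.+1)`!%:R)^-1)) by ring.
have -> : 2 * B * K * n%:R / m.+1%:R * (rho ^+ m / m`!%:R) * 2^-1 ^+ k =
   2 * B * K * n%:R * ((rho ^+ m / m.+1%:R * 2^-1 ^+ k) * m`!%:R^-1) by ring.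
have r64 : 0 <= 2 * (r / 64) by rewrite mulr_ge0// divr_ge0// ltW.
rewrite ler_wpM2l ?mulr_ge0//; apply: ler_pM (fact_ratio_le _ _ _).
- rewrite mulr_ge0// mulr_ge0// exprn_ge0//; by rewrite divr_ge0// ltW.
- by rewrite mulr_ge0// invr_ge0.
rewrite exprD [X in _ * X <= _]mulrCA -exprMn.
have -> : 4 / r * (2 * (r / 64)) = 8^-1 by field; rewrite gt_eqF.
have q4 : (2 * (r / 64)) ^+ m <= rho ^+ m * 4^-1 ^+ m.
  rewrite -exprMn lerXn2r ?nnegrE ?mulr_ge0 ?divr_ge0 ?invr_ge0 ?(ltW r0) ?(ltW rho0)//.
  by rewrite mulrA; lra.
(* One factor m + 1 comes from the bound on [ccoef], the other is the gain to be produced; the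
   factor 4^(-m), left by 2 r / 64 <= rho / 4, pays for both. *)
have q5 : m.+1%:R * (4^-1 ^+ m) <= m.+1%:R^-1 :> R.
  rewrite exprVn ler_pdivrMr ?exprn_gt0// ler_pdivlMl ?ltr0n//.
  by rewrite -natrX -natrM ler_nat sqr_le_exp4.
rewrite [leLHS]mulrA.
have q6 : 8^-1 ^+ k.+1 <= 2^-1 ^+ k :> R.
  rewrite exprS (@le_trans _ _ (8^-1 ^+ k))//.
    by rewrite ler_piMl ?exprn_ge0 ?invr_ge0// invf_le1// ler1n.
  by rewrite lerXn2r ?nnegrE ?invr_ge0// lef_pV2 ?posrE// ler_nat.
apply: ler_pM q6.
- by rewrite mulr_ge0// exprn_ge0.
- by rewrite exprn_ge0// invr_ge0.
apply: le_trans (ler_wpM2l (ler0n _ _) q4) _.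
by rewrite mulrCA ler_wpM2l// exprn_ge0// ltW.
Qed.

End Operator.

Section Summable.
Variable R : realType.
Local Notation C := R[i].
Variables p q : nat.
Implicit Types a b : nat -> 'M[C]_(p, q).

Definition smb a := exists M, mgeo a M.

Lemma smbD a b : smb a -> smb b -> smb (fun k => a k + b k).
Proof. by move=> [M h] [M' h']; exists (M + M'); exact: mgeoD. Qed.

Lemma smbN a : smb a -> smb (fun k => - a k).
Proof. by move=> [M h]; exists M => k; rewrite nmmN. Qed.

Lemma smbZ c a : smb a -> smb (fun k => c *: a k).
Proof.
by move=> [M h]; exists (nm c * M) => k; rewrite nmmZ -mulrA ler_wpM2l ?nm_ge0.
Qed.

Lemma smbS a : smb a -> smb (fun k => a k.+1).
Proof. by move=> [M h]; exists (M / 2); exact: mgeoS. Qed.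

Lemma eq_smb a b : a =1 b -> smb a -> smb b.
Proof. by move=> /funext ->. Qed.

Lemma smb_sumD a b : smb a -> smb b -> msum (fun k => a k + b k) = msum a + msum b.
Proof. by move=> [M h] [M' h']; exact: msumD h h'. Qed.

Lemma smb_sumN a : smb a -> msum (fun k => - a k) = - msum a.
Proof. by move=> [M h]; exact: msumN h. Qed.

Lemma smb_sumB a b : smb a -> smb b -> msum (fun k => a k - b k) = msum a - msum b.
Proof. by move=> ha hb; rewrite smb_sumD ?smb_sumN//; exact: smbN. Qed.

Lemma smbB a b : smb a -> smb b -> smb (fun k => a k - b k).
Proof. by move=> ha hb; apply: smbD => //; exact: smbN. Qed.

Lemma smb_sumZ c a : smb a -> msum (fun k => c *: a k) = c *: msum a.
Proof. by move=> [M h]; exact: msumZ h. Qed.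

Lemma smb_recl a : smb a -> msum a = a 0%N + msum (fun k => a k.+1).
Proof. by move=> [M h]; exact: msum_recl h. Qed.

End Summable.

Section SummableMul.
Variable R : realType.
Local Notation C := R[i].

Lemma smb_mulr p q s (a : nat -> 'M[C]_(p, q)) (c : 'M[C]_(q, s)) :
  smb a -> smb (fun k => a k *m c).
Proof.
move=> [M h]; exists (M * nmm c) => k; rewrite (le_trans (nmm_mul _ _))// mulrAC.
by rewrite ler_wpM2r ?nmm_ge0.
Qed.

Lemma smb_summulr p q s (a : nat -> 'M[C]_(p, q)) (c : 'M[C]_(q, s)) :
  smb a -> msum (fun k => a k *m c) = msum a *m c.
Proof. by move=> [M h]; exact: msum_mulmxr h. Qed.

Lemma smb_summull p q s (a : nat -> 'M[C]_(p, q)) (c : 'M[C]_(s, p)) :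
  smb a -> msum (fun k => c *m a k) = c *m msum a.
Proof. by move=> [M h]; exact: msum_mulmxl h. Qed.

End SummableMul.

Lemma sum_ord_recl (V : zmodType) m (F : nat -> V) :
  \sum_(j < m.+1) F j = F 0%N + \sum_(j < m) F j.+1.
Proof. by rewrite big_ord_recl. Qed.

Lemma sum_ord_recr (V : zmodType) m (F : nat -> V) :
  \sum_(j < m.+1) F j = \sum_(j < m) F j + F m.
Proof. by rewrite big_ord_recr. Qed.

Lemma add_rearrange (V : zmodType) (a b c e : V) : a + b + c + e = a + (c + e) + b.
Proof. by rewrite -!addrA; congr (_ + _); rewrite addrC -addrA. Qed.

Section OperatorAlgebra.
Variables (R : realType) (n : nat).
Local Notation C := R[i].
Local Notation T := 'rV[C]_n.
Variables (q : T) (G : nat -> 'M[C]_n) (K r : R).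
Hypothesis r0 : 0 < r.
Hypothesis K0 : 0 <= K.
Hypothesis G_gevrey : forall k, nmm (G k) <= K * k`!%:R / r ^+ k.

Local Notation W := (Wop G).
Local Notation Z := (Zop q G).
Local Notation TT := (TTop q G).
Local Notation near_q := (near_q q r).

Lemma bnd_le rho rho' B p (u : nat -> 'M[C]_(p, n)) : 0 <= rho -> rho <= rho' -> 0 <= B ->
  bnd rho B u -> bnd rho' B u.
Proof.
move=> h0 h B0 hu m; apply: le_trans (hu m) _.
rewrite ler_wpM2r ?invr_ge0// ler_wpM2l// lerXn2r ?nnegrE//.
exact: le_trans h.
Qed.

Lemma bndD rho B B' p (u v : nat -> 'M[C]_(p, n)) : bnd rho B u -> bnd rho B' v ->
  bnd rho (B + B') (fun m => u m + v m).
Proof. by move=> hu hv m; rewrite (le_trans (nmmD _ _))// !mulrDl lerD. Qed.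

Lemma bnd_mull rho B p s (c : 'M[C]_(s, p)) (u : nat -> 'M[C]_(p, n)) : bnd rho B u ->
  bnd rho (nmm c * B) (fun m => c *m u m).
Proof.
by move=> hu m; rewrite (le_trans (nmm_mul _ _))// -!mulrA ler_wpM2l ?nmm_ge0// !mulrA.
Qed.

Lemma bnd_mulr rho B p (c : 'M[C]_n) (u : nat -> 'M[C]_(p, n)) : bnd rho B u ->
  bnd rho (B * nmm c) (fun m => u m *m c).
Proof.
move=> hu m; rewrite (le_trans (nmm_mul _ _))//.
have -> : B * nmm c * rho ^+ m / m`!%:R = (B * rho ^+ m / m`!%:R) * nmm c by ring.
by rewrite ler_wpM2r ?nmm_ge0.
Qed.

(** Doubling the type pays for the factor m, since m <= 2^m. *)
Lemma bnd_deg B p (u : nat -> 'M[C]_(p, n)) : 0 <= B -> bnd (r / 8) B u ->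
  bnd (r / 4) B (fun m => m%:R *: u m).
Proof.
move=> B0 hu m; rewrite nmmZ nm_nat.
apply: le_trans (ler_wpM2l (ler0n _ _) (hu m)) _.
have -> : r / 4 = 2 * (r / 8) by field.
have : 0 <= r / 8 by rewrite divr_ge0// ltW.
move: (r / 8) => y y0; rewrite exprMn; set x := y ^+ m.
have x0 : 0 <= x by rewrite exprn_ge0.
have -> : B * (2 ^+ m * x) / m`!%:R = 2 ^+ m * (B * x / m`!%:R) by ring.
rewrite ler_wpM2r ?mulr_ge0 ?invr_ge0//.
by rewrite -natrX ler_nat ltnW// ltn_expl.
Qed.

(** Multiplication of the series by zeta. *)
Definition zshift p (u : nat -> 'M[C]_(p, n)) (m : nat) := ext u (m%:Z - 1).

Lemma ext_shift p (u : nat -> 'M[C]_(p, n)) (m : int) : ext (zshift u) m = ext u (m - 1).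
Proof. by case: m. Qed.

Lemma zshift0 p (u : nat -> 'M[C]_(p, n)) : zshift u 0 = 0.
Proof. by []. Qed.

Lemma zshiftS p (u : nat -> 'M[C]_(p, n)) m : zshift u m.+1 = u m.
Proof. by rewrite /zshift (_ : m.+1%:Z - 1 = m); [|lia]. Qed.

Lemma bnd_shift B p (u : nat -> 'M[C]_(p, n)) : 0 <= B -> bnd (r / 8) B u ->
  bnd (r / 4) (B / (r / 8)) (zshift u).
Proof.
move=> B0 hu; have r80 : 0 < r / 8 by rewrite divr_gt0.
case=> [|m].
  by rewrite zshift0 nmm0 !mulr_ge0 ?invr_ge0 ?exprn_ge0 ?divr_ge0 ?(ltW r0).
rewrite zshiftS; apply: le_trans (hu m) _.
have -> : r / 4 = 2 * (r / 8) by field.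
move: (r / 8) r80 => x r80; rewrite exprMn factS natrM invfM.
have -> : B / x * (2 ^+ m.+1 * x ^+ m.+1) * (m.+1%:R^-1 * m`!%:R^-1) =
   (B * x ^+ m / m`!%:R) * (2 ^+ m.+1 / m.+1%:R).
  move: (_%:R^-1) (_%:R^-1) => F S; rewrite [x ^+ m.+1]exprS; field.
  by rewrite gt_eqF.
rewrite ler_peMr ?mulr_ge0 ?invr_ge0 ?exprn_ge0 ?(ltW r80)//.
by rewrite ler_pdivlMr ?ltr0n// mul1r -natrX ler_nat ltnW// ltn_expl.
Qed.

Section Fixed.
Variables (rho : R).
Hypothesis rho_le : rho <= r / 4.
Hypothesis rho_ge : r / 8 <= rho.

Lemma W_smb B p (u : nat -> 'M[C]_(p, n)) (m : int) : 0 <= B -> bnd rho B u ->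
  smb (fun k => ext u (m + k%:Z) *m G k).
Proof.
move=> B0 hu; have [M hM] := W_geo r0 K0 G_gevrey m rho_le rho_ge B0.
by exists M; exact: hM.
Qed.

Lemma Z_smb B p (u : nat -> 'M[C]_(p, n)) t (m : int) : 0 <= B -> bnd rho B u ->
  near_q t -> smb (fun l => W u (m - l%:Z) *m dexpN q t l).
Proof.
move=> B0 hu ht; have [M hM] := Z_geo q r0 K0 G_gevrey m rho_le rho_ge B0.
by exists M; exact: hM.
Qed.

Lemma extD p (u v : nat -> 'M[C]_(p, n)) m :
  ext (fun k => u k + v k) m = ext u m + ext v m.
Proof. by case: m => m //=; rewrite addr0. Qed.

Lemma ext_mull p s (c : 'M[C]_(s, p)) (u : nat -> 'M[C]_(p, n)) m :
  ext (fun k => c *m u k) m = c *m ext u m.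
Proof. by case: m => m //=; rewrite mulmx0. Qed.

Lemma W_add B B' p (u v : nat -> 'M[C]_(p, n)) m : 0 <= B -> 0 <= B' ->
  bnd rho B u -> bnd rho B' v -> W (fun k => u k + v k) m = W u m + W v m.
Proof.
move=> B0 B0' hu hv; rewrite /Wop -(smb_sumD (W_smb m B0 hu) (W_smb m B0' hv)).
by apply: eq_msum => k; rewrite extD mulmxDl.
Qed.

Lemma W_mull B p s (c : 'M[C]_(s, p)) (u : nat -> 'M[C]_(p, n)) m : 0 <= B ->
  bnd rho B u -> W (fun k => c *m u k) m = c *m W u m.
Proof.
move=> B0 hu; rewrite /Wop -(smb_summull c (W_smb m B0 hu)).
by apply: eq_msum => k; rewrite ext_mull mulmxA.
Qed.

Lemma Z_add B B' p (u v : nat -> 'M[C]_(p, n)) t m : 0 <= B -> 0 <= B' ->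
  bnd rho B u -> bnd rho B' v -> near_q t ->
  Z t (fun k => u k + v k) m = Z t u m + Z t v m.
Proof.
move=> B0 B0' hu hv ht.
rewrite /Zop -(smb_sumD (Z_smb m B0 hu ht) (Z_smb m B0' hv ht)).
by apply: eq_msum => k; rewrite (W_add _ B0 B0' hu hv) mulmxDl.
Qed.

Lemma Z_mull B p s (c : 'M[C]_(s, p)) (u : nat -> 'M[C]_(p, n)) t m : 0 <= B ->
  bnd rho B u -> near_q t -> Z t (fun k => c *m u k) m = c *m Z t u m.
Proof.
move=> B0 hu ht; rewrite /Zop -(smb_summull c (Z_smb m B0 hu ht)).
by apply: eq_msum => k; rewrite (W_mull _ _ B0 hu) mulmxA.
Qed.

Lemma TT_add B B' p (u v : nat -> 'M[C]_(p, n)) t m : 0 <= B -> 0 <= B' ->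
  bnd rho B u -> bnd rho B' v -> near_q t ->
  TT t (fun k => u k + v k) m = TT t u m + TT t v m.
Proof.
move=> B0 B0' hu hv ht; rewrite /TTop -big_split; apply: eq_bigr => j _ /=.
by rewrite (Z_add _ B0 B0' hu hv ht) mulmxDl.
Qed.

Lemma TT_mull B p s (c : 'M[C]_(s, p)) (u : nat -> 'M[C]_(p, n)) t m : 0 <= B ->
  bnd rho B u -> near_q t -> TT t (fun k => c *m u k) m = c *m TT t u m.
Proof.
move=> B0 hu ht; rewrite /TTop mulmx_sumr; apply: eq_bigr => j _.
by rewrite (Z_mull _ _ B0 hu ht) mulmxA.
Qed.

End Fixed.

Lemma W_shift p (u : nat -> 'M[C]_(p, n)) m : W (zshift u) m = W u (m - 1).
Proof. by apply: eq_msum => k; rewrite ext_shift addrAC. Qed.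

Lemma Z_shift p (u : nat -> 'M[C]_(p, n)) t m : Z t (zshift u) m = Z t u (m - 1).
Proof. by apply: eq_msum => k; rewrite W_shift addrAC. Qed.

Lemma dexp0 t : dexp q t 0 = 1%:M.
Proof.
apply/matrixP => i j; rewrite mxE [X in X *+ _]mxE expr0 fact0 divr1.
by rewrite mxE.
Qed.

Lemma TT_of_Z p (u : nat -> 'M[C]_(p, n)) t (A : 'M[C]_(p, n)) :
  (forall m : nat, Z t u m%:Z = if m == 0%N then A else 0) ->
  forall m, TT t u m = A *m dexp q t m.
Proof.
move=> h m; rewrite /TTop big_ord_recr/= big1 ?add0r.
  by rewrite subrr (h 0%N).
move=> j _; rewrite (_ : m%:Z - j%:Z = (m - j)%N).
  by rewrite h subn_eq0 leqNgt ltn_ord mul0mx.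
by rewrite subzn// ltnW// ltn_ord.
Qed.

Lemma TT_recl p (u : nat -> 'M[C]_(p, n)) t m :
  TT t u m = Z t u m%:Z + \sum_(j < m) Z t u (m - j.+1)%N%:Z *m dexp q t j.+1.
Proof.
pose F (j : nat) := Z t u (m%:Z - j%:Z) *m dexp q t j.
have e0 : F 0%N = Z t u m%:Z.
  have e : m%:Z - 0%:Z = m%:Z by exact: subr0.
  by rewrite /F e dexp0 mulmx1.
have eS (j : 'I_m) : F j.+1 = Z t u (m - j.+1)%N%:Z *m dexp q t j.+1.
  have e : m%:Z - j.+1%:Z = (m - j.+1)%N%:Z by rewrite subzn// ltn_ord.
  by rewrite /F e.
apply: etrans (sum_ord_recl m F) _.
by apply: congr2; [exact: e0|apply: eq_bigr => j _; exact: eS].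
Qed.

(** [TTop] is a unitriangular transform of the coefficients of [Zop] of nonnegative index, as [dexp]
    is 1 in degree 0; hence the induction on m. *)
Lemma Z_of_TT p (u : nat -> 'M[C]_(p, n)) t (A : 'M[C]_(p, n)) :
  (forall m, TT t u m = A *m dexp q t m) ->
  forall m : nat, Z t u m%:Z = if m == 0%N then A else 0.
Proof.
move=> h m; have [k] := ubnP m; elim: k m => // k IH m mk.
have := h m; rewrite TT_recl; case: m mk => [|m] mk.
  by rewrite big_ord0 addr0 dexp0 mulmx1.
rewrite (sum_ord_recr m (fun j => Z t u (m.+1 - j.+1)%N%:Z *m dexp q t j.+1)).
have -> : \sum_(j < m) Z t u (m.+1 - j.+1)%N%:Z *m dexp q t j.+1 = 0.
  apply: big1 => j _; rewrite subSS IH.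
    by rewrite subn_eq0 leqNgt ltn_ord mul0mx.
  by rewrite (leq_ltn_trans (leq_subr _ _)).
rewrite subnn add0r (IH 0%N (leq_trans (ltn0Sn m) mk)) /=.
by rewrite -[X in _ = X -> _]add0r => /addIr.
Qed.

Section ZetaDerivative.
Variables (d : T) (rho B : R) (p : nat) (u : nat -> 'M[C]_(p, n)).
Hypothesis G_sol : fsol q d G.
Hypothesis B0 : 0 <= B.
Hypothesis u_bnd : bnd (r / 8) B u.

Let V := residue_of q d (G 1%N).
Let r48 : r / 8 <= r / 4. Proof. by have := r0; lra. Qed.
Let v m : 'M[C]_(p, n) := m%:R *: u m + zshift u m *m diag_mx q + u m *m V.
Let hW m := W_smb r48 (lexx _) m B0 u_bnd.

Let ext_v m : ext v m = m%:~R *: ext u m + ext u (m - 1) *m diag_mx q + ext u m *m V.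
Proof. by case: m => m //=; rewrite !mul0mx scaler0 !addr0. Qed.

(** The equations [fsol_eq] say that the series of the [G k] solves a differential equation in zeta.
    So zeta d/dzeta of the product u G, completed by its terms in [diag q] and [diag d], is again a
    product v G, with v = zeta u' + zeta u (diag q) + u V. Coefficientwise, the discrepancy is the
    telescoping series of [y k - y k.+1]. *)
Lemma W_zeta m : W v m = m%:~R *: W u m + W u (m - 1) *m diag_mx q + W u m *m diag_mx d.
Proof.
pose x k := ext u (m + k%:Z) *m G k.
pose y k := ext u (m - 1 + k%:Z) *m diag_mx q *m G k.
pose z k := ext u (m - 1 + k%:Z) *m G k.
have sx : smb x := hW m.
have sz : smb z := hW (m - 1).
have sy : smb y.
  have Bq : 0 <= B * nmm (diag_mx q : 'M[C]_n) by rewrite mulr_ge0 ?nmm_ge0.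
  apply: eq_smb (W_smb r48 (lexx _) (m - 1) Bq (bnd_mulr (diag_mx q) u_bnd)) => k.
  by rewrite /y; case: (m - 1 + k%:Z) => j //=; rewrite !mul0mx.
have s1 := smbZ m%:~R sx; have s2 := smb_mulr (diag_mx d) sx.
have s3 := smbB sy (smbS sy); have s4 := smb_mulr (diag_mx q) (smbS sz).
have -> : W v m = msum (fun k => m%:~R *: x k + x k *m diag_mx d
    + (y k - y k.+1) + z k.+1 *m diag_mx q).
  apply: eq_msum => k; rewrite ext_v /x /y /z.
  have -> : m - 1 + k.+1%:Z = m + k%:Z by rewrite -[k.+1]addn1 PoszD; ring.
  have -> : m + k%:Z - 1 = m - 1 + k%:Z by ring.
  set X := ext u (m + k%:Z); set Y := ext u (m - 1 + k%:Z).
  have e := G_sol.2 k; rewrite /fsol_eq -/V in e.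
  rewrite intrD -pmulrn scalerDl !mulmxDl -!scalemxAl -!mulmxA.
  have -> : G k *m diag_mx d = diag_mx q *m G k.+1 + V *m G k + k%:R *: G k - G k.+1 *m diag_mx q.
    by rewrite e addrAC subrr add0r.
  rewrite !mulmxDr mulmxN -scalemxAr.
  set a1 := m%:~R *: _; set a2 := k%:R *: _; set a3 := Y *m _; set a4 := X *m (V *m _).
  set a5 := X *m (diag_mx q *m _); set a6 := X *m (G k.+1 *m _).
  clearbody a1 a2 a3 a4 a5 a6; clear.
  by apply/matrixP => i j; rewrite !mxE; ring.
rewrite (smb_sumD (smbD (smbD s1 s2) s3) s4) (smb_sumD (smbD s1 s2) s3).
rewrite (smb_sumD s1 s2) (smb_sumZ _ sx) (smb_summulr _ sx).
rewrite (smb_sumB sy (smbS sy)) (smb_summulr _ (smbS sz)).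
rewrite (smb_recl sy) addrK.
have -> : W u (m - 1) = z 0%N + msum (fun k => z k.+1) := smb_recl sz.
have -> : y 0%N = z 0%N *m diag_mx q.
  by rewrite /y /z G_sol.1 !mulmx1.
rewrite mulmxDl; exact: add_rearrange.
Qed.

End ZetaDerivative.

End OperatorAlgebra.

(** * Dependence of the operators on the parameter t *)

Section OperatorCalculus.
Variables (R : realType) (n : nat).
Local Notation C := R[i].
Local Notation T := 'rV[C]_n.
Variables (q : T) (G : nat -> 'M[C]_n) (K r : R).
Hypothesis r0 : 0 < r.
Hypothesis K0 : 0 <= K.
Hypothesis G_gevrey : forall k, nmm (G k) <= K * k`!%:R / r ^+ k.

Local Notation W := (Wop G).
Local Notation Z := (Zop q G).
Local Notation TT := (TTop q G).
Local Notation near_q := (near_q q r).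

Let r48 : r / 8 <= r / 4. Proof. by have := r0; lra. Qed.

Lemma dexpN_comm (d t : T) l : dexpN q t l *m diag_mx d = diag_mx d *m dexpN q t l.
Proof. exact: diag_mxC. Qed.

Lemma dexpNS t l : l.+1%:R *: dexpN q t l.+1 = - (dexpN q t l *m diag_mx (t - q)).
Proof.
apply/matrixP => i j; rewrite /dexpN mul_diag_diag !mxE.
case: (i == j); rewrite ?mulr1n ?mulr0n ?mulr0 ?oppr0//.
have f0 : (l`!%:R : C) != 0 by rewrite pnatr_eq0 -lt0n fact_gt0.
have s0 : (l.+1%:R : C) != 0 by rewrite pnatr_eq0.
rewrite exprSr factS natrM; move: (l.+1%:R) (l`!%:R) s0 f0 => S F S0 F0.
by move: (_ ^+ l) => X; field; rewrite S0 F0.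
Qed.

Lemma smb_shift1 p m (a : nat -> 'M[C]_(p, m)) : smb a ->
  smb (fun l => if l is l'.+1 then a l' else 0) /\
  msum (fun l => if l is l'.+1 then a l' else 0) = msum a.
Proof.
move=> [M h]; have [h1 h2] := msum_shift 1 h.
have E : (fun l => if l is l'.+1 then a l' else 0) =
    (fun s => if (s < 1)%N then 0 else a (s - 1)%N).
  by apply/funext => -[|l] //=; rewrite subn1.
by rewrite E; split=> //; exists (M * 2 ^+ 1).
Qed.

Lemma zeta_term p (c : C) (A B : 'M[C]_(p, n)) (E Q D : 'M[C]_n) :
  E *m Q = Q *m E -> E *m D = D *m E ->
  (c *: A + B *m Q + A *m D) *m E = c *: (A *m E) + B *m E *m Q + A *m E *m D.
Proof. by move=> hQ hD; rewrite !mulmxDl -scalemxAl -!mulmxA hQ hD. Qed.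

Lemma zeta_sum p (a b z : 'M[C]_(p, n)) (x y : 'M[C]_n) :
  a + z *m x + z *m y + b = a + z *m (x + y) + b.
Proof. by rewrite mulmxDr addrA. Qed.

Lemma index_shift (m : int) (l : nat) : m - l.+1%:Z = m - 1 - l%:Z.
Proof. lia. Qed.

(** Multiplying by exp (- zeta (diag t - diag q)) replaces [diag q] with [diag t] in [W_zeta]: the
    equation at t arises from the one at q in this way. *)
Lemma Z_zeta (d t : T) (B : R) p (u : nat -> 'M[C]_(p, n)) (m : int) :
  fsol q d G -> 0 <= B -> bnd (r / 8) B u -> near_q t ->
  Z t (fun k => k%:R *: u k + zshift u k *m diag_mx q
                 + u k *m residue_of q d (G 1%N)) m
  = m%:~R *: Z t u m + Z t u (m - 1) *m diag_mx t + Z t u m *m diag_mx d.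
Proof.
move=> sol B0 hu ht.
pose x l := W u (m - l%:Z) *m dexpN q t l.
pose z l := W u (m - 1 - l%:Z) *m dexpN q t l.
have sx : smb x := Z_smb r0 K0 G_gevrey r48 (lexx _) m B0 hu ht.
have sz : smb z := Z_smb r0 K0 G_gevrey r48 (lexx _) (m - 1) B0 hu ht.
have szt := smb_mulr (diag_mx (t - q)) sz.
have [sy yE] := smb_shift1 szt.
set y := (fun l => _) in sy yE.
have s1 := smbZ m%:~R sx; have s2 := smb_mulr (diag_mx q) sz.
have s3 := smb_mulr (diag_mx d) sx.
have -> : Z t (fun k => k%:R *: u k + zshift u k *m diag_mx q
    + u k *m residue_of q d (G 1%N)) m =
   msum (fun l => m%:~R *: x l + y l + z l *m diag_mx q + x l *m diag_mx d).
  apply: eq_msum => l; rewrite (W_zeta r0 K0 G_gevrey sol B0 hu).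
  have -> : m - l%:Z - 1 = m - 1 - l%:Z by rewrite addrAC.
  apply: etrans (zeta_term _ _ _ (dexpN_comm q t l) (dexpN_comm d t l)) _.
  have -> // : (m - l%:Z)%:~R *: (W u (m - l%:Z) *m dexpN q t l) = m%:~R *: x l + y l.
  rewrite intrD scalerDl; congr (_ + _).
  rewrite mulrNz -pmulrn scaleNr /y; case: l => [|l]; first by rewrite scale0r oppr0.
  by rewrite scalemxAr dexpNS mulmxN opprK mulmxA index_shift.
rewrite (smb_sumD (smbD (smbD s1 sy) s2) s3) (smb_sumD (smbD s1 sy) s2) (smb_sumD s1 sy).
rewrite (smb_sumZ _ sx) yE (smb_summulr _ sz) (smb_summulr _ sz) (smb_summulr _ sx).
have -> : diag_mx t = diag_mx (t - q) + diag_mx q :> 'M[C]_n by rewrite -raddfD subrK.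
exact: zeta_sum.
Qed.

Lemma unif_dexpN A l i j : unif A (fun t => dexpN q t l i j).
Proof.
apply: unif_polf; have [->|ij] := eqVneq i j.
  apply: (@polf_ext _ _ (fun t => (-1 * (t 0 j + - q 0 j)) ^+ l * (l`!%:R)^-1)).
    by move=> t; rewrite !mxE eqxx mulr1n mulN1r.
  apply: polf_mul (polf_cst _ _); elim: l => [|l IH].
    exact: (polf_ext (fun t => esym (expr0 _)) (polf_cst _ 1)).
  apply: (polf_ext (fun t => esym (exprS _ _))); apply: polf_mul IH.
  by apply: polf_scale; apply: polf_add; [exact: polf_crd|exact: polf_cst].
apply: (@polf_ext _ _ (fun=> 0)); last exact: polf_cst.
by move=> t; rewrite !mxE (negPf ij).
Qed.

Lemma unif_dexp A l i j : unif A (fun t => dexp q t l i j).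
Proof.
apply: unif_polf; have [->|ij] := eqVneq i j.
  apply: (@polf_ext _ _ (fun t => (t 0 j + - q 0 j) ^+ l * (l`!%:R)^-1)).
    by move=> t; rewrite !mxE eqxx mulr1n.
  apply: polf_mul (polf_cst _ _); elim: l => [|l IH].
    exact: (polf_ext (fun t => esym (expr0 _)) (polf_cst _ 1)).
  apply: (polf_ext (fun t => esym (exprS _ _))); apply: polf_mul IH.
  by apply: polf_add; [exact: polf_crd|exact: polf_cst].
apply: (@polf_ext _ _ (fun=> 0)); last exact: polf_cst.
by move=> t; rewrite !mxE (negPf ij).
Qed.

Lemma diff_dexpN_entry i l t h :
  'd (fun t : T => (- (t 0 i - q 0 i)) ^+ l.+1 / l.+1`!%:R : C) t h
  = - ((- (t 0 i - q 0 i)) ^+ l / l`!%:R * h 0 i).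
Proof.
have fN k : (k`!%:R : C) != 0 by rewrite pnatr_eq0 -lt0n fact_gt0.
have sN k : (k.+1%:R : C) != 0 by rewrite pnatr_eq0.
pose f k (t : T) := (- (t 0 i - q 0 i)) ^+ k / k`!%:R : C.
pose g k (t : T) := (- k.+1%:R^-1 * (t 0 i - q 0 i)) : C.
have df k : differentiable (f k) t.
  have := @unif_dexpN (bal t 1) k i i => /(unif_eq (g := f k)) => H.
  apply: (unif_differentiable (H _) (bal_center t ltr01)) => y _.
  by rewrite !mxE eqxx mulr1n.
have pc : polf (fun t : T => t 0 i - q 0 i).
  by apply: polf_sub; [exact: polf_crd|exact: polf_cst].
have dg k : differentiable (g k) t.
  by apply: polf_differentiable; apply: polf_scale.
have dgE k : 'd (g k) t h = - k.+1%:R^-1 * h 0 i.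
  have dc := polf_differentiable t (polf_cst n (- k.+1%:R^-1 : C)).
  apply: etrans (diff_mulE h dc (polf_differentiable t pc)) _.
  have e1 : 'd (fun t : T => t 0 i - q 0 i) t h = h 0 i.
    have d1 := polf_differentiable t (@polf_crd R n i).
    have d2 := polf_differentiable t (polf_cst n (q 0 i)).
    have e0 := diff_subE h d1 d2.
    transitivity ('d (fun t : T => t 0 i : C) t h - 'd (fun=> q 0 i : C) t h); first exact: e0.
    transitivity (h 0 i - 0); last exact: subr0.
    by f_equal; [exact: diff_coord|f_equal; exact: diff_cstE].
  transitivity (- k.+1%:R^-1 * h 0 i + 0 * (t 0 i - q 0 i)).
    by f_equal; f_equal; [exact: e1|exact: diff_cstE].
  by rewrite mul0r addr0.
have fS k (y : T) : f k.+1 y = f k y * g k y.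
  rewrite /f /g exprSr factS natrM; move: (sN k) (fN k).
  move: (k.+1%:R) (k`!%:R) (_ ^+ k) => S F X S0 F0.
  by field; rewrite S0 F0.
have dfS k : 'd (f k.+1) t h = f k t * (- k.+1%:R^-1 * h 0 i) + 'd (f k) t h * g k t.
  apply: etrans (eq_diff t h (fS k)) _.
  apply: etrans (diff_mulE h (df k) (dg k)) _.
  by f_equal; f_equal; exact: dgE.
have : 'd (f l.+1) t h = - (f l t * h 0 i).
  elim: l => [|l IH]; apply: etrans (dfS _) _.
    have e0 : 'd (f 0%N) t h = 0.
      apply: etrans (eq_diff (g := fun=> 1) t h _) (diff_cstE 1 t h) => y.
      by rewrite /f expr0 fact0 divr1.
    transitivity (f 0%N t * (- 1%:R^-1 * h 0 i) + 0 * g 0%N t).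
      by f_equal; f_equal; exact: e0.
    rewrite (_ : f 0%N t = 1); last by rewrite /f expr0 fact0 divr1.
    by rewrite mul0r addr0 invr1; ring.
  transitivity (f l.+1 t * (- l.+2%:R^-1 * h 0 i) + - (f l t * h 0 i) * g l.+1 t).
    by f_equal; f_equal; exact: IH.
  rewrite fS /g; move: (sN l) (sN l.+1) (f l t); rewrite -(natr1 l.+1).
  move: (l.+1%:R) => S S0 S1 F; field.
  by rewrite S0 S1.
by [].
Qed.

Lemma md_dexpN t h l : md (fun t => dexpN q t l) t h =
  if l is l'.+1 then - (dexpN q t l' *m diag_mx h) else 0.
Proof.
apply/matrixP => i j; apply: etrans (mdE _ t h i j) _.
have [<-|ij] := eqVneq i j; last first.
  apply: etrans (eq_diff (g := fun=> 0) t h _) _.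
    by move=> y; rewrite !mxE (negPf ij).
  apply: etrans (diff_cstE 0 t h) _; case: l => [|l]; first by rewrite mxE.
  by rewrite mul_diag_diag !mxE (negPf ij) mulr0n oppr0.
apply: etrans (eq_diff (g := fun y : T => (- (y 0 i - q 0 i)) ^+ l / l`!%:R : C) t h _) _.
  by move=> y; rewrite !mxE eqxx mulr1n.
case: l => [|l].
  apply: etrans (eq_diff (g := fun=> 1) t h _) _.
    by move=> y; rewrite expr0 fact0 divr1.
  by apply: etrans (diff_cstE 1 t h) _; rewrite mxE.
apply: etrans (diff_dexpN_entry i l t h) _.
by rewrite mul_diag_diag !mxE eqxx !mulr1n.
Qed.

Section Family.
Variables (p : nat) (x : T) (s rho B : R) (u : nat -> T -> 'M[C]_(p, n)).
Hypothesis rho_le : rho <= r / 4.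
Hypothesis rho_ge : r / 8 <= rho.
Hypothesis bal_near : forall t, bal x s t -> near_q t.
Hypothesis B0 : 0 <= B.
Hypothesis u_unif : forall m, munif (bal x s) (u m).
Hypothesis u_bnd : forall t, bal x s t -> bnd rho B (u^~ t).

Let ext_unif m : munif (bal x s) (fun t => ext (u^~ t) m).
Proof. by case: m => m; [exact: u_unif|exact: munif_cst]. Qed.

Let Wterm_unif m k : munif (bal x s) (fun t => ext (u^~ t) (m + k%:Z) *m G k).
Proof. by apply: munif_mul (munif_cst _ _). Qed.

Lemma W_unif m : munif (bal x s) (fun t => W (u^~ t) m).
Proof.
have [M hM] := W_geo r0 K0 G_gevrey m rho_le rho_ge B0.
exact: munif_msum (Wterm_unif m) (fun t ht => hM _ _ (u_bnd ht)).
Qed.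

Let Zterm_unif m l : munif (bal x s) (fun t => W (u^~ t) (m - l%:Z) *m dexpN q t l).
Proof. by apply: munif_mul (W_unif _) _ => i j; exact: unif_dexpN. Qed.

Lemma Z_unif m : munif (bal x s) (fun t => Z t (u^~ t) m).
Proof.
have [M hM] := Z_geo q r0 K0 G_gevrey m rho_le rho_ge B0.
exact: munif_msum (Zterm_unif m) (fun t ht => hM _ _ _ (u_bnd ht) (bal_near ht)).
Qed.

Lemma TT_unif m : munif (bal x s) (fun t => TT t (u^~ t) m).
Proof.
apply: munif_sum => j _; apply: munif_mul (Z_unif _) _ => a b.
exact: unif_dexp.
Qed.

Lemma md_bnd t h : bal x s t -> exists2 B', 0 <= B' &
  bnd rho B' (fun m => md (u m) t h).
Proof.
rewrite /bal/= => ht; have s0 : 0 < s - nv (t - x) by rewrite subr_gt0.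
exists ((p * n)%:R * (2 * B * nv h / (s - nv (t - x)))).
  by rewrite !(mulr_ge0, nv_ge0)// invr_ge0 ltW.
move=> m; have hs : nv (t - x) + (s - nv (t - x)) <= s by lra.
apply: le_trans (md_le h s0 hs (u_unif m) (fun z hz => u_bnd hz m)) _.
by rewrite le_eqVlt; apply/orP; left; apply/eqP; ring.
Qed.

Let md_ext t h m : md (fun t => ext (u^~ t) m) t h = ext (fun m => md (u m) t h) m.
Proof. by case: m => m //=; exact: md_cst. Qed.

Lemma md_W t h m : bal x s t ->
  md (fun t => W (u^~ t) m) t h = W (fun k => md (u k) t h) m.
Proof.
move=> ht; have [M hM] := W_geo r0 K0 G_gevrey m rho_le rho_ge B0.
apply: etrans (md_msum h (Wterm_unif m) (fun t ht => hM _ _ (u_bnd ht)) ht) _.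
apply: eq_msum => k.
apply: etrans (md_mul h (ext_unif _) (munif_cst _ (G k)) ht) _.
by rewrite md_cst mulmx0 add0r md_ext.
Qed.

(** Apart from u, only the exponential depends on t, and its differential is its product by - zeta
    [diag_mx h]: hence the shifted term. *)
Lemma md_Z t h m : bal x s t ->
  md (fun t => Z t (u^~ t) m) t h =
  Z t (fun k => md (u k) t h) m - Z t (u^~ t) (m - 1) *m diag_mx h.
Proof.
move=> ht; have [M hM] := Z_geo q r0 K0 G_gevrey m rho_le rho_ge B0.
apply: etrans (md_msum h (Zterm_unif m) (fun t ht => hM _ _ _ (u_bnd ht) (bal_near ht)) ht) _.
have [B' B'0 hB'] := md_bnd h ht; have nt := bal_near ht.
have s1 := Z_smb r0 K0 G_gevrey rho_le rho_ge m B'0 hB' nt.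
have s2 := smb_mulr (diag_mx h) (Z_smb r0 K0 G_gevrey rho_le rho_ge (m - 1) B0 (u_bnd ht) nt).
have [s3 e3] := smb_shift1 s2.
rewrite -[X in _ = _ - X](smb_summulr _ (Z_smb r0 K0 G_gevrey rho_le rho_ge (m - 1) B0 (u_bnd ht) nt)).
rewrite -e3 -(smb_sumB s1 s3); apply: eq_msum => l.
have ul : munif (bal x s) (fun t => dexpN q t l) by move=> i j; exact: unif_dexpN.
apply: etrans (md_mul h (W_unif _) ul ht) _.
rewrite (md_W h _ ht) md_dexpN addrC; congr (_ + _).
case: l {ul} => [|l]; first by rewrite mulmx0 oppr0.
by rewrite mulmxN mulmxA index_shift.
Qed.

End Family.

End OperatorCalculus.

Lemma mulN1mx (R : pzRingType) p n (A : 'M[R]_(p, n)) : (- 1%:M) *m A = - A.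
Proof. by rewrite mulNmx mul1mx. Qed.

Lemma tail_rearrange (R : comPzRingType) n (y a s x s' : 'rV[R]_n) :
  y - (a + s - s') - (x - s) = (y - a) - (x - s').
Proof. by apply/rowP => j; rewrite !mxE; ring. Qed.

Lemma kernel_coef (R : comPzRingType) p m (a : 'I_p) (v : 'rV[R]_p) (c : 'rV[R]_m)
    (M : 'M[R]_(m, p)) (l : 'cV[R]_p) :
  delta_mx 0 a = v + c *m M -> M *m l = 0 -> l a 0 = (v *m l) 0 0.
Proof.
move=> e h; have <- : delta_mx 0 a *m l = v *m l.
  by rewrite e mulmxDl -mulmxA h mulmx0 addr0.
by rewrite -rowE mxE.
Qed.

(** * Reduction of the Fredholm problem to a finite determinant *)

Section Fredholm.
Variables (R : realType) (n : nat).
Local Notation C := R[i].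
Local Notation T := 'rV[C]_n.
Variables (q : T) (G : nat -> 'M[C]_n) (K r : R).
Hypothesis r0 : 0 < r.
Hypothesis K0 : 0 <= K.
Hypothesis G0 : G 0%N = 1%:M.
Hypothesis G_gevrey : forall k, nmm (G k) <= K * k`!%:R / r ^+ k.

Local Notation TT := (TTop q G).
Local Notation D := (bal q (r / 64)).

Let r48 : r / 8 <= r / 4. Proof. by have := r0; lra. Qed.
Let D_near t : D t -> near_q q r t. Proof. exact: bal_near_q. Qed.
Let weight_ge0 m : 0 <= (r / 8) ^+ m / m`!%:R :> R.
Proof. by rewrite divr_ge0// exprn_ge0// divr_ge0// ltW. Qed.

(** From some index on, the factor 1 / (m + 1) of [TTop_sub_le] beats the constant, uniformly in t,
    rho and u. *)
Lemma head_size : exists J : nat, forall rho B (u : nat -> T) t m,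
  rho <= r / 4 -> r / 8 <= rho -> 0 <= B -> bnd rho B u -> D t -> (J <= m)%N ->
  nmm (TT t u m - u m) <= 2^-1 * (B * rho ^+ m / m`!%:R).
Proof.
have [J hJ] : exists J : nat, 2 * (2 * K + 4 * K * n%:R) < J%:R.
  by exists (Num.truncn (2 * (2 * K + 4 * K * n%:R))).+1; exact: truncnS_gt.
exists J => rho B u t m h1 h2 B0 hu Dt Jm.
apply: le_trans (TTop_sub_le r0 K0 G0 G_gevrey m h1 h2 B0 hu (D_near Dt)) _.
rewrite ler_wpM2r//.
  rewrite divr_ge0// mulr_ge0// exprn_ge0// (le_trans _ h2)// divr_ge0//.
  exact: ltW.
rewrite ler_pdivrMr ?ltr0n//.
have : J%:R <= m%:R :> R by rewrite ler_nat.
by rewrite -(natr1 m); lra.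
Qed.

Variable J : nat.
Hypothesis hJ : forall rho B (u : nat -> T) t m,
  rho <= r / 4 -> r / 8 <= rho -> 0 <= B -> bnd rho B u -> D t -> (J <= m)%N ->
  nmm (TT t u m - u m) <= 2^-1 * (B * rho ^+ m / m`!%:R).

Lemma TT_opp rho B (u : nat -> T) t m : rho <= r / 4 -> r / 8 <= rho -> 0 <= B ->
  bnd rho B u -> D t -> TT t (fun k => - u k) m = - TT t u m.
Proof.
move=> h1 h2 B0 hu Dt.
have e : (fun k => - u k) = (fun k => (- 1%:M : 'M[C]_1) *m u k).
  by apply/funext => k; exact: esym (mulN1mx _).
rewrite e; apply: etrans _ (mulN1mx _).
refine (TT_mull r0 K0 G_gevrey h1 h2 _ m B0 hu (D_near Dt)).
Qed.

Lemma bnd_opp rho B (u : nat -> T) : bnd rho B u -> bnd rho B (fun m => - u m).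
Proof. by move=> h m; rewrite nmmN. Qed.

Lemma TT_sub rho B B' (u v : nat -> T) t m : rho <= r / 4 -> r / 8 <= rho ->
  0 <= B -> 0 <= B' -> bnd rho B u -> bnd rho B' v -> D t ->
  TT t (fun k => u k - v k) m = TT t u m - TT t v m.
Proof.
move=> h1 h2 B0 B0' hu hv Dt.
apply: etrans (TT_add r0 K0 G_gevrey h1 h2 m B0 B0' hu (bnd_opp hv) (D_near Dt)) _.
by f_equal; exact: (TT_opp _ h1 h2 B0' hv Dt).
Qed.

Lemma TT_zero t m : D t -> TT t (fun=> 0 : T) m = 0.
Proof.
move=> Dt; have hz : bnd (r / 8) 0 (fun=> 0 : T) by move=> k; rewrite nmm0 !mul0r.
have e : (fun=> 0 : T) = (fun k : nat => 0 - 0 : T).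
  by apply/funext => k; rewrite subr0.
rewrite e; apply: etrans (TT_sub m r48 (lexx _) (lexx 0) (lexx 0) hz hz Dt) _.
exact: subrr.
Qed.

Lemma TT_scale rho B (c : C) (u : nat -> T) t m : rho <= r / 4 -> r / 8 <= rho ->
  0 <= B -> bnd rho B u -> D t ->
  TT t (fun k => c *: u k) m = c *: TT t u m.
Proof.
move=> h1 h2 B0 hu Dt.
have e : (fun k => c *: u k) = (fun k => (c%:M : 'M[C]_1) *m u k).
  by apply/funext => k; exact: esym (mul_scalar_mx _ _).
rewrite e; apply: etrans _ (mul_scalar_mx _ _).
refine (TT_mull r0 K0 G_gevrey h1 h2 _ m B0 hu (D_near Dt)).
Qed.

Lemma bnd_scale rho B (c : C) (u : nat -> T) : bnd rho B u ->
  bnd rho (nm c * B) (fun m => c *: u m).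
Proof.
by move=> hu m; rewrite nmmZ -!mulrA ler_wpM2l ?nm_ge0// !mulrA.
Qed.

Lemma bnd_leB B B' (u : nat -> T) : B <= B' -> bnd (r / 8) B u -> bnd (r / 8) B' u.
Proof.
move=> h hu m; apply: le_trans (hu m) _; rewrite -!mulrA ler_wpM2r//.
Qed.

Lemma bnd_sum rho (I : Type) (s : seq I) (u : I -> nat -> T) (B : I -> R) :
  (forall i, bnd rho (B i) (u i)) ->
  bnd rho (\sum_(i <- s) B i) (fun m => \sum_(i <- s) u i m).
Proof.
move=> h; elim: s => [|i s IH] m; first by rewrite !big_nil nmm0 !mul0r.
rewrite !big_cons; exact: (bndD (h i) IH m).
Qed.

Lemma TT_sum rho (I : Type) (s : seq I) (u : I -> nat -> T) (B : I -> R) t m :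
  rho <= r / 4 -> r / 8 <= rho -> (forall i, 0 <= B i) ->
  (forall i, bnd rho (B i) (u i)) -> D t ->
  TT t (fun k => \sum_(i <- s) u i k) m = \sum_(i <- s) TT t (u i) m.
Proof.
move=> h1 h2 B0 h Dt; elim: s => [|i s IH].
  have e : (fun k => \sum_(i <- [::]) u i k) = (fun=> 0 : T).
    by apply/funext => k; rewrite big_nil.
  by rewrite e big_nil TT_zero.
have Bs : 0 <= \sum_(i <- s) B i by apply: sumr_ge0.
have e : (fun k => \sum_(j <- i :: s) u j k) = (fun k => u i k + \sum_(j <- s) u j k).
  by apply/funext => k; rewrite big_cons.
rewrite e; apply: etrans (TT_add r0 K0 G_gevrey h1 h2 m (B0 i) Bs (h i) (bnd_sum s h) (D_near Dt)) _.
apply: etrans _ (esym (big_cons _ _ _ _ _ _)).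
by f_equal.
Qed.

Section TailSolution.
Variables (a : nat -> T -> T) (B : R).
Hypothesis B0 : 0 <= B.
Hypothesis a_unif : forall m, munif D (a m).
Hypothesis a_bnd : forall t, D t -> bnd (r / 8) B (a^~ t).

(** Successive corrections of a Neumann series on the indices m >= J: each one is the error left by
    the previous one, and is half as large. They vanish on the head, which therefore stays that of
    [a]. *)
Let Fixpoint e (k m : nat) (t : T) {struct k} : T :=
  if k is k'.+1 then (if (m < J)%N then 0 else e k' m t - TT t (e k' ^~ t) m)
  else a m t.

Let e_bnd k t : D t -> bnd (r / 8) (B * 2^-1 ^+ k) (e k ^~ t).
Proof.
move=> Dt; elim: k => [|k IH] m; first by rewrite expr0 mulr1; exact: a_bnd.
have Bk : 0 <= B * 2^-1 ^+ k by rewrite mulr_ge0// half_expn_ge0.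
rewrite /=; case: ltnP => Jm.
  by rewrite nmm0 -mulrA mulr_ge0 ?weight_ge0// mulr_ge0 ?half_expn_ge0.
rewrite -nmmN opprB; apply: le_trans (hJ r48 (lexx _) Bk IH Dt Jm) _.
by rewrite exprS le_eqVlt; apply/orP; left; apply/eqP; ring.
Qed.

Let e_unif k m : munif D (e k m).
Proof.
elim: k m => [|k IH] m; first exact: a_unif.
rewrite /=; case: (ltnP m J) => Jm; first exact: munif_cst.
apply: munif_sub (IH m) _.
have Bk : 0 <= B * 2^-1 ^+ k by rewrite mulr_ge0// half_expn_ge0.
exact: (TT_unif r0 K0 G_gevrey r48 (lexx _) D_near Bk IH (fun t Dt => e_bnd k Dt)).
Qed.

Let e_geo m t : D t -> mgeo (fun k => e k m t) (B * (r / 8) ^+ m / m`!%:R).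
Proof.
move=> Dt k; apply: le_trans (e_bnd k Dt m) _.
by rewrite le_eqVlt; apply/orP; left; apply/eqP; ring.
Qed.

Lemma tail_solution : exists x : nat -> T -> T,
  [/\ forall m, munif D (x m), forall t, D t -> bnd (r / 8) (2 * B) (x^~ t),
      forall m t, (m < J)%N -> x m t = a m t &
      forall m t, D t -> (J <= m)%N -> TT t (x^~ t) m = a m t].
Proof.
pose x m t := msum (fun k => e k m t).
have x_bnd t : D t -> bnd (r / 8) (2 * B) (x^~ t).
  by move=> Dt m; apply: le_trans (msum_le (e_geo m Dt)) _; rewrite !mulrA.
exists x; split=> //.
- by move=> m; apply: munif_msum (fun k => e_unif k m) (fun t Dt => e_geo m Dt).
- move=> m t mJ; rewrite /x (@msum_finite _ _ _ _ 1) ?big_ord1// => -[|k] //= _.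
  by rewrite mJ.
move=> m t Dt Jm; apply/subr0_eq/nmm_eq0/eqP; rewrite eq_le nmm_ge0 andbT.
apply: (@le_geo _ _ _ (4 * (B * (r / 8) ^+ m / m`!%:R))) => N; rewrite add0r.
pose SN k := \sum_(j < N) e j k t.
pose BN := \sum_(j < N) B * 2^-1 ^+ j.
have SN_bnd : bnd (r / 8) BN SN := bnd_sum (index_enum 'I_N) (fun j : 'I_N => e_bnd j Dt).
have BN0 : 0 <= BN by apply: sumr_ge0 => j _; rewrite mulr_ge0// half_expn_ge0.
have dB : bnd (r / 8) (2 * B * 2^-1 ^+ N) (fun k => x k t - SN k).
  move=> k; apply: le_trans (msum_tail (e_geo k Dt) N) _.
  by rewrite le_eqVlt; apply/orP; left; apply/eqP; ring.
have dB0 : 0 <= 2 * B * 2^-1 ^+ N by rewrite !mulr_ge0// half_expn_ge0.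
have B20 : 0 <= 2 * B by rewrite mulr_ge0.
have := hJ r48 (lexx _) dB0 dB Dt Jm.
rewrite (TT_sub _ r48 (lexx _) B20 BN0 (x_bnd t Dt) SN_bnd Dt).
rewrite (TT_sum _ m r48 (lexx _) (fun j : 'I_N => mulr_ge0 B0 (half_expn_ge0 R j))
  (fun j : 'I_N => e_bnd j Dt) Dt).
(* On the tail, the image of e_0 + ... + e_(N-1) telescopes to a - e_N. *)
have -> : \sum_(j < N) TT t (e j ^~ t) m = a m t + SN m - \sum_(j < N.+1) e j m t.
  rewrite (sum_ord_recl N (fun j => e j m t)) /= opprD addrACA subrr add0r -sumrB.
  by apply: eq_bigr => j _; rewrite /= ltnNge Jm /= opprB addrCA subrr addr0.
have h2 := msum_tail (e_geo m Dt) N.+1.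
set S' := \sum_(j < N.+1) _ in h2 *; set y := TT _ _ _.
have -> : y - (a m t + SN m - S') - (x m t - SN m) = (y - a m t) - (x m t - S').
  exact: tail_rearrange.
move=> h1.
have -> : y - a m t = (y - a m t - (x m t - S')) + (x m t - S') by rewrite subrK.
rewrite (le_trans (nmmD _ _))//.
rewrite -/(x m t) exprS in h2.
by move: h1 h2; have := weight_ge0 m; have := half_expn_ge0 R N; have := B0; nra.
Qed.

End TailSolution.

(** Applying the contraction repeatedly halves the constant B. The bound is at type r / 4 because
    the sequences obtained from a solution by [zshift] and [bnd_deg] only satisfy that one. *)
Lemma tail_unique B (z : nat -> T) t : 0 <= B -> bnd (r / 4) B z -> D t ->
  (forall m, (m < J)%N -> z m = 0) -> (forall m, (J <= m)%N -> TT t z m = 0) ->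
  forall m, z m = 0.
Proof.
move=> B0 hz Dt z0 zJ.
have H k : bnd (r / 4) (B * 2^-1 ^+ k) z.
  elim: k => [|k IH] m; first by rewrite expr0 mulr1.
  have Bk : 0 <= B * 2^-1 ^+ k by rewrite mulr_ge0// half_expn_ge0.
  have w0 : 0 <= (r / 4) ^+ m / m`!%:R by rewrite divr_ge0// exprn_ge0// divr_ge0// ltW.
  have [mJ|Jm] := ltnP m J.
    by rewrite z0// nmm0 -mulrA mulr_ge0// mulr_ge0// half_expn_ge0.
  have := hJ (lexx _) r48 Bk IH Dt Jm; rewrite zJ// sub0r nmmN => /le_trans; apply.
  by rewrite exprS le_eqVlt; apply/orP; left; apply/eqP; ring.
move=> m; apply: nmm_eq0; apply/eqP; rewrite eq_le nmm_ge0 andbT.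
apply: (@le_geo _ _ _ (B * (r / 4) ^+ m / m`!%:R)) => k.
rewrite add0r; apply: le_trans (H k m) _.
by rewrite le_eqVlt; apply/orP; left; apply/eqP; ring.
Qed.

Local Notation I := ('I_J * 'I_n)%type.
Local Notation N := #|{: I}|.

Definition unit_data (a : I) (m : nat) : T := if m == a.1 then delta_mx 0 a.2 else 0.

Lemma unit_data_bnd a : exists2 B, 0 <= B & bnd (r / 8) B (unit_data a).
Proof.
have rp m : 0 < (r / 8) ^+ m by rewrite exprn_gt0// divr_gt0.
exists (nmm (delta_mx 0 a.2 : T) * (a.1`!%:R / (r / 8) ^+ a.1)).
  by rewrite mulr_ge0 ?nmm_ge0// divr_ge0// ltW.
move=> m; rewrite /unit_data; case: eqP => [->|_]; last first.
  by rewrite nmm0 -!mulrA !mulr_ge0 ?nmm_ge0 ?invr_ge0// ?(ltW (rp _)).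
rewrite -mulrA -mulrA; have -> : a.1`!%:R / (r / 8) ^+ a.1 * ((r / 8) ^+ a.1 / a.1`!%:R) = 1.
  have F0 : (a.1`!%:R : R) != 0 by rewrite pnatr_eq0 -lt0n fact_gt0.
  move: F0 (rp a.1); move: ((r / 8) ^+ a.1) (a.1`!%:R : R) => y F F0 y0.
  by field; rewrite F0 gt_eqF.
by rewrite mulr1.
Qed.

(** The solutions of the homogeneous tail equations are parametrized by their first J terms. The
    images of this basis on the head form the finite matrix [head_mx], and the whole problem is
    invertible when its determinant is nonzero. *)
Lemma head_basis : exists (X : I -> nat -> T -> T) (BX : I -> R),
  forall a, [/\ 0 <= BX a, forall m, munif D (X a m),
    forall t, D t -> bnd (r / 8) (BX a) (X a ^~ t),
    forall m t, (m < J)%N -> X a m t = unit_data a m &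
    forall m t, D t -> (J <= m)%N -> TT t (X a ^~ t) m = 0].
Proof.
have H a : exists XB : (nat -> T -> T) * R, [/\ 0 <= XB.2, forall m, munif D (XB.1 m),
    forall t, D t -> bnd (r / 8) XB.2 (XB.1 ^~ t),
    forall m t, (m < J)%N -> XB.1 m t = unit_data a m &
    forall m t, D t -> (J <= m)%N -> TT t (XB.1 ^~ t) m = 0].
  have [B B0 hB] := unit_data_bnd a.
  have [x [x1 x2 x3 x4]] := @tail_solution (fun m _ => unit_data a m) B B0
    (fun m => munif_cst _ _) (fun t _ => hB).
  exists (x, 2 * B); split=> //=; first by rewrite mulr_ge0.
  move=> m t Dt Jm; rewrite x4// /unit_data; case: eqP => // e.
  by move: Jm; rewrite e leqNgt ltn_ord.
have [XB hXB] := choice H; exists (fun a => (XB a).1), (fun a => (XB a).2).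
by move=> a; exact: hXB.
Qed.

Variables (X : I -> nat -> T -> T) (BX : I -> R).
Hypothesis hX : forall a, [/\ 0 <= BX a, forall m, munif D (X a m),
    forall t, D t -> bnd (r / 8) (BX a) (X a ^~ t),
    forall m t, (m < J)%N -> X a m t = unit_data a m &
    forall m t, D t -> (J <= m)%N -> TT t (X a ^~ t) m = 0].

Let BX0 a : 0 <= BX a. Proof. by case: (hX a). Qed.
Let X_unif a m : munif D (X a m). Proof. by case: (hX a). Qed.
Let X_bnd a t : D t -> bnd (r / 8) (BX a) (X a ^~ t). Proof. by case: (hX a) => _ _ /(_ t). Qed.
Let X_head a m t : (m < J)%N -> X a m t = unit_data a m. Proof. by case: (hX a) => _ _ _ /(_ m t). Qed.
Let X_tail a m t : D t -> (J <= m)%N -> TT t (X a ^~ t) m = 0.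
Proof. by case: (hX a) => _ _ _ _ /(_ m t). Qed.

Local Notation ev a := (@enum_val ('I_J * 'I_n)%type {: I} a).

Definition head_mx t : 'M[C]_N := \matrix_(a, b)
  (TT t (X (ev a) ^~ t) (ev b).1) 0 (ev b).2.

Definition head_det t := \det (head_mx t).

Definition combo (c : 'rV[C]_N) t m : T := \sum_a c 0 a *: X (ev a) m t.

Definition head_row (z : nat -> T) : 'rV[C]_N := \row_a z (ev a).1 0 (ev a).2.

Lemma head_rowE (z z' : nat -> T) : head_row z = head_row z' ->
  forall m, (m < J)%N -> z m = z' m.
Proof.
move=> /rowP e m mJ; apply/rowP => i.
by have := e (enum_rank (Ordinal mJ, i)); rewrite !mxE enum_rankK.
Qed.

Lemma head_rowD (u v w : nat -> T) : (forall m, u m = v m + w m) ->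
  head_row u = head_row v + head_row w.
Proof. by move=> e; apply/rowP => b; rewrite !mxE e mxE. Qed.

Lemma head_row_unit (u : nat -> T) (a : 'I_N) :
  (forall m, (m < J)%N -> u m = unit_data (ev a) m) -> head_row u = delta_mx 0 a.
Proof.
move=> e; apply/rowP => b; rewrite !mxE e ?ltn_ord// /unit_data eqxx /=.
have [->|ba] := eqVneq b a; first by rewrite eqxx mxE !eqxx.
case: eqP => [e1|e1]; rewrite mxE ?eqxx //=.
case: eqP => // e2; case/eqP: ba; apply: enum_val_inj.
by case: (ev b) (ev a) e1 e2 => [u1 v1] [u2 v2] /= /val_inj -> ->.
Qed.

Lemma combo_head (c : 'rV[C]_N) t m (mJ : (m < J)%N) i :
  combo c t m 0 i = c 0 (enum_rank (Ordinal mJ, i)).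
Proof.
rewrite /combo summxE (bigD1 (enum_rank (Ordinal mJ, i)))//= [X in _ + X]big1.
  by rewrite addr0 mxE X_head// /unit_data enum_rankK eqxx mxE !eqxx mulr1.
move=> a ai; rewrite mxE X_head// /unit_data; case: eqP => [e|_]; last by rewrite mxE mulr0.
rewrite mxE eqxx /=; case: eqP => [e2|_]; last by rewrite mulr0.
exfalso; case/negP: ai; apply/eqP; rewrite -[a]enum_valK; congr enum_rank.
by case: (ev a) e e2 => u v /= e ->; congr (_, _); apply: val_inj.
Qed.

Lemma combo_bnd (c : 'rV[C]_N) t : D t -> bnd (r / 8) (\sum_a nm (c 0 a) * BX (ev a)) (combo c t).
Proof. by move=> Dt; apply: bnd_sum => a; apply: bnd_scale; exact: X_bnd. Qed.

Lemma TT_combo (c : 'rV[C]_N) t m : D t ->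
  TT t (combo c t) m = \sum_a c 0 a *: TT t (X (ev a) ^~ t) m.
Proof.
move=> Dt.
rewrite (TT_sum (B := fun a => nm (c 0 a) * BX (ev a)) _ _ r48 (lexx _)) => //.
- by apply: eq_bigr => a _; apply: (TT_scale _ _ r48 (lexx _) (BX0 _) (X_bnd _ Dt) Dt).
- by move=> a; rewrite mulr_ge0 ?nm_ge0.
- by move=> a; apply: bnd_scale; exact: X_bnd.
Qed.

Lemma head_combo (c : 'rV[C]_N) t : D t -> head_row (fun m => TT t (combo c t) m) = c *m head_mx t.
Proof.
move=> Dt; apply/rowP => b; rewrite mxE TT_combo// summxE mxE.
by apply: eq_bigr => a _; rewrite !mxE.
Qed.

Lemma combo_tail (c : 'rV[C]_N) t m : D t -> (J <= m)%N -> TT t (combo c t) m = 0.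
Proof.
by move=> Dt Jm; rewrite TT_combo// big1// => a _; rewrite X_tail// scaler0.
Qed.

Lemma decompose B B' (z y : nat -> T) t : D t -> 0 <= B -> 0 <= B' ->
  bnd (r / 4) B z -> bnd (r / 4) B' y -> (forall m, (m < J)%N -> y m = 0) ->
  (forall m, (J <= m)%N -> TT t z m = TT t y m) ->
  forall m, z m = y m + combo (head_row z) t m.
Proof.
move=> Dt B0 B0' hz hy y0 zy m.
have cB0 : 0 <= \sum_a nm (head_row z 0 a) * BX (ev a).
  by apply: sumr_ge0 => a _; rewrite mulr_ge0 ?nm_ge0.
have r80 : 0 <= r / 8 by rewrite divr_ge0// ltW.
have cb := bnd_le r80 r48 cB0 (combo_bnd (head_row z) Dt).
have zyB := bndD hz (bnd_opp hy).
have zyB0 := addr_ge0 B0 B0'.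
apply/subr0_eq; rewrite opprD addrA.
have zycB := bndD zyB (bnd_opp cb).
apply: (tail_unique (addr_ge0 zyB0 cB0) zycB Dt) => k kJ.
  rewrite y0// subr0; apply/rowP => i; rewrite mxE [X in _ + X]mxE combo_head.
  by rewrite mxE enum_rankK subrr mxE.
rewrite (TT_sub _ (lexx _) r48 zyB0 cB0 zyB cb Dt).
by rewrite (TT_sub _ (lexx _) r48 B0 B0' hz hy Dt) zy// combo_tail// subrr subr0.
Qed.

Lemma TT_injective B (z : nat -> T) t : D t -> head_det t != 0 -> 0 <= B ->
  bnd (r / 4) B z -> (forall m, TT t z m = 0) -> forall m, z m = 0.
Proof.
move=> Dt ft B0 hz z0.
have zB : bnd (r / 4) 0 (fun=> 0 : T) by move=> k; rewrite nmm0 !mul0r.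
have TT0 m : TT t (fun=> 0) m = 0 :> T.
  exact: TT_zero.
have dec := decompose Dt B0 (lexx 0) hz zB (fun _ _ => erefl)
  (fun m _ => etrans (z0 m) (esym (TT0 m))).
have zc : z = combo (head_row z) t by apply/funext => m; rewrite {1}dec add0r.
have : head_row z *m head_mx t = 0.
  rewrite -head_combo// -zc; apply/rowP => a; by rewrite !mxE z0 mxE.
have mu : head_mx t \in unitmx by rewrite unitmxE unitfE.
move=> /(congr1 (mulmx^~ (invmx (head_mx t)))); rewrite mulmxK// mul0mx => h0 m.
by rewrite {1}dec h0 add0r /combo big1// => a _; rewrite mxE scale0r.
Qed.

Lemma unif_det A N' (M : T -> 'M[C]_N') (A_bal : exists x s, A = bal x s) :
  munif A M -> unif A (fun t => \det (M t)).
Proof.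
move=> uM; have [x [s AE]] := A_bal; rewrite AE in uM *.
apply: unif_sum => sg _; apply: unif_mul; first exact: unif_cst.
by apply: unif_prod => i _; exact: uM.
Qed.

Lemma head_mx_unif : munif D head_mx.
Proof.
move=> a b; apply: unif_eq (TT_unif r0 K0 G_gevrey r48 (lexx _) D_near (BX0 _)
  (X_unif (ev a)) (fun t Dt => X_bnd _ Dt) (ev b).1 0 (ev b).2).
by move=> t _; rewrite mxE.
Qed.

Lemma head_det_unif : unif D head_det.
Proof. by apply: unif_det head_mx_unif; exists q, (r / 64). Qed.

Lemma adj_unif : munif D (fun t => \adj (head_mx t)).
Proof.
move=> a b; apply: (@unif_eq _ _ _ (fun t => (-1) ^+ (b + a) * \det (row' b (col' a (head_mx t))))).
  by move=> t _; rewrite mxE.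
apply: unif_scale; apply: unif_det; first by exists q, (r / 64).
move=> c d; apply: unif_eq (head_mx_unif (lift b c) (lift a d)) => t _.
by rewrite !mxE.
Qed.

(** The adjugate instead of the inverse: the right-hand side is multiplied by the determinant and
    nothing is divided, so that x is holomorphic on the whole ball, including the zeros of the
    determinant. *)
Lemma cramer_solution (b : nat -> T -> T) B : 0 <= B -> (forall m, munif D (b m)) ->
  (forall t, D t -> bnd (r / 8) B (b^~ t)) ->
  exists (x : nat -> T -> T) (B' : R), [/\ 0 <= B', forall m, munif D (x m),
    forall t, D t -> bnd (r / 8) B' (x^~ t) &
    forall m t, D t -> TT t (x^~ t) m = head_det t *: b m t].
Proof.
move=> B0 ub hb.
pose b' m t : T := if (m < J)%N then 0 else b m t.
have ub' m : munif D (b' m).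
  by rewrite /b'; case: (ltnP m J) => _; [exact: munif_cst|exact: ub].
have hb' t : D t -> bnd (r / 8) B (b'^~ t).
  move=> Dt m; rewrite /b'; case: ltnP => _; last exact: hb.
  by rewrite nmm0 -mulrA mulr_ge0// weight_ge0.
have [y [y1 y2 y3 y4]] := tail_solution B0 ub' hb'.
have B20 : 0 <= 2 * B by rewrite mulr_ge0.
pose rhs t := head_row (fun m => b m t - TT t (y^~ t) m).
have ur : munif D rhs.
  move=> i a; rewrite ord1.
  apply: unif_eq (unif_sub (ub (ev a).1 0 (ev a).2)
    (TT_unif r0 K0 G_gevrey r48 (lexx _) D_near B20 y1 (fun t Dt => y2 t Dt) (ev a).1 0 (ev a).2)).
  by move=> t _; rewrite !mxE.
pose c t := rhs t *m \adj (head_mx t).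
have uc : munif D c := munif_mul ur adj_unif.
have [Sc Sc0 hSc] := munif_bounded uc.
have [Sd Sd0 hSd] := unif_bounded head_det_unif.
pose x m t : T := head_det t *: y m t + combo (c t) t m.
pose Bc := \sum_(a < N) Sc * BX (ev a).
have Bc0 : 0 <= Bc by apply: sumr_ge0 => a _; rewrite mulr_ge0.
have fyB t : D t -> bnd (r / 8) (nm (head_det t) * (2 * B)) (fun m => head_det t *: y m t).
  by move=> Dt; apply: bnd_scale; exact: y2.
exists x, (Sd * (2 * B) + Bc); split.
- by rewrite addr_ge0// mulr_ge0.
- move=> m; apply: munif_add; first exact: munif_scalef head_det_unif (y1 m).
  apply: munif_sum => a _; apply: munif_scalef (X_unif _ _); exact: uc.
- move=> t Dt; apply: bndD.
    by apply: bnd_leB (fyB t Dt); rewrite ler_wpM2r ?hSd.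
  apply: bnd_leB (combo_bnd (c t) Dt); apply: ler_sum => a _.
  rewrite ler_wpM2r//; apply: le_trans (hSc t Dt); exact: nm_le_nmm.
move=> m t Dt.
have cB0 : 0 <= \sum_a nm (c t 0 a) * BX (ev a).
  by apply: sumr_ge0 => a _; rewrite mulr_ge0 ?nm_ge0.
have f0 : 0 <= nm (head_det t) * (2 * B) by rewrite mulr_ge0 ?nm_ge0.
have TTx k : TT t (x^~ t) k = head_det t *: TT t (y^~ t) k + TT t (combo (c t) t) k.
  apply: etrans (TT_add r0 K0 G_gevrey r48 (lexx _) k f0 cB0 (fyB t Dt) (combo_bnd (c t) Dt) (D_near Dt)) _.
  by f_equal; exact: (TT_scale _ _ r48 (lexx _) B20 (y2 t Dt) Dt).
have [mJ|Jm] := ltnP m J; last first.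
  by rewrite TTx combo_tail// addr0 y4// /b' ltnNge Jm.
rewrite TTx.
have : head_row (fun k => TT t (combo (c t) t) k) =
    head_row (fun k => head_det t *: (b k t - TT t (y^~ t) k)).
  rewrite head_combo// /c -mulmxA mul_adj_mx mul_mx_scalar.
  by apply/rowP => a; rewrite !mxE.
move=> /head_rowE/(_ m mJ) ->.
by rewrite scalerBr addrCA subrr addr0.
Qed.

(** Approximate solvability is enough: if [head_mx] kills a column l, applying the head of the
    equation to l bounds each entry of l by a multiple of eps. The error y is allowed because the
    unit data will only be reached up to a truncation. *)
Lemma head_det_neq0 t : D t ->
  (forall (a : I) (eps : R), 0 < eps -> exists (z y : nat -> T) (B : R),
    [/\ 0 <= B, bnd (r / 4) B z, bnd (r / 8) eps y,
        forall m, (m < J)%N -> y m = 0 &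
        forall m, TT t z m = unit_data a m + y m]) ->
  head_det t != 0.
Proof.
move=> Dt H; rewrite /head_det -det_tr; apply/det0P => -[l l0 hl].
case/negP: l0; apply/eqP; rewrite -[l]trmxK; set l' := l^T.
have {hl} Ml : head_mx t *m l' = 0.
  by apply: trmx_inj; rewrite trmx_mul trmxK hl trmx0.
suff -> : l' = 0 by rewrite trmx0.
apply/colP => a0; rewrite [RHS]mxE; pose a := enum_val a0.
have [BTT BTT0 hTT] : exists2 M, 0 <= M & forall eps (u : nat -> T), 0 <= eps -> bnd (r / 8) eps u ->
    nm ((head_row (fun m => TT t u m) *m l') 0 0) <= M * eps.
  pose W (b : 'I_N) : R := ((2 * K + 4 * K * n%:R) / (ev b).1.+1%:R + 1) *
      ((r / 8) ^+ (ev b).1 / (ev b).1`!%:R).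
  have W0 b : 0 <= W b.
    rewrite mulr_ge0 ?weight_ge0// addr_ge0// divr_ge0//.
    by rewrite addr_ge0// !mulr_ge0.
  exists (\sum_b W b * nm (l' b 0)).
    by apply: sumr_ge0 => b _; rewrite mulr_ge0 ?nm_ge0.
  move=> eps u e0 hu; rewrite mxE (le_trans (nm_sum _ _ _))// mulr_suml.
  apply: ler_sum => b _; rewrite nmM mulrAC ler_wpM2r ?nm_ge0// mxE.
  set m := (ev b).1.
  apply: le_trans (nm_le_nmm _ _ _) _.
  have -> : TT t u m = (TT t u m - u m) + u m by rewrite subrK.
  rewrite (le_trans (nmmD _ _))//.
  have h1 := TTop_sub_le r0 K0 G0 G_gevrey m r48 (lexx _) e0 hu (D_near Dt).
  apply: le_trans (lerD h1 (hu m)) _.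
  by rewrite /W -/m le_eqVlt; apply/orP; left; apply/eqP; ring.
apply: nm_eq0; apply/eqP; rewrite eq_le nm_ge0 andbT.
apply: (@le0_small _ _ (BTT * 2) 1) => // s s0 _.
have [z [y [B [B0 hz hy y0 e]]]] := H a s s0.
have [w [_ w2 w3 w4]] := @tail_solution (fun m _ => y m) s (ltW s0)
    (fun m => munif_cst _ _) (fun _ _ => hy).
have wB : bnd (r / 4) (2 * s) (w^~ t).
  by apply: bnd_le (w2 t Dt) => //; rewrite ?divr_ge0 ?mulr_ge0 ?(ltW r0) ?(ltW s0).
have s20 : 0 <= 2 * s by rewrite mulr_ge0 ?(ltW s0).
have tl m : (J <= m)%N -> TT t z m = TT t (w^~ t) m.
  move=> Jm; rewrite e w4// /unit_data; case: eqP => [me|_]; last by rewrite add0r.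
  by move: Jm; rewrite me leqNgt ltn_ord.
have dec := decompose Dt B0 s20 hz wB (fun m mJ => etrans (w3 m t mJ) (y0 m mJ)) tl.
have cB0 : 0 <= \sum_a nm (head_row z 0 a) * BX (ev a).
  by apply: sumr_ge0 => b _; rewrite mulr_ge0 ?nm_ge0.
have TTz m : TT t z m = TT t (w^~ t) m + TT t (combo (head_row z) t) m.
  apply: etrans _ (TT_add r0 K0 G_gevrey r48 (lexx _) m s20 cB0 (w2 t Dt) (combo_bnd _ Dt) (D_near Dt)).
  by have <- : z = (fun k => w k t + combo (head_row z) t k) by apply/funext.
have hr : head_row (fun m => TT t z m) = head_row (fun m => TT t (w^~ t) m) + head_row z *m head_mx t.
  by rewrite -head_combo//; exact: head_rowD.
have dl : head_row (fun m => TT t z m) = delta_mx 0 a0.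
  apply: head_row_unit => m mJ; apply: etrans (e m) _.
  by rewrite y0// addr0.
have -> := kernel_coef (etrans (esym dl) hr) Ml.
by apply: le_trans (hTT _ _ s20 (w2 t Dt)) _; rewrite mulrA.
Qed.

End Fredholm.

Lemma nmm_row_le (R : realType) p m (A : 'M[R[i]]_(p, m)) i : nmm (row i A) <= nmm A.
Proof.
have -> : nmm (row i A) = \sum_j nm (A i j).
  by rewrite /nmm big_ord1; apply: eq_bigr => j _; rewrite mxE.
rewrite /nmm [leRHS](bigD1 i)//= lerDl; apply: sumr_ge0 => k _.
by apply: sumr_ge0 => j _; exact: nm_ge0.
Qed.

Lemma geometric_fact_le (R : realType) (x : R) (m k : nat) : 0 < x -> (k <= m)%N ->
  x ^+ (m - k) / (m - k)`!%:R <= k`!%:R / (2 * x) ^+ k * ((2 * x) ^+ m / m`!%:R) * 2 ^+ k.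
Proof.
move=> x0 km; have := fact_prod_le R (m - k) k; rewrite subnK// => h.
have Fm : 0 < (m`!%:R : R) by rewrite ltr0n fact_gt0.
have X0 : 0 < x ^+ (m - k) by rewrite exprn_gt0.
have e1 : x ^+ m = x ^+ (m - k) * x ^+ k by rewrite -exprD subnK.
have e2 : (2 * x) ^+ m = 2 ^+ m * (x ^+ (m - k) * x ^+ k) by rewrite exprMn e1.
have e3 : (2 * x) ^+ k = 2 ^+ k * x ^+ k by rewrite exprMn.
rewrite e2 e3.
have -> : k`!%:R / (2 ^+ k * x ^+ k) * (2 ^+ m * (x ^+ (m - k) * x ^+ k) / m`!%:R) * 2 ^+ k
    = x ^+ (m - k) * (2 ^+ m * k`!%:R / m`!%:R).
  have xk : 0 < x ^+ k by rewrite exprn_gt0.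
  have tk : 0 < 2 ^+ k :> R by rewrite exprn_gt0.
  move: (x ^+ k) (2 ^+ k) (m`!%:R : R) (k`!%:R : R) (x ^+ (m - k)) (2 ^+ m : R) xk tk Fm.
  by move=> a b c e f g a0 b0 c0; field; rewrite !gt_eqF.
rewrite ler_pM2l// ler_pdivlMr// mulrC; exact: h.
Qed.

(** * A criterion for the determinant to be nonzero *)

Section Fredholm2.
Variables (R : realType) (n : nat).
Local Notation C := R[i].
Local Notation T := 'rV[C]_n.
Variables (q : T) (G : nat -> 'M[C]_n) (K r : R).
Hypothesis r0 : 0 < r.
Hypothesis K0 : 0 <= K.
Hypothesis G0 : G 0%N = 1%:M.
Hypothesis G_gevrey : forall k, nmm (G k) <= K * k`!%:R / r ^+ k.

Local Notation Z := (Zop q G).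
Local Notation TT := (TTop q G).
Local Notation D := (bal q (r / 64)).

Let r48 : r / 8 <= r / 4. Proof. by have := r0; lra. Qed.
Let r80 : 0 <= r / 8. Proof. by have := r0; lra. Qed.
Let r40 : 0 < r / 4. Proof. by have := r0; lra. Qed.
Let D_near t : D t -> near_q q r t. Proof. exact: bal_near_q. Qed.

Lemma iter_zshift p (u : nat -> 'M[C]_(p, n)) k m :
  iter k (@zshift R n p) u m = if (m < k)%N then 0 else u (m - k)%N.
Proof.
elim: k m => [|k IH] m; first by rewrite ltn0 subn0.
by rewrite iterS; case: m => [|m]; rewrite ?zshift0// (zshiftS r0 K0) IH.
Qed.

Lemma Z_iter_zshift p (u : nat -> 'M[C]_(p, n)) t k m :
  Z t (iter k (@zshift R n p) u) m = Z t u (m - k%:Z).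
Proof.
elim: k m => [|k IH] m; first by congr Zop; lia.
rewrite iterS; apply: etrans (Z_shift _ _ _ _ _) _; apply: etrans (IH _) _.
congr Zop; lia.
Qed.

Lemma bnd_iter_zshift p B (u : nat -> 'M[C]_(p, n)) k : 0 <= B -> bnd (r / 8) B u ->
  exists2 B', 0 <= B' & bnd (r / 4) B' (iter k (@zshift R n p) u).
Proof.
move=> B0 hu; have e4 : r / 4 = 2 * (r / 8) by field.
have rk : 0 < (r / 4) ^+ k by rewrite exprn_gt0.
exists (B * (k`!%:R / (r / 4) ^+ k * 2 ^+ k)).
  by rewrite !mulr_ge0// ?invr_ge0 ?exprn_ge0// ltW.
move=> m; rewrite iter_zshift; case: ltnP => [mk|km].
  by rewrite nmm0 !mulr_ge0// ?invr_ge0 ?exprn_ge0// ltW.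
apply: le_trans (hu _) _; rewrite -!mulrA ler_wpM2l//.
have x0 : 0 < r / 8 by rewrite divr_gt0.
have := geometric_fact_le x0 km; rewrite -e4 => /le_trans; apply.
by rewrite le_eqVlt; apply/orP; left; apply/eqP; ring.
Qed.

Lemma Z_0 p t m : near_q q r t -> Z t (fun=> 0 : 'M[C]_(p, n)) m = 0.
Proof.
move=> Dt; have hz : bnd (r / 8) 0 (fun=> 0 : 'M[C]_(p, n)) by move=> k; rewrite nmm0 !mul0r.
apply: etrans _ (mul0mx _ (Z t (fun=> 0 : 'M[C]_(p, n)) m)).
apply: etrans _ (Z_mull r0 K0 G_gevrey r48 (lexx _) (0 : 'M[C]_p) m (lexx 0) hz Dt).
have e : (fun=> 0) = (fun k : nat => (0 : 'M[C]_p) *m (0 : 'M[C]_(p, n))).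
  by apply/funext => k; rewrite mulmx0.
exact: (congr1 (fun v => Z t v m) e).
Qed.

Lemma Z_opp p rho B (u : nat -> 'M[C]_(p, n)) t m : rho <= r / 4 -> r / 8 <= rho -> 0 <= B ->
  bnd rho B u -> near_q q r t -> Z t (fun k => - u k) m = - Z t u m.
Proof.
move=> h1 h2 B0 hu Dt.
have e : (fun k => - u k) = (fun k => (- 1%:M : 'M[C]_p) *m u k).
  by apply/funext => k; exact: esym (mulN1mx _).
rewrite e; apply: etrans _ (mulN1mx _).
refine (Z_mull r0 K0 G_gevrey h1 h2 _ m B0 hu Dt).
Qed.

Lemma nmm_dexp t l : nmm (dexp q t l) = nmm (dexpN q t l).
Proof.
by rewrite !nmm_diag; apply: eq_bigr => i _; rewrite !mxE !nmM !nmX nmN.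
Qed.

Section Nondegenerate.
Variables (t : T) (u : nat -> 'M[C]_n) (Bu : R).
(** Half the radius of the problem: it leaves the factor 2^(-m) gained in [tail_le], which makes the
    truncation error small at type r / 8. *)
Hypothesis near_t : near_q q (r / 2) t.
Hypothesis Bu0 : 0 <= Bu.
Hypothesis u_bnd : bnd (r / 8) Bu u.
Hypothesis u_Z : forall m : nat, Z t u m%:Z = if m == 0%N then 1%:M else 0.

Let near_t' : near_q q r t.
Proof. by move=> i; apply: le_trans (near_t i) _; have := r0; lra. Qed.

(** In w_k zeta^k u, the coefficient of index k is w_k and those of larger index vanish; subtracting
    this image lowers the degree of the data, whatever it does to the lower coefficients. *)
Lemma Z_finite_surjective (k : nat) (w : nat -> T) :
  (forall m, (k <= m)%N -> w m = 0) ->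
  exists (z : nat -> T) (B : R), [/\ 0 <= B, bnd (r / 4) B z &
    forall m : nat, Z t z m%:Z = w m].
Proof.
elim: k w => [|k IH] w hw.
  exists (fun=> 0), 0; split=> //; first by move=> m; rewrite nmm0 !mul0r.
  by move=> m; rewrite hw//; exact: Z_0.
have [B1 B10 h1] := bnd_iter_zshift k Bu0 u_bnd.
pose s := iter k (@zshift R n n) u; pose z1 m : T := w k *m s m.
have hz1 : bnd (r / 4) (nmm (w k) * B1) z1 := bnd_mull _ h1.
have Bz1 : 0 <= nmm (w k) * B1 by rewrite mulr_ge0 ?nmm_ge0.
have Zz1 (m : nat) : Z t z1 m%:Z = w k *m Z t u (m%:Z - k%:Z).
  apply: etrans (Z_mull r0 K0 G_gevrey (lexx _) r48 _ _ B10 h1 near_t') _.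
  exact: (congr1 (mulmx (w k)) (Z_iter_zshift u t k m)).
have w'0 m : (k <= m)%N -> w m - Z t z1 m%:Z = 0.
  move=> km; have e : Z t u (m%:Z - k%:Z) = if (m - k == 0)%N then 1%:M else 0.
    by rewrite subzn//; exact: u_Z.
  rewrite Zz1 e subn_eq0; case: (leqP m k) => mk.
    have -> : m = k by apply/eqP; rewrite eqn_leq mk km.
    by rewrite mulmx1 subrr.
  by rewrite hw// mulmx0 subr0.
have [z2 [B2 [B20 h2 e2]]] := IH (fun m => w m - Z t z1 m%:Z) w'0.
exists (fun m => z2 m + z1 m), (B2 + nmm (w k) * B1); split; first exact: addr_ge0.
  exact: bndD.
move=> m; apply: etrans (Z_add r0 K0 G_gevrey (lexx _) r48 m%:Z B20 Bz1 h2 hz1 near_t') _.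
by rewrite e2 subrK.
Qed.

Lemma dexp_le l : nmm (dexp q t l) <= n%:R * ((r / 128) ^+ l / l`!%:R).
Proof.
have r20 : 0 < r / 2 by rewrite divr_gt0.
have e : r / 2 / 64 = r / 128 by field.
by have := dexpN_le r20 l near_t; rewrite e nmm_dexp.
Qed.

Lemma dexpN_le' l : nmm (dexpN q t l) <= n%:R * ((r / 128) ^+ l / l`!%:R).
Proof.
have r20 : 0 < r / 2 by rewrite divr_gt0.
have e : r / 2 / 64 = r / 128 by field.
by have := dexpN_le r20 l near_t; rewrite e.
Qed.

(* The truncation of [e * zeta ^ k * exp (- tau zeta)], multiplied by
   [exp (tau zeta)]: only the terms of degree above the truncation survive. *)
Let trunc (e : T) (k M m : nat) : T :=
  if (k <= m)%N && (m <= M)%N then e *m dexpN q t (m - k) else 0.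

Let tail (e : T) (k M m : nat) : T := \sum_(j < m.+1) trunc e k M (m - j) *m dexp q t j.

Lemma tail_exact e k M m : (m <= M)%N -> tail e k M m = if m == k then e else 0.
Proof.
move=> mM; have [mk|km] := ltnP m k.
  rewrite ltn_eqF// /tail big1// => j _.
  by rewrite /trunc leqNgt (leq_ltn_trans (leq_subr _ _) mk) mul0mx.
have -> : tail e k M m = e *m cmx q t m (m - k).
  rewrite /cmx.
  have -> : diag_mx (\row_i ccoef (t 0 i - q 0 i) m (m - k)) =
      \sum_(j < m.+1) (if (m - k < j)%N then 0 else dexpN q t (m - k - j) *m dexp q t j).
    apply/matrixP => a b; rewrite summxE mxE [X in X *+ _]mxE /ccoef -sumrMnl.
    apply: eq_bigr => j _; case: ifP => _; first by rewrite mul0rn mxE.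
    by rewrite mul_diag_diag !mxE.
  rewrite mulmx_sumr; apply: eq_bigr => j _; rewrite /trunc.
  have -> : (k <= m - j)%N && (m - j <= M)%N = (j <= m - k)%N.
    by rewrite (leq_trans (leq_subr _ _) mM) andbT -ltnS; have := ltn_ord j; lia.
  rewrite leqNgt; case: ltnP => _ /=; first by rewrite mul0mx mulmx0.
  by rewrite mulmxA subnAC.
rewrite /cmx; have -> : (m == k) = (m - k == 0)%N by rewrite subn_eq0 eqn_leq km andbT.
have -> : \row_i ccoef (t 0 i - q 0 i) m (m - k) = const_mx (m - k == 0)%N%:R :> T.
  by apply/rowP => i; rewrite !mxE ccoef_exp// leq_subr.
by rewrite diag_const_mx mul_mx_scalar; case: eqP => _; rewrite ?scale1r ?scale0r.
Qed.

Let tail_const (e : T) (k : nat) : R :=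
  nmm e * n%:R * n%:R * (k`!%:R / (r / 32) ^+ k * 2 ^+ k).

Lemma tail_term_le e k M m j : (j <= m)%N -> (k <= m)%N ->
  nmm (trunc e k M (m - j) *m dexp q t j) <=
  nmm e * n%:R * n%:R * ((r / 64) ^+ (m - k) / (m - k)`!%:R).
Proof.
move=> jm km.
have rp l : 0 <= (r / 64) ^+ l by rewrite exprn_ge0// divr_ge0// ltW.
rewrite /trunc; case: ifP => [/andP[h _]|_]; last first.
  by rewrite mul0mx nmm0 mulr_ge0 ?divr_ge0// !mulr_ge0 ?nmm_ge0.
have sE : (m - k)%N = (m - j - k + j)%N by lia.
rewrite sE; set a := (m - j - k)%N.
rewrite (le_trans (nmm_mul _ _))//.
have h1 : nmm (e *m dexpN q t a) <= nmm e * (n%:R * ((r / 128) ^+ a / a`!%:R)).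
  by rewrite (le_trans (nmm_mul _ _))// ler_wpM2l ?nmm_ge0 ?dexpN_le'.
apply: le_trans (ler_pM (nmm_ge0 _) (nmm_ge0 _) h1 (dexp_le j)) _.
have -> : nmm e * (n%:R * ((r / 128) ^+ a / a`!%:R)) * (n%:R * ((r / 128) ^+ j / j`!%:R))
  = nmm e * n%:R * n%:R * ((r / 128) ^+ a * (r / 128) ^+ j * (a`!%:R^-1 / j`!%:R)) by ring.
rewrite ler_wpM2l ?mulr_ge0 ?nmm_ge0// -exprD.
have -> : r / 64 = 2 * (r / 128) by field.
have x0 : 0 <= r / 128 by rewrite divr_ge0// ltW.
move: (r / 128) x0 => x x0; rewrite exprMn.
have -> : 2 ^+ (a + j) * x ^+ (a + j) / (a + j)`!%:R = x ^+ (a + j) * (2 ^+ (a + j) / (a + j)`!%:R).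
  by rewrite mulrAC mulrC.
rewrite ler_wpM2l ?exprn_ge0//.
have F l : 0 < (l`!%:R : R) by rewrite ltr0n fact_gt0.
have := fact_prod_le R a j.
move: (a`!%:R : R) (j`!%:R : R) ((a + j)`!%:R : R) (2 ^+ (a + j)) (F a) (F j) (F (a + j)%N).
move=> A B S P A0 B0 S0 h'.
rewrite ler_pdivlMr// (_ : A^-1 / B * S = S / A / B); last by ring.
by rewrite ler_pdivrMr.
Qed.

Lemma tail_le e k M m : (k <= m)%N ->
  nmm (tail e k M m) <= tail_const e k * 2^-1 ^+ m * ((r / 8) ^+ m / m`!%:R).
Proof.
move=> km.
rewrite (le_trans (nmm_sum _ _ _))//.
have h (j : 'I_m.+1) : nmm (trunc e k M (m - j) *m dexp q t j) <=
  nmm e * n%:R * n%:R * ((r / 64) ^+ (m - k) / (m - k)`!%:R).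
  by apply: tail_term_le => //; rewrite -ltnS.
apply: le_trans (ler_sum _ (fun j _ => h j)) _.
rewrite sumr_const card_ord -[leLHS]mulr_natl.
have r64 : 0 < r / 64 by rewrite divr_gt0.
have := geometric_fact_le r64 km.
have -> : 2 * (r / 64) = r / 32 by field.
have -> : (r / 8) ^+ m = 2 ^+ m * (2 ^+ m * (r / 32) ^+ m).
  by rewrite -!exprMn; congr (_ ^+ _); field.
rewrite /tail_const; move=> h2.
have m2 : m.+1%:R <= 2 ^+ m :> R by rewrite -natrX ler_nat ltn_expl.
have e2 : 2^-1 ^+ m * 2 ^+ m = 1 :> R by rewrite -exprMn mulVf ?pnatr_eq0//; exact: expr1n.
set c := nmm e * n%:R * n%:R; have c0 : 0 <= c by rewrite !mulr_ge0 ?nmm_ge0.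
set A := k`!%:R / _ ^+ k in h2 *; set X := (r / 32) ^+ m in h2 *.
set Y := _ / (m - k)`!%:R in h2 *.
have -> : c * (A * 2 ^+ k) * 2^-1 ^+ m * (2 ^+ m * (2 ^+ m * X) / m`!%:R)
   = (2^-1 ^+ m * 2 ^+ m) * (2 ^+ m * (c * (A * (X / m`!%:R) * 2 ^+ k))) by ring.
rewrite e2 mul1r; apply: ler_pM => //; last exact: ler_wpM2l.
by rewrite mulr_ge0// /Y divr_ge0// exprn_ge0// ltW.
Qed.

Lemma unit_data_solvable J (a : 'I_J * 'I_n) (eps : R) : 0 < eps ->
  exists (z y : nat -> T) (B : R),
    [/\ 0 <= B, bnd (r / 4) B z, bnd (r / 8) eps y,
        forall m, (m < J)%N -> y m = 0 &
        forall m, TT t z m = unit_data R a m + y m].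
Proof.
move=> eps0; pose e : T := delta_mx 0 a.2; pose k : nat := a.1.
have [N hN] := half_expn_small (tail_const e k) eps0.
(* Truncating after N makes the error smaller than eps; truncating after J keeps it out of the
   head. *)
pose M := (N + J)%N.
have kM : (k <= M)%N by rewrite (leq_trans (ltnW (ltn_ord a.1)))// leq_addl.
have tr m : (M.+1 <= m)%N -> trunc e k M m = 0.
  by move=> h; rewrite /trunc [(m <= M)%N]leqNgt h andbF.
have [z [B [B0 hz eZ]]] := Z_finite_surjective tr.
have eT m : TT t z m = tail e k M m.
  apply: eq_bigr => j _; congr (_ *m _).
  by have h : (j <= m)%N by [rewrite -ltnS]; rewrite subzn// eZ.
exists z, (fun m => if (m <= M)%N then 0 else tail e k M m), B; split=> //.
- move=> m; have w0 : 0 <= (r / 8) ^+ m / m`!%:R by rewrite divr_ge0// exprn_ge0.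
  case: leqP => h; first by rewrite nmm0 -mulrA mulr_ge0// ltW.
  apply: le_trans (tail_le _ _ (leq_trans kM (ltnW h))) _.
  rewrite -[leRHS]mulrA ler_wpM2r// ltW// hN//.
  by rewrite (leq_trans _ (ltnW h))// leq_addr.
- by move=> m mJ; rewrite (leq_trans (ltnW mJ) (leq_addl _ _)).
move=> m; rewrite eT /unit_data; case: leqP => h; first by rewrite tail_exact ?addr0.
by rewrite gtn_eqF ?add0r// (leq_ltn_trans kM).
Qed.

End Nondegenerate.

(** f is the determinant. The last two clauses say that f times the solution extends holomorphically
    to the whole ball, and that, on the half ball, the mere existence of a solution forces f to be
    nonzero. The coefficients of the equation multiply u on the right, so the matrix problem
    consists of n copies of the row problem and a single determinant serves all rows. *)
Lemma fredholm : exists f : T -> C, [/\ unif D f,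
  forall t, D t -> f t != 0 -> forall p B (z : nat -> 'M[C]_(p, n)), 0 <= B ->
    bnd (r / 4) B z -> (forall m, TT t z m = 0) -> forall m, z m = 0,
  exists (x : nat -> T -> 'M[C]_n) (B : R), [/\ 0 <= B, forall m, munif D (x m),
    forall t, D t -> bnd (r / 8) B (x^~ t) &
    forall m t, D t -> TT t (x^~ t) m = f t *: dexp q t m] &
  forall t (u : nat -> 'M[C]_n) B, near_q q (r / 2) t -> D t -> 0 <= B -> bnd (r / 8) B u ->
    (forall m : nat, Z t u m%:Z = if m == 0%N then 1%:M else 0) -> f t != 0].
Proof.
have [J hJ] := head_size q r0 K0 G0 G_gevrey.
have [X [BX hX]] := head_basis r0 K0 G_gevrey hJ.
exists (head_det q G X); split.
- exact (head_det_unif r0 K0 G_gevrey hX).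
- move=> t Dt ft p B z B0 hz z0 m; apply/row_matrixP => i; rewrite row0.
  apply: etrans (rowE _ _) _.
  have hb := bnd_mull (delta_mx 0 i : 'rV_p) hz.
  have B'0 : 0 <= nmm (delta_mx 0 i : 'rV[C]_p) * B by rewrite mulr_ge0 ?nmm_ge0.
  refine (TT_injective r0 K0 G_gevrey hJ hX Dt ft B'0 hb _ m) => k.
  apply: etrans (TT_mull r0 K0 G_gevrey (lexx _) r48 _ k B0 hz (D_near Dt)) _.
  by rewrite z0 mulmx0.
- have H (i : 'I_n) : exists xB : (nat -> T -> T) * R, [/\ 0 <= xB.2,
      forall m, munif D (xB.1 m), forall t, D t -> bnd (r / 8) xB.2 (xB.1^~ t) &
      forall m t, D t -> TT t (xB.1^~ t) m = head_det q G X t *: row i (dexp q t m)].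
    have ub m : munif D (fun t => row i (dexp q t m)).
      move=> a b; apply: unif_eq (unif_dexp q D m i b) => t _.
      by rewrite [RHS]mxE.
    have hb t : D t -> bnd (r / 8) n%:R (fun m => row i (dexp q t m)).
      move=> Dt m.
      apply: le_trans (nmm_row_le _ _) _; rewrite nmm_dexp.
      apply: le_trans (dexpN_le r0 m (D_near Dt)) _.
      rewrite -mulrA ler_wpM2l// ler_wpM2r ?invr_ge0//.
      by rewrite lerXn2r ?nnegrE//; have := r0; lra.
    have [x [B [B0 h1 h2 h3]]] := cramer_solution r0 K0 G_gevrey hJ hX (ler0n _ n) ub hb.
    by exists (x, B).
  have [xB hxB] := choice H.
  pose x m t : 'M[C]_n := \matrix_(i, j) (xB i).1 m t 0 j.
  have x_row i m t : row i (x m t) = (xB i).1 m t by apply/rowP => j; rewrite !mxE.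
  have B0 : 0 <= \sum_i (xB i).2 by apply: sumr_ge0 => i _; case: (hxB i).
  have x_bnd t : D t -> bnd (r / 8) (\sum_i (xB i).2) (x^~ t).
    move=> Dt m; have -> : nmm (x m t) = \sum_i nmm ((xB i).1 m t).
      apply: eq_bigr => i _; rewrite {1}/nmm big_ord1; apply: eq_bigr => j _.
      by rewrite mxE.
    by rewrite !mulr_suml; apply: ler_sum => i _; case: (hxB i) => _ _ h _; exact: h.
  exists x, (\sum_i (xB i).2); split=> //.
    move=> m i j; case: (hxB i) => _ h _ _; apply: unif_eq (h m 0 j) => t _.
    by rewrite mxE.
  move=> m t Dt; apply/row_matrixP => i.
  case: (hxB i) => _ _ _ h; have := h m t Dt.
  have -> : (xB i).1^~ t = (fun k => delta_mx 0 i *m x k t).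
    by apply/funext => k; rewrite -rowE x_row.
  move=> e; apply: etrans (rowE _ _) _.
  apply: etrans (esym (TT_mull r0 K0 G_gevrey r48 (lexx _) (delta_mx 0 i) m B0 (x_bnd t Dt) (D_near Dt))) _.
  by rewrite e !rowE scalemxAr.
move=> t u B nt Dt B0 hu hZ.
apply: (head_det_neq0 r0 K0 G0 G_gevrey hJ hX Dt) => a eps eps0.
exact: unit_data_solvable nt B0 hu hZ _ a eps eps0.
Qed.

End Fredholm2.

(** * Density and identity principles *)

Section RealInduction.
Variable R : realType.

Lemma real_induction (P : R -> Prop) : P 0 ->
  (forall s, 0 <= s -> s < 1 -> P s ->
     exists2 e, 0 < e & forall s', s < s' -> s' < s + e -> s' <= 1 -> P s') ->
  (forall s, 0 < s -> s <= 1 -> (forall s', 0 <= s' -> s' < s -> P s') -> P s) ->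
  forall s, 0 <= s -> s <= 1 -> P s.
Proof.
move=> P0 Pr Pl.
pose A : set R := [set s | 0 <= s /\ s <= 1 /\ forall s', 0 <= s' -> s' <= s -> P s'].
have A0 : A 0.
  split=> //; split=> // s' h1 h2; suff -> : s' = 0 by [].
  by apply/eqP; rewrite eq_le h1 h2.
have supA : has_sup A.
  by split; [exists 0 | exists 1 => s [_ [h _]]].
have lt_sup s' : 0 <= s' -> s' < sup A -> P s'.
  move=> s0 lts; have e0 : 0 < sup A - s' by rewrite subr_gt0.
  have [a [_ [_ ha]] h] := sup_adherent e0 supA; apply: ha => //.
  by rewrite ltW//; move: h; rewrite opprB addrC subrK.
have c0 : 0 <= sup A by apply: ub_le_sup A0; exact: supA.2.
have c1 : sup A <= 1 by apply: ge_sup; [exists 0|move=> s [_ []]].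
have Pc : P (sup A).
  have [->//|cn] := eqVneq (sup A) 0.
  by apply: Pl => //; rewrite lt_neqAle eq_sym cn.
have Ac : A (sup A).
  split=> //; split=> // s' h1; rewrite le_eqVlt => /orP[/eqP->//|]; exact: lt_sup.
have c_eq1 : sup A = 1.
  apply/eqP; rewrite eq_le c1 leNgt; apply/negP => clt.
  have [e e0 he] := Pr _ c0 clt Pc.
  pose a := Num.min 1 (sup A + e / 2).
  have e2 : 0 < e / 2 by rewrite divr_gt0.
  have Aa : A a.
    split; first by rewrite le_min ler01 addr_ge0// ltW.
    split; first by rewrite ge_min lexx.
    move=> s' h1 h2; have [h|h] := leP s' (sup A).
      by move: h; rewrite le_eqVlt => /orP[/eqP->//|]; exact: lt_sup.
    move: h2; rewrite le_min => /andP[h3 h4]; apply: he => //.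
    by apply: le_lt_trans h4 _; lra.
  have := ub_le_sup supA.2 Aa; rewrite leNgt => /negP; apply.
  by rewrite lt_min clt/=; lra.
by case: Ac => _ [_ h] s s0 s1; apply: h => //; rewrite c_eq1.
Qed.

(** The local hypothesis is symmetric in s1 and s2, so it provides both the step to the right and
    the passage to a supremum. *)
Lemma segment_induction (P : R -> Prop) : P 0 ->
  (forall s, 0 <= s -> s <= 1 -> exists2 e, 0 < e & forall s1 s2,
     0 <= s1 -> s1 <= 1 -> 0 <= s2 -> s2 <= 1 ->
     `|s1 - s| < e -> `|s2 - s| < e -> P s1 -> P s2) ->
  forall s, 0 <= s -> s <= 1 -> P s.
Proof.
move=> P0 h; apply: real_induction => //.
  move=> s s0 s1 Ps; have [e e0 he] := h s s0 (ltW s1); exists e => // s' h1 h2 h3.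
  apply: (he s s') => //; rewrite ?ltW//; first by rewrite (le_lt_trans s0).
    by rewrite subrr normr0.
  by rewrite gtr0_norm ?subr_gt0//; lra.
move=> s s0 s1 hs; have [e e0 he] := h s (ltW s0) s1.
pose s' := Num.max 0 (s - e / 2).
have e2 : 0 < e / 2 by rewrite divr_gt0.
have s'0 : 0 <= s' by rewrite le_max lexx.
have s's : s' < s by rewrite gt_max s0/=; lra.
apply: (he s' s) => //; [lra|exact: ltW| |by rewrite subrr normr0|exact: hs].
rewrite ltr0_norm ?subr_lt0// opprB.
have : s - e / 2 <= s' by rewrite le_max lexx orbT.
lra.
Qed.

End RealInduction.

Section Density.
Variables (R : realType) (n : nat).
Local Notation C := R[i].
Local Notation rc := (real_complex R).
Local Notation T := 'rV[C]_n.

Lemma bal_convex (x a b : T) (r s : R) : bal x r a -> bal x r b ->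
  0 <= s -> s <= 1 -> bal x r (a + rc s *: (b - a)).
Proof.
rewrite /bal/= => ha hb s0 s1.
have -> : a + rc s *: (b - a) - x = rc (1 - s) *: (a - x) + rc s *: (b - x).
  rewrite rmorphB rmorph1 /=; apply/rowP => i; rewrite !mxE; ring.
rewrite (le_lt_trans (nvD _ _))// !nvZ !nmR ger0_norm ?subr_ge0// ger0_norm//.
pose M := Num.max (nv (a - x)) (nv (b - x)).
have Mr : M < r by rewrite gt_max ha hb.
have aM : nv (a - x) <= M by rewrite le_max lexx.
have bM : nv (b - x) <= M by rewrite le_max lexx orbT.
by apply: le_lt_trans Mr; nra.
Qed.

Lemma unif_zero_line (f : T -> C) x h r d s : 0 < s -> s * nv h < r ->
  unif (bal x r) f -> 0 < d -> (forall l, nm l < d -> f (x + l *: h) = 0) ->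
  forall l, nm l <= s / 2 -> f (x + l *: h) = 0.
Proof.
move=> s0 sr uf d0 hd; have [c tc] := unif_tay s0 sr uf.
case: (tay_dichotomy s0 tc) => // -[e e0 he] l _; exfalso.
pose m := Num.min (d / 2) (e / 2).
have m0 : 0 < m by rewrite lt_min !divr_gt0.
have nm_m : nm (rc m) = m by rewrite nmR gtr0_norm.
have md2 : m <= d / 2 by rewrite ge_min lexx.
have me2 : m <= e / 2 by rewrite ge_min lexx orbT.
have := he (rc m); rewrite nm_m => /(_ m0); rewrite hd ?nm_m ?eqxx; last by lra.
by have lt : m < e by [lra]; move=> /(_ lt).
Qed.

(** If f vanished on the line around b, its expansions at successive points of the segment would
    spread the vanishing back to a. The step depends on the distance from the current point to the
    boundary of the ball. *)
Lemma line_dense (f : T -> C) x r a b d : unif (bal x r) f -> bal x r a -> bal x r b ->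
  f a != 0 -> 0 < d -> exists2 l, nm (l - 1) < d & f (a + l *: (b - a)) != 0.
Proof.
move=> uf xa xb fa d0; set h := b - a.
pose P s := exists2 e : R, 0 < e & forall l, nm l < e -> f (a + (rc s + l) *: h) = 0.
apply: contrapT => hn.
have P1 : P 1.
  exists d => // l ld; apply: contrapT => /eqP fl; apply: hn; exists (1 + l) => //.
  by rewrite addrAC subrr add0r.
suff /(_ 1 ler01 (lexx 1)) : forall s, 0 <= s -> s <= 1 -> P (1 - s).
  rewrite subrr => -[e e0 /(_ 0)]; rewrite nm0 => /(_ e0).
  by rewrite rmorph0 addr0 scale0r addr0 => /eqP; rewrite (negPf fa).
apply: segment_induction; first by rewrite subr0.
move=> s s0 s1; set c := a + rc (1 - s) *: h.
have xc : bal x r c by apply: bal_convex => //; lra.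
have [rho rho0 rhoE] : exists2 rho, 0 < rho & rho + nv (c - x) = r.
  by exists (r - nv (c - x)); rewrite ?subrK ?subr_gt0.
have h0 := nv_ge0 h; have h1 : 0 < nv h + 1 by lra.
have [S S0 Sh] : exists2 S, 0 < S & S * nv h + S = rho / 4.
  exists (rho / (4 * (nv h + 1))); first by rewrite divr_gt0// mulr_gt0.
  by field; rewrite gt_eqF.
exists (S / 8); first by rewrite divr_gt0.
move=> a1 a2 _ _ _ _ h3 h4 [e e0 he].
set c1 := a + rc (1 - a1) *: h.
have c1c : nv (c1 - c) <= S / 8 * nv h.
  have -> : c1 - c = rc (s - a1) *: h.
    rewrite /c1 /c !rmorphB rmorph1; apply/rowP => i; rewrite !mxE; ring.
  by rewrite nvZ nmR ler_wpM2r// distrC ltW.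
have c1x : nv (c1 - x) + rho / 2 <= r.
  apply: le_trans (lerD (nv_tri c1 c x) (lexx _)) _.
  move: (nv (c1 - c)) (nv (c - x)) (nv h) c1c rhoE Sh h0 => u v w.
  by move: rho0 S0; clear; lra.
have uf1 := unif_bal_sub c1x uf.
have Sh2 : S * nv h < rho / 2 by move: (nv h) h0 Sh S0 rho0 => u; clear; lra.
have c1E l : c1 + l *: h = a + (rc (1 - a1) + l) *: h by rewrite /c1 -addrA -scalerDl.
have z := unif_zero_line S0 Sh2 uf1 e0 (fun l le => etrans (congr1 f (c1E l)) (he l le)).
exists (S / 4); first by rewrite divr_gt0.
move=> l lS; have := z (rc (a1 - a2) + l); rewrite c1E.
have -> : rc (1 - a1) + (rc (a1 - a2) + l) = rc (1 - a2) + l.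
  by rewrite addrA -rmorphD/=; congr (rc _ + l); ring.
apply; rewrite (le_trans (nmD _ _))// nmR.
have : `|a1 - a2| < S / 4.
  have -> : a1 - a2 = (a1 - s) - (a2 - s) by ring.
  rewrite (le_lt_trans (ler_normB _ _))//; move: h3 h4 S0; clear; lra.
move: (nm l) lS S0 => u; clear; lra.
Qed.

Lemma unif_dense (f : T -> C) x r a b d : unif (bal x r) f -> bal x r a -> bal x r b ->
  f a != 0 -> 0 < d -> exists2 y, bal b d y & f y != 0.
Proof.
move=> uf xa xb fa d0; have h0 := nv_ge0 (b - a); have h1 : 0 < nv (b - a) + 1 by lra.
have e0 : 0 < d / (nv (b - a) + 1) by rewrite divr_gt0.
have [l hl fl] := line_dense uf xa xb fa e0; exists (a + l *: (b - a)) => //.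
rewrite /bal/=; have -> : a + l *: (b - a) - b = (l - 1) *: (b - a).
  by apply/rowP => i; rewrite !mxE; ring.
rewrite nvZ; have : d / (nv (b - a) + 1) * (nv (b - a) + 1) = d by rewrite mulfVK// gt_eqF.
by have := nm_ge0 (l - 1); nra.
Qed.

Lemma unif_identity (f : T -> C) x r a d : unif (bal x r) f -> bal x r a -> 0 < d ->
  (forall y, bal a d y -> f y = 0) -> forall y, bal x r y -> f y = 0.
Proof.
move=> uf xa d0 hd y xy; apply: contrapT => /eqP fy.
by have [z az] := unif_dense uf xy xa fy d0; rewrite hd ?eqxx.
Qed.

End Density.

(** * The local solution near a point *)

Lemma md_congr (R : realType) n p m x r (F F' : 'rV[R[i]]_n -> 'M[R[i]]_(p, m)) t h :
  munif (bal x r) F -> munif (bal x r) F' -> (forall z, bal x r z -> F z = F' z) ->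
  bal x r t -> md F t h = md F' t h.
Proof.
move=> uF uF' e xt; apply/subr0_eq; apply: etrans (esym (md_sub h uF uF' xt)) _.
apply: nmm_eq0; apply/eqP; rewrite eq_le nmm_ge0 andbT.
have s0 : 0 < r - nv (t - x) by rewrite subr_gt0.
have hs : nv (t - x) + (r - nv (t - x)) <= r by rewrite addrC subrK.
apply: le_trans (md_le (S := 0) h s0 hs (munif_sub uF uF') _) _.
  by move=> z xz; rewrite e// subrr nmm0.
by rewrite mulr0 !mul0r mulr0.
Qed.

Lemma md_scalar (R : realType) n (f : 'rV[R[i]]_n -> R[i]) t h :
  md (fun t => (f t)%:M : 'M[R[i]]_n) t h = ('d f t h)%:M.
Proof.
apply/matrixP => i j; apply: etrans (mdE _ t h i j) _.
have [->|ij] := eqVneq i j.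
  apply: etrans (eq_diff (g := f) t h _) _; first by move=> y; rewrite mxE eqxx.
  by rewrite mxE eqxx.
apply: etrans (eq_diff (g := fun=> 0) t h _) _; first by move=> y; rewrite mxE (negPf ij).
by apply: etrans (diff_cstE 0 t h) _; rewrite mxE (negPf ij).
Qed.

Section ChartAlgebra.
Variables (R : realType) (n : nat).
Local Notation C := R[i].
Implicit Types (a c : C) (H Y D X M L S : 'M[C]_n).

Lemma deriv_rel0 a c H Y : a%:M *m (c%:M + Y *m H)
  + (- (c%:M + (Y *m H - H *m Y))) *m a%:M + (- (a *: H)) *m Y = 0.
Proof.
rewrite mul_scalar_mx mul_mx_scalar mulNmx -scalemxAl.
by move: (Y *m H) (H *m Y) => P Q; apply/matrixP => i j; rewrite !mxE; ring.
Qed.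

Lemma deriv_rel1 a H X : a%:M *m (0 + a%:M *m H) + X *m 0 + (- (a *: H)) *m a%:M = 0.
Proof.
by rewrite !mul_scalar_mx mul_mx_scalar mulmx0 addr0 add0r scalerN subrr.
Qed.

Lemma rel_zero M X Y a : a%:M *m (0 + 0 *m M) + X *m 0 + Y *m 0 = 0.
Proof. by rewrite mul0mx !mulmx0 !addr0 mulmx0. Qed.

Lemma deriv_solve a M H X S Y : a%:M *m Y + (- M) *m X + (- (a *: H)) *m S = 0 ->
  a *: Y = M *m X + a *: (H *m S).
Proof.
rewrite mul_scalar_mx !mulNmx -scalemxAl -addrA -opprD => /subr0_eq ->.
by [].
Qed.

Lemma deriv_solve' a c H M X Y S : a%:M *m (Y + S *m H) + (- (c%:M + M)) *m X
  + (- (a *: H)) *m S = 0 -> a *: Y = c *: X + M *m X + a *: (H *m S - S *m H).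
Proof.
rewrite mul_scalar_mx !mulNmx mulmxDl mul_scalar_mx -scalemxAl.
move: (S *m H) (M *m X) (H *m S) => P Q Z /matrixP e; apply/matrixP => i j.
have := e i j; rewrite !mxE => /eqP; rewrite -addrA addr_eq0 => /eqP h.
have -> : a * Y i j = a * (Y i j + P i j) - a * P i j by ring.
by rewrite h; ring.
Qed.

Lemma euler_rel0 a L D Y : a%:M *m ((0 : int)%:~R *: (a%:M : 'M[C]_n) + Y *m L + a%:M *m D)
  + (- (a *: D + (Y *m L - L *m Y))) *m a%:M + (- (a *: L)) *m Y = 0.
Proof.
rewrite mulr0z scale0r !mul_scalar_mx mul_mx_scalar mulNmx -scalemxAl.
by move: (Y *m L) (L *m Y) => P Q; apply/matrixP => i j; rewrite !mxE; ring.
Qed.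

Lemma euler_rel1 a c L D X : a%:M *m (c *: 0 + a%:M *m L + 0 *m D) + X *m 0
  + (- (a *: L)) *m a%:M = 0.
Proof.
by rewrite !mul_scalar_mx mul_mx_scalar mulmx0 mul0mx !addr0 scaler0 add0r scalerN subrr.
Qed.

Lemma euler_zero a c L D X Y : a%:M *m (c *: 0 + 0 *m L + 0 *m D) + X *m 0 + Y *m 0 = 0.
Proof. by rewrite !mul0mx !mulmx0 scaler0 !addr0 mulmx0. Qed.

Lemma euler_solve a k L D M X Y : a%:M *m ((- k%:Z)%:~R *: Y + X *m L + Y *m D)
  + (- M) *m Y + (- (a *: L)) *m X = 0 ->
  a *: (L *m X) + M *m Y + k%:R *: (a *: Y) = a *: (X *m L) + a *: (Y *m D).
Proof.
rewrite mul_scalar_mx !mulNmx -scalemxAl mulrNz -pmulrn.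
move: (X *m L) (Y *m D) (L *m X) (M *m Y) => P Q Z W /matrixP e; apply/matrixP => i j.
have := e i j; rewrite !mxE => /eqP; rewrite -addrA addr_eq0 => /eqP h.
have -> : a * P i j + a * Q i j =
  a * (- k%:R * Y i j + P i j + Q i j) + a * (k%:R * Y i j) by ring.
by rewrite h; ring.
Qed.

End ChartAlgebra.

Section Chart.
Variables (R : realType) (n : nat).
Local Notation C := R[i].
Local Notation T := 'rV[C]_n.
Variables (q d : T) (G : nat -> 'M[C]_n) (K r : R).
Hypothesis r0 : 0 < r.
Hypothesis K0 : 0 <= K.
Hypothesis G_sol : fsol q d G.
Hypothesis G_gevrey : forall k, nmm (G k) <= K * k`!%:R / r ^+ k.

Local Notation W := (Wop G).
Local Notation Z := (Zop q G).
Local Notation TT := (TTop q G).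
Local Notation D := (bal q (r / 64)).

Let G0 : G 0%N = 1%:M. Proof. by case: G_sol. Qed.
Let r48 : r / 8 <= r / 4. Proof. by have := r0; lra. Qed.
Let r80 : 0 <= r / 8. Proof. by have := r0; lra. Qed.
Let D_near t : D t -> near_q q r t. Proof. exact: bal_near_q. Qed.

(** Left multiplication by constant matrices commutes with the operators, and each relation needed
    below has three terms. *)
Definition lin3 p (a b c : 'M[C]_p) (u v w : nat -> 'M[C]_(p, n)) m :=
  a *m u m + b *m v m + c *m w m.

Lemma bnd_lin3 rho p (a b c : 'M[C]_p) (u v w : nat -> 'M[C]_(p, n)) B1 B2 B3 :
  bnd rho B1 u -> bnd rho B2 v -> bnd rho B3 w ->
  bnd rho (nmm a * B1 + nmm b * B2 + nmm c * B3) (lin3 a b c u v w).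
Proof.
move=> h1 h2 h3; exact: bndD (bndD (bnd_mull a h1) (bnd_mull b h2)) (bnd_mull c h3).
Qed.

Lemma Z_lin3 rho p (a b c : 'M[C]_p) (u v w : nat -> 'M[C]_(p, n)) B1 B2 B3 t m :
  rho <= r / 4 -> r / 8 <= rho -> 0 <= B1 -> 0 <= B2 -> 0 <= B3 ->
  bnd rho B1 u -> bnd rho B2 v -> bnd rho B3 w -> near_q q r t ->
  Z t (lin3 a b c u v w) m = a *m Z t u m + b *m Z t v m + c *m Z t w m.
Proof.
move=> l1 l2 p1 p2 p3 h1 h2 h3 nt.
have n1 : 0 <= nmm a * B1 by rewrite mulr_ge0 ?nmm_ge0.
have n2 : 0 <= nmm b * B2 by rewrite mulr_ge0 ?nmm_ge0.
have n3 : 0 <= nmm c * B3 by rewrite mulr_ge0 ?nmm_ge0.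
apply: etrans (Z_add r0 K0 G_gevrey l1 l2 m (addr_ge0 n1 n2) n3
  (bndD (bnd_mull a h1) (bnd_mull b h2)) (bnd_mull c h3) nt) _.
refine (congr2 +%R _ (Z_mull r0 K0 G_gevrey l1 l2 c m p3 h3 nt)).
apply: etrans (Z_add r0 K0 G_gevrey l1 l2 m n1 n2 (bnd_mull a h1) (bnd_mull b h2) nt) _.
exact (congr2 +%R (Z_mull r0 K0 G_gevrey l1 l2 a m p1 h1 nt)
  (Z_mull r0 K0 G_gevrey l1 l2 b m p2 h2 nt)).
Qed.

Definition one_seq m : 'M[C]_n := if m == 0%N then 1%:M else 0.

Lemma one_seq_bnd : bnd (r / 8) (nmm (1%:M : 'M[C]_n)) one_seq.
Proof.
case=> [|m]; first by rewrite expr0 fact0 divr1 mulr1.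
by rewrite /one_seq /= nmm0 mulr_ge0 ?invr_ge0// mulr_ge0 ?nmm_ge0 ?exprn_ge0.
Qed.

Lemma W_one (m : int) : W one_seq m = if m is Negz k then G k.+1 else one_seq `|m|%N.
Proof.
have E (a : nat -> 'M[C]_n) k : (forall j, j != k -> a j = 0) -> msum a = a k.
  move=> h; rewrite (@msum_finite _ _ _ _ k.+1) => [|j kj]; last by rewrite h// gtn_eqF.
  rewrite big_ord_recr/= big1 ?add0r// => j _; rewrite h// ltn_eqF//.
case: m => [m|k]; rewrite /Wop.
  rewrite (E _ 0%N) => [|[|j] // _].
    by rewrite addr0 /= G0 mulmx1.
  by rewrite (_ : m%:Z + j.+1%:Z = (m + j).+1%:Z) ?mul0mx//; lia.
rewrite (E _ k.+1) => [|j jk].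
  by rewrite (_ : Negz k + k.+1%:Z = 0%:Z) ?mul1mx//; lia.
case e : (Negz k + j%:Z) => [l|l] /=; last by rewrite mul0mx.
rewrite /one_seq; case: eqP => [l0|_]; last by rewrite mul0mx.
by move: e jk; rewrite l0 => e; have -> : j = k.+1 by [lia]; rewrite eqxx.
Qed.

Lemma dexpN_base l : dexpN q q l = if l == 0%N then 1%:M else 0.
Proof.
apply/matrixP => i j; rewrite mxE [X in X *+ _]mxE subrr oppr0 expr0n.
case: l => [|l] /=; first by rewrite fact0 divr1 mxE.
by rewrite mul0r mul0rn mxE.
Qed.

Lemma Z_base p (u : nat -> 'M[C]_(p, n)) m : Z q u m = W u m.
Proof.
rewrite /Zop (@msum_finite _ _ _ _ 1) => [|l l1].
  by rewrite big_ord1 dexpN_base /= mulmx1 subr0.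
by rewrite dexpN_base gtn_eqF// mulmx0.
Qed.

Variables (f : T -> C) (x : nat -> T -> 'M[C]_n) (B : R).
Hypothesis f_unif : unif D f.
Hypothesis f_inj : forall t, D t -> f t != 0 ->
  forall p B (z : nat -> 'M[C]_(p, n)), 0 <= B ->
    bnd (r / 4) B z -> (forall m, TT t z m = 0) -> forall m, z m = 0.
Hypothesis B0 : 0 <= B.
Hypothesis x_unif : forall m, munif D (x m).
Hypothesis x_bnd : forall t, D t -> bnd (r / 8) B (x^~ t).
Hypothesis x_sol : forall m t, D t -> TT t (x^~ t) m = f t *: dexp q t m.
Hypothesis f_crit : forall t (u : nat -> 'M[C]_n) B, near_q q (r / 2) t -> D t ->
  0 <= B -> bnd (r / 8) B u ->
  (forall m : nat, Z t u m%:Z = if m == 0%N then 1%:M else 0) -> f t != 0.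

(** As x is f times the solution, this is f N_k where f does not vanish; unlike N_k, it is
    holomorphic on all of the ball. *)
Definition ycoef (k : nat) (t : T) : 'M[C]_n := Z t (x^~ t) (- k%:Z).
Local Notation y := ycoef.

Let x_bnd4 t : D t -> bnd (r / 4) B (x^~ t).
Proof. by move=> Dt; apply: bnd_le (x_bnd Dt). Qed.

Lemma Zx_pos t (m : nat) : D t -> Z t (x^~ t) m%:Z = if m == 0%N then (f t)%:M else 0.
Proof.
move=> Dt; apply: (@Z_of_TT _ _ q G n (x^~ t) t (f t)%:M) => k.
by apply: etrans (x_sol k Dt) _; rewrite mul_scalar_mx.
Qed.

Lemma ycoef0 t : D t -> y 0 t = (f t)%:M.
Proof. exact: (@Zx_pos t 0). Qed.

Lemma ycoef_unif k : munif D (y k).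
Proof.
exact: (Z_unif r0 K0 G_gevrey r48 (lexx _) D_near B0 x_unif (fun t Dt => x_bnd Dt)).
Qed.

(** Source of all relations: a combination whose coefficients of nonnegative index cancel is the
    zero sequence by [f_inj], hence its coefficients of negative index cancel too, and these are
    relations between the [ycoef]. *)
Lemma annihilate (u v w : nat -> 'M[C]_n) (a b c : 'M[C]_n) B1 B2 B3 t :
  D t -> f t != 0 -> 0 <= B1 -> 0 <= B2 -> 0 <= B3 ->
  bnd (r / 4) B1 u -> bnd (r / 4) B2 v -> bnd (r / 4) B3 w ->
  (forall m : nat, a *m Z t u m%:Z + b *m Z t v m%:Z + c *m Z t w m%:Z = 0) ->
  (forall m, lin3 a b c u v w m = 0) /\
  (forall k : int, a *m Z t u k + b *m Z t v k + c *m Z t w k = 0).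
Proof.
move=> Dt ft p1 p2 p3 h1 h2 h3 hZ.
have ZE k := Z_lin3 a b c k (lexx _) r48 p1 p2 p3 h1 h2 h3 (D_near Dt).
have z0 : forall m, lin3 a b c u v w m = 0.
  refine (f_inj Dt ft _ (bnd_lin3 a b c h1 h2 h3) _).
    by rewrite !addr_ge0// mulr_ge0 ?nmm_ge0.
  move=> m; apply: etrans (@TT_of_Z _ _ q G n (lin3 a b c u v w) t 0 _ m) (mul0mx _ _).
  by move=> k; rewrite if_same; apply: etrans (ZE k%:Z) _; exact: hZ.
split=> // k; apply: etrans (esym (ZE k)) _.
have -> : lin3 a b c u v w = (fun=> 0) by apply/funext.
by apply: (Z_0 r0 K0 G_gevrey); exact: D_near.
Qed.

Lemma zshift_bnd t : D t -> bnd (r / 4) (B / (r / 8)) (zshift (x^~ t)).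
Proof. by move=> Dt; apply: bnd_shift; rewrite ?r0 ?K0 ?B0//; exact: x_bnd. Qed.

Let BS0 : 0 <= B / (r / 8). Proof. by rewrite divr_ge0. Qed.

Lemma int_pred (k : nat) : - k%:Z - 1 = - k.+1%:Z. Proof. lia. Qed.

Lemma Zx_shift t (m : int) : Z t (zshift (x^~ t)) m = Z t (x^~ t) (m - 1).
Proof. exact: Z_shift. Qed.

Lemma Zx_pred t (m : nat) : D t -> Z t (x^~ t) (m%:Z - 1) =
  if m is m'.+1 then (if m' == 0%N then (f t)%:M else 0) else y 1 t.
Proof.
by case: m => // m Dt; rewrite (_ : m.+1%:Z - 1 = m%:Z) ?Zx_pos//; lia.
Qed.

(* [gam y_1 h / f] is the connection matrix [[N_1, diag h]]. *)
Definition gam (Y : 'M[C]_n) (h : T) : 'M[C]_n := Y *m diag_mx h - diag_mx h *m Y.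

(** The derivative of x only contributes in degrees 0 and 1 on the nonnegative side. The multiple of
    x is chosen to cancel degree 0 and that of zeta x to cancel degree 1; [annihilate] does the
    rest. *)
Lemma xderiv_rel t h : D t -> f t != 0 ->
  (forall m, f t *: md (x m) t h =
     (('d f t h)%:M + gam (y 1 t) h) *m x m t + f t *: (diag_mx h *m zshift (x^~ t) m)) /\
  (forall k, f t *: md (y k) t h = ('d f t h) *: y k t + gam (y 1 t) h *m y k t
     + f t *: (diag_mx h *m y k.+1 t - y k.+1 t *m diag_mx h)).
Proof.
move=> Dt ft; set H := diag_mx h; set Y := gam _ _.
have [B1 B10 hB1] := md_bnd B0 x_unif (fun t Dt => x_bnd Dt) h Dt.
have hB14 := bnd_le r80 r48 B10 hB1.
pose dx m := md (x m) t h.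
have Zdx k : Z t dx k = md (fun t => Z t (x^~ t) k) t h + Z t (x^~ t) (k - 1) *m H.
  by rewrite (md_Z r0 K0 G_gevrey r48 (lexx _) D_near B0 x_unif (fun t Dt => x_bnd Dt) h k Dt) subrK.
have hZ (m : nat) : (f t)%:M *m Z t dx m%:Z + (- (('d f t h)%:M + Y)) *m Z t (x^~ t) m%:Z
    + (- (f t *: H)) *m Z t (zshift (x^~ t)) m%:Z = 0.
  rewrite Zx_shift Zdx (Zx_pos m Dt) (Zx_pred m Dt).
  have mdE0 : md (fun t => Z t (x^~ t) m%:Z) t h = if m == 0%N then ('d f t h)%:M else 0.
    have uZ := Z_unif r0 K0 G_gevrey r48 (lexx _) D_near B0 x_unif (fun t Dt => x_bnd Dt) m%:Z.
    case: m uZ => [|m] uZ; rewrite /=.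
      apply: etrans _ (md_scalar f t h); apply: md_congr uZ _ (fun z Dz => Zx_pos 0 Dz) Dt.
      by apply: munif_eq (ycoef_unif 0) => z Dz; exact: ycoef0.
    apply: etrans (md_cst 0 t h).
    by apply: md_congr uZ (munif_cst _ _) (fun z Dz => Zx_pos m.+1 Dz) Dt.
  rewrite mdE0; case: m {mdE0} => [|[|m]] /=.
  - exact: deriv_rel0.
  - exact: deriv_rel1.
  exact: rel_zero.
have [h1 h2] := annihilate Dt ft B10 B0 BS0 hB14 (x_bnd4 Dt) (zshift_bnd Dt) hZ.
split=> [m|k].
  by have := h1 m; rewrite /lin3; exact: deriv_solve.
have := h2 (- k%:Z); rewrite Zx_shift Zdx int_pred; exact: deriv_solve'.
Qed.

(** Same argument with zeta d/dzeta in place of the derivative in t, by means of [Z_zeta]; the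
    coefficient of index - k is the equation of the formal solution at t, multiplied by powers of
    f. *)
Lemma euler_rel t k : D t -> f t != 0 ->
  f t *: (diag_mx t *m y k.+1 t) + (f t *: diag_mx d + gam (y 1 t) t) *m y k t
    + k%:R *: (f t *: y k t)
  = f t *: (y k.+1 t *m diag_mx t) + f t *: (y k t *m diag_mx d).
Proof.
move=> Dt ft.
pose zx m := m%:R *: x m t + zshift (x^~ t) m *m diag_mx q
  + x m t *m residue_of q d (G 1%N).
have ZZ k' := Z_zeta r0 K0 G_gevrey k' G_sol B0 (x_bnd Dt) (D_near Dt).
pose Bz := B + B / (r / 8) * nmm (diag_mx q : 'M[C]_n) + B * nmm (residue_of q d (G 1%N)).
have Bz0 : 0 <= Bz by rewrite !addr_ge0// mulr_ge0 ?nmm_ge0.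
have hBz : bnd (r / 4) Bz zx.
  exact: bndD (bndD (bnd_deg r0 B0 (x_bnd Dt)) (bnd_mulr _ (zshift_bnd Dt))) (bnd_mulr _ (x_bnd4 Dt)).
have hZ (m : nat) : (f t)%:M *m Z t zx m%:Z
    + (- (f t *: diag_mx d + gam (y 1 t) t)) *m Z t (x^~ t) m%:Z
    + (- (f t *: diag_mx t)) *m Z t (zshift (x^~ t)) m%:Z = 0.
  rewrite Zx_shift (ZZ m%:Z) (Zx_pos m Dt) (Zx_pred m Dt); case: m => [|[|m]] /=.
  - exact: euler_rel0.
  - exact: euler_rel1.
  exact: euler_zero.
have [_ h2] := annihilate Dt ft Bz0 B0 BS0 hBz (x_bnd4 Dt) (zshift_bnd Dt) hZ.
have := h2 (- k%:Z); rewrite Zx_shift (ZZ (- k%:Z)) int_pred; exact: euler_solve.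
Qed.

(** At t = q the exponential is 1, so [one_seq] solves the problem and its negative coefficients are
    the [G k]. *)
Lemma chart_center : f q != 0 /\ forall k, y k q = f q *: G k.
Proof.
have r20 : 0 < r / 64 by rewrite divr_gt0.
have Dq : D q := bal_center q r20.
have nq : near_q q (r / 2) q by move=> i; rewrite subrr nm0; have := r0; lra.
have Z1 (m : nat) : Z q one_seq m%:Z = if m == 0%N then 1%:M else 0.
  by rewrite Z_base W_one.
have fq : f q != 0 := f_crit nq Dq (nmm_ge0 _) one_seq_bnd Z1.
split=> // k.
have b1 : bnd (r / 4) (nmm (1%:M : 'M[C]_n)) one_seq by apply: bnd_le one_seq_bnd; rewrite ?nmm_ge0.
have hZ (m : nat) : 1%:M *m Z q (x^~ q) m%:Z + (- (f q)%:M) *m Z q one_seq m%:Z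
    + 0 *m Z q one_seq m%:Z = 0.
  rewrite (Zx_pos m Dq) Z1 mul1mx mul0mx addr0; case: eqP => _.
    by rewrite mulmx1 subrr.
  by rewrite mulmx0 addr0.
have [_ h2] := annihilate Dq fq B0 (nmm_ge0 _) (nmm_ge0 _) (x_bnd4 Dq) b1 b1 hZ.
have := h2 (- k%:Z); rewrite mul1mx mul0mx addr0 mulNmx mul_scalar_mx => /subr0_eq.
rewrite /ycoef => ->; congr (_ *: _); rewrite Z_base W_one.
by case: k => [|k] /=; rewrite ?G0.
Qed.

End Chart.

(** * Leading terms along a line *)

Section Orders.
Variable R : realType.
Local Notation C := R[i].
Implicit Types (u v : C -> C) (rho : R) (p q : C).

(** p may be zero: only u = p l^k + O(l^(k+1)) is asserted, which makes the notion stable under sums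
    and products. *)
Definition ord u rho p k := exists2 K, 0 <= K &
  forall l, nm l <= rho -> nm (u l - p * l ^+ k) <= K * nm l ^+ k.+1.

Lemma tay_ord u r c k : 0 < r -> tay u r c -> (forall j, (j < k)%N -> c j = 0) ->
  ord u (r / 2) (c k) k.
Proof. by move=> r0 tc h; have [K K0 hK] := tay_leading r0 tc h; exists K. Qed.

Lemma ord_sub u v rho p q k : ord u rho p k -> ord v rho q k ->
  ord (fun l => u l - v l) rho (p - q) k.
Proof.
move=> [K K0 h] [K' K'0 h']; exists (K + K'); first exact: addr_ge0.
move=> l lr; have -> : u l - v l - (p - q) * l ^+ k = (u l - p * l ^+ k) - (v l - q * l ^+ k).
  by ring.
by rewrite (le_trans (nmB _ _))// mulrDl lerD ?h ?h'.
Qed.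

Lemma ord_add u v rho p q k : ord u rho p k -> ord v rho q k ->
  ord (fun l => u l + v l) rho (p + q) k.
Proof.
move=> [K K0 h] [K' K'0 h']; exists (K + K'); first exact: addr_ge0.
move=> l lr; have -> : u l + v l - (p + q) * l ^+ k = (u l - p * l ^+ k) + (v l - q * l ^+ k).
  by ring.
by rewrite (le_trans (nmD _ _))// mulrDl lerD ?h ?h'.
Qed.

Lemma ord_sum (I : Type) (s : seq I) (u : I -> C -> C) rho (p : I -> C) k :
  (forall i, ord (u i) rho (p i) k) ->
  ord (fun l => \sum_(i <- s) u i l) rho (\sum_(i <- s) p i) k.
Proof.
move=> h; elim: s => [|i s IH].
  exists 0 => // l _; by rewrite !big_nil mul0r subr0 nm0 mul0r.
have [K K0 hK] := ord_add (h i) IH; exists K => // l lr.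
by rewrite !big_cons; exact: hK.
Qed.

Lemma ord_bound u rho p k : 0 <= rho -> ord u rho p k ->
  exists2 K, 0 <= K & forall l, nm l <= rho -> nm (u l) <= K * nm l ^+ k.
Proof.
move=> r0 [K K0 h]; exists (nm p + K * rho).
  by rewrite addr_ge0 ?nm_ge0 ?mulr_ge0.
move=> l lr; rewrite -[u l](subrK (p * l ^+ k)) (le_trans (nmD _ _))//.
rewrite [leRHS]mulrDl [leRHS]addrC; apply: lerD; last by rewrite nmM nmX.
apply: le_trans (h l lr) _.
by rewrite exprS mulrA ler_wpM2r ?exprn_ge0 ?nm_ge0// ler_wpM2l.
Qed.

Lemma ord_mul u v rho p q i j : 0 <= rho -> ord u rho p i -> ord v rho q j ->
  ord (fun l => u l * v l) rho (p * q) (i + j).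
Proof.
move=> r0 hu hv; have [K1 K10 h1] := ord_bound r0 hv.
case: hu => [K K0 h]; case: hv => [K' K'0 h'].
exists (K * K1 + nm p * K'); first by rewrite addr_ge0// mulr_ge0 ?nm_ge0.
move=> l lr; have -> : u l * v l - p * q * l ^+ (i + j) =
    (u l - p * l ^+ i) * v l + p * l ^+ i * (v l - q * l ^+ j) by rewrite exprD; ring.
have N0 k : 0 <= nm l ^+ k by rewrite exprn_ge0 ?nm_ge0.
rewrite (le_trans (nmD _ _))// [leRHS]mulrDl !nmM nmX lerD//.
  apply: le_trans (ler_pM (nm_ge0 _) (nm_ge0 _) (h l lr) (h1 l lr)) _.
  by rewrite le_eqVlt -addSn exprD; apply/orP; left; apply/eqP; ring.
apply: le_trans (ler_wpM2l _ (h' l lr)) _; first by rewrite mulr_ge0 ?nm_ge0.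
by rewrite le_eqVlt -addnS exprD; apply/orP; left; apply/eqP; ring.
Qed.

Lemma ord_shift u rho p k : 0 <= rho -> ord u rho p k -> ord (fun l => l * u l) rho 0 k.
Proof.
move=> r0 hu; have [K K0 h] := ord_bound r0 hu; exists K => // l lr.
by rewrite mul0r subr0 nmM exprS mulrCA ler_wpM2l ?nm_ge0 ?h.
Qed.

Lemma ord_eq0 u rho p k K d : 0 < rho -> 0 < d -> ord u rho p k ->
  (forall l, nm l < d -> nm (u l) <= K * nm l ^+ k.+1) -> p = 0.
Proof.
move=> r0 d0 [K' K'0 h] hd; have m0 : 0 < Num.min rho (d / 2) by rewrite lt_min r0 divr_gt0.
apply: (@coef_eq0 _ _ (K + K') (Num.min rho (d / 2)) k) => // l.
rewrite le_min => /andP[lr ld].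
have -> : p * l ^+ k = u l - (u l - p * l ^+ k) by ring.
rewrite (le_trans (nmB _ _))// mulrDl lerD ?h ?hd//; move: ld d0; clear; lra.
Qed.

(** l d/dl preserves the order and multiplies the leading coefficient by k, so that k = 0 needs no
    separate treatment afterwards. *)
Lemma tay_euler u r c c' k : 0 < r -> tay u r c' -> (forall j, c' j = c j.+1 *+ j.+1) ->
  (forall j, (j < k)%N -> c j = 0) -> ord (fun l => l * u l) (r / 2) (c k *+ k) k.
Proof.
move=> r0 tc e h; case: k h => [|k] h.
  rewrite mulr0n; apply: ord_shift (tay_ord (k := 0) r0 tc _) => //.
  by rewrite divr_ge0// ltW.
have [K K0 hK] := tay_leading r0 tc (fun j jk => etrans (e j) (etrans
  (congr1 (fun z => z *+ j.+1) (h j.+1 jk)) (mul0rn _ _))).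
exists K => // l lr; rewrite -e exprS.
have -> : l * u l - c' k * (l * l ^+ k) = l * (u l - c' k * l ^+ k) by ring.
by rewrite nmM [nm l ^+ k.+2]exprS mulrCA ler_wpM2l ?nm_ge0 ?hK.
Qed.

End Orders.

Lemma line_entry (R : realType) n (c F : R[i]) (H X S : 'M[R[i]]_n) (h : 'rV[R[i]]_n) i j :
  ((c%:M + F *: H) *m X + F *: (diag_mx h *m S)) i j
  = c * X i j + F * (\sum_k H i k * X k j + h 0 i * S i j).
Proof.
rewrite mulmxDl mul_scalar_mx -scalemxAl.
by move: (diag_mulE h S i j); rewrite !mxE => ->; rewrite mulrDr addrA.
Qed.

Lemma lead_ring (F : comPzRingType) (c a : F) k e :
  c * (a *+ k) - (c *+ e) * a - c * 0 = c * (a * (k%:R - e%:R)).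
Proof. by rewrite -(mulr_natr a k) -(mulr_natr c e); ring. Qed.

Lemma euler_ring (F : comPzRingType) (l f x' f' x y : F) : f * x' = f' * x + f * y ->
  f * (l * x') - (l * f') * x - f * (l * y) = 0.
Proof.
move=> e; have -> : f * (l * x') - l * f' * x - f * (l * y) = l * (f * x') - l * (f' * x + f * y).
  by ring.
by rewrite e subrr.
Qed.

Lemma euler_ring0 (F : comPzRingType) (l f x' f' x y : F) : l = 0 ->
  f * (l * x') - (l * f') * x - f * (l * y) = 0.
Proof. by move=> ->; ring. Qed.

(** * Zeros of the determinant near which the solution extends do not exist *)

Section Removable.
Variables (R : realType) (n : nat).
Local Notation C := R[i].
Local Notation T := 'rV[C]_n.
Variables (q : T) (G : nat -> 'M[C]_n) (K r : R).
Hypothesis r0 : 0 < r.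
Hypothesis K0 : 0 <= K.
Hypothesis G_gevrey : forall k, nmm (G k) <= K * k`!%:R / r ^+ k.

Local Notation Z := (Zop q G).
Local Notation TT := (TTop q G).
Local Notation D := (bal q (r / 64)).

Let r48 : r / 8 <= r / 4. Proof. by have := r0; lra. Qed.
Let r80 : 0 <= r / 8. Proof. by have := r0; lra. Qed.
Let D_near t : D t -> near_q q r t. Proof. exact: bal_near_q. Qed.

Variables (f : T -> C) (x : nat -> T -> 'M[C]_n) (B : R).
Hypothesis f_unif : unif D f.
Hypothesis f_inj : forall t, D t -> f t != 0 ->
  forall p B (z : nat -> 'M[C]_(p, n)), 0 <= B ->
    bnd (r / 4) B z -> (forall m, TT t z m = 0) -> forall m, z m = 0.
Hypothesis B0 : 0 <= B.
Hypothesis x_unif : forall m, munif D (x m).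
Hypothesis x_bnd : forall t, D t -> bnd (r / 8) B (x^~ t).
Hypothesis x_sol : forall m t, D t -> TT t (x^~ t) m = f t *: dexp q t m.
Hypothesis f_crit : forall t (u : nat -> 'M[C]_n) B, near_q q (r / 2) t -> D t ->
  0 <= B -> bnd (r / 8) B u ->
  (forall m : nat, Z t u m%:Z = if m == 0%N then 1%:M else 0) -> f t != 0.

Variables (t : T) (s : R) (N1 : T -> 'M[C]_n).
Hypothesis near_t : near_q q (r / 2) t.
Hypothesis s0 : 0 < s.
Hypothesis sD : bal t s `<=` D.
Hypothesis N1_unif : munif (bal t s) N1.
Hypothesis N1E : forall z, bal t s z -> f z != 0 -> ycoef q G x 1 z = f z *: N1 z.

Section Direction.
Variables (h : T) (cf : nat -> C) (a : nat -> 'I_n -> 'I_n -> nat -> C) (e : nat).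
Hypothesis h_small : 4 * nv h < s / 2.
Hypothesis f_tay : tay (fun l => f (t + l *: h)) 4 cf.
Hypothesis a_tail : forall m i j l N, nm l <= 2 ->
  nm (x m (t + l *: h) i j - \sum_(k < N) a m i j k * l ^+ k)
    <= 2 * (B * (r / 8) ^+ m / m`!%:R) * (nm l / 4) ^+ N.
Hypothesis a_le : forall m i j k, nm (a m i j k) <= B * (r / 8) ^+ m / m`!%:R.
Hypothesis cf_e : cf e != 0.
Hypothesis cf_lt : forall j, (j < e)%N -> cf j = 0.

Local Notation pt l := (t + l *: h).
Let w m : R := B * (r / 8) ^+ m / m`!%:R.
Let w0 m : 0 <= w m. Proof. by rewrite divr_ge0// mulr_ge0// exprn_ge0. Qed.
Let f4 : 0 < 4 :> R. Proof. by []. Qed.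
Let e42 : 4 / 2 = 2 :> R. Proof. by field. Qed.
Let ts : bal t s t. Proof. exact: bal_center. Qed.
Let us f0 : unif D f0 -> unif (bal t s) f0. Proof. exact: unif_subset. Qed.
Let sh4 : 4 * nv h < s. Proof. by have := s0; have := h_small; lra. Qed.

Let pt_bal l : nm l <= 2 -> bal t s (pt l).
Proof.
move=> l2; rewrite /bal/= addrC addKr nvZ; apply: le_lt_trans sh4.
by rewrite ler_wpM2r ?nv_ge0// (le_trans l2)//; lra.
Qed.

Let a_tay m i j : tay (fun l => x m (pt l) i j) 4 (a m i j).
Proof.
exists (2 * w m); first by rewrite mulr_ge0.
by move=> l N; rewrite e42; exact: a_tail.
Qed.

Let d_tay (g : T -> C) c : unif D g -> tay (fun l => g (pt l)) 4 c ->
  exists2 c', tay (fun l => 'd g (pt l) h) 4 c' & forall k, c' k = c k.+1 *+ k.+1.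
Proof.
move=> ug tg; have s2s : s / 2 < s by have := s0; lra.
have ud := unif_diff h s2s (us ug).
have [c' tc'] := unif_tay f4 h_small ud; exists c' => //.
exact: tay_diff f4 h_small s0 (us ug) tg tc'.
Qed.

Let line_rel m i j l : nm l <= 2 -> f (pt l) != 0 ->
  f (pt l) * 'd (fun z => x m z i j : C) (pt l) h = 'd f (pt l) h * x m (pt l) i j
    + f (pt l) * (\sum_k gam (N1 (pt l)) h i k * x m (pt l) k j
                   + h 0 i * zshift (x^~ (pt l)) m i j).
Proof.
move=> l2 fl; have Dl := sD (pt_bal l2).
have [/(_ m) E _] := xderiv_rel r0 K0 G_gevrey f_inj B0 x_unif x_bnd x_sol h Dl fl.
move: E; rewrite (N1E (pt_bal l2) fl); move: (zshift _ m) => S.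
have -> : gam (f (pt l) *: N1 (pt l)) h = f (pt l) *: gam (N1 (pt l)) h.
  by rewrite /gam scalerBr -scalemxAl -scalemxAr.
move=> /matrixP/(_ i j); rewrite mxE mdE => ->.
exact: line_entry.
Qed.

Let line_ord (g : T -> C) : unif (bal t s) g -> exists p, ord (fun l => g (pt l)) 2 p 0.
Proof.
move=> ug; have [c tc] := unif_tay f4 sh4 ug.
by exists (c 0%N); rewrite -e42; apply: tay_ord tc _.
Qed.

Let f_ord : ord (fun l => f (pt l)) 2 (cf e) e.
Proof. by rewrite -e42; exact: tay_ord f_tay cf_lt. Qed.

Let f_neq0 : exists2 dl : R, 0 < dl & forall l, 0 < nm l -> nm l < dl -> f (pt l) != 0.
Proof.
case: (tay_dichotomy f4 f_tay) => // fz; exfalso; case/eqP: cf_e.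
apply: (@ord_eq0 _ (fun l => f (pt l)) 2 _ e 0 2 _ _ f_ord) => // l l2.
by rewrite fz ?nm0 ?mul0r// e42 ltW.
Qed.

(** Since N_1 is regular, x satisfies f l x' = l f' x + l f (regular combination of terms of order
    k). The coefficients of l^(e+k) give a (k - e) = 0 up to the nonzero factor [cf e], hence a = 0
    for k < e. *)
Lemma coefs_step m k : (k < e)%N -> (forall i j k', (k' < k)%N -> a m i j k' = 0) ->
  (forall i j, exists p, ord (fun l => zshift (x^~ (pt l)) m i j) 2 p k) ->
  forall i j, a m i j k = 0.
Proof.
move=> ke IH hz i j.
have X_ord i' j' : ord (fun l => x m (pt l) i' j') 2 (a m i' j' k) k.
  by rewrite -e42; exact: tay_ord (a_tay m i' j') (IH i' j').
have [c1 t1 e1] := d_tay f_unif f_tay.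
have [c2 t2 e2] := d_tay (x_unif m i j) (a_tay m i j).
have oF' := tay_euler f4 t1 e1 cf_lt; have oX' := tay_euler f4 t2 e2 (IH i j).
rewrite e42 in oF' oX'.
pose Y l := \sum_k gam (N1 (pt l)) h i k * x m (pt l) k j
  + h 0 i * zshift (x^~ (pt l)) m i j.
have [p oY] : exists p, ord Y 2 p k.
  have H k' : exists p, ord (fun l => gam (N1 (pt l)) h i k' * x m (pt l) k' j) 2 p k.
    have ug : munif (bal t s) (fun z => gam (N1 z) h).
      by apply: munif_sub; apply: munif_mul => //; exact: munif_cst.
    have [p hp] := line_ord (ug i k'); exists (p * a m k' j k).
    exact: ord_mul hp (X_ord k' j).
  have [p hp] := choice H; have [p' hp'] := hz i j.
  have hc : ord (fun=> h 0 i) 2 (h 0 i) 0.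
    by exists (0 : R) => // l _; rewrite expr0 mulr1 subrr nm0 mul0r.
  exists (\sum_k p k + h 0 i * p'); apply: ord_add (ord_sum _ hp) _.
  exact: ord_mul hc hp'.
have oYl := ord_shift (ler0n R 2) oY.
have oU := ord_sub (ord_sub (ord_mul (ler0n R 2) f_ord oX') (ord_mul (ler0n R 2) oF' (X_ord i j)))
  (ord_mul (ler0n R 2) f_ord oYl).
have [dl dl0 hdl] := f_neq0.
have d0 : 0 < Num.min dl 2 by rewrite lt_min dl0/=.
have r2 : 0 < 2 :> R by [].
rewrite lead_ring in oU.
suff /eqP : cf e * (a m i j k * (k%:R - e%:R)) = 0.
  rewrite !mulf_eq0 (negPf cf_e) /= subr_eq0 eqr_nat (ltn_eqF ke) orbF.
  exact/eqP.
apply: (ord_eq0 (K := 0) r2 d0 oU) => l; rewrite lt_min => /andP[ld l2]; rewrite mul0r.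
have nm_le0 (z : C) : z = 0 -> nm z <= 0 by move=> ->; rewrite nm0.
apply: nm_le0; have [l0|l0] := eqVneq l 0; first exact: euler_ring0.
have fl : f (pt l) != 0 by apply: hdl; rewrite ?nm_gt0.
have E := line_rel m i j (ltW l2) fl.
exact: euler_ring E.
Qed.

(** The equation for x_m involves x_(m-1) through [zshift]: the induction on m is outside, the one
    on the order k inside. *)
Lemma coefs_vanish m k : (k < e)%N -> forall i j, a m i j k = 0.
Proof.
elim: m k => [|m IHm] k; have [k'] := ubnP k; elim: k' k => // k' IH k kk' ke.
  apply: coefs_step => // [i j k1 k1k|i j].
    by apply: IH (leq_trans k1k _) (ltn_trans k1k ke) _ _; rewrite -ltnS.
  by exists 0, 0 => // l _; rewrite zshift0 mxE mul0r subr0 nm0 mul0r.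
apply: coefs_step => // [i j k1 k1k|i j].
  by apply: IH (leq_trans k1k _) (ltn_trans k1k ke) _ _; rewrite -ltnS.
exists (a m i j k).
have [K1 K10 hK] : ord (fun l => x m (pt l) i j) 2 (a m i j k) k.
  rewrite -e42; apply: tay_ord (a_tay m i j) _ => // j' j'k.
  exact: IHm (ltn_trans j'k ke) _ _.
by exists K1 => // l l2; rewrite (zshiftS r0 K0); exact: hK.
Qed.

(** The value at l = 0 of x_m / l^e, which makes sense by [coefs_vanish]; divided by [cf e], it is
    the solution at t. *)
Let lead m : 'M[C]_n := \matrix_(i, j) a m i j e.

Let nn : R := n%:R * n%:R.
Let nn0 : 0 <= nn. Proof. by rewrite mulr_ge0. Qed.

Let nmm_bound (A : 'M[C]_n) c : (forall i j, nm (A i j) <= c) -> nmm A <= nn * c.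
Proof.
move=> hA; apply: le_trans (ler_sum _ (fun i _ => ler_sum _ (fun j _ => hA i j))) _.
by rewrite !sumr_const card_ord -mulrnA -[leLHS]mulr_natl natrM.
Qed.

Let lead_bnd : bnd (r / 8) (nn * B) lead.
Proof.
move=> m; rewrite (_ : _ / _ = nn * w m); last by rewrite /w; ring.
by apply: nmm_bound => i j; rewrite mxE; exact: a_le.
Qed.

Let nnB0 : 0 <= nn * B. Proof. exact: mulr_ge0. Qed.

(** [Z_geo] provides a constant for each size of u, without saying that it depends linearly on it;
    dividing v by V recovers linearity. *)
Let scale_bound (V : R) (b Mb : R) (v : nat -> 'M[C]_n) z (m : int) : 0 <= V -> 0 <= b ->
  bnd (r / 8) (b * V) v -> near_q q r z ->
  (forall u : nat -> 'M[C]_n, bnd (r / 8) b u -> nmm (Z z u m) <= Mb) -> nmm (Z z v m) <= Mb * V.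
Proof.
rewrite le_eqVlt => /orP[/eqP <-|V0] b0 hv nz hM.
  have -> : v = (fun=> 0).
    apply/funext => k; apply/nmm_eq0/eqP; rewrite eq_le nmm_ge0 andbT.
    by apply: le_trans (hv k) _; rewrite mulr0 !mul0r.
  by rewrite (Z_0 r0 K0 G_gevrey n m nz) nmm0 mulr0.
pose c : C := (real_complex R V).
have nc : nm c = V by rewrite nmR gtr0_norm.
have c0 : c != 0 by rewrite -nm_gt0 nc.
pose u k := c^-1 *: v k.
have hu : bnd (r / 8) b u.
  move=> k; rewrite nmmZ nmV nc ler_pdivrMl//; apply: le_trans (hv k) _.
  by rewrite le_eqVlt; apply/orP; left; apply/eqP; ring.
have vE : v = (fun k => c%:M *m u k).
  by apply/funext => k; rewrite mul_scalar_mx scalerA divff// scale1r.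
have -> : Z z v m = c *: Z z u m.
  rewrite {1}vE; apply: etrans (Z_mull r0 K0 G_gevrey r48 (lexx _) _ m b0 hu nz) _.
  exact: mul_scalar_mx.
by rewrite nmmZ nc mulrC ler_wpM2r ?hM// ltW.
Qed.

(** [a_tail] bounds the remainders of all the x_m with the same weights, so that the remainder
    sequence belongs to the growth class and the operator applies to it as a whole. *)
Let Z_rem (m : int) : exists2 M, 0 <= M & forall l, nm l <= 2 ->
  nmm (Z (pt l) (x^~ (pt l)) m - l ^+ e *: Z (pt l) lead m) <= M * nm l ^+ e.+1.
Proof.
have B20 : 0 <= nn * (2 * B) by rewrite mulr_ge0// mulr_ge0.
have [M hM] := Z_geo q r0 K0 G_gevrey m r48 (lexx _) B20.
exists (2 * `|M|) => [|l l2]; first by rewrite mulr_ge0.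
have Nl := D_near (sD (pt_bal l2)); have xb := x_bnd (sD (pt_bal l2)).
pose v k := x k (pt l) - l ^+ e *: lead k.
have vb : bnd (r / 8) (nn * (2 * B) * nm l ^+ e.+1) v.
  move=> k; rewrite (_ : _ / _ = nn * (2 * w k * nm l ^+ e.+1)); last by rewrite /w; ring.
  apply: nmm_bound => i j; rewrite !mxE.
  have := a_tail k i j e.+1 l2; rewrite big_ord_recr/= big1 ?add0r; last first.
    by move=> i' _; rewrite coefs_vanish ?mul0r.
  rewrite [a k i j e * _]mulrC => /le_trans; apply; rewrite -/(w k).
  apply: ler_wpM2l; first exact: mulr_ge0.
  apply: lerXn2r; rewrite ?nnegrE ?divr_ge0 ?nm_ge0//.
  by rewrite ler_pdivrMr// ler_peMr ?nm_ge0// ler1n.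
have ZE : Z (pt l) v m = Z (pt l) (x^~ (pt l)) m - l ^+ e *: Z (pt l) lead m.
  have le0 : 0 <= nmm ((l ^+ e)%:M : 'M[C]_n) * (nn * B) by rewrite mulr_ge0 ?nmm_ge0.
  have hl := bnd_mull ((l ^+ e)%:M : 'M[C]_n) lead_bnd.
  have vE : v = (fun k => x k (pt l) + - ((l ^+ e)%:M *m lead k)).
    by apply/funext => k; rewrite mul_scalar_mx.
  have hl' : bnd (r / 8) (nmm ((l ^+ e)%:M : 'M[C]_n) * (nn * B))
      (fun k => - ((l ^+ e)%:M *m lead k)) by move=> k; rewrite nmmN; exact: hl.
  rewrite vE; apply: etrans (Z_add r0 K0 G_gevrey r48 (lexx _) m B0 le0 xb hl' Nl) _.
  congr (_ + _).
  apply: etrans (Z_opp r0 K0 G_gevrey m r48 (lexx _) le0 hl Nl) _; congr (- _).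
  apply: etrans (Z_mull r0 K0 G_gevrey r48 (lexx _) _ m nnB0 lead_bnd Nl) _.
  exact: mul_scalar_mx.
rewrite -ZE; refine (scale_bound _ B20 vb Nl _).
  by rewrite exprn_ge0 ?nm_ge0.
move=> u hu; have gu := hM _ u _ hu Nl; apply: le_trans (msum_le gu) _.
by rewrite ler_wpM2l// ler_norm.
Qed.

Let Z_lead m : Z t lead m%:Z = if m == 0%N then (cf e)%:M else 0.
Proof.
have ZP l : nm l <= 2 -> Z (pt l) (x^~ (pt l)) m%:Z = f (pt l) *: one_seq R n m.
  move=> l2; apply: etrans (Zx_pos x_sol m (sD (pt_bal l2))) _.
  by rewrite /one_seq; case: eqP; rewrite ?scaler0// scalemx1.
suff : forall i j, cf e * one_seq R n m i j - Z t lead m%:Z i j = 0.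
  move=> H; apply/matrixP => i j; rewrite -(subr0_eq (H i j)) /one_seq.
  by case: eqP => _; rewrite !mxE ?mulr0// mulr_natr.
move=> i j; have [M M0 hM] := Z_rem m%:Z.
have Zu : unif D (fun z => Z z lead m%:Z i j) := Z_unif r0 K0 G_gevrey r48 (lexx _) D_near nnB0
  (fun k => munif_cst D (lead k)) (fun _ _ => lead_bnd) m%:Z i j.
have [c tc] := unif_tay f4 sh4 (us Zu).
have oc : ord (fun l => Z (pt l) lead m%:Z i j) 2 (c 0%N) 0.
  by rewrite -e42; apply: tay_ord tc _.
have c0 : c 0%N = Z t lead m%:Z i j.
  case: oc => Kc _ /(_ 0); rewrite nm0 => /(_ (ler0n _ _)).
  rewrite expr0 mulr1 expr1 mulr0 scale0r addr0 => h0.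
  by apply/esym/subr0_eq/nm_eq0/eqP; rewrite eq_le nm_ge0 andbT.
have ol : ord (fun l : C => l ^+ e) 2 1 e.
  by exists (0 : R) => // l _; rewrite mul1r subrr nm0 mul0r.
have oo : ord (fun=> one_seq R n m i j) 2 (one_seq R n m i j) 0.
  by exists (0 : R) => // l _; rewrite expr0 mulr1 subrr nm0 mul0r.
have h1 := ord_mul (ler0n R 2) f_ord oo; have h2 := ord_mul (ler0n R 2) ol oc.
rewrite addn0 mul1r c0 in h1 h2.
apply: (@ord_eq0 _ _ 2 _ e M 2 _ _ (ord_sub h1 h2)) => // l l2.
apply: le_trans (hM l (ltW l2)); rewrite (ZP l (ltW l2)).
apply: le_trans (nm_le_nmm _ i j); rewrite [X in _ <= nm X]mx_subE.
by rewrite [X in _ <= nm (X - _)]mxE [X in _ <= nm (_ - X)]mxE.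
Qed.

Lemma removable_direction : f t != 0.
Proof.
apply: (@f_crit t (fun m => (cf e)^-1%:M *m lead m) (nmm ((cf e)^-1%:M : 'M[C]_n) * (nn * B))) => //.
- exact: sD.
- by rewrite mulr_ge0 ?nmm_ge0.
- exact: bnd_mull.
move=> m; apply: etrans (Z_mull r0 K0 G_gevrey r48 (lexx _) _ m%:Z nnB0 lead_bnd (D_near (sD ts))) _.
rewrite Z_lead; case: eqP => _; last by rewrite mulmx0.
by rewrite -scalar_mxM mulVf.
Qed.

End Direction.

(** Regularity of N_1 near t forces x to vanish to at least the order e of f along a line through t.
    The limit of x / l^e then solves the problem at t itself, and [f_crit] concludes. *)
Lemma removable : (exists2 z, bal t s z & f z != 0) -> f t != 0.
Proof.
move=> [z tz fz]; have s16 : 0 < s / 16 by rewrite divr_gt0.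
have ts := bal_center t s0.
have [b tb fb] := unif_dense (unif_subset sD f_unif) tz ts fz s16.
(* The line goes through a point where f is nonzero, taken so close to t that the disc of radius 4
   in l stays in the ball. *)
pose h := b - t; have hs : 4 * nv h < s / 2 by move: tb; rewrite /bal/= -/h; lra.
have f4 : 0 < 4 :> R by [].
have pt4 l : nm l <= 4 -> D (t + l *: h).
  move=> l4; apply: sD; rewrite /bal/= addrC addKr nvZ.
  apply: le_lt_trans (_ : 4 * nv h < s); first by rewrite ler_wpM2r ?nv_ge0.
  by have := s0; lra.
have [Sf Sf0 hSf] := unif_bounded f_unif.
have [cf [_ tf]] := unif_line f4 f_unif pt4 (fun l l4 => hSf _ (pt4 l l4)).
have f_tay : tay (fun l => f (t + l *: h)) 4 cf.
  by exists (2 * Sf); [rewrite mulr_ge0|exact: tf].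
have [k0 ck0] : exists k, cf k != 0.
  apply: contrapT => hn; case/eqP: fb.
  have -> : b = t + 1 *: h by rewrite scale1r addrC subrK.
  apply: (tay_zero f4 f_tay) => [k|]; last by rewrite nm1; lra.
  by apply: contrapT => /eqP ck; apply: hn; exists k.
case: (ex_minnP (ex_intro (fun k => cf k != 0) k0 ck0)) => e ce he.
have cf_lt j : (j < e)%N -> cf j = 0.
  by move=> je; apply/eqP/negPn/negP => /he; rewrite leqNgt je.
have H (mij : nat * 'I_n * 'I_n) : exists c : nat -> C,
    (forall k, nm (c k) * 4 ^+ k <= B * (r / 8) ^+ mij.1.1 / mij.1.1`!%:R) /\
    forall l N, nm l <= 4 / 2 ->
      nm (x mij.1.1 (t + l *: h) mij.1.2 mij.2 - \sum_(k < N) c k * l ^+ k)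
      <= 2 * (B * (r / 8) ^+ mij.1.1 / mij.1.1`!%:R) * (nm l / 4) ^+ N.
  apply: (unif_line f4 (x_unif mij.1.1 mij.1.2 mij.2) pt4) => l l4.
  by apply: le_trans (nm_le_nmm _ _ _) (x_bnd (pt4 l l4) _).
have [c hc] := choice H.
have e42 : 4 / 2 = 2 :> R by field.
apply: (@removable_direction h cf (fun m i j => c (m, i, j)) e hs f_tay _ _ ce cf_lt).
  by move=> m i j l N l2; apply: (hc (m, i, j)).2; rewrite e42.
move=> m i j k; apply: le_trans ((hc (m, i, j)).1 k).
by rewrite ler_peMr ?nm_ge0// exprn_ege1// ler1n.
Qed.

End Removable.

(** * Charts: local solutions with their regular points *)

Section Solutions.
Variables (R : realType) (n : nat).
Local Notation C := R[i].
Local Notation T := 'rV[C]_n.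
Local Notation M := 'M[C]_n.
Implicit Types (N : nat -> T -> M) (t h : T) (O : set T).

Section MatrixOrders.
Implicit Types (F : C -> M).

Definition mord0 F e := forall i j, ord (fun l => F l i j) 2 0 e.
Definition mord F := forall i j, exists p, ord (fun l => F l i j) 2 p 0.

Lemma mord0_add F F' e : mord0 F e -> mord0 F' e -> mord0 (fun l => F l + F' l) e.
Proof.
move=> h h' i j; have := ord_add (h i j) (h' i j); rewrite addr0 => -[K K0 hK].
by exists K => // l l2; rewrite mx_addE; exact: hK.
Qed.

Lemma mord0_sub F F' e : mord0 F e -> mord0 F' e -> mord0 (fun l => F l - F' l) e.
Proof.
move=> h h' i j; have := ord_sub (h i j) (h' i j); rewrite subr0 => -[K K0 hK].
by exists K => // l l2; rewrite mx_subE; exact: hK.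
Qed.

Lemma mord0_mull F F' e : mord F -> mord0 F' e -> mord0 (fun l => F l *m F' l) e.
Proof.
move=> h h' i j.
have H k : ord (fun l => F l i k * F' l k j) 2 0 e.
  have [p hp] := h i k; have := ord_mul (ler0n R 2) hp (h' k j).
  by rewrite add0n mulr0.
have := ord_sum (index_enum 'I_n) H; rewrite big1// => -[K K0 hK].
by exists K => // l l2; rewrite mx_mulE; exact: hK.
Qed.

Lemma mord0_mulr F F' e : mord0 F e -> mord F' -> mord0 (fun l => F l *m F' l) e.
Proof.
move=> h' h i j.
have H k : ord (fun l => F l i k * F' l k j) 2 0 e.
  have [p hp] := h k j; have := ord_mul (ler0n R 2) (h' i k) hp.
  by rewrite addn0 mul0r.
have := ord_sum (index_enum 'I_n) H; rewrite big1// => -[K K0 hK].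
by exists K => // l l2; rewrite mx_mulE; exact: hK.
Qed.

Lemma mord_cst (A : M) : mord (fun=> A).
Proof.
move=> i j; exists (A i j), 0 => // l _.
by rewrite expr0 mulr1 subrr nm0 mul0r.
Qed.

Lemma mord_line (F : T -> M) t h s : munif (bal t s) F -> 4 * nv h < s ->
  mord (fun l => F (t + l *: h)).
Proof.
move=> uF hs i j; have f4 : 0 < 4 :> R by [].
have e42 : 4 / 2 = 2 :> R by field.
have [c tc] := unif_tay f4 hs (uF i j).
by exists (c 0%N); rewrite -e42; apply: tay_ord tc _.
Qed.

End MatrixOrders.

(* With [V = diag d + [N_1, diag t]], the first condition reads
   [diag t N_(k+1) + V N_k + k N_k = N_(k+1) diag t + N_k diag d], and the
   second one
   [d N_k = [N_1, diag dt] N_k + [diag dt, N_(k+1)]]. *)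
Definition solves (d : T) N t := fsol t d (N^~ t) /\
  forall h k, md (N k) t h = gam (N 1%N t) h *m N k t
    + (diag_mx h *m N k.+1 t - N k.+1 t *m diag_mx h).

Definition hsol d O N := forall t, O t ->
  (exists2 s, 0 < s & forall k, munif (bal t s) (N k)) /\ solves d N t.

Lemma gamB (A B : M) h : gam (A - B) h = gam A h - gam B h.
Proof.
rewrite /gam mulmxBl mulmxBr; move: (A *m _) (B *m _) (_ *m A) (_ *m B) => a b c e.
by apply/matrixP => i j; rewrite !mxE; ring.
Qed.

Lemma deriv_sub (A A' X X' Y Y' H : M) :
  A *m X + (H *m Y - Y *m H) - (A' *m X' + (H *m Y' - Y' *m H)) =
  A *m (X - X') + (A - A') *m X' + (H *m (Y - Y') - (Y - Y') *m H).
Proof.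
rewrite !mulmxBr !mulmxBl.
move: (A *m X) (A *m X') (A' *m X') (H *m Y) (H *m Y') (Y *m H) (Y' *m H) => a b c e f g k.
by apply/matrixP => i j; rewrite !mxE; ring.
Qed.

(* The equation determines the derivatives at [p] of all the [N_k] recursively
   from their values. *)
Lemma hsol_unique d N N' p s : 0 < s -> hsol d (bal p s) N -> hsol d (bal p s) N' ->
  (forall k, N k p = N' k p) ->
  exists2 e, 0 < e & forall y, bal p e y -> forall k, N k y = N' k y.
Proof.
move=> s0 hN hN' eqp; have pp := bal_center p s0.
have [[s1 s10 u1] _] := hN p pp; have [[s2 s20 u2] _] := hN' p pp.
pose S := Num.min s (Num.min s1 s2).
have S0 : 0 < S by rewrite !lt_min s0 s10.
have Ss : bal p S `<=` bal p s by apply: bal_le; rewrite ge_min lexx.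
have {}u1 k : munif (bal p S) (N k).
  by apply: munif_subset (u1 k); apply: bal_le; rewrite !ge_min lexx orbT.
have {}u2 k : munif (bal p S) (N' k).
  by apply: munif_subset (u2 k); apply: bal_le; rewrite !ge_min lexx !orbT.
exists (S / 16); first by rewrite divr_gt0.
move=> y; rewrite /bal/= => yS.
pose h := y - p; have hS : 4 * nv h < S / 2 by rewrite /h; move: yS S0; clear; lra.
have hS' : 4 * nv h < S by move: hS S0; clear; lra.
have f4 : 0 < 4 :> R by [].
have e42 : 4 / 2 = 2 :> R by field.
have SS : S / 2 < S by move: S0; clear; lra.
have r2 : 0 < 2 :> R by [].
pose pt l := p + l *: h.
have ptS l : nm l <= 2 -> bal p S (pt l).
  move=> l2; rewrite /bal/= /pt addrC addKr nvZ; apply: le_lt_trans hS'.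
  by rewrite ler_wpM2r ?nv_ge0// (le_trans l2)//; lra.
pose Dl k z := N k z - N' k z.
have uD k : munif (bal p S) (Dl k) := munif_sub (u1 k) (u2 k).
have Ht (kij : nat * 'I_n * 'I_n) :
    exists c, tay (fun l => Dl kij.1.1 (pt l) kij.1.2 kij.2) 4 c.
  exact: unif_tay f4 hS' (uD kij.1.1 kij.1.2 kij.2).
have [c hc] := choice Ht.
have tc k i j : tay (fun l => Dl k (pt l) i j) 4 (c (k, i, j)) := hc (k, i, j).
have cz e : forall k i j, c (k, i, j) e = 0.
  have [m] := ubnP e; elim: m e => // m IH [_|e em] k i j.
    have [K K0 /(_ 0)] : ord (fun l => Dl k (pt l) i j) 2 (c (k, i, j) 0%N) 0.
      by rewrite -e42; apply: tay_ord (tc k i j) _.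
    rewrite nm0 => /(_ (ler0n _ _)); rewrite expr0 mulr1 expr1 mulr0 /pt scale0r addr0.
    rewrite /Dl eqp subrr mxE sub0r nmN => h0.
    by apply: nm_eq0; apply/eqP; rewrite eq_le nm_ge0 andbT.
  have ce e' : (e' <= e)%N -> forall k i j, c (k, i, j) e' = 0.
    by move=> e'e; apply: IH; rewrite (leq_ltn_trans e'e).
  have oD k' : mord0 (fun l => Dl k' (pt l)) e.
    move=> i' j'; rewrite -e42 -(ce e (leqnn e) k' i' j').
    by apply: tay_ord (tc k' i' j') _ => // j1 j1e; apply: ce (ltnW j1e) _ _ _.
  have ud := unif_diff h SS (uD k i j).
  have [c' tc'] := unif_tay f4 hS ud.
  have ec' := tay_diff f4 hS S0 (uD k i j) (tc k i j) tc'.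
  have oc' : ord (fun l => 'd (fun z => Dl k z i j : C) (pt l) h) 2 (c' e) e.
    rewrite -e42; apply: tay_ord tc' _ => // j1 j1e.
    by rewrite ec' ce ?mul0rn.
  pose Rh l := gam (N 1%N (pt l)) h *m Dl k (pt l) + gam (Dl 1%N (pt l)) h *m N' k (pt l)
    + (diag_mx h *m Dl k.+1 (pt l) - Dl k.+1 (pt l) *m diag_mx h).
  have oR : mord0 Rh e.
    apply: mord0_add; [apply: mord0_add|apply: mord0_sub].
    - apply: mord0_mull (oD k); apply: (@mord_line (fun z => gam (N 1%N z) h) _ _ S) => //.
      by apply: munif_sub; apply: munif_mul => //; exact: munif_cst.
    - apply: mord0_mulr (mord_line (u2 k) hS').
      apply: mord0_sub; first exact: mord0_mulr (oD 1%N) (mord_cst _).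
      exact: mord0_mull (mord_cst _) (oD 1%N).
    - exact: mord0_mull (mord_cst _) (oD _).
    - exact: mord0_mulr (oD _) (mord_cst _).
  have E l : nm l <= 2 -> 'd (fun z => Dl k z i j : C) (pt l) h = Rh l i j.
    move=> l2; apply: etrans (esym (mdE (Dl k) _ h i j)) _.
    congr (fun_of_matrix _ i j).
    apply: etrans (md_sub h (u1 k) (u2 k) (ptS l l2)) _.
    have [_ [_ ->]] := hN _ (Ss _ (ptS l l2)); have [_ [_ ->]] := hN' _ (Ss _ (ptS l l2)).
    by rewrite deriv_sub -gamB.
  have : c' e = 0.
    have oc2 := ord_sub oc' (oR i j); rewrite subr0 in oc2.
    apply: (ord_eq0 (K := 0) r2 r2 oc2) => l l2; rewrite mul0r.
    have nm_le0 (z z' : C) : z = z' -> nm (z - z') <= 0 by move=> ->; rewrite subrr nm0.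
    exact: nm_le0 (E l (ltW l2)).
  by rewrite ec' => /eqP; rewrite mulrn_eq0 => /eqP.
move=> k; apply/subr0_eq/matrixP => i j; rewrite [RHS]mxE.
have -> : y = pt 1 by rewrite /pt scale1r addrC subrK.
apply: (tay_zero f4 (tc k i j) (fun e => cz e k i j)).
by rewrite nm1 e42 ler1n.
Qed.

(** A set of regular points and the sequence of the N_k, given by total functions whose values
    matter on that set only. *)
Definition sec := (set T * (nat -> T -> M))%type.

(** The last clause is maximality: a point near which the solution extends is already regular. Hence
    the regular set is determined by the solution, and charts with different determinants can be
    compared. *)
Definition chart d (S : sec) (x : T) (s : R) :=
  [/\ 0 < s, hsol d (bal x s `&` S.1) S.2,
    exists f : T -> C, [/\ unif (bal x s) f, exists2 y, bal x s y & f y != 0,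
      forall y, bal x s y -> S.1 y <-> f y != 0 &
      forall k, exists2 Y : T -> M, munif (bal x s) Y &
        forall y, bal x s y -> S.1 y -> Y y = f y *: S.2 k y] &
    forall t s' N', 0 < s' -> bal t s' `<=` bal x s -> hsol d (bal t s') N' ->
      (forall y, bal t s' y -> S.1 y -> forall k, S.2 k y = N' k y) -> S.1 t].

Lemma chart_sub d S x s x' s' : 0 < s' -> bal x' s' `<=` bal x s ->
  chart d S x s -> chart d S x' s'.
Proof.
move=> s'0 sub [s0 h1 [f [uf [y xy fy] hf hY]] mx]; have x'x := sub _ (bal_center x' s'0).
split=> //.
- by move=> t [/sub xt St]; exact: h1.
- exists f; split; [exact: unif_subset uf|exact: unif_dense uf xy x'x fy s'0| |].
    by move=> z /sub; exact: hf.
  move=> k; have [Y uY hY'] := hY k; exists Y; first exact: munif_subset uY.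
  by move=> z /sub; exact: hY'.
- move=> t s1 N' s10 ts1; exact: mx s10 (subset_trans ts1 sub).
Qed.

Definition agree (p : T) (S S' : sec) := exists2 e : R, 0 < e & forall y, bal p e y ->
  (S.1 y <-> S'.1 y) /\ (S.1 y -> forall k, S.2 k y = S'.2 k y).

Lemma agree_refl p S : agree p S S.
Proof. by exists 1. Qed.

Lemma agree_sym p S S' : agree p S S' -> agree p S' S.
Proof.
move=> [e e0 h]; exists e => // y /h[h1 h2]; split; first by rewrite h1.
by move=> /h1/h2 E k; rewrite E.
Qed.

Lemma agree_trans p S1 S2 S3 : agree p S1 S2 -> agree p S2 S3 -> agree p S1 S3.
Proof.
move=> [e e0 h] [e' e'0 h']; exists (Num.min e e'); first by rewrite lt_min e0.
move=> y yb; have /h[h1 h2] : bal p e y by apply: bal_le yb; rewrite ge_min lexx.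
have /h'[h3 h4] : bal p e' y by apply: bal_le yb; rewrite ge_min lexx orbT.
split; first by rewrite h1 h3.
by move=> Sy k; rewrite h2// h4//; apply/h1.
Qed.

Lemma agree_open p S S' : agree p S S' ->
  exists2 e : R, 0 < e & forall y, bal p e y -> agree y S S'.
Proof.
move=> [e e0 h]; exists e => // y py; have e1 : 0 < e - nv (y - p) by rewrite subr_gt0.
exists (e - nv (y - p)) => // z yz; apply: h.
by apply: bal_subset yz; rewrite addrC subrK.
Qed.

(** f' Y - f Y' vanishes near p, including where f and f' are zero, hence on the whole ball: the
    solutions agree wherever both are regular. Near a regular point of one chart its solution thus
    extends the other one, whose maximality gives the inclusion of the regular sets. *)
Lemma chart_agree d S S' x s p : chart d S x s -> chart d S' x s -> bal x s p ->
  agree p S S' -> forall y, bal x s y -> (S.1 y <-> S'.1 y) /\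
    (S.1 y -> forall k, S.2 k y = S'.2 k y).
Proof.
move=> [s0 h [f [uf _ hf hY]] mx] [_ h' [f' [uf' _ hf' hY']] mx'] xp [e e0 he].
have E k y : bal x s y -> S.1 y -> S'.1 y -> S.2 k y = S'.2 k y.
  have [Y uY eY] := hY k; have [Y' uY' eY'] := hY' k.
  have s1 : 0 < Num.min e (s - nv (p - x)) by rewrite lt_min e0 subr_gt0.
  have Z i j z : bal x s z -> f' z * Y z i j - f z * Y' z i j = 0.
    apply: (unif_identity (unif_sub (unif_mul uf' (uY i j)) (unif_mul uf (uY' i j))) xp s1).
    move=> w pw; have xw : bal x s w.
      by apply: bal_subset pw; rewrite -lerBrDl ge_min lexx orbT.
    have /he[e1 e2] : bal p e w by apply: bal_le pw; rewrite ge_min lexx.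
    have [Sw|Sw] := pselect (S.1 w).
      rewrite eY// eY'//; last exact/e1.
      by rewrite e2// !mxE; ring.
    have fw : f w = 0 by apply: contrapT => /eqP /(hf _ xw).
    have f'w : f' w = 0 by apply: contrapT => /eqP /(hf' _ xw)/e1.
    by rewrite fw f'w !mul0r subrr.
  move=> xy Sy S'y; have fy := (hf y xy).1 Sy; have f'y := (hf' y xy).1 S'y.
  apply/matrixP => i j; have := Z i j y xy; rewrite eY// eY'// !mxE => /subr0_eq.
  by rewrite mulrCA => /(mulfI fy)/(mulfI f'y).
have Sopen (S0 : sec) f0 : unif (bal x s) f0 -> (forall y, bal x s y -> S0.1 y <-> f0 y != 0) ->
    forall y, bal x s y -> S0.1 y -> exists2 s1, 0 < s1 &
      bal y s1 `<=` bal x s `&` S0.1.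
  move=> u0 hS0 y xy S0y; have s1 : 0 < s - nv (y - x) by rewrite subr_gt0.
  have hs : nv (y - x) + (s - nv (y - x)) <= s by rewrite addrC subrK.
  have [s2 s20 [s2s nz _]] := unif_inv s1 (unif_bal_sub hs u0) ((hS0 y xy).1 S0y).
  exists s2; [exact: s20|move=> z yz].
  have xz : bal x s z := bal_subset hs (bal_le s2s yz).
  by split; [exact: xz|apply: (hS0 z xz).2; exact: nz].
move=> y xy; have iff1 : S.1 y <-> S'.1 y.
  split=> Sy.
    have [s1 s10 sub] := Sopen S f uf hf y xy Sy.
    apply: (mx' y s1 S.2 s10 (fun z hz => (sub z hz).1)) => [z hz|z hz S'z k].
      exact: h (sub z hz).
    exact: esym (E k z (sub z hz).1 (sub z hz).2 S'z).
  have [s1 s10 sub] := Sopen S' f' uf' hf' y xy Sy.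
  apply: (mx y s1 S'.2 s10 (fun z hz => (sub z hz).1)) => [z hz|z hz Sz k].
    exact: h' (sub z hz).
  exact: (E k z (sub z hz).1 Sz (sub z hz).2).
by split=> // Sy k; apply: E => //; apply/iff1.
Qed.

Lemma chart_nbhs d S x s y : chart d S x s -> bal x s y -> S.1 y ->
  exists2 s', 0 < s' & bal y s' `<=` bal x s `&` S.1.
Proof.
move=> [s0 _ [f [uf _ hf _]] _] xy Sy.
have s1 : 0 < s - nv (y - x) by rewrite subr_gt0.
have hs : nv (y - x) + (s - nv (y - x)) <= s by rewrite addrC subrK.
have [s2 s20 [s2s nz _]] := unif_inv s1 (unif_bal_sub hs uf) ((hf y xy).1 Sy).
exists s2; [exact: s20|move=> z yz].
have xz : bal x s z := bal_subset hs (bal_le s2s yz).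
by split; [exact: xz|apply: (hf z xz).2; exact: nz].
Qed.

Lemma chart_point_agree d S S' x s p : chart d S x s -> chart d S' x s -> bal x s p ->
  S.1 p -> S'.1 p -> (forall k, S.2 k p = S'.2 k p) -> agree p S S'.
Proof.
move=> c c' xp Sp S'p e; have [s1 s10 h1] := chart_nbhs c xp Sp.
have [s2 s20 h2] := chart_nbhs c' xp S'p; case: c => _ h _ _; case: c' => _ h' _ _.
have m0 : 0 < Num.min s1 s2 by rewrite lt_min s10.
have b1 : bal p (Num.min s1 s2) `<=` bal p s1 by apply: bal_le; rewrite ge_min lexx.
have b2 : bal p (Num.min s1 s2) `<=` bal p s2 by apply: bal_le; rewrite ge_min lexx orbT.
have [e0 e00 he] := hsol_unique m0 (fun z hz => h _ (h1 _ (b1 _ hz)))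
  (fun z hz => h' _ (h2 _ (b2 _ hz))) e.
exists (Num.min e0 (Num.min s1 s2)); first by rewrite lt_min e00.
move=> y py; have py1 : bal p e0 y by apply: bal_le py; rewrite ge_min lexx.
have py2 : bal p (Num.min s1 s2) y by apply: bal_le py; rewrite ge_min lexx orbT.
split; last by move=> _ k; exact: he.
by split=> _; [apply: (h2 _ (b2 _ py2)).2|apply: (h1 _ (b1 _ py2)).2].
Qed.

Lemma scale_solves_deriv (f c : C) (A X Y H dX : M) : f != 0 ->
  f *: (f *: dX + c *: X) = c *: (f *: X) + (f *: A) *m (f *: X)
    + f *: (H *m (f *: Y) - (f *: Y) *m H) ->
  dX = A *m X + (H *m Y - Y *m H).
Proof.
move=> f0; rewrite -!scalemxAl -!scalemxAr.
move: (A *m X) (H *m Y) (Y *m H) => P Q S /matrixP e; apply/matrixP => i j.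
have := e i j; rewrite !mxE => E; apply: (mulfI (mulf_neq0 f0 f0)).
have -> : f * f * dX i j = f * (f * dX i j + c * X i j) - f * (c * X i j) by ring.
by rewrite E; ring.
Qed.

Lemma scale_solves_euler (f : C) k (L D X Y A : M) : f != 0 ->
  f *: (L *m (f *: Y)) + (f *: D + (f *: A *m L - L *m (f *: A))) *m (f *: X)
    + k%:R *: (f *: (f *: X))
  = f *: (f *: Y *m L) + f *: (f *: X *m D) ->
  L *m Y + (D + (A *m L - L *m A)) *m X + k%:R *: X = Y *m L + X *m D.
Proof.
move=> f0 e; apply: (scalerI (mulf_neq0 f0 f0)).
move: e; have -> : f *: A *m L - L *m (f *: A) = f *: (A *m L - L *m A).
  by rewrite scalerBr -scalemxAl -scalemxAr.
rewrite -scalerDr -!scalemxAl -!scalemxAr.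
move: (L *m Y) (_ *m X) (Y *m L) (X *m D) => P Q S Z /matrixP e; apply/matrixP => i j.
have := e i j; rewrite !mxE => E.
have -> : f * f * (S i j + Z i j) = f * (f * S i j) + f * (f * Z i j) by ring.
by rewrite -E; ring.
Qed.

(** r / 128 is half the radius on which the determinant lives, as [f_crit] requires; maximality of
    the chart is [removable]. *)
Lemma local_chart (q d : T) (G : nat -> M) (r : R) : 0 < r ->
  (forall i j, q 0 i != q 0 j -> 2 * r <= nm (q 0 i - q 0 j)) ->
  nonresonant q d -> fsol q d G ->
  exists S, [/\ chart d S q (r / 128), S.1 q & forall k, S.2 k q = G k].
Proof.
move=> r0 sep nr sol; have [K K0 gev] := gevrey r0 sep nr sol.
have [f [uf finj [x [B [B0 ux xb xs]]] fcrit]] := fredholm q r0 K0 sol.1 gev.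
have [fq yq] := chart_center r0 K0 sol gev finj B0 xb xs fcrit.
pose y := ycoef q G x.
pose S : sec := ([set t | f t != 0], fun k t => (f t)^-1 *: y k t).
have sub : bal q (r / 128) `<=` bal q (r / 64) by apply: bal_le; move: r0; clear; lra.
have r128 : 0 < r / 128 by rewrite divr_gt0.
have uy k : munif (bal q (r / 64)) (y k) := ycoef_unif r0 K0 gev B0 ux xb k.
have yE k t : f t != 0 -> y k t = f t *: S.2 k t.
  by move=> ft; rewrite /= scalerA divff// scale1r.
have hS : hsol d (bal q (r / 128) `&` S.1) S.2.
  move=> t [/sub Dt ft]; have s1 : 0 < r / 64 - nv (t - q) by rewrite subr_gt0.
  have hs : nv (t - q) + (r / 64 - nv (t - q)) <= r / 64 by rewrite addrC subrK.
  have [s2 s20 [s2s nz ui]] := unif_inv s1 (unif_bal_sub hs uf) ft.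
  have tD : bal t s2 `<=` bal q (r / 64) by move=> z tz; exact: bal_subset hs _ (bal_le s2s tz).
  have uN k : munif (bal t s2) (S.2 k).
    exact: munif_scalef ui (munif_subset tD (uy k)).
  have tt := bal_center t s20.
  split; first by exists s2.
  split; [split|].
  - apply: etrans (congr1 (fun X => (f t)^-1 *: X) (ycoef0 xs Dt)) _.
    by rewrite -mul_scalar_mx -scalar_mxM mulVf.
  - move=> k; have := euler_rel r0 K0 sol gev finj B0 xb xs k Dt ft.
    rewrite -/y !yE//; exact: scale_solves_euler.
  move=> h k; have [_ /(_ k)] := xderiv_rel r0 K0 gev finj B0 ux xb xs h Dt ft.
  rewrite -/y; have -> : md (y k) t h = f t *: md (S.2 k) t h + 'd f t h *: S.2 k t.
    have uf1 : munif (bal t s2) (fun z => (f z)%:M : M).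
      apply: munif_eq (munif_scalef (unif_subset tD uf) (munif_cst _ (1%:M))) => z _.
      by rewrite scalemx1.
    have E : md (y k) t h = md (fun z => (f z)%:M *m S.2 k z) t h.
      apply: md_congr (munif_subset tD (uy k)) (munif_mul uf1 (uN k)) _ tt => z tz.
      apply: etrans _ (esym (mul_scalar_mx _ _)); apply: yE; exact: nz.
    rewrite E; apply: etrans (md_mul h uf1 (uN k) tt) _.
    by rewrite md_scalar !mul_scalar_mx.
  have -> : gam (y 1 t) h = f t *: gam (S.2 1%N t) h.
    by rewrite yE// /gam scalerBr -scalemxAl -scalemxAr.
  rewrite (yE k)// (yE k.+1)//; apply: (scale_solves_deriv ft).
exists S; split; [|exact: fq|]; last first.
  move=> k; apply: etrans (congr1 (fun X => (f q)^-1 *: X) (yq k)) _.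
  by rewrite scalerA mulVf// scale1r.
split; [exact: r128|exact: hS| |].
  exists f; split; [exact: unif_subset uf| |by move=> z _|].
    by exists q; [exact: bal_center|exact: fq].
  move=> k; exists (y k); first exact: munif_subset (uy k).
  by move=> t _; exact: yE.
move=> t s' N' s'0 tsub hN' eN.
have tt := bal_center t s'0; have Dt := tsub _ tt.
have [[s1 s10 u1] _] := hN' t tt.
pose m := Num.min s' s1; have m0 : 0 < m by rewrite lt_min s'0.
have ms' : bal t m `<=` bal t s' by apply: bal_le; rewrite ge_min lexx.
have mD : bal t m `<=` bal q (r / 64) := subset_trans ms' (subset_trans tsub sub).
have nt : near_q q (r / 2) t.
  have : bal q (r / 2 / 64) t by rewrite (_ : r / 2 / 64 = r / 128)//; field.
  exact: bal_near_q.
have u1' : munif (bal t m) (N' 1%N).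
  by apply: munif_subset (u1 1%N); apply: bal_le; rewrite ge_min lexx orbT.
change (f t != 0).
have E z : bal t m z -> f z != 0 -> y 1 z = f z *: N' 1%N z.
  move=> tz fz; have e1 : S.2 1%N z = N' 1%N z := eN z (ms' z tz) fz 1%N.
  by rewrite -e1; exact: yE.
apply: (removable r0 K0 gev uf finj B0 ux xb xs fcrit nt m0 mD u1' E).
exact: unif_dense uf (sub _ (bal_center q r128)) (mD _ (bal_center t m0)) fq m0.
Qed.

End Solutions.

(** * Lifting and continuation of germs *)

Section Lifting.
Variables (R : realType) (V : normedModType R[i]) (S : Type).
Local Notation C := R[i].
(** [isg p n] says that n can serve as a germ at p, and [agr p] is equality of germs at p. The space
    of germs is not built: the openness hypotheses on the two relations stand for its topology. *)
Variables (U : set V) (agr : V -> S -> S -> Prop) (isg : V -> S -> Prop).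
Hypothesis agr_refl : forall p n, agr p n n.
Hypothesis agr_sym : forall p n n', agr p n n' -> agr p n' n.
Hypothesis agr_trans : forall p n1 n2 n3, agr p n1 n2 -> agr p n2 n3 -> agr p n1 n3.
Hypothesis agr_open : forall p n n', agr p n n' ->
  exists2 e : R, 0 < e & forall y, bal p e y -> agr y n n'.
Hypothesis isg_open : forall p n, isg p n ->
  exists2 e : R, 0 < e & forall y, bal p e y -> U y -> isg y n.
Hypothesis isg_identity : forall p n n', isg p n -> isg p n' ->
  exists2 e : R, 0 < e & forall p1 p2, bal p e p1 -> bal p e p2 ->
    agr p1 n n' -> agr p2 n n'.

Definition pcont (g : R -> V) := forall s, 0 <= s -> s <= 1 -> forall e : R, 0 < e ->
  exists2 d, 0 < d & forall s', 0 <= s' -> s' <= 1 -> `|s' - s| < d -> bal (g s) e (g s').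

Definition path_on (A : set V) (g : R -> V) :=
  pcont g /\ forall s, 0 <= s -> s <= 1 -> A (g s).

(** A lift is only determined up to [agr]; its continuity is expressed by a single germ n with which
    it agrees around s. *)
Definition lift_on (b : R) (g : R -> V) (sg : R -> S) := forall s, 0 <= s -> s <= b ->
  exists n e, [/\ 0 < e, isg (g s) n &
    forall s', 0 <= s' -> s' <= b -> `|s' - s| < e -> agr (g s') (sg s') n].

Definition lifts g sg := lift_on 1 g sg.

Lemma lift_extend g sg a b n : pcont g -> 0 <= a -> a <= b -> b <= 1 -> lift_on a g sg ->
  (forall s, a <= s -> s <= b -> isg (g s) n) -> agr (g a) (sg a) n ->
  lift_on b g (fun s => if s <= a then sg s else n).
Proof.
move=> gc a0 ab b1 hl hn ha s s0 sb; case: (ltrgtP s a) => [sa|sa|->].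
- have [m [e [e0 hm hag]]] := hl s s0 (ltW sa).
  exists m, (Num.min e (a - s)); split=> //; first by rewrite lt_min e0 subr_gt0.
  move=> s' s'0 s'b; rewrite lt_min => /andP[h1 h2].
  have s'a : s' <= a by move: h2 => /ltr_normlP[_]; lra.
  by rewrite s'a; exact: hag.
- exists n, (s - a); split; [by rewrite subr_gt0|by apply: hn => //; exact: ltW|].
  move=> s' s'0 s'b h; have s'a : a < s' by move: h => /ltr_normlP[]; lra.
  by rewrite leNgt s'a.
have [m [e [e0 hm hag]]] := hl a a0 (lexx a).
have amn : agr (g a) m n.
  by apply: agr_trans ha; apply: agr_sym; apply: hag => //; rewrite subrr normr0.
have [e1 e10 h1] := agr_open amn.
have [d d0 hd] := gc a a0 (le_trans ab b1) e1 e10.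
exists n, (Num.min e d); split; [by rewrite lt_min e0|exact: hn|].
move=> s' s'0 s'b; rewrite lt_min => /andP[h2 h3]; case: ifP => // s'a.
apply: agr_trans (hag s' s'0 s'a h2) (h1 _ _).
by apply: hd => //; exact: le_trans s'b b1.
Qed.

(** Beyond any reached time, openness is enough. To reach a time s, a germ given shortly before must
    extend up to s, with a margin e that depends neither on that germ nor on its time. *)
Lemma lift_exists g n0 : path_on U g -> isg (g 0) n0 ->
  (forall s, 0 < s -> s <= 1 -> exists2 e, 0 < e & forall s1 n, 0 < s1 -> s - e < s1 ->
     s1 < s -> isg (g s1) n -> exists2 n', agr (g s1) n n' &
       forall s', s1 <= s' -> s' <= s -> isg (g s') n') ->
  exists2 sg, lifts g sg & agr (g 0) (sg 0) n0.
Proof.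
move=> [gc gU] h0 hB.
pose P b := exists2 sg, lift_on b g sg & agr (g 0) (sg 0) n0.
suff : P 1 by [].
apply: (@real_induction _ P _ _ _ 1 ler01 (lexx 1)).
- exists (fun=> n0) => // s s0 s1; have -> : s = 0 by apply/eqP; rewrite eq_le s0 s1.
  by exists n0, 1; split.
- move=> s s0 s1 [sg hsg sg0]; have [n [e [e0 hn hag]]] := hsg s s0 (lexx s).
  have [e1 e10 he1] := isg_open hn; have [d d0 hd] := gc s s0 (ltW s1) e1 e10.
  exists d => // b sb bd b1; exists (fun s' => if s' <= s then sg s' else n); last by rewrite s0.
  apply: lift_extend => //; first exact: ltW.
    move=> s' h1 h2; have s'0 : 0 <= s' := le_trans s0 h1.
    have s'1 : s' <= 1 := le_trans h2 b1.
    apply: he1; last exact: gU.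
    by apply: hd => //; rewrite ger0_norm ?subr_ge0//; lra.
  by apply: hag => //; rewrite subrr normr0.
move=> s s0 s1 hP; have [e e0 he] := hB s s0 s1.
pose a := Num.max (s / 2) (s - e / 2).
have a0 : 0 < a by rewrite lt_max divr_gt0.
have as_ : a < s by rewrite gt_max; apply/andP; split; lra.
have ae : s - e < a by rewrite lt_max; apply/orP; right; lra.
have [sg hsg sg0] := hP a (ltW a0) as_.
have [n [e1 [e10 hn hag]]] := hsg a (ltW a0) (lexx a).
have [n' nn' hn'] := he a n a0 ae as_ hn.
exists (fun s' => if s' <= a then sg s' else n'); last by rewrite (ltW a0).
apply: lift_extend hn' _ => //; try exact: ltW.
apply: agr_trans nn'; apply: hag => //; [exact: ltW|by rewrite subrr normr0].
Qed.

Lemma lift_const g sg n a b : path_on U g -> lifts g sg -> 0 <= a -> a <= 1 -> 0 <= b -> b <= 1 ->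
  (forall s, 0 <= s -> s <= 1 -> isg (g (a + s * (b - a))) n) ->
  agr (g a) (sg a) n -> agr (g b) (sg b) n.
Proof.
move=> [gc gU] hl a0 a1 b0 b1 hn ha.
have pt01 s : 0 <= s -> s <= 1 -> 0 <= a + s * (b - a) /\ a + s * (b - a) <= 1.
  by move=> s0 s1; split; nra.
pose P s := agr (g (a + s * (b - a))) (sg (a + s * (b - a))) n.
have P1 : P 1; last by move: P1; rewrite /P mul1r addrC subrK.
apply: (@segment_induction _ P _ _ 1 ler01 (lexx 1)); first by rewrite /P mul0r addr0.
move=> s s0 s1; set u := a + s * (b - a); have [u0 u1] := pt01 s s0 s1.
have [m [e [e0 hm hag]]] := hl u u0 u1.
have [e1 e10 he1] := isg_identity hm (hn s s0 s1).
have [d d0 hd] := gc u u0 u1 e1 e10.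
have m0 : 0 < Num.min e d by rewrite lt_min e0.
have k0 : 0 < `|b - a| + 1 by rewrite ltr_wpDl.
exists (Num.min e d / (`|b - a| + 1)); first by rewrite divr_gt0.
move=> s1' s2' h1 h2 h3 h4 h5 h6; rewrite /P.
have close z : `|z - s| < Num.min e d / (`|b - a| + 1) ->
    `|a + z * (b - a) - u| < e /\ `|a + z * (b - a) - u| < d.
  move=> hz; have : `|a + z * (b - a) - u| < Num.min e d.
    have -> : a + z * (b - a) - u = (z - s) * (b - a) by rewrite /u; ring.
    rewrite normrM; move: hz; rewrite ltr_pdivlMr// => hz.
    apply: le_lt_trans hz; rewrite ler_wpM2l//; lra.
  by rewrite lt_min => /andP.
have [c1 c2] := close _ h5; have [c3 c4] := close _ h6.
have [x0 x1] := pt01 _ h1 h2; have [y0 y1] := pt01 _ h3 h4.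
move=> hP; apply: agr_trans (hag _ y0 y1 c3) _.
apply: (he1 _ _ (hd _ x0 x1 c2) (hd _ y0 y1 c4)).
by apply: agr_trans hP; apply: agr_sym; exact: hag.
Qed.

(** The family of paths is indexed by an arbitrary filter: neighborhoods of a real parameter give
    homotopies, neighborhoods of a point of [V] give the dependence on the end point, and a
    two-element type gives uniqueness. *)
Lemma lift_stable (I : Type) (F : set_system I) (FF : Filter F)
    (g : I -> R -> V) (sg : I -> R -> S) (i0 : I) :
  (forall s, 0 <= s -> s <= 1 -> forall e : R, 0 < e -> exists2 d, 0 < d &
     F [set i | forall s', 0 <= s' -> s' <= 1 -> `|s' - s| < d -> bal (g i0 s) e (g i s')]) ->
  lifts (g i0) (sg i0) -> F [set i | path_on U (g i) /\ lifts (g i) (sg i)] ->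
  F [set i | agr (g i 0) (sg i 0) (sg i0 0)] ->
  forall s, 0 <= s -> s <= 1 -> F [set i | agr (g i s) (sg i s) (sg i0 s)].
Proof.
move=> gc hl0 hl ha.
apply: (@segment_induction _ (fun s => F [set i | agr (g i s) (sg i s) (sg i0 s)]) ha).
move=> s s0 s1; have [n [e [e0 hn hag]]] := hl0 s s0 s1.
have [e1 e10 he1] := isg_open hn; have [d d0 hd] := gc s s0 s1 e1 e10.
exists (Num.min e d); first by rewrite lt_min e0.
move=> a b a0 a1 b0 b1; rewrite !lt_min => /andP[ae ad] /andP[be bd] Pa.
have near_n z : 0 <= z -> z <= 1 -> `|z - s| < e -> F [set i | agr (g i z) (sg i0 z) n].
  move=> z0 z1 ze; have [e2 e20 he2] := agr_open (hag z z0 z1 ze).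
  have [d2 d20] := gc z z0 z1 e2 e20; apply: filterS => i hi.
  by apply/he2/hi => //; rewrite subrr normr0.
have Fa := near_n a a0 a1 ae; have Fb := near_n b b0 b1 be.
refine (filterS _ (filterI (filterI hl hd) (filterI Pa (filterI Fa Fb)))).
move=> i [[[pi li] hi] [h1 [h2 h3]]] /=.
apply: agr_trans (agr_sym h3).
apply: (lift_const pi li a0 a1 b0 b1 _ (agr_trans h1 h2)) => z z0 z1.
have x0 : 0 <= a + z * (b - a) by nra.
have x1 : a + z * (b - a) <= 1 by nra.
apply: he1; last exact: pi.2.
apply: hi => //.
have -> : a + z * (b - a) - s = (1 - z) * (a - s) + z * (b - s) by ring.
rewrite (le_lt_trans (ler_normD _ _))// !normrM (ger0_norm z0) ger0_norm ?subr_ge0//.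
pose m := Num.max `|a - s| `|b - s|.
have md : m < d by rewrite gt_max ad bd.
have am : `|a - s| <= m by rewrite le_max lexx.
have bm : `|b - s| <= m by rewrite le_max lexx orbT.
by apply: le_lt_trans md; nra.
Qed.

Lemma lift_unique g sg sg' : path_on U g -> lifts g sg -> lifts g sg' ->
  agr (g 0) (sg 0) (sg' 0) -> forall s, 0 <= s -> s <= 1 -> agr (g s) (sg s) (sg' s).
Proof.
move=> [gc gU] h h' h0 s s0 s1.
(* Only the full set belongs to this filter, so stability along the constant family of paths
   compares the two lifts. *)
pose F : set_system bool := [set A | A false /\ A true].
have FF : Filter F by split=> [|A B [] ? ? [] ? ?|A B AB [] /AB ? /AB].
have : F [set b : bool | agr (g s) ((if b then sg' else sg) s) (sg' s)].
  apply: (@lift_stable bool F FF (fun=> g) (fun b => if b then sg' else sg) true) => //.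
    move=> u u0 u1 e e0; have [d d0 hd] := gc u u0 u1 e e0; exists d => //.
  by split; [exact: h0|exact: agr_refl].
by case.
Qed.

Definition path_cat (X : Type) (f f' : R -> X) s := if s <= 1/2 then f (2 * s) else f' (2 * s - 1).

Lemma path_cat_on A g g' : path_on A g -> path_on A g' -> g 1 = g' 0 ->
  path_on A (path_cat g g').
Proof.
move=> [gc gA] [gc' gA'] e; split; last first.
  by move=> s s0 s1; rewrite /path_cat; case: leP => h; [apply: gA|apply: gA']; lra.
move=> s s0 s1 e0 e00; rewrite /path_cat; case: (ltrgtP s (1/2)) => [h|h|h].
- have [d d0 hd] := gc (2 * s) ltac:(lra) ltac:(lra) e0 e00.
  exists (Num.min (d / 2) (1/2 - s)); first by rewrite lt_min divr_gt0// subr_gt0.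
  move=> s' s'0 s'1; rewrite lt_min => /andP[h1 /ltr_normlP[_ h2]].
  have h3 : s' <= 1/2 by lra.
  rewrite h3; apply: hd; try lra.
  by rewrite -mulrBr normrM ger0_norm//; lra.
- have [d d0 hd] := gc' (2 * s - 1) ltac:(lra) ltac:(lra) e0 e00.
  exists (Num.min (d / 2) (s - 1/2)); first by rewrite lt_min divr_gt0// subr_gt0.
  move=> s' s'0 s'1; rewrite lt_min => /andP[h1 /ltr_normlP[h2 _]].
  have h3 : (s' <= 1/2) = false by apply/negbTE; rewrite -ltNge; lra.
  rewrite h3; apply: hd; try lra.
  rewrite (_ : _ - _ = 2 * (s' - s)); last by ring.
  by rewrite normrM ger0_norm//; lra.
have [d d0 hd] := gc 1 ler01 (lexx 1) e0 e00.
have [d' d'0 hd'] := gc' 0 (lexx 0) ler01 e0 e00.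
exists (Num.min (d / 2) (d' / 2)); first by rewrite lt_min !divr_gt0.
move=> s' s'0 s'1; rewrite lt_min h => /andP[h1 h2].
rewrite (_ : 2 * (1/2) = 1); last by field.
case: leP => h3.
  apply: hd; try lra; rewrite (_ : _ - _ = 2 * (s' - 1/2)); last by field.
  by rewrite normrM ger0_norm//; lra.
rewrite e; apply: hd'; try lra; rewrite (_ : _ - _ = 2 * (s' - 1/2)); last by field.
by rewrite normrM ger0_norm//; lra.
Qed.

Lemma lift_cat g g' sg sg' : path_on U g -> path_on U g' -> g 1 = g' 0 -> lifts g sg ->
  lifts g' sg' -> agr (g 1) (sg 1) (sg' 0) -> lifts (path_cat g g') (path_cat sg sg').
Proof.
move=> [gc gA] [gc' gA'] e hl hl' ha s s0 s1; rewrite /path_cat.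
case: (ltrgtP s (1/2)) => [h|h|h].
- have [n [e0 [e00 hn hag]]] := hl (2 * s) ltac:(lra) ltac:(lra).
  exists n, (Num.min (e0 / 2) (1/2 - s)); split=> //; first by rewrite lt_min divr_gt0// subr_gt0.
  move=> s' s'0 s'1; rewrite lt_min => /andP[h1 /ltr_normlP[_ h2]].
  have h3 : s' <= 1/2 by lra.
  rewrite h3; apply: hag; try lra.
  by rewrite -mulrBr normrM ger0_norm//; lra.
- have [n [e0 [e00 hn hag]]] := hl' (2 * s - 1) ltac:(lra) ltac:(lra).
  exists n, (Num.min (e0 / 2) (s - 1/2)); split=> //; first by rewrite lt_min divr_gt0// subr_gt0.
  move=> s' s'0 s'1; rewrite lt_min => /andP[h1 /ltr_normlP[h2 _]].
  have h3 : (s' <= 1/2) = false by apply/negbTE; rewrite -ltNge; lra.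
  rewrite h3; apply: hag; try lra.
  rewrite (_ : _ - _ = 2 * (s' - s)); last by ring.
  by rewrite normrM ger0_norm//; lra.
have [n [e0 [e00 hn hag]]] := hl 1 ler01 (lexx 1).
have [n' [e1 [e10 hn' hag']]] := hl' 0 (lexx 0) ler01.
have nn' : agr (g' 0) n' n.
  rewrite -e; apply: agr_trans (hag 1 _ _ _) => //; last by rewrite subrr normr0.
  apply: agr_sym; apply: agr_trans ha _; rewrite e.
  by apply: hag' => //; rewrite subrr normr0.
have [e2 e20 he2] := agr_open nn'; have [d d0 hd] := gc' 0 (lexx 0) ler01 e2 e20.
exists n, (Num.min (e0 / 2) (Num.min (e1 / 2) (d / 2))).
split; first by rewrite !lt_min !divr_gt0.
  by rewrite h (_ : 2 * (1/2) = 1)//; field.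
move=> s' s'0 s'1; rewrite !lt_min h => /andP[h1 /andP[h2 h2']].
case: leP => h3.
  apply: hag; try lra; rewrite (_ : _ - _ = 2 * (s' - 1/2)); last by field.
  by rewrite normrM ger0_norm//; lra.
have E : 2 * s' - 1 - 0 = 2 * (s' - 1/2) by field.
apply: agr_trans (hag' _ _ _ _) (he2 _ (hd _ _ _ _)); try lra.
  by rewrite E normrM ger0_norm//; lra.
by rewrite E normrM ger0_norm//; lra.
Qed.

Definition path_rev (X : Type) (f : R -> X) s := f (1 - s).

Lemma path_rev_on A g : path_on A g -> path_on A (path_rev g).
Proof.
move=> [gc gA]; split; last by move=> s s0 s1; apply: gA; lra.
move=> s s0 s1 e e0; have [d d0 hd] := gc (1 - s) ltac:(lra) ltac:(lra) e e0.
exists d => // s' s'0 s'1 h; apply: hd; try lra.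
by rewrite (_ : 1 - s' - (1 - s) = - (s' - s)) ?normrN//; ring.
Qed.

Lemma lift_rev g sg : lifts g sg -> lifts (path_rev g) (path_rev sg).
Proof.
move=> hl s s0 s1; have [n [e [e0 hn hag]]] := hl (1 - s) ltac:(lra) ltac:(lra).
exists n, e; split=> // s' s'0 s'1 h; apply: hag; try lra.
by rewrite (_ : 1 - s' - (1 - s) = - (s' - s)) ?normrN//; ring.
Qed.

End Lifting.

(** * Monodromy and continuation along a family of paths *)

Section Continuation.
Variables (R : realType) (V : normedModType R[i]) (S : Type).
Local Notation C := R[i].
Variables (U : set V) (agr : V -> S -> S -> Prop) (isg : V -> S -> Prop).
Hypothesis agr_refl : forall p n, agr p n n.
Hypothesis agr_sym : forall p n n', agr p n n' -> agr p n' n.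
Hypothesis agr_trans : forall p n1 n2 n3, agr p n1 n2 -> agr p n2 n3 -> agr p n1 n3.
Hypothesis agr_open : forall p n n', agr p n n' ->
  exists2 e : R, 0 < e & forall y, bal p e y -> agr y n n'.
Hypothesis isg_open : forall p n, isg p n ->
  exists2 e : R, 0 < e & forall y, bal p e y -> U y -> isg y n.
Hypothesis isg_identity : forall p n n', isg p n -> isg p n' ->
  exists2 e : R, 0 < e & forall p1 p2, bal p e p1 -> bal p e p2 ->
    agr p1 n n' -> agr p2 n n'.

Local Notation lft := (lifts agr isg).
Local Notation lft_exists := (lift_exists agr_refl agr_sym agr_trans agr_open isg_open).
Local Notation lft_unique := (lift_unique agr_refl agr_sym agr_trans agr_open isg_open isg_identity).
Local Notation lft_cat := (lift_cat agr_sym agr_trans agr_open).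

Lemma pcont_of_within (g : R -> V) : {within @unit_itv R, continuous g} -> pcont g.
Proof.
move=> /subspace_continuousP gc s s0 s1 e e0.
have us : unit_itv s by rewrite /unit_itv/= s0 s1.
have hb : nbhs (g s) (bal (g s) e) by apply/nbhs_balP; exists e.
have := gc s us _ hb; rewrite /within/= => /nbhs_ballP[d d0 hd].
exists d => // s' s'0 s'1 h; apply: hd; last by rewrite /unit_itv/= s'0 s'1.
by rewrite /ball/= distrC.
Qed.

Lemma within_of_pcont (g : R -> V) : pcont g -> {within @unit_itv R, continuous g}.
Proof.
move=> gc; apply/subspace_continuousP => s /andP[s0 s1] A /nbhs_balP[e e0 hA].
have [d d0 hd] := gc s s0 s1 e e0.
apply/nbhs_ballP; exists d => // s'; rewrite /ball/= => h /andP[s'0 s'1].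
by apply/hA/hd => //; rewrite distrC.
Qed.

Lemma square_continuous (H : R * R -> V) :
  {within @unit_itv R `*` @unit_itv R, continuous H} ->
  forall r s, 0 <= r -> r <= 1 -> 0 <= s -> s <= 1 -> forall e : R, 0 < e ->
    exists2 d, 0 < d & forall r' s', 0 <= r' -> r' <= 1 -> 0 <= s' -> s' <= 1 ->
      `|r' - r| < d -> `|s' - s| < d -> bal (H (r, s)) e (H (r', s')).
Proof.
move=> /subspace_continuousP Hc r s r0 r1 s0 s1 e e0.
have us : (@unit_itv R `*` @unit_itv R) (r, s) by split; rewrite /unit_itv/= ?r0 ?r1 ?s0 ?s1.
have hb : nbhs (H (r, s)) (bal (H (r, s)) e) by apply/nbhs_balP; exists e.
have := Hc (r, s) us _ hb; rewrite /within/= => /nbhs_ballP[d d0 hd].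
exists d => // r' s' r'0 r'1 s'0 s'1 h h'; apply: hd.
  by split; rewrite /ball/= distrC.
by split; rewrite /unit_itv/= ?r'0 ?r'1 ?s'0 ?s'1.
Qed.

Section Monodromy.
Variables (B : set V) (c0 : V) (n0 : S).
Hypothesis BU : B `<=` U.
Hypothesis B_cover : forall c, B c -> exists2 e : R, 0 < e & forall c1 n,
  B c1 -> bal c e c1 -> isg c1 n -> exists2 n', agr c1 n n' &
    forall c2, B c2 -> bal c e c2 -> isg c2 n'.
Hypothesis B_star : forall c, B c -> exists2 e : R, 0 < e & forall c' u,
  B c' -> bal c e c' -> 0 <= u -> u <= 1 -> B (c + real_complex R u *: (c' - c)).
Hypothesis B_sc : simply_connected R B.
Hypothesis Bc0 : B c0.
Hypothesis c0n0 : isg c0 n0.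

Let BpU g : path_on B g -> path_on U g.
Proof. by move=> [gc gB]; split=> // s s0 s1; apply/BU/gB. Qed.

Lemma cover_lift g n : path_on B g -> isg (g 0) n ->
  exists2 sg, lft g sg & agr (g 0) (sg 0) n.
Proof.
move=> gB gn; apply: lft_exists (BpU gB) gn _ => s s0 s1; case: gB => gc gB.
have [e e0 he] := B_cover (gB s (ltW s0) s1).
have [d d0 hd] := gc s (ltW s0) s1 e e0; exists d => // s1' m s1'0 h1 h2 hm.
have near_s s' : s1' <= s' -> s' <= s -> B (g s') /\ bal (g s) e (g s').
  move=> h3 h4; have s'0 : 0 <= s' by rewrite (le_trans _ h3)// ltW.
  have s'1 : s' <= 1 := le_trans h4 s1.
  split; first exact: gB.
  by apply: hd => //; rewrite ler0_norm ?subr_le0//; lra.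
have [x1 x2] := near_s s1' (lexx _) (ltW h2).
have [n' nn' hn'] := he (g s1') m x1 x2 hm; exists n' => // s' h3 h4.
by have [y1 y2] := near_s s' h3 h4; exact: hn'.
Qed.

Lemma lift_point g sg s : lft g sg -> 0 <= s -> s <= 1 ->
  exists2 n, isg (g s) n & agr (g s) (sg s) n.
Proof.
move=> hl s0 s1; have [n [e [e0 hn hag]]] := hl s s0 s1; exists n => //.
by apply: hag => //; rewrite subrr normr0.
Qed.

(** The end germ of the lift of H(r, .) is locally constant in r, and for r = 1 the path is
    constant, with the germ n0 as a lift. *)
Lemma loop_lift_end g sg : path_on B g -> g 0 = c0 -> g 1 = c0 -> lft g sg ->
  agr c0 (sg 0) n0 -> agr c0 (sg 1) n0.
Proof.
move=> gB g0 g1 hl ha; case: (gB) => gc gBs.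
have gp : path_in B g.
  by split; [exact: within_of_pcont|move=> s /andP[s0 s1]; exact: gBs].
have [H [Hc HB H01 Hends]] := B_sc.2 g gp (etrans g0 (esym g1)).
have Hsq := square_continuous Hc.
have u0 : @unit_itv R 0 by rewrite /unit_itv/= lexx ler01.
have u1 : @unit_itv R 1 by rewrite /unit_itv/= lexx ler01.
pose h r s := H (r, s).
have hp r : 0 <= r -> r <= 1 -> path_on B (h r).
  move=> r0 r1; split; last by move=> s s0 s1; apply: HB; rewrite /unit_itv/= ?r0 ?r1 ?s0 ?s1.
  move=> s s0 s1 e e0; have [d d0 hd] := Hsq r s r0 r1 s0 s1 e e0.
  by exists d => // s' s'0 s'1 hs; apply: hd => //; rewrite subrr normr0.
have h0 r : 0 <= r -> r <= 1 -> h r 0 = c0.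
  by move=> r0 r1; have [e _] := Hends r ltac:(by rewrite /unit_itv/= r0 r1); exact: etrans e g0.
have h1 r : 0 <= r -> r <= 1 -> h r 1 = c0.
  by move=> r0 r1; have [_ e] := Hends r ltac:(by rewrite /unit_itv/= r0 r1); exact: etrans e g0.
have ex r : exists tau : R -> S, 0 <= r -> r <= 1 -> lft (h r) tau /\ agr c0 (tau 0) n0.
  have [/andP[r0 r1]|hr] := pselect (0 <= r <= 1); last first.
    by exists (fun=> n0) => r0 r1; case: hr; rewrite r0 r1.
  have [|tau t1 t2] := @cover_lift (h r) n0 (hp r r0 r1); first by rewrite h0.
  by exists tau => _ _; split=> //; rewrite -(h0 r r0 r1).
have [tau htau] := choice ex.
(* Stated in 1 - r because the induction starts at 0, while the constant loop of the homotopy is at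
   r = 1. *)
have tau_end : forall r, 0 <= r -> r <= 1 -> agr c0 (tau (1 - r) 1) n0.
  apply: (@segment_induction _ (fun r => agr c0 (tau (1 - r) 1) n0)).
    rewrite subr0; have [t1 t2] := htau 1 ler01 (lexx 1).
    have e1 s : 0 <= s -> s <= 1 -> h 1 s = c0.
      by move=> s0 s1; have [_ e] := H01 s ltac:(by rewrite /unit_itv/= s0 s1); exact: etrans e g0.
    have lc : lft (h 1) (fun=> n0).
      by move=> s s0 s1; exists n0, 1; rewrite e1//; split.
    have e0 : h 1 0 = c0 by exact: e1.
    have := lft_unique (BpU (hp 1 ler01 (lexx 1))) t1 lc _ ler01 (lexx 1).
    by rewrite e0 e1//; apply.
  move=> r r0 r1; pose F : set_system R := nbhs (1 - r).
  have q0 : 0 <= 1 - r by lra.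
  have q1 : 1 - r <= 1 by lra.
  (* Neighborhoods of [1 - r] in [R] leave the unit interval, outside which H is arbitrary:
     parameters are clamped to it. *)
  pose cl z : R := Num.max 0 (Num.min 1 z).
  have cl0 z : 0 <= cl z by rewrite le_max lexx.
  have cl1 z : cl z <= 1 by rewrite ge_max ler01 ge_min lexx.
  have clE z : 0 <= z -> z <= 1 -> cl z = z by move=> z0 z1; rewrite /cl min_r// max_r.
  have cl_dist z : `|cl z - (1 - r)| <= `|z - (1 - r)|.
    rewrite /cl; have [z1|z1] := leP 1 z.
      rewrite max_r ?ler01// !ger0_norm; lra.
    have [z0|z0] := leP 0 z; first by [].
    by rewrite !ler0_norm; lra.
  have FE : F [set z | agr (h (cl z) 1) (tau (cl z) 1) (tau (cl (1 - r)) 1)].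
    apply: (@lift_stable R V S U agr isg agr_sym agr_trans agr_open isg_open isg_identity R F _ (fun z => h (cl z)) (fun z => tau (cl z)) (1 - r)) => //.
    - move=> s s0 s1 e e0; rewrite /h clE//.
      have [d d0 hd] := Hsq (1 - r) s q0 q1 s0 s1 e e0; exists d => //.
      apply/nbhs_ballP; exists d => // z; rewrite /ball/= distrC => hz s' s'0 s'1 hs.
      by apply: hd => //; exact: le_lt_trans (cl_dist z) hz.
    - by have [] := htau _ (cl0 (1 - r)) (cl1 (1 - r)).
    - apply: filterE => z; have [t1 _] := htau _ (cl0 z) (cl1 z).
      by split=> //; apply: BpU; exact: hp.
    apply: filterE => z; rewrite /= h0//.
    have [_ t1] := htau _ (cl0 z) (cl1 z); have [_ t2] := htau _ (cl0 (1 - r)) (cl1 (1 - r)).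
    exact: agr_trans t1 (agr_sym t2).
  move: FE => /nbhs_ballP[d d0 hd]; exists d => // a b a0 a1 b0 b1 ad bd.
  have key z : 0 <= z -> z <= 1 -> `|z - r| < d -> agr c0 (tau (1 - z) 1) (tau (1 - r) 1).
    move=> z0 z1 hz; have w0 : 0 <= 1 - z by lra.
    have w1 : 1 - z <= 1 by lra.
    have bz : ball (1 - r) d (1 - z).
      by rewrite /ball/= (_ : 1 - r - (1 - z) = z - r)//; ring.
    by have := hd _ bz; rewrite /= (clE _ w0 w1) (clE _ q0 q1) (h1 _ w0 w1).
  move=> ha'; exact: agr_trans (key b b0 b1 bd) (agr_trans (agr_sym (key a a0 a1 ad)) ha').
have := tau_end 1 ler01 (lexx 1); rewrite subrr => te.
have [t1 t2] := htau 0 (lexx 0) ler01.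
have hE s : 0 <= s -> s <= 1 -> h 0 s = g s.
  by move=> s0 s1; have [e _] := H01 s ltac:(by rewrite /unit_itv/= s0 s1).
have lg : lft (h 0) sg.
  move=> s s0 s1; have [n [e [e0 hn hag]]] := hl s s0 s1; exists n, e; rewrite hE//.
  by split=> // s' s'0 s'1 hs; rewrite hE//; exact: hag.
have := lft_unique (BpU (hp 0 (lexx 0) ler01)) lg t1 _ ler01 (lexx 1).
rewrite !hE// g0 g1 => /(_ (agr_trans ha (agr_sym t2))) E.
exact: agr_trans E te.
Qed.

(** The first path followed by the reverse of the second one is a loop, to which [loop_lift_end]
    applies; reversing its second half again gives a lift of the second path starting at n0. *)
Lemma lift_end_unique g g' sg sg' : path_on B g -> path_on B g' -> g 0 = c0 -> g' 0 = c0 ->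
  g 1 = g' 1 -> lft g sg -> lft g' sg' -> agr c0 (sg 0) n0 -> agr c0 (sg' 0) n0 ->
  agr (g 1) (sg 1) (sg' 1).
Proof.
move=> gB gB' g0 g0' e1 hl hl' h0 h0'.
have rB := path_rev_on gB'; have r0 : path_rev g' 0 = g 1 by rewrite /path_rev subr0.
have r1 : path_rev g' 1 = c0 by rewrite /path_rev subrr.
have [n hn agn] := lift_point hl ler01 (lexx 1).
have [|sr hsr sr0] := @cover_lift (path_rev g') n rB; first by rewrite r0.
rewrite r0 in sr0.
have catB := path_cat_on gB rB (esym r0).
have half0 : (0 <= 1 / 2 :> R) by lra.
have half1 : (1 <= 1 / 2 :> R) = false by apply/negbTE; rewrite -ltNge; lra.
have catL := lft_cat (BpU gB) (BpU rB) (esym r0) hl hsr (agr_trans agn (agr_sym sr0)).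
have E0 (X : Type) (f f' : R -> X) : path_cat f f' 0 = f 0 by rewrite /path_cat half0 mulr0.
have E1 (X : Type) (f f' : R -> X) : path_cat f f' 1 = f' 1.
  by rewrite /path_cat half1; congr f'; ring.
have := loop_lift_end catB _ _ catL; rewrite !E0 !E1 g0 r1 => /(_ erefl erefl h0) end0.
have lr := lift_rev hsr.
have RR : path_rev (path_rev g') = g' by apply/funext => s; rewrite /path_rev subKr.
rewrite RR in lr.
have := lft_unique (BpU gB') lr hl' _ ler01 (lexx 1).
rewrite g0' /path_rev subr0 subrr -e1 => /(_ (agr_trans end0 (agr_sym h0'))) E.
exact: agr_trans agn (agr_trans (agr_sym sr0) E).
Qed.

Theorem monodromy : exists N : V -> S, agr c0 (N c0) n0 /\
  forall c, B c -> exists n, isg c n /\ exists2 e : R, 0 < e &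
    forall c', B c' -> bal c e c' -> agr c' (N c') n.
Proof.
have ex c : exists N : S, B c -> exists g sg, [/\ path_on B g, g 0 = c0, g 1 = c,
    lft g sg & agr c0 (sg 0) n0 /\ sg 1 = N].
  have [Bc|nBc] := pselect (B c); last by exists n0.
  have [g [[gc gB] g0 g1]] := B_sc.1 c0 c Bc0 Bc.
  have gp : path_on B g.
    split; first exact: pcont_of_within.
    by move=> s s0 s1; apply: gB; rewrite /unit_itv/= s0 s1.
  have [|sg hsg sg0] := @cover_lift g n0 gp; first by rewrite g0.
  by rewrite g0 in sg0; exists (sg 1) => _; exists g, sg.
have [N hN] := choice ex; exists N; split.
  have [g [sg [gp g0 g1 hl [h0 <-]]]] := hN c0 Bc0.
  exact: loop_lift_end gp g0 g1 hl h0.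
move=> c Bc; have [g [sg [gp g0 g1 hl [h0 e1]]]] := hN c Bc.
have [n hn agn] := lift_point hl ler01 (lexx 1); rewrite g1 in hn agn.
exists n; split=> //; have [e e0 he] := isg_open hn; have [e' e'0 he'] := B_star Bc.
exists (Num.min e e'); first by rewrite lt_min e0.
move=> c' Bc' cc'; have ce : bal c e c' by apply: bal_le cc'; rewrite ge_min lexx.
have ce' : bal c e' c' by apply: bal_le cc'; rewrite ge_min lexx orbT.
(* The path to c, prolonged by the segment to c', is compared with the path chosen for c': the germ
   at c thus serves for all c' near c. *)
pose l s := c + real_complex R s *: (c' - c).
have l0 : l 0 = c by rewrite /l scale0r addr0.
have l1 : l 1 = c' by rewrite /l scale1r addrC subrK.
have lB : path_on B l.
  split; last by move=> s s0 s1; exact: he'.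
  move=> s s0 s1 eps eps0; have k0 : 0 < nv (c' - c) + 1 by rewrite ltr_wpDl ?nv_ge0.
  exists (eps / (nv (c' - c) + 1)); first by rewrite divr_gt0.
  move=> s' _ _ hs; rewrite /bal/= /l.
  rewrite opprD addrACA subrr add0r -scalerBl -rmorphB nvZ nmR.
  move: hs; rewrite ltr_pdivlMr// => hs; apply: le_lt_trans hs.
  by rewrite ler_wpM2l//; lra.
have lnv s : 0 <= s -> s <= 1 -> bal c e (l s).
  move=> s0 s1; rewrite /bal/= /l addrC addKr nvZ nmR ger0_norm//.
  apply: le_lt_trans ce; rewrite -[leRHS]mul1r ler_wpM2r ?nv_ge0//.
have ll : lft l (fun=> n).
  move=> s s0 s1; exists n, 1; split=> //.
  by apply: he; [exact: lnv|apply/BU; exact: lB.2].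
have e1l : g 1 = l 0 by rewrite l0.
have half0 : (0 <= 1 / 2 :> R) by lra.
have half1 : (1 <= 1 / 2 :> R) = false by apply/negbTE; rewrite -ltNge; lra.
have E0 (X : Type) (f f' : R -> X) : path_cat f f' 0 = f 0 by rewrite /path_cat half0 mulr0.
have E1 (X : Type) (f f' : R -> X) : path_cat f f' 1 = f' 1.
  by rewrite /path_cat half1; congr f'; ring.
have agn' : agr (g 1) (sg 1) n by rewrite g1.
have catL := lft_cat (BpU gp) (BpU lB) e1l hl ll agn'.
have [g' [sg' [gp' g0' g1' hl' [h0' e1']]]] := hN c' Bc'.
have := lift_end_unique gp' (path_cat_on gp lB e1l) g0' _ _ hl' catL h0'.
by rewrite !E0 !E1 g1' l1 e1'; apply.
Qed.

End Monodromy.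

(** Each t has its own path from [B], so nothing is to be chosen; the continuity of the family in t
    makes the end germs fit together. Extension is asked at positive times only, since at time 0 the
    germ given by [N] spreads by openness. *)
Theorem continuation (B : set V) (N : V -> S) (g : V -> R -> V) :
  (forall c, B c -> exists n, isg c n /\ exists2 e : R, 0 < e &
    forall c', B c' -> bal c e c' -> agr c' (N c') n) ->
  (forall t, U t -> [/\ path_on U (g t), B (g t 0) & g t 1 = t]) ->
  (forall t s, U t -> 0 <= s -> s <= 1 -> forall e : R, 0 < e -> exists2 d, 0 < d &
     forall t' s', bal t d t' -> 0 <= s' -> s' <= 1 -> `|s' - s| < d ->
       bal (g t s) e (g t' s')) ->
  (forall t, U t -> forall s, 0 < s -> s <= 1 -> exists2 e, 0 < e & forall s1 n,
     0 < s1 -> s - e < s1 -> s1 < s -> isg (g t s1) n -> exists2 n', agr (g t s1) n n' &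
       forall s', s1 <= s' -> s' <= s -> isg (g t s') n') ->
  open U ->
  exists M : V -> S,
    (forall t, U t -> exists n, isg t n /\ exists2 e : R, 0 < e &
       forall t', U t' -> bal t e t' -> agr t' (M t') n) /\
    (forall t, U t -> (forall s, 0 <= s -> s <= 1 -> g t s = t) -> agr t (M t) (N t)).
Proof.
move=> hN hg gc gB oU.
have ex t : exists sg, U t -> lft (g t) sg /\ agr (g t 0) (sg 0) (N (g t 0)).
  have [Ut|nUt] := pselect (U t); last by exists (fun=> N t).
  have [gp Bg0 _] := hg t Ut; have [n [hn [e e0 he]]] := hN _ Bg0.
  have [sg h1 h2] := lft_exists gp hn (gB t Ut); exists sg => _; split=> //.
  by apply: agr_trans h2 (agr_sym (he _ Bg0 _)); exact: bal_center.
have [sg hsg] := choice ex; exists (fun t => sg t 1); split; last first.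
  move=> t Ut gt; have [hl h0] := hsg t Ut; have [gp Bg0 _] := hg t Ut.
  have [n [hn [e e0 he]]] := hN _ Bg0.
  have lc : lft (g t) (fun=> N t).
    rewrite gt// in hn Bg0 he *.
    have aN : agr t (N t) n by apply: he => //; exact: bal_center.
    by move=> s s0 s1; exists n, 1; rewrite gt//; split=> // s' s'0 s'1 _; rewrite gt.
  have := lft_unique gp hl lc _ ler01 (lexx 1); rewrite !gt//; apply.
  by rewrite gt// in h0.
move=> t Ut; have [hl h0] := hsg t Ut; have [gp Bg0 g1] := hg t Ut.
have [n hn agn] := lift_point hl ler01 (lexx 1); rewrite g1 in hn agn.
exists n; split=> //.
have nU : nbhs t U by apply: open_nbhs_nbhs.
have F1 : nbhs t [set t' | agr (g t' 1) (sg t' 1) (sg t 1)].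
  apply: (@lift_stable R V S U agr isg agr_sym agr_trans agr_open isg_open isg_identity V (nbhs t) _ g sg t) => //.
  - move=> s s0 s1 e e0; have [d d0 hd] := gc t s Ut s0 s1 e e0; exists d => //.
    apply/nbhs_balP; exists d => // t' tt' s' s'0 s'1 hs; exact: hd.
  - apply: filterS nU => t' Ut'; have [hl' _] := hsg t' Ut'; have [gp' _ _] := hg t' Ut'.
    by split.
  have [m [hm [e e0 he]]] := hN _ Bg0; have am : agr (g t 0) (N (g t 0)) m.
    by apply: he => //; exact: bal_center.
  have [e' e'0 he'] := agr_open (agr_trans h0 am).
  have m0 : 0 < Num.min e e' by rewrite lt_min e0.
  have [d d0 hd] := gc t 0 Ut (lexx 0) ler01 _ m0.
  have nd : nbhs t (bal t d) by apply/nbhs_balP; exists d.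
  refine (filterS _ (filterI nU nd)) => t' [Ut' tt'] /=.
  have [hl' h0'] := hsg t' Ut'; have [_ Bg0' _] := hg t' Ut'.
  have b0 : bal (g t 0) (Num.min e e') (g t' 0).
    by apply: hd => //; rewrite subrr normr0.
  have b1 : bal (g t 0) e (g t' 0) by apply: bal_le b0; rewrite ge_min lexx.
  have b2 : bal (g t 0) e' (g t' 0) by apply: bal_le b0; rewrite ge_min lexx orbT.
  exact: agr_trans h0' (agr_trans (he _ Bg0' b1) (agr_sym (he' _ b2))).
have [e e0 he] := agr_open agn.
have [d d0 hd] : exists2 d : R, 0 < d & bal t d `<=` [set t' | agr (g t' 1) (sg t' 1) (sg t 1)].
  by apply/nbhs_balP.
exists (Num.min e d); first by rewrite lt_min e0.
move=> t' Ut' tt'; have [_ _ g1'] := hg t' Ut'.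
have b1 : bal t e t' by apply: bal_le tt'; rewrite ge_min lexx.
have b2 : bal t d t' by apply: bal_le tt'; rewrite ge_min lexx orbT.
have := hd t' b2; rewrite /= g1' => h; exact: agr_trans h (he t' b1).
Qed.

End Continuation.

(** * Continuation along the strata *)

Section Strata.
Variables (R : realType) (n : nat).
Local Notation C := R[i].
Local Notation T := 'rV[C]_n.
Local Notation rc := (real_complex R).
Implicit Types (p q t x y : T).

(** Linear description of the closure of the stratum of p; see [closure_stratum] and
    [coarser_closure]. *)
Definition coarser p x := forall i j, p 0 i = p 0 j -> x 0 i = x 0 j.

Lemma stratum_trans p x y : stratum p x -> stratum x y -> stratum p y.
Proof. by move=> h h' i j; rewrite h h'. Qed.

Lemma stratum_sym p x : stratum p x -> stratum x p.
Proof. by move=> h i j; rewrite h. Qed.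

Lemma separation p : exists2 r : R, 0 < r & forall i j, p 0 i != p 0 j ->
  2 * r <= nm (p 0 i - p 0 j).
Proof.
pose r := \big[Num.min/1]_(ij : 'I_n * 'I_n | p 0 ij.1 != p 0 ij.2) (nm (p 0 ij.1 - p 0 ij.2)).
exists (r / 2).
  rewrite divr_gt0//; apply: (big_ind (fun z => 0 < z)) => //.
    by move=> a b a0 b0; rewrite lt_min a0.
  by move=> ij h; rewrite nm_gt0 subr_eq0.
move=> i j ij; have -> : 2 * (r / 2) = r by field.
by apply/bigmin_leP; right; exists (i, j).
Qed.

Lemma separated_near p (r : R) x i j : (forall i j, p 0 i != p 0 j -> 2 * r <= nm (p 0 i - p 0 j)) ->
  bal p r x -> p 0 i != p 0 j -> x 0 i != x 0 j.
Proof.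
move=> sep px pij; apply/eqP => xij; have := sep i j pij; rewrite leNgt => /negP; apply.
have -> : p 0 i - p 0 j = (x - p) 0 j - (x - p) 0 i by rewrite !mxE xij; ring.
have h k := le_lt_trans (nm_le_nv (x - p) k) px.
by apply: le_lt_trans (nmB _ _) _; have := h i; have := h j; lra.
Qed.

Lemma coarser_stratum p (r : R) x : (forall i j, p 0 i != p 0 j -> 2 * r <= nm (p 0 i - p 0 j)) ->
  bal p r x -> coarser p x -> stratum p x.
Proof.
move=> sep px c i j; split; first exact: c.
move=> xij; apply: contrapT => /eqP pij.
by have := separated_near sep px pij; rewrite xij eqxx.
Qed.

Lemma coarser_line p a b (l : C) : coarser p a -> coarser p b -> coarser p (a + l *: (b - a)).
Proof. by move=> ha hb i j e; rewrite !mxE (ha i j e) (hb i j e). Qed.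

Lemma coarser_refl p : coarser p p. Proof. by []. Qed.

(** The points x + s (p - x) with s > 0 small belong to the stratum of p: equalities that x has in
    addition to those of p are broken, and the inequalities of x persist. *)
Lemma closure_stratum p x : coarser p x -> closure (stratum p) x.
Proof.
move=> px A /nbhs_balP[e e0 hA]; have [r r0 sep] := separation x.
have k0 : 0 < nv (p - x) + 1 by rewrite ltr_wpDl ?nv_ge0.
pose m := Num.min r e; have m0 : 0 < m by rewrite lt_min r0.
pose s := m / (nv (p - x) + 1); have s0 : 0 < s by rewrite divr_gt0.
pose y := x + rc s *: (p - x).
have xy : bal x m y.
  rewrite /bal/= /y addrC addKr nvZ nmR gtr0_norm//.
  have <- : s * (nv (p - x) + 1) = m by rewrite /s mulfVK// gt_eqF.
  by rewrite mulrDr mulr1 ltrDl.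
exists y; split; last by apply: hA; apply: bal_le xy; rewrite ge_min lexx orbT.
move=> i j; split; first exact: (coarser_line (rc s) px (@coarser_refl p)).
have [xij|xij] := eqVneq (x 0 i) (x 0 j); last first.
  have xr : bal x r y by apply: bal_le xy; rewrite ge_min lexx.
  by have := separated_near sep xr xij => /eqP.
rewrite !mxE xij => /addrI.
have sn : rc s != 0 by rewrite -nm_gt0 nmR gtr0_norm.
by move=> /(mulfI sn)/addIr.
Qed.

Lemma coarser_closure p x : closure (stratum p) x -> coarser p x.
Proof.
move=> cx i j pij; apply/subr0_eq/nm_eq0/eqP; rewrite eq_le nm_ge0 andbT.
apply: (@le0_small _ _ 2 1) => // s s0 _.
have nb : nbhs x (bal x s) by apply/nbhs_balP; exists s.
have [y [py xy]] := cx _ nb; have yij : y 0 i = y 0 j by apply/(py i j).1.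
have -> : x 0 i - x 0 j = (y - x) 0 j - (y - x) 0 i by rewrite !mxE yij; ring.
have h k := le_lt_trans (nm_le_nv (y - x) k) xy.
by apply: le_trans (nmB _ _) _; have := h i; have := h j; lra.
Qed.

Variable d : T.
Local Notation sec := (sec R n).

(** The line through x0 and p satisfies all the equalities of p, hence lies in the stratum of p near
    p; the determinant, nonzero at x0, is nonzero at points of this line arbitrarily near p. *)
Lemma stratum_dense (S : sec) x s x0 p e : chart d S x s -> bal x s x0 -> bal x s p ->
  S.1 x0 -> coarser p x0 -> 0 < e -> exists y, [/\ bal p e y, stratum p y & S.1 y].
Proof.
move=> [s0 _ [f [uf _ hf _]] _] xx0 xp Sx0 px0 e0.
have [r r0 sep] := separation p.
have k0 : 0 < nv (p - x0) + 1 by rewrite ltr_wpDl ?nv_ge0.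
pose m := Num.min (Num.min e r) (s - nv (p - x)).
have m0 : 0 < m by rewrite !lt_min e0 r0 subr_gt0.
have mk : 0 < m / (nv (p - x0) + 1) by rewrite divr_gt0.
have [l hl fl] := line_dense uf xx0 xp ((hf x0 xx0).1 Sx0) mk.
set y := x0 + l *: (p - x0) in fl; exists y.
have py : bal p m y.
  rewrite /bal/=; have -> : y - p = (l - 1) *: (p - x0).
    by rewrite /y; apply/rowP => i; rewrite !mxE; ring.
  rewrite nvZ; move: hl; rewrite ltr_pdivlMr// => hl; apply: le_lt_trans hl.
  by rewrite ler_wpM2l ?nm_ge0// lerDl.
have pe : bal p e y by apply: bal_le py; rewrite !ge_min lexx.
have pr : bal p r y by apply: bal_le py; rewrite !ge_min lexx !orbT.
have xy : bal x s y.
  by apply: bal_subset py; rewrite -lerBrDl ge_min lexx orbT.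
split=> //; last exact: (hf y xy).2.
by apply: coarser_stratum sep pr _; exact: coarser_line.
Qed.

(** The regular set must meet the stratum of p inside the ball: otherwise the singular locus could
    contain the stratum locally, and there would be no regular point in it from which to
    continue. *)
Definition germ p (S : sec) := exists s, chart d S p s /\
  exists x, [/\ bal p s x, stratum p x & S.1 x].

Lemma bal_sub_center p (s : R) y : bal p s y -> bal y (s - nv (y - p)) `<=` bal p s.
Proof. by move=> _; apply: bal_subset; rewrite addrC subrK. Qed.

Lemma germ_open p S : germ p S ->
  exists2 e : R, 0 < e & forall y, bal p e y -> germ y S.
Proof.
move=> [s [c [x0 [px0 sx0 Sx0]]]]; have s0 : 0 < s by case: c.
have [r r0 sep] := separation p; exists (Num.min s r); first by rewrite lt_min s0.
move=> y py; have ps : bal p s y by apply: bal_le py; rewrite ge_min lexx.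
have pr : bal p r y by apply: bal_le py; rewrite ge_min lexx orbT.
have s1 : 0 < s - nv (y - p) by rewrite subr_gt0.
exists (s - nv (y - p)); split; first exact: chart_sub s1 (bal_sub_center ps) c.
apply: stratum_dense c px0 ps Sx0 _ s1 => i j yij; apply/(sx0 i j).1.
by apply: contrapT => /eqP pij; have := separated_near sep pr pij; rewrite yij eqxx.
Qed.

Lemma germ_identity p S S' : germ p S -> germ p S' ->
  exists2 e : R, 0 < e & forall p1 p2, bal p e p1 -> bal p e p2 ->
    agree p1 S S' -> agree p2 S S'.
Proof.
move=> [s [c _]] [s' [c' _]]; have s0 : 0 < s by case: c.
have s'0 : 0 < s' by case: c'.
have m0 : 0 < Num.min s s' by rewrite lt_min s0.
have b1 : bal p (Num.min s s') `<=` bal p s by apply: bal_le; rewrite ge_min lexx.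
have b2 : bal p (Num.min s s') `<=` bal p s' by apply: bal_le; rewrite ge_min lexx orbT.
exists (Num.min s s'); [exact: m0|move=> p1 p2 h1 h2 ag].
have E := chart_agree (chart_sub m0 b1 c) (chart_sub m0 b2 c') h1 ag.
exists (Num.min s s' - nv (p2 - p)); first by rewrite subr_gt0.
by move=> y /(bal_sub_center h2); exact: E.
Qed.

Lemma germ_cover c : nonresonant c d -> exists2 e : R, 0 < e & forall c1 S,
  stratum c c1 -> bal c e c1 -> germ c1 S -> exists2 S', agree c1 S S' &
    forall c2, stratum c c2 -> bal c e c2 -> germ c2 S'.
Proof.
move=> nr; have [r r0 sep] := separation c.
pose e := r / 1024; have e0 : 0 < e by rewrite divr_gt0.
have eE : r / 2 / 128 = 4 * e by rewrite /e; field.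
exists e => // c1 S sc1 cc1 [s [ch [x0 [c1x0 sx0 Sx0]]]].
have s0 : 0 < s by case: ch.
pose m := Num.min s e; have m0 : 0 < m by rewrite lt_min s0.
have me : m <= e by rewrite ge_min lexx orbT.
have ms : m <= s by rewrite ge_min lexx.
have coa : coarser c1 x0 by move=> i j; rewrite sx0.
have [q [c1q sq Sq]] := stratum_dense ch c1x0 (bal_center c1 s0) Sx0 coa m0.
have cq : nv (q - c) < 2 * e.
  apply: le_lt_trans (nv_tri q c1 c) _; move: c1q cc1; rewrite /bal/= => h1 h2.
  by move: h1 h2 me; clear; lra.
have scq := stratum_trans sc1 sq.
have r20 : 0 < r / 2 by rewrite divr_gt0.
have sepq i j : q 0 i != q 0 j -> 2 * (r / 2) <= nm (q 0 i - q 0 j).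
  move=> qij; have cij : c 0 i != c 0 j.
    by apply/eqP => cij; case/eqP: qij; apply/(scq i j).1.
  have := sep i j cij; have := nm_tri (c 0 i) (q 0 i) (c 0 j).
  have := nm_tri (q 0 i) (q 0 j) (c 0 j).
  have k1 := le_lt_trans (nm_le_nv (q - c) i) cq; have k2 := le_lt_trans (nm_le_nv (q - c) j) cq.
  rewrite !mxE in k1 k2; rewrite (nmC (c 0 i) (q 0 i)); move: k1 k2 r0; rewrite /e; clear; lra.
have nrq : nonresonant q d by move=> i j /(scq i j).2; exact: nr.
have c1qs : bal c1 s q := bal_le ms c1q.
have solq : fsol q d (S.2 ^~ q) by case: ch => _ /(_ q (conj c1qs Sq)) [_ []].
have [S' [ch' S'q eqq]] := local_chart r20 sepq nrq solq; rewrite eE in ch'.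
have sub1 : bal c1 m `<=` bal q (4 * e).
  apply: bal_subset; rewrite nvC; move: c1q me e0; rewrite /bal/=; clear; lra.
have C1 := chart_sub m0 (bal_le ms) ch; have C2 := chart_sub m0 sub1 ch'.
exists S'.
  have agq : agree q S S' by apply: chart_point_agree C1 C2 c1q Sq S'q _ => k; rewrite eqq.
  by exists m => // y c1y; exact: chart_agree C1 C2 c1q agq y c1y.
move=> c2 sc2 cc2.
have c2q : nv (c2 - q) < 3 * e.
  apply: le_lt_trans (nv_tri c2 c q) _; rewrite (nvC c); move: cc2 cq; rewrite /bal/=; clear; lra.
have sub2 : bal c2 e `<=` bal q (4 * e).
  by apply: bal_subset; move: c2q; clear; lra.
exists e; split; first exact: chart_sub e0 sub2 ch'.
have e40 : 0 < 4 * e by rewrite mulr_gt0.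
have qc2 : bal q (4 * e) c2 by rewrite /bal/=; move: c2q e0; clear; lra.
have coq : coarser c2 q by move=> i j /(sc2 i j).2 /(scq i j).1.
exact: stratum_dense ch' (bal_center q e40) qc2 S'q coq e0.
Qed.

End Strata.

Lemma segment_sub (F : comPzRingType) m (a b t t' : 'rV[F]_m) (s s' : F) :
  a + s' *: (t' - a) - (b + s *: (t - b)) =
  ((1 - s') *: (a - b) + s' *: (t' - t)) + (s' - s) *: (t - b).
Proof. by apply/rowP => i; rewrite !mxE; ring. Qed.

Lemma interpolation_le (R : realDomainType) (a b s : R) : 0 <= s -> s <= 1 -> a <= b ->
  (1 - s) * a + s * b <= b.
Proof. nra. Qed.

(** * The solution on U *)

Section Global.
Variables (R : realType) (n : nat).
Local Notation C := R[i].
Local Notation T := 'rV[C]_n.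
Local Notation rc := (real_complex R).
Variables (d to : T) (rep : 'I_n -> 'I_n) (U : set T) (G : nat -> 'M[C]_n).
Hypothesis rep_choice : block_choice to rep.
Hypothesis U_open : open U.
Hypothesis U_to : U to.
Hypothesis U_sc : simply_connected R (U `&` stratum to).
Hypothesis U_star : star_shaped rep U.
Hypothesis U_strata : forall s : T, closure (stratum s) `&` stratum to = set0 ->
  U `&` closure (stratum s) = set0.
Hypothesis to_nonres : nonresonant to d.
Hypothesis G_sol : fsol to d G.

Local Notation germ := (germ d).
Local Notation pr := (proj_o rep).

Lemma U_coarser t : U t -> coarser t to.
Proof.
move=> Ut; have : closure (stratum t) `&` stratum to !=set0.
  apply/set0P/eqP => e; have := U_strata e; rewrite -subset0 => /(_ t); apply.
  split=> //; exact: subset_closure.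
by move=> [x [/coarser_closure cx sx]] i j tij; apply/(sx i j).2; exact: cx.
Qed.

Lemma U_nonres t : U t -> nonresonant t d.
Proof. by move=> Ut i j /(U_coarser Ut); exact: to_nonres. Qed.

Lemma repK i : rep (rep i) = rep i.
Proof. by case: rep_choice => h1 h2; apply: h2. Qed.

Lemma proj_coarser t t' : U t -> coarser t (pr t').
Proof.
by move=> Ut i j /(U_coarser Ut) e; rewrite !mxE; case: rep_choice => _ /(_ i j e) ->.
Qed.

Let g (t : T) (s : R) : T := pr t + rc s *: (t - pr t).

Lemma g_proj t s : pr (g t s) = pr t.
Proof.
by apply/rowP => i; rewrite !mxE repK subrr mulr0 addr0.
Qed.

Lemma g_tau t s : tau rep (g t s) = rc s *: tau rep t.
Proof. by apply/rowP => i; rewrite !mxE repK; ring. Qed.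

(** The segment stays over p_o(t) and in the closure of the stratum of t, and its tau-coordinates
    are those of t multiplied by s <= 1, so that (b) applies. *)
Lemma g_U t s : U t -> 0 <= s -> s <= 1 -> U (g t s).
Proof.
move=> Ut s0 s1; apply: (U_star Ut _ (g_proj t s)).
  apply: closure_stratum; apply: coarser_line; last exact: coarser_refl.
  exact: proj_coarser.
rewrite g_tau /euclidean_norm ler_sqrtC ?qualifE/=; try by apply: sumr_ge0 => i _; rewrite exprn_ge0.
apply: ler_sum => i _; rewrite mxE normrM exprMn ler_piMl ?exprn_ge0//.
by rewrite expr_le1// nmE nmR ger0_norm// -(rmorph1 rc) lecR.
Qed.

Lemma proj_stratum t : U t -> stratum to (pr t).
Proof.
move=> Ut i j; rewrite !mxE; case: rep_choice => h1 h2; split; first by move=> /h2 ->.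
by move=> /(U_coarser Ut); rewrite !h1.
Qed.

Lemma g0 t : g t 0 = pr t. Proof. by rewrite /g scale0r addr0. Qed.
Lemma g1 t : g t 1 = t. Proof. by rewrite /g scale1r addrC subrK. Qed.

Lemma g_stratum t s : U t -> 0 < s -> s <= 1 -> stratum t (g t s).
Proof.
move=> Ut s0 s1 i j; split.
  by apply: coarser_line; [exact: proj_coarser|exact: coarser_refl].
move=> e; have gU := g_U Ut (ltW s0) s1; have := U_coarser gU e.
case: rep_choice => _ h2 /h2 rij; move: e; rewrite !mxE rij => /addrI.
have sn : rc s != 0 by rewrite -nm_gt0 nmR gtr0_norm.
by move=> /(mulfI sn)/addIr.
Qed.

Lemma nv_proj (t t' : T) : nv (pr t' - pr t : T) <= nv (t' - t).
Proof.
apply: nv_le; first exact: nv_ge0.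
by move=> i; rewrite !mxE; have := nm_le_nv (t' - t) (rep i); rewrite !mxE.
Qed.

Lemma g_continuous (t : T) s : 0 <= s -> s <= 1 -> forall e : R, 0 < e -> exists2 del, 0 < del &
  forall t' s', bal t del t' -> 0 <= s' -> s' <= 1 -> `|s' - s| < del ->
    bal (g t s) e (g t' s').
Proof.
move=> s0 s1 e e0; have k0 : 0 < nv (t - pr t) + 1 by rewrite ltr_wpDl ?nv_ge0.
pose m := Num.min (e / 2) (e / 2 / (nv (t - pr t) + 1)).
have m0 : 0 < m by rewrite lt_min !divr_gt0.
exists m => // t' s' tt' s'0 s'1 hs; rewrite /bal/=.
have -> : g t' s' - g t s =
    (rc (1 - s') *: (pr t' - pr t) + rc s' *: (t' - t)) + rc (s' - s) *: (t - pr t).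
  have e1 : rc (1 - s') = 1 - rc s' by rewrite rmorphB rmorph1.
  have e2 : rc (s' - s) = rc s' - rc s by rewrite rmorphB.
  by rewrite e1 e2; exact: segment_sub.
apply: le_lt_trans (nvD _ _) _.
have h1 : nv (rc (1 - s') *: (pr t' - pr t) + rc s' *: (t' - t)) <= nv (t' - t).
  apply: le_trans (nvD _ _) _; rewrite !nvZ !nmR !ger0_norm ?subr_ge0//.
  exact: interpolation_le (nv_proj t t').
have h2 : nv (rc (s' - s) *: (t - pr t)) < e / 2.
  rewrite nvZ nmR; have : `|s' - s| < e / 2 / (nv (t - pr t) + 1).
    by apply: lt_le_trans hs _; rewrite ge_min lexx orbT.
  rewrite ltr_pdivlMr// => h; apply: le_lt_trans h.
  by rewrite ler_wpM2l// lerDl.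
have h3 : nv (t' - t) < e / 2 by apply: lt_le_trans tt' _; rewrite ge_min lexx.
rewrite [ltRHS](splitr e); apply: ler_ltD => //; exact: le_trans h1 (ltW h3).
Qed.

Lemma g_path t : U t -> path_on U (g t).
Proof.
move=> Ut; split; last by move=> s s0 s1; exact: g_U.
move=> s s0 s1 e e0; have [del del0 h] := g_continuous t s0 s1 e0.
by exists del => // s' s'0 s'1 hs; apply: h => //; exact: bal_center.
Qed.

Let germ_openU p S : germ p S ->
  exists2 e : R, 0 < e & forall y, bal p e y -> U y -> germ y S.
Proof. by move=> /germ_open[e e0 h]; exists e => // y py _; exact: h. Qed.

Let B := U `&` stratum to.

Lemma B_cover c : B c -> exists2 e : R, 0 < e & forall c1 S,
  B c1 -> bal c e c1 -> germ c1 S -> exists2 S', agree c1 S S' &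
    forall c2, B c2 -> bal c e c2 -> germ c2 S'.
Proof.
move=> [Uc sc]; have [e e0 he] := germ_cover (U_nonres Uc); exists e => // c1 S [_ sc1] h1 h2.
have toc c' : stratum to c' -> stratum c c' := stratum_trans (stratum_sym sc).
have [S' h3 h4] := he c1 S (toc _ sc1) h1 h2; exists S' => // c2 [_ sc2].
exact: h4 (toc _ sc2).
Qed.

Lemma B_star c : B c -> exists2 e : R, 0 < e & forall c' u,
  B c' -> bal c e c' -> 0 <= u -> u <= 1 -> B (c + rc u *: (c' - c)).
Proof.
move=> [Uc sc]; have [r r0 sep] := separation c.
have [e e0 he] := (openP U).1 U_open c Uc.
exists (Num.min e r); first by rewrite lt_min e0.
move=> c' u [_ sc'] cc' u0 u1.
have m0 : 0 < Num.min e r by rewrite lt_min e0.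
have cb := bal_convex (bal_center c m0) cc' u0 u1.
split; first by apply: he; apply: bal_le cb; rewrite ge_min lexx.
have cr : bal c r (c + rc u *: (c' - c)) by apply: bal_le cb; rewrite ge_min lexx orbT.
have coc : coarser c c' by move=> i j /(sc i j).2/(sc' i j).1.
exact: stratum_trans sc (coarser_stratum sep cr (coarser_line (rc u) (@coarser_refl R n c) coc)).
Qed.

Let BU : B `<=` U. Proof. by move=> c []. Qed.

Theorem global_solution : exists (Reg : set T) (N : nat -> T -> 'M[C]_n),
  [/\ hsol d (U `&` Reg) N, Reg to /\ (forall k, N k to = G k) &
    forall t, U t -> exists (s : R) (f : T -> C), [/\ 0 < s, bal t s `<=` U,
      unif (bal t s) f, exists2 y, bal t s y & f y != 0 &
      forall y, bal t s y -> Reg y <-> f y != 0]].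
Proof.
have Bto : B to by split.
have [r r0 sep] := separation to.
have [S0 [ch0 S0to S0G]] := local_chart r0 sep to_nonres G_sol.
have g0to : germ to S0.
  exists (r / 128); split=> //; exists to; split=> //.
  by apply: bal_center; case: ch0.
have [N [Nto hN]] := monodromy (@agree_refl R n) (@agree_sym R n) (@agree_trans R n)
  (@agree_open R n) germ_openU (@germ_identity R n d) BU B_cover B_star U_sc Bto g0to.
have gP t : U t -> [/\ path_on U (g t), B (g t 0) & g t 1 = t].
  move=> Ut; split; [exact: g_path| |exact: g1].
  by split; [exact: g_U|rewrite g0; exact: proj_stratum].
(* At positive times the path stays in the stratum of t, so the margin of [germ_cover] at [g t s]
   applies to it. *)
have gE t : U t -> forall s, 0 < s -> s <= 1 -> exists2 e, 0 < e & forall s1 S,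
    0 < s1 -> s - e < s1 -> s1 < s -> germ (g t s1) S ->
    exists2 S', agree (g t s1) S S' & forall s', s1 <= s' -> s' <= s -> germ (g t s') S'.
  move=> Ut s s0 s1; have gs := g_U Ut (ltW s0) s1.
  have [e e0 he] := germ_cover (U_nonres gs).
  have [del del0 hdel] := (g_path Ut).1 s (ltW s0) s1 e e0.
  exists del => // a S a0 h1 h2 hS.
  have near_s s' : a <= s' -> s' <= s -> stratum (g t s) (g t s') /\ bal (g t s) e (g t s').
    move=> h3 h4; have s'0 : 0 < s' := lt_le_trans a0 h3; have s'1 := le_trans h4 s1.
    split.
      exact: stratum_trans (stratum_sym (g_stratum Ut s0 s1)) (g_stratum Ut s'0 s'1).
    apply: hdel => //; first exact: ltW.
    by rewrite ler0_norm ?subr_le0// opprB ltrBlDr -ltrBlDl (lt_le_trans h1).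
  have [x1 x2] := near_s a (lexx a) (ltW h2).
  have [S' h3 h4] := he _ S x1 x2 hS; exists S' => // s' h5 h6.
  by have [y1 y2] := near_s s' h5 h6; exact: h4.
have [M [hM Mto]] := @continuation R T (sec R n) U (@agree R n) germ (@agree_refl R n)
  (@agree_sym R n) (@agree_trans R n) (@agree_open R n) germ_openU (@germ_identity R n d)
  B N g hN gP (fun t s _ s0 s1 => g_continuous t s0 s1) gE U_open.
exists [set t | (M t).1 t], (fun k t => (M t).2 k t).
have loc t : U t -> exists S s, [/\ chart d S t s, bal t s `<=` U &
    forall y, bal t s y -> ((M y).1 y <-> S.1 y) /\ ((M y).1 y -> forall k, (M y).2 k y = S.2 k y)].
  move=> Ut; have [S [[s [ch _]] [e e0 he]]] := hM t Ut.
  have [e' e'0 he'] := (openP U).1 U_open t Ut; have s0 : 0 < s by case: ch.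
  pose m := Num.min s (Num.min e e'); have m0 : 0 < m by rewrite !lt_min s0 e0.
  have ms : bal t m `<=` bal t s by apply: bal_le; rewrite ge_min lexx.
  have mU : bal t m `<=` U.
    by apply: subset_trans he'; apply: bal_le; rewrite !ge_min lexx !orbT.
  exists S, m; split=> //; first exact: chart_sub m0 ms ch.
  move=> y ty; have tey : bal t e y by apply: bal_le ty; rewrite !ge_min lexx orbT.
  have [e1 e10 h1] := he y (mU y ty) tey; exact: h1 (bal_center y e10).
(* The path leading to [to] is constant: the continuation there is the germ of the initial chart,
   built from [G]. *)
have to_E : (M to).1 to /\ forall k, (M to).2 k to = G k.
  have gto s : 0 <= s -> s <= 1 -> g to s = to.
    move=> _ _; rewrite /g (_ : pr to = to) ?subrr ?scaler0 ?addr0//.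
    by apply/rowP => i; rewrite mxE; case: rep_choice => ->.
  have [e e0 he] := agree_trans (Mto to U_to gto) Nto.
  have [h1 h2] := he to (bal_center to e0); have M1 := h1.2 S0to.
  by split=> // k; rewrite h2.
split=> //; last first.
  move=> t Ut; have [S [s [ch tU hS]]] := loc t Ut; case: (ch) => s0 _ [f [uf nz hf _]] _.
  exists s, f; split=> // y ty; rewrite -(hf y ty); exact: (hS y ty).1.
move=> t [Ut Mt]; have [S [s [ch tU hS]]] := loc t Ut; have s0 : 0 < s by case: ch.
have tt := bal_center t s0; have St : S.1 t by apply/(hS t tt).1.
have [s' s'0 hs'] := chart_nbhs ch tt St.
have E y : bal t s' y -> forall k, (M y).2 k y = S.2 k y.
  move=> /hs'[ty Sy] k; have [h1 h2] := hS y ty; apply: h2; exact/h1.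
case: ch => _ /(_ t (conj tt St))[[s1 s10 u1] [solt eqt]] _ _.
pose m := Num.min s' s1; have m0 : 0 < m by rewrite lt_min s'0.
have ms' : bal t m `<=` bal t s' by apply: bal_le; rewrite ge_min lexx.
have uS k : munif (bal t m) (S.2 k).
  by apply: munif_subset (u1 k); apply: bal_le; rewrite ge_min lexx orbT.
have Em k y : bal t m y -> S.2 k y = (M y).2 k y by move=> /ms' ty; rewrite E.
have uM k : munif (bal t m) (fun t => (M t).2 k t) := munif_eq (Em k) (uS k).
have tm := bal_center t m0.
split; first by exists m.
split; first by rewrite (_ : (fun k => _) = (S.2 ^~ t))//; apply/funext => k; rewrite -Em.
move=> h k; rewrite -(md_congr h (uS k) (uM k) (Em k) tm) eqt.
by rewrite !Em.
Qed.

End Global.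

(** * The integrable connection *)

Section MatrixDifferential.
Variables (R : realType) (V : normedModType R[i]).
Local Notation C := R[i].

(** The proof of linearity is an argument so that an entry of L can carry the linear structure that
    [diff_crit] expects. *)
Definition entry_form p q (L : V -> 'M[C]_(p, q)) (_ : linear L) i j (h : V) : C := L h i j.

Lemma entry_form_linear p q (L : V -> 'M[C]_(p, q)) (lL : linear L) i j :
  linear (entry_form lL i j).
Proof. by move=> a u v; rewrite /entry_form lL !mxE. Qed.

HB.instance Definition _ p q (L : V -> 'M[C]_(p, q)) (lL : linear L) i j :=
  GRing.isLinear.Build C V C *:%R (entry_form lL i j) (entry_form_linear lL i j).

(** The differential is an explicit function, so that the one of a long expression is obtained by
    composing the rules below and only then simplified. The bound r <= 1 allows higher powers of
    [nv h] to be absorbed by the square in products. *)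
Definition has_diff p q (F : V -> 'M[C]_(p, q)) (x : V) (L : V -> 'M[C]_(p, q)) :=
  linear L /\ exists K r : R, [/\ 0 <= K, 0 < r <= 1, forall h, nmm (L h) <= K * nv h &
    forall h, nv h < r -> nmm (F (x + h) - F x - L h) <= K * nv h ^+ 2].

Lemma has_diffP p q (F : V -> 'M[C]_(p, q)) x L : has_diff F x L ->
  differentiable F x /\ forall h, 'd F x h = L h.
Proof.
move=> [lL [K [r [K0 /andP[r0 _] h1 h2]]]].
have E i j : differentiable (fun t => F t i j : C) x /\
    'd (fun t => F t i j : C) x = entry_form lL i j :> (V -> C).
  apply: (@diff_crit _ _ (fun t => F t i j : C) x (entry_form lL i j) K r) => //.
    by move=> h; apply: le_trans (h1 h); exact: nm_le_nmm.
  move=> h hr; apply: le_trans (h2 h hr); apply: le_trans (nm_le_nmm _ i j).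
  by rewrite !mxE.
have [dF dE] := mx_differentiable (fun i j => (E i j).1); split=> // h.
by rewrite dE; apply/matrixP => i j; rewrite mxE (E i j).2.
Qed.

Lemma has_diff_eq p q (F F' : V -> 'M[C]_(p, q)) x L L' (r : R) : 0 < r ->
  (forall y, bal x r y -> F y = F' y) -> (forall h, L h = L' h) ->
  has_diff F x L -> has_diff F' x L'.
Proof.
move=> r0 e eL [lL [K [r' [K0 /andP[r'0 r'1] h1 h2]]]].
have -> : L' = L by apply/funext => h; rewrite eL.
split=> //; exists K, (Num.min r r'); split=> //.
  by rewrite lt_min r0 r'0 ge_min r'1 orbT.
move=> h; rewrite lt_min => /andP[hr hr']; rewrite -!e; first exact: h2.
  exact: bal_center.
by rewrite /bal/= addrC addKr.
Qed.

Lemma has_diff_cst p q (A : 'M[C]_(p, q)) x : has_diff (fun=> A) x (fun=> 0).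
Proof.
split; first by move=> a u v; rewrite scaler0 addr0.
exists 0, 1; split=> //; first by rewrite ltr01 lexx.
  by move=> h; rewrite nmm0 mul0r.
by move=> h _; rewrite subrr subr0 nmm0 mul0r.
Qed.

Lemma has_diffD p q (F F' : V -> 'M[C]_(p, q)) x L L' : has_diff F x L -> has_diff F' x L' ->
  has_diff (fun y => F y + F' y) x (fun h => L h + L' h).
Proof.
move=> [lL [K [r [K0 /andP[r0 r1] h1 h2]]]] [lL' [K' [r' [K'0 /andP[r'0 r'1] h1' h2']]]].
split; first by move=> a u v; rewrite lL lL' scalerDr addrACA.
exists (K + K'), (Num.min r r'); split; first exact: addr_ge0.
- by rewrite lt_min r0 r'0 ge_min r1.
- by move=> h; apply: le_trans (nmmD _ _) _; rewrite mulrDl lerD.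
move=> h; rewrite lt_min => /andP[hr hr'].
rewrite (_ : _ - _ - _ = (F (x + h) - F x - L h) + (F' (x + h) - F' x - L' h)).
  by apply: le_trans (nmmD _ _) _; rewrite mulrDl lerD ?h2 ?h2'.
move: (F (x + h)) (F x) (L h) (F' (x + h)) (F' x) (L' h) => a b c a' b' c'.
by rewrite !opprD [RHS]addrACA; congr (_ + _); rewrite addrACA.
Qed.

Lemma has_diffN p q (F : V -> 'M[C]_(p, q)) x L : has_diff F x L ->
  has_diff (fun y => - F y) x (fun h => - L h).
Proof.
move=> [lL [K [r [K0 r01 h1 h2]]]].
split; first by move=> a u v; rewrite lL scalerN opprD.
exists K, r; split=> // h; first by rewrite nmmN.
by move=> hr; rewrite -!opprD nmmN; exact: h2.
Qed.

Lemma has_diff_linear p q (L : V -> 'M[C]_(p, q)) x K : 0 <= K -> linear L ->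
  (forall h, nmm (L h) <= K * nv h) -> has_diff L x L.
Proof.
move=> K0 lL h1; split=> //; exists K, 1; split=> //; first by rewrite ltr01 lexx.
move=> h _; have -> : L (x + h) = L x + L h.
  by have := lL 1 x h; rewrite !scale1r.
by rewrite [L x + L h]addrC addrK subrr nmm0 mulr_ge0// sqr_ge0.
Qed.

Lemma has_diff_mul p q s (F : V -> 'M[C]_(p, q)) (F' : V -> 'M[C]_(q, s)) x L L' :
  has_diff F x L -> has_diff F' x L' ->
  has_diff (fun y => F y *m F' y) x (fun h => F x *m L' h + L h *m F' x).
Proof.
move=> [lL [K [r [K0 /andP[r0 r1] h1 h2]]]] [lL' [K' [r' [K'0 /andP[r'0 r'1] h1' h2']]]].
split.
  move=> a u v; rewrite lL lL' mulmxDr mulmxDl -scalemxAr -scalemxAl scalerDr.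
  by rewrite addrACA.
pose M := nmm (F x) * K' + K * nmm (F' x) + (K * (nmm (F' x) + 2 * K') + K * (2 * K')).
have P1 := nmm_ge0 (F x); have P2 := nmm_ge0 (F' x).
have M0 : 0 <= K * (nmm (F' x) + 2 * K') + K * (2 * K').
  by rewrite !(addr_ge0, mulr_ge0).
exists M, (Num.min r r'); split.
- by rewrite !(addr_ge0, mulr_ge0).
- by rewrite lt_min r0 r'0 ge_min r1.
- move=> h; apply: le_trans (nmmD _ _) _.
  apply: le_trans (lerD (nmm_mul _ _) (nmm_mul _ _)) _.
  apply: (@le_trans _ _ ((nmm (F x) * K' + K * nmm (F' x)) * nv h)).
    rewrite mulrDl lerD//; first by rewrite -mulrA ler_wpM2l.
    by rewrite mulrAC ler_wpM2r.
  by rewrite ler_wpM2r ?nv_ge0// lerDl.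
move=> h; rewrite lt_min => /andP[hr hr'].
set D := F (x + h) - F x - L h; set D' := F' (x + h) - F' x - L' h.
have N0 := nv_ge0 h; have N1 : nv h <= 1 by rewrite ltW// (lt_le_trans hr).
have bD := h2 h hr; have bD' := h2' h hr'.
have b1 : nmm (F' (x + h) - F' x) <= 2 * K' * nv h.
  rewrite -[F' (x + h) - F' x](subrK (L' h)) -/D' (le_trans (nmmD _ _))//.
  have := h1' h; have : K' * nv h ^+ 2 <= K' * nv h by rewrite ler_wpM2l// expr2 ler_piMl.
  by move: bD'; rewrite -/D'; lra.
have b2 : nmm (F' (x + h)) <= nmm (F' x) + 2 * K'.
  rewrite -[F' (x + h)](subrK (F' x)) addrC (le_trans (nmmD _ _))// lerD2l.
  by apply: le_trans b1 _; rewrite ler_piMr// mulr_ge0.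
have -> : F (x + h) *m F' (x + h) - F x *m F' x - (F x *m L' h + L h *m F' x) =
    D *m F' (x + h) + F x *m D' + L h *m (F' (x + h) - F' x).
  rewrite /D /D' !mulmxBl !mulmxBr.
  move: (F (x + h) *m F' (x + h)) (F x *m F' (x + h)) (L h *m F' (x + h)) (F x *m F' x)
    (F x *m L' h) (L h *m F' x) => a b c e f g.
  by apply/matrixP => i j; rewrite !mxE; ring.
apply: le_trans (nmmD _ _) _; apply: le_trans (lerD (nmmD _ _) (lexx _)) _.
apply: le_trans (lerD (lerD (nmm_mul _ _) (nmm_mul _ _)) (nmm_mul _ _)) _.
have c1 := ler_pM (nmm_ge0 _) (nmm_ge0 _) bD b2.
have c2 := ler_wpM2l P1 bD'.
have c3 := ler_pM (nmm_ge0 _) (nmm_ge0 _) (h1 h) b1.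
apply: le_trans (lerD (lerD c1 c2) c3) _.
apply: (@le_trans _ _ ((K * (nmm (F' x) + 2 * K') + nmm (F x) * K' + K * (2 * K')) * nv h ^+ 2)).
  by rewrite le_eqVlt; apply/orP; left; apply/eqP; ring.
rewrite ler_wpM2r ?sqr_ge0// /M.
have : 0 <= K * nmm (F' x) by rewrite mulr_ge0.
by move: (K * nmm (F' x)) (nmm (F x) * K') (K * (nmm (F' x) + _)) (K * (2 * K')) => a b c e; lra.
Qed.

End MatrixDifferential.

(** * Flatness as an identity between words in matrices *)

Section CurvatureAlgebra.
Variables (F : comPzRingType) (n : nat).
Local Notation M := 'M[F]_n.
Implicit Types (A B X Y : M).

Lemma entryN A i j : (- A) i j = - A i j. Proof. by rewrite mxE. Qed.
Lemma entry0 i j : (0 : M) i j = 0. Proof. by rewrite mxE. Qed.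
Lemma entryZ (c : F) A i j : (c *: A) i j = c * A i j. Proof. by rewrite mxE. Qed.
Lemma entryD A B i j : (A + B) i j = A i j + B i j. Proof. by rewrite mxE. Qed.

(* A copy of the product without structure to infer, so that syntactically
   equal words are recognized as equal. *)
Definition word A B : M := A *m B.

Lemma wordE A B : A *m B = word A B. Proof. by []. Qed.
Lemma wordDl A B X : word (A + B) X = word A X + word B X. Proof. exact: mulmxDl. Qed.
Lemma wordDr A B X : word X (A + B) = word X A + word X B. Proof. exact: mulmxDr. Qed.
Lemma wordNl A X : word (- A) X = - word A X. Proof. exact: mulNmx. Qed.
Lemma wordNr A X : word X (- A) = - word X A. Proof. exact: mulmxN. Qed.
Lemma wordZl c A X : word (c *: A) X = c *: word A X. Proof. by rewrite /word scalemxAl. Qed.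
Lemma wordZr c A X : word X (c *: A) = c *: word X A. Proof. by rewrite /word scalemxAr. Qed.
Lemma wordA A B X : word (word A B) X = word A (word B X).
Proof. by rewrite /word mulmxA. Qed.

Definition word_lin := (wordDl, wordDr, wordNl, wordNr, wordZl, wordZr, wordA).

Lemma word_comm A B X : word A B = word B A -> word A (word B X) = word B (word A X).
Proof. by move=> e; rewrite -!wordA e. Qed.

End CurvatureAlgebra.

(** Once products are expanded and reordered by the commutation rules, the words are treated as
    independent unknowns and the identity is linear in them; [ring] checks it on each entry. *)
Ltac words_ring :=
  repeat match goal with |- context [@word ?R ?k ?A ?B] => generalize (@word R k A B); intro end;
  apply/matrixP => ? ?; rewrite ?(entryD, entryN, entryZ, entry0); ring.

Section Identities.
Variables (F : comPzRingType) (n : nat).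
Local Notation M := 'M[F]_n.
Variables (D L Hu Hv N N2 : M).
Hypothesis uL : word Hu L = word L Hu.
Hypothesis uD : word D Hu = word Hu D.
Hypothesis uv : word Hu Hv = word Hv Hu.

Let V := D + (word N L - word L N).
Let gu := word N Hu - word Hu N.
Let gv := word N Hv - word Hv N.

(** Jacobi's identity: Hu commutes with D and L, so [V, Hu] = [[N, L], Hu] = [[N, Hu], L]. *)
Lemma jacobi_residue : word V Hu = word Hu V + (word gu L - word L gu).
Proof.
rewrite /V /gu; rewrite ?word_lin; rewrite ?uL -?uD ?(word_comm _ uL).
words_ring.
Qed.

Lemma jacobi_gauge : word Hu gv = word gv Hu - word gu Hv + word Hv gu.
Proof.
rewrite /gu /gv; rewrite ?word_lin; rewrite ?uv ?(word_comm _ uv); words_ring.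
Qed.

Let X := word gu N + (word Hu N2 - word N2 Hu).
Let Y := word gv N + (word Hv N2 - word N2 Hv).

(** X and Y are the derivatives of N_1 along the two vectors, as given by the equation for d N_1.
    This is the vanishing of the part of the curvature which does not involve z. *)
Lemma zero_curvature : word X Hv - word Hv X = (word Y Hu - word Hu Y) + (word gu gv - word gv gu).
Proof.
rewrite /X /Y /gu /gv; rewrite ?word_lin.
rewrite ?uv ?(word_comm _ uv); words_ring.
Qed.

Hypothesis euler : word L N2 + word V N + N = word N2 L + word N D.

(** The left-hand side is the derivative of V along Hu: V evolves by commutators, as in an
    isomonodromic deformation. The relation [euler], which is the equation of index 1, is used to
    eliminate N_2. *)
Lemma residue_derivative : (word X L - word L X) + gu = word gu V - word V gu.
Proof.
have e : word N2 L = word L N2 + word V N + N - word N D by rewrite euler addrK.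
have eA Z : word N2 (word L Z) = word L (word N2 Z) + word V (word N Z) + word N Z - word N (word D Z).
  by rewrite -wordA e ?word_lin.
move: e eA; rewrite /X /V /gu; clear euler => e eA; rewrite ?word_lin.
rewrite ?uL ?e ?eA; rewrite ?word_lin.
rewrite ?e ?eA; rewrite ?word_lin; rewrite ?uL -?uD ?(word_comm _ uL) -?(word_comm _ uD); words_ring.
Qed.

End Identities.

Section Curvature.
Variables (F : comPzRingType) (n : nat).
Local Notation M := 'M[F]_n.
Variables (a b z : F) (L V Hu Hv gu gv X Y : M).
Hypothesis uL : word Hu L = word L Hu.
Hypothesis vL : word Hv L = word L Hv.
Hypothesis uv : word Hu Hv = word Hv Hu.
Hypothesis Vu : word V Hu = word Hu V + (word gu L - word L gu).
Hypothesis Vv : word V Hv = word Hv V + (word gv L - word L gv).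
Hypothesis ugv : word Hu gv = word gv Hu - word gu Hv + word Hv gu.
Hypothesis XY : word X Hv - word Hv X = (word Y Hu - word Hu Y) + (word gu gv - word gv gu).
Hypothesis Xu : (word X L - word L X) + gu = word gu V - word V gu.
Hypothesis Yv : (word Y L - word L Y) + gv = word gv V - word V gv.

(* [cform a Hu gu] is the value of the connection form on the vector whose
   components along t and z are Hu and a, with z standing for 1/z; [dform] is
   the derivative of [cform b Hv gv] along that vector. *)
Definition cform (z : F) (L V : M) (a : F) (H g : M) : M :=
  - (z *: H) + (a * (z * z)) *: L + (a * z) *: V - g.

Definition dform (z a : F) (L V Hu gu X : M) (b : F) (Hv : M) : M :=
  (a * (z * z)) *: Hv + (b * (z * z)) *: Hu - (2 * a * b * (z * z * z)) *: L
  + (b * z) *: ((word X L - word L X) + gu) - (a * b * (z * z)) *: V - (word X Hv - word Hv X).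

Lemma flat : dform z a L V Hu gu X b Hv - dform z b L V Hv gv Y a Hu
  + (word (cform z L V a Hu gu) (cform z L V b Hv gv) - word (cform z L V b Hv gv) (cform z L V a Hu gu)) = 0.
Proof.
rewrite /dform Xu Yv XY /cform; rewrite ?word_lin.
rewrite ?scalerA.
rewrite ?uL ?vL ?uv ?Vu ?Vv ?ugv; words_ring.
Qed.

End Curvature.

Section ProductDifferentials.
Variables (R : realType) (n : nat).
Local Notation C := R[i].
Local Notation T := 'rV[C]_n.
Local Notation P := (T * C)%type.
Implicit Types p h : P.

Lemma nv_fst p : nv p.1 <= nv p.
Proof. by rewrite -lecR -!nvE prod_normE/= comparable_le_max ?real_comparable ?normr_real// lexx. Qed.

Lemma nm_snd p : nm p.2 <= nv p.
Proof. by rewrite -lecR -nmE -nvE prod_normE/= comparable_le_max ?real_comparable ?normr_real// lexx orbT. Qed.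

Lemma mx_lincombE m k a (A B : 'M[C]_(m, k)) i j : (a *: A + B) i j = a * A i j + B i j.
Proof. by rewrite !mxE. Qed.

Lemma md_linear m k (F : T -> 'M[C]_(m, k)) x : linear (md F x).
Proof.
move=> a u v; apply/matrixP => i j; apply: etrans (mdE F x _ i j) _.
apply: etrans _ (esym (mx_lincombE a _ _ i j)).
apply: etrans _ (congr2 (fun b c => a * b + c) (esym (mdE F x u i j)) (esym (mdE F x v i j))).
exact: linearP.
Qed.

Lemma has_diff_fst m k (F : T -> 'M[C]_(m, k)) p s : 0 < s -> munif (bal p.1 s) F ->
  has_diff (fun q : P => F q.1) p (fun h => md F p.1 h.1).
Proof.
move=> s0 uF; have [S S0 hS] := munif_bounded uF; split.
  by move=> a u v; exact: md_linear.
exists ((m * k)%:R * (2 * S / s + 8 * S / s ^+ 2)), (Num.min 1 (s / 4)); split.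
- by rewrite !(mulr_ge0, addr_ge0) ?invr_ge0 ?exprn_ge0// ltW.
- by rewrite lt_min ltr01 divr_gt0// ge_min lexx.
- move=> h; have := md_le h.1 s0 (_ : nv (p.1 - p.1) + s <= s) uF hS.
  rewrite subrr nv0 add0r => /(_ (lexx s)) /le_trans; apply.
  rewrite -[leRHS]mulrA ler_wpM2l ?ler0n// [leRHS]mulrDl ler_wpDr//.
    by rewrite !mulr_ge0 ?nv_ge0 ?invr_ge0 ?exprn_ge0// ltW.
  by rewrite mulrAC ler_wpM2l ?nv_fst// !mulr_ge0// invr_ge0 ltW.
move=> h; rewrite lt_min => /andP[_ /ltW hs].
have hs' : nv h.1 <= s / 4 := le_trans (nv_fst h) hs.
apply: (@le_trans _ _ ((m * k)%:R * (8 * S / s ^+ 2 * nv h ^+ 2))); last first.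
  rewrite -[leRHS]mulrA ler_wpM2l ?ler0n// ler_wpM2r ?sqr_ge0// ler_wpDl//.
  by rewrite !mulr_ge0 ?invr_ge0// ltW.
rewrite /nmm (@le_trans _ _ (\sum_(i < m) \sum_(j < k) (8 * S / s ^+ 2 * nv h ^+ 2)))//.
  apply: ler_sum => i _; apply: ler_sum => j _.
  have hSij y : bal p.1 s y -> nm (F y i j) <= S.
    by move=> hy; exact: le_trans (nm_le_nmm _ _ _) (hS y hy).
  have [_ _ H] := unif_diff_taylor s0 (uF i j) hSij.
  apply: le_trans (_ : _ <= 8 * S / s ^+ 2 * nv h.1 ^+ 2) _.
    apply: le_trans (H h.1 hs').
    rewrite le_eqVlt; apply/orP; left; apply/eqP; congr nm.
    apply: etrans (mx_subE _ _ i j) _.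
    apply: (congr2 (fun a b : C => a - b)); last exact: (mdE F p.1 h.1 i j).
    exact: (mx_subE (F (p.1 + h.1)) (F p.1) i j).
  rewrite ler_wpM2l ?ler_sqr ?nnegrE ?nv_ge0 ?nv_fst//.
  by rewrite !mulr_ge0 ?invr_ge0 ?exprn_ge0// ltW.
by rewrite !sumr_const !card_ord -mulrnA -[leLHS]mulr_natl (mulnC k m).
Qed.

Lemma has_diff_inv p : p.2 != 0 ->
  has_diff (fun q : P => (q.2^-1)%:M : 'M[C]_n) p (fun h => (- (h.2 * (p.2^-1 * p.2^-1)))%:M).
Proof.
move=> z0; have m0 : 0 < nm p.2 by rewrite nm_gt0.
set z := p.2 in z0 m0 *; set e := nmm (1%:M : 'M[C]_n).
have nmS (a : C) : nmm (a%:M : 'M[C]_n) = nm a * e.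
  by rewrite -[a%:M]scalemx1 nmmZ.
have e0 : 0 <= e := nmm_ge0 _.
split.
  move=> a u v; rewrite -[in RHS]scalemx1 -[in LHS]scalemx1 -[X in _ = _ + X]scalemx1 scalerA -scalerDl.
  by congr (_ *: _); rewrite /= mulrDl -scalerAl opprD mulrN.
exists (((nm z)^-1 ^+ 2 + 2 * (nm z)^-1 ^+ 3) * e), (Num.min 1 (nm z / 2)).
have i0 : 0 <= (nm z)^-1 by rewrite invr_ge0 ltW.
split.
- by rewrite !(mulr_ge0, addr_ge0) ?exprn_ge0.
- by rewrite lt_min ltr01 divr_gt0// ge_min lexx.
- move=> h; rewrite nmS nmN !nmM nmV [leRHS]mulrAC ler_wpM2r//.
  rewrite [leLHS]mulrC ler_pM ?nm_ge0 ?mulr_ge0// ?nm_snd//.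
  by rewrite expr2 lerDl mulr_ge0// exprn_ge0.
move=> h; rewrite lt_min => /andP[_ hs].
set w := h.2; have hw : nm w <= nv h := nm_snd h.
have w2 : nm w < nm z / 2 := le_lt_trans hw hs.
have zw : nm z / 2 <= nm (z + w).
  have := nm_ge_sub z (- w); rewrite opprK nmN.
  by move: w2; move: (nm z) (nm w) (nm (z + w)); clear; move=> a b c; lra.
have zw0 : z + w != 0.
  by rewrite -nm_gt0 (lt_le_trans _ zw)// divr_gt0.
rewrite (_ : _ - _ - _ = (w ^+ 2 * (z^-1 ^+ 2 * (z + w)^-1))%:M); last first.
  rewrite -!(raddfB (@scalar_mx C n)); congr scalar_mx => /=.
  by rewrite -/z -/w; field; rewrite z0 zw0.
rewrite nmS [leRHS]mulrAC ler_wpM2r// nmM nmX [leLHS]mulrC.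
rewrite ler_pM ?nm_ge0 ?exprn_ge0 ?nm_ge0//; last first.
  by rewrite ler_sqr ?nnegrE ?nm_ge0 ?nv_ge0.
rewrite nmM nmX !nmV ler_wpDl ?exprn_ge0// [_ ^+ 3]exprSr mulrCA ler_wpM2l ?exprn_ge0//.
rewrite -[2]invrK -invfM lef_pV2 ?posrE ?mulr_gt0 ?invr_gt0//.
  by rewrite mulrC.
by rewrite nm_gt0.
Qed.

Lemma has_diff_diag p : has_diff (fun q : P => diag_mx q.1) p (fun h => diag_mx h.1).
Proof.
apply: (@has_diff_linear _ _ _ _ (fun q : P => diag_mx q.1) p (n * n)%:R); first exact: ler0n.
  by move=> a u v; rewrite /= linearP.
move=> h; apply: le_trans (_ : _ <= \sum_(i < n) \sum_(j < n) nv h) _.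
  apply: ler_sum => i _; apply: ler_sum => j _; rewrite mxE.
  case: eqP => [_|_]; first by rewrite mulr1n (le_trans (nm_le_nv _ _))// nv_fst.
  by rewrite mulr0n nm0 nv_ge0.
by rewrite !sumr_const !card_ord -mulrnA -[leLHS]mulr_natl.
Qed.

Lemma dLambda p h : d_of (fun q : P => diag_mx q.1) p h = diag_mx h.1.
Proof. exact: (has_diffP (has_diff_diag p)).2. Qed.

Lemma dLambda_over_z p h : p.2 != 0 ->
  d_of (fun q : P => q.2^-1 *: diag_mx q.1) p h =
  p.2^-1 *: diag_mx h.1 - (h.2 * (p.2^-1 * p.2^-1)) *: diag_mx p.1.
Proof.
move=> z0; have D := has_diff_mul (has_diff_inv z0) (has_diff_diag p).
have D' : has_diff (fun q : P => q.2^-1 *: diag_mx q.1) p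
    (fun h => p.2^-1 *: diag_mx h.1 - (h.2 * (p.2^-1 * p.2^-1)) *: diag_mx p.1).
  apply: has_diff_eq ltr01 _ _ D => [y _|v]; first exact: mul_scalar_mx.
  by rewrite !mul_scalar_mx scaleNr.
exact: (has_diffP D').2.
Qed.

End ProductDifferentials.

Section ProductRule.
Variables (F : comPzRingType) (n : nat).
Local Notation M := 'M[F]_n.

(** The left-hand side has the exact shape produced by composing the rules for [has_diff]; scalars
    appear as scalar matrices because the only product rule used is the one for matrices. *)
Lemma dform_product (z a b : F) (L Hu Hv N X D : M) (S := z%:M : M)
    (S' := (- (a * (z * z)))%:M : M) (B := b%:M : M) :
  - (S *m 0 + S' *m Hv)
  + ((B *m (S *m S)) *m Hu + (B *m (S *m S' + S' *m S) + 0 *m (S *m S)) *m L)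
  + ((B *m S) *m (0 + ((N *m Hu + X *m L) + - (L *m X + Hu *m N)))
     + (B *m S' + 0 *m S) *m (D + (N *m L + - (L *m N))))
  + - ((N *m 0 + X *m Hv) + - (Hv *m X + 0 *m N))
  = dform z a L (D + (N *m L - L *m N)) Hu (N *m Hu - Hu *m N) X b Hv.
Proof.
rewrite /S /S' /B !(mulmx0, mul0mx, add0r, addr0).
do 3!rewrite ?(mul_scalar_mx, mulmxDl, scalerDr) -?scalemxAl.
rewrite /dform !wordE ?word_lin ?scalerA.
words_ring.
Qed.

Lemma cform_product (z b : F) (L Hv N D : M) (S := z%:M : M) (B := b%:M : M) :
  - (S *m Hv) + (B *m (S *m S)) *m L + (B *m S) *m (D + (N *m L + - (L *m N)))
  + - (N *m Hv + - (Hv *m N))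
  = cform z L (D + (N *m L - L *m N)) b Hv (N *m Hv - Hv *m N).
Proof.
rewrite /S /B.
do 3!rewrite ?(mul_scalar_mx, mulmxDl, scalerDr) -?scalemxAl.
rewrite /cform !wordE ?word_lin ?scalerA.
words_ring.
Qed.

End ProductRule.

Section FlatConnection.
Variables (R : realType) (n : nat).
Local Notation C := R[i].
Local Notation T := 'rV[C]_n.
Local Notation P := (T * C)%type.
Local Notation M := 'M[C]_n.
Variables (d : T) (O : set T) (N : nat -> T -> M).
Hypothesis N_sol : hsol d O N.

(** The sign turns [lie (diag_mx h)] of this matrix into [N_1, diag h], which is [gam]; the diagonal
    part of N_1 commutes with [diag_mx h] and does not contribute. *)
Definition offdiag t : M := diag_part (N 1 t) - N 1 t.

Lemma diag_part_diag (A : M) (h : T) : diag_part A *m diag_mx h = diag_mx h *m diag_part A.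
Proof.
apply/matrixP => i j; rewrite mul_mx_diag mul_diag_mx !mxE.
by case: eqP => [->|_]; rewrite ?mulr0 ?mul0r 1?mulrC.
Qed.

Lemma lie_offdiag t h : lie (diag_mx h) (offdiag t) = gam (N 1 t) h.
Proof.
rewrite /lie /offdiag /gam mulmxBr mulmxBl diag_part_diag opprB addrC addrA addrNK.
by [].
Qed.

Let V t := diag_mx d + (N 1 t *m diag_mx t - diag_mx t *m N 1 t).

Lemma deformedE (p v : P) : p.2 != 0 ->
  deformed_connection offdiag (diag_mx d) p v =
  cform p.2^-1 (diag_mx p.1) (V p.1) v.2 (diag_mx v.1) (gam (N 1 p.1) v.1).
Proof.
move=> z0; rewrite /deformed_connection dLambda_over_z// dLambda !lie_offdiag /dz_over_z.
rewrite lie_offdiag /cform /V /gam [_ + diag_mx d]addrC opprB.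
by rewrite [_ - _ *: diag_mx v.1]addrC.
Qed.

Lemma deformed_has_diff (p v : P) : O p.1 -> p.2 != 0 ->
  has_diff ((deformed_connection offdiag (diag_mx d))^~ v) p
    (fun u => dform p.2^-1 u.2 (diag_mx p.1) (V p.1) (diag_mx u.1) (gam (N 1 p.1) u.1)
       (md (N 1) p.1 u.1) v.2 (diag_mx v.1)).
Proof.
move=> Op z0; have [[s s0 uN] _] := N_sol Op.
have hN := has_diff_fst s0 (uN 1).
have hS := has_diff_inv (n := n) z0; have hL := has_diff_diag p.
have hc (A : M) := has_diff_cst A p.
have h1 := has_diffN (has_diff_mul hS (hc (diag_mx v.1))).
have h2 := has_diff_mul (has_diff_mul (hc v.2%:M) (has_diff_mul hS hS)) hL.
have hV := has_diffD (hc (diag_mx d)) (has_diffD (has_diff_mul hN hL) (has_diffN (has_diff_mul hL hN))).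
have h3 := has_diff_mul (has_diff_mul (hc v.2%:M) hS) hV.
have h4 := has_diffN (has_diffD (has_diff_mul hN (hc (diag_mx v.1)))
  (has_diffN (has_diff_mul (hc (diag_mx v.1)) hN))).
have m0 : 0 < nm p.2 by rewrite nm_gt0.
apply: has_diff_eq m0 _ _ (has_diffD (has_diffD (has_diffD h1 h2) h3) h4) => [y hy|u]; last first.
  exact: dform_product.
have y0 : y.2 != 0.
  have e : p.2 - (p.2 - y.2) = y.2 by rewrite opprB addrC subrK.
  rewrite -nm_gt0; have := nm_ge_sub p.2 (p.2 - y.2).
  have : nm (p.2 - y.2) < nm p.2 by rewrite nmC; exact: le_lt_trans (nm_snd (y - p)) hy.
  by rewrite e => lt; apply: lt_le_trans; rewrite subr_gt0.
by rewrite deformedE//; exact: cform_product.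
Qed.

Lemma deformed_integrable : integrable_connection O (deformed_connection offdiag (diag_mx d)).
Proof.
split=> [v p [Op z0]|p u v [Op z0]].
  exact: (has_diffP (deformed_has_diff v Op z0)).1.
have [_ [[N0 fN] dN]] := N_sol Op.
have cd (x y : T) : diag_mx x *m diag_mx y = diag_mx y *m diag_mx x by exact: diag_mxC.
have eu := fN 1; have eX h := dN h 1.
have dv := (has_diffP (deformed_has_diff v Op z0)).2 u.
have du := (has_diffP (deformed_has_diff u Op z0)).2 v.
rewrite (eX u.1) in dv; rewrite (eX v.1) in du.
apply: etrans (congr2 +%R (congr2 (fun a b : M => a - b) dv du)
  (congr2 (fun a b : M => a *m b - b *m a) (deformedE u z0) (deformedE v z0))) _.
have e : word (diag_mx p.1) (N 2 p.1) + word (V p.1) (N 1 p.1) + N 1 p.1 =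
    word (N 2 p.1) (diag_mx p.1) + word (N 1 p.1) (diag_mx d).
  by move: eu; rewrite /fsol_eq scale1r.
apply: flat.
- exact: cd.
- exact: cd.
- exact: cd.
- exact: (@jacobi_residue _ _ (diag_mx d) (diag_mx p.1) (diag_mx u.1) (N 1%N p.1) (cd _ _) (cd _ _)).
- exact: (@jacobi_residue _ _ (diag_mx d) (diag_mx p.1) (diag_mx v.1) (N 1%N p.1) (cd _ _) (cd _ _)).
- exact: (@jacobi_gauge _ _ (diag_mx u.1) (diag_mx v.1) (N 1%N p.1) (cd _ _)).
- exact: (@zero_curvature _ _ (diag_mx u.1) (diag_mx v.1) (N 1%N p.1) (N 2%N p.1) (cd _ _)).
- exact: (@residue_derivative _ _ (diag_mx d) (diag_mx p.1) (diag_mx u.1) (N 1%N p.1) (N 2%N p.1) (cd _ _) (cd _ _) e).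
- exact: (@residue_derivative _ _ (diag_mx d) (diag_mx p.1) (diag_mx v.1) (N 1%N p.1) (N 2%N p.1) (cd _ _) (cd _ _) e).
Qed.

Lemma deformed_restrict t (A : M) z w : z != 0 -> V t = A ->
  restrict_at t (deformed_connection offdiag (diag_mx d)) z w = system_at t A z w.
Proof.
move=> z0 <-; rewrite /restrict_at deformedE// /cform /system_at /= /gam.
rewrite (_ : diag_mx 0 = 0); last by apply/matrixP => i j; rewrite !mxE mul0rn.
move: (V t) => B; rewrite !(mulmx0, mul0mx) !(subr0, scaler0, oppr0, add0r).
by rewrite [RHS]scalerDr scalerA mulrA.
Qed.

End FlatConnection.

(** * Formal equivalence with the diagonal connection *)

Section FormalEquivalence.
Variables (R : realType) (n : nat).
Local Notation C := R[i].
Local Notation T := 'rV[C]_n.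
Local Notation M := 'M[C]_n.
Local Notation rc := (real_complex R).

Lemma connected_bal (x : T) s : 0 < s -> connected (bal x s).
Proof.
move=> s0; pose g (y : T) (a : R) : T := x + rc a *: (y - x).
have nvg y a b : nv (g y a - g y b : T) = `|a - b| * nv (y - x : T).
  by rewrite /g opprD addrACA subrr add0r -scalerBl -rmorphB nvZ nmR.
have g0 y : g y 0 = x by rewrite /g rmorph0 scale0r addr0.
have g1 y : g y 1 = y by rewrite /g rmorph1 scale1r addrC subrK.
have -> : bal x s = \bigcup_(y in bal x s) (g y @` `[0, 1]).
  apply/seteqP; split => [y hy|z [y hy [a]]].
    by exists y => //; exists 1; [rewrite /= in_itv/= ler01 lexx|exact: g1].
  rewrite /= in_itv/= => /andP[a0 a1] <-.
  have e : nv (g y a - x : T) = a * nv (y - x : T) by rewrite -[X in _ - X](g0 y) nvg subr0 ger0_norm.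
  change (nv (g y a - x : T) < s); rewrite e.
  by apply: le_lt_trans hy; rewrite ler_piMl ?nv_ge0.
apply: bigcup_connected.
  by exists x => y hy; exists 0; [rewrite /= in_itv/= ler01 lexx|exact: g0].
move=> y _; apply: connected_continuous_connected (@segment_connected R 0 1) _.
apply: continuous_subspaceT => a A /nbhs_balP[r r0 rA].
have d0 : 0 < nv (y - x : T) + 1 by rewrite ltr_wpDl ?nv_ge0.
apply/nbhs_ballP; exists (r / (nv (y - x : T) + 1)); first exact: divr_gt0.
move=> b; rewrite -ball_normE /ball_/= => hb; apply: rA.
rewrite /bal/= nvC nvg; apply: le_lt_trans (_ : _ <= `|a - b| * (nv (y - x : T) + 1)) _.
  by rewrite ler_wpM2l// lerDl.
by rewrite -ltr_pdivlMr.
Qed.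

Lemma finite_expansion (a : nat -> M) (B : M) (z : C) : (forall k, a k.+3 = 0) ->
  a 0 + z *: a 1 + z ^+ 2 *: a 2 = B -> series (fun k => z ^+ k *: a k) @ \oo --> B.
Proof.
move=> a0 <-; apply: cvg_near_cst; exists 3 => // k /= hk.
rewrite -(subnKC hk) /series/= big_mkord !add3n 3!big_ord_recl/= big1 ?addr0.
  by rewrite expr0 scale1r expr1 addrA.
by move=> j _; rewrite /= a0 scaler0.
Qed.

Lemma sum_head3 (f : nat -> M) k : (forall j, f j.+3 = 0) ->
  \sum_(j < k.+3) f j = f 0 + f 1 + f 2.
Proof.
by move=> f0; rewrite 3!big_ord_recl/= big1 ?addr0 ?addrA// => j _; exact: f0.
Qed.

(** After multiplication by z^2, both connections are polynomials of degree at most 2 in z. *)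
Definition expansion3 (A0 A1 A2 : T -> T * C -> M) (k : nat) : T -> T * C -> M :=
  match k with 0 => A0 | 1 => A1 | 2 => A2 | _ => fun _ _ => 0 end.

Variables (d : T) (O : set T) (N : nat -> T -> M).
Hypothesis N_sol : hsol d O N.
Hypothesis O_open : forall x, O x -> exists2 s : R, 0 < s & bal x s `<=` O.

Let V t := diag_mx d + (N 1 t *m diag_mx t - diag_mx t *m N 1 t).

Lemma cform_expansion (z b : C) (L W H g : M) : z != 0 ->
  b *: L + z *: (b *: W - H) + z ^+ 2 *: - g = z ^+ 2 *: cform z^-1 L W b H g.
Proof.
by move=> z0; rewrite /cform; apply/matrixP => i j; rewrite !mxE; field.
Qed.

Lemma step0 (b : C) (L : M) : 0 + b *: L *m 1%:M = 1%:M *m (b *: L).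
Proof. by rewrite add0r mulmx1 mul1mx. Qed.

Lemma step1 (b : C) (L D H X : M) :
  0 + (b *: L *m X + (b *: (D + (X *m L - L *m X)) - H) *m 1%:M)
  = X *m (b *: L) + 1%:M *m (b *: D - H).
Proof.
rewrite mulmx1 mul1mx -scalemxAl -scalemxAr.
by move: (X *m L) (L *m X) => x y; apply/matrixP => i j; rewrite !mxE; ring.
Qed.

(** The coefficient of z^(k+2): the terms in b, the component along z, are the equation of index k +
    1 of the formal solution, and the others are the equation for the differential of N_k. *)
Lemma step2 (b c : C) (L W D H g X0 X1 X2 Y : M) :
  L *m X2 + W *m X1 + c *: X1 = X2 *m L + X1 *m D ->
  Y = g *m X0 + (H *m X1 - X1 *m H) ->
  Y + (c * b) *: X1 + (b *: L *m X2 + (b *: W - H) *m X1 + (- g) *m X0)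
  = X2 *m (b *: L) + X1 *m (b *: D - H) + X0 *m 0.
Proof.
move=> e ->; rewrite mulmx0 addr0 mulmxBl mulmxBr mulNmx -!scalemxAl -!scalemxAr.
have {}e : b *: (L *m X2 + W *m X1 + c *: X1) = b *: (X2 *m L + X1 *m D) by rewrite e.
move: e; move: (L *m X2) (W *m X1) (X2 *m L) (X1 *m D) (g *m X0) (H *m X1) (X1 *m H).
move=> x1 x2 x3 x4 x5 x6 x7 /matrixP e; apply/matrixP => i j; have := e i j; rewrite !mxE => {}e.
have -> : b * x3 i j + (b * x4 i j - x7 i j) = b * (x3 i j + x4 i j) - x7 i j by ring.
rewrite -e; ring.
Qed.

Lemma deformed_formal : formally_equivalent O
  (deformed_connection (offdiag N) (diag_mx d)) (diagonal_connection (diag_mx d)).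
Proof.
move=> x Ox; have [s s0 sO] := O_open Ox.
exists (bal x s), N, 2,
  (expansion3 (fun t v => v.2 *: diag_mx t) (fun t v => v.2 *: V t - diag_mx v.1)
     (fun t v => - gam (N 1 t) v.1)),
  (expansion3 (fun t v => v.2 *: diag_mx t) (fun t v => v.2 *: diag_mx d - diag_mx v.1)
     (fun t v => 0)).
split.
- by split=> //; [exact: open_bal|exact: bal_center].
- split=> [k y hy|t ht].
    have [[r r0 uN] _] := N_sol (sO y hy).
    exact: (munif_differentiable (uN k) (bal_center y r0)).1.
  by have [_ [[N0 _] _]] := N_sol (sO t ht); rewrite N0 unitmx1.
- move=> t v ht; near=> z.
  have z0 : z != 0 by near: z; exact: nbhs_dnbhs_neq.
  apply: finite_expansion => //=; rewrite (@deformedE R n d N (t, z) v z0).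
  exact: cform_expansion.
- move=> t v ht; near=> z.
  have z0 : z != 0 by near: z; exact: nbhs_dnbhs_neq.
  apply: finite_expansion => //=.
  rewrite -[0 in LHS]oppr0 (cform_expansion _ _ _ _ _ z0); congr (_ *: _).
  rewrite /diagonal_connection (@dLambda_over_z R n (t, z) v z0) /cform subr0 /dz_over_z/=.
  by rewrite opprB [_ - _ *: diag_mx v.1]addrC.
move=> k t v ht; have [_ [[N0 fN] dN]] := N_sol (sO t ht).
case: k => [|[|k]].
- by rewrite !big_ord1 /= subn0 N0; exact: step0.
- by rewrite !big_ord_recl !big_ord0 /= !addr0 N0; exact: step1.
rewrite (sum_head3 (f := fun j => expansion3 _ _ _ j t v *m N (k.+2 - j) t)); last first.
  by move=> j; rewrite mul0mx.
rewrite (sum_head3 (f := fun j => N (k.+2 - j) t *m expansion3 _ _ _ j t v)); last first.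
  by move=> j; rewrite mulmx0.
rewrite /= !subSS !subn0; apply: step2; first exact: (fN k.+1).
have [[r r0 uN] _] := N_sol (sO t ht).
by apply: etrans ((munif_differentiable (uN k) (bal_center t r0)).2 v.1) _; exact: dN.
Unshelve. all: by end_near. Qed.

End FormalEquivalence.

Lemma diag_part_row (R : realType) n (A : 'M[R[i]]_n) : diag_part A = diag_mx (\row_i A i i).
Proof. by apply/matrixP => i j; rewrite !mxE; case: eqP => [->|_]; rewrite ?mulr1n. Qed.

Lemma im_ad_block (R : realType) n (q : 'rV[R[i]]_n) (A : 'M[R[i]]_n) i j :
  im_ad q (nondiag_part A) -> i != j -> q 0 i = q 0 j -> A i j = 0.
Proof.
move=> [B]; rewrite /lie mul_diag_mx mul_mx_diag => /matrixP/(_ i j); rewrite !mxE.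
by move=> e /negbTE ij qij; move: e; rewrite ij subr0 qij mulrC subrr.
Qed.

Lemma nonresonant_row (R : realType) n (q : 'rV[R[i]]_n) (A : 'M[R[i]]_n) :
  partially_nonresonant q (diag_part A) -> nonresonant q (\row_i A i i).
Proof.
move=> h i j qij k k0; have := h j i (esym qij) k%:Z; rewrite !mxE !eqxx.
by apply; rewrite eqz_nat -lt0n.
Qed.

Theorem theorem4p9 (R : realType) (n : nat)
    (to : 'rV[R[i]]_n) (rep : 'I_n -> 'I_n)
    (U : set 'rV[R[i]]_n) (A1 : 'M[R[i]]_n)
    (to_Delta : Delta to)
    (rep_choice : block_choice to rep)
    (U_open : open U) (U_connected : connected U) (U_to : U to)
    (U_simply_connected : simply_connected R (U `&` stratum to))
    (U_star_shaped : star_shaped rep U)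
    (U_strata : forall s : 'rV[R[i]]_n,
       closure (stratum s) `&` stratum to = set0 ->
       U `&` closure (stratum s) = set0)
    (A1_nondiag : im_ad to (nondiag_part A1))
    (A1_diag : partially_nonresonant to (diag_part A1)) :
  exists (Theta : set 'rV[R[i]]_n) (F1 : 'rV[R[i]]_n -> 'M[R[i]]_n),
    [/\ hypersurface U Theta /\ ~ Theta to,
        holomorphic_on (U `\` Theta) F1 /\
        (forall t i, (U `\` Theta) t -> F1 t i i = 0),
        integrable_connection (U `\` Theta)
          (deformed_connection F1 (diag_part A1)),
        (forall z w : R[i], z != 0 ->
           restrict_at to (deformed_connection F1 (diag_part A1)) z w
           = system_at to A1 z w)
      & formally_equivalent (U `\` Theta)
          (deformed_connection F1 (diag_part A1))
          (diagonal_connection (diag_part A1))].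
Proof.
set d : 'rV[R[i]]_n := \row_i A1 i i.
have to_nonres : nonresonant to d := nonresonant_row A1_diag.
have A_diag i : A1 i i = d 0 i by rewrite mxE.
have A_block i j := @im_ad_block R n to A1 i j A1_nondiag.
have [G [G_sol G_res]] := formal_solution_exists A_block A_diag to_nonres.
have [Reg [N [N_sol [Reg_to N_to] Reg_loc]]] := global_solution rep_choice U_open U_to
  U_simply_connected U_star_shaped U_strata to_nonres G_sol.
have O_open x : (U `&` Reg) x -> exists2 s : R, 0 < s & bal x s `<=` U `&` Reg.
  move=> [Ux Rx]; have [s [f [s0 sU uf _ hf]]] := Reg_loc x Ux.
  have [s' s'0 [s's nz _]] := unif_inv s0 uf ((hf x (bal_center x s0)).1 Rx).
  by exists s' => // y hy; have hy' := bal_le s's hy; split; [exact: sU|apply/(hf y hy'); exact: nz].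
have UE : U `\` (U `\` Reg) = U `&` Reg.
  apply/seteqP; split => [x [Ux h]|x [Ux Rx]]; split => //; last by case.
  by apply: contrapT => Rx; apply: h.
exists (U `\` Reg), (offdiag N); rewrite UE diag_part_row -/d; split.
- split; last by case.
  split=> [x []//|x Ux]; have [s [f [s0 sU uf [y hy fy] hf]]] := Reg_loc x Ux.
  exists (bal x s), f; split.
  + by split; [exact: open_bal|exact: connected_bal|exact: bal_center|exact: sU].
  + by move=> z hz; exact: unif_differentiable uf hz.
  + by exists y.
  apply/seteqP; split=> z.
    move=> [[Uz Rz] hz]; split=> //; apply/eqP/negPn/negP => fz.
    by apply: Rz; apply/(hf z hz).
  move=> [hz fz]; split=> //; split; first exact: sU.
  by move=> /(hf z hz); rewrite fz eqxx.
- split=> [x Ox|t i _]; last by rewrite /offdiag !mxE eqxx subrr.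
  have [[s s0 uN] _] := N_sol x Ox.
  have uF : munif (bal x s) (offdiag N).
    move=> i j; case: (eqVneq i j) => [->|ij].
      by apply: unif_eq (unif_cst _ 0) => t _; rewrite /offdiag !mxE eqxx subrr.
    apply: unif_eq (unif_opp (uN 1%N i j)) => t _.
    by rewrite /offdiag !mxE (negbTE ij) sub0r.
  exact: (munif_differentiable uF (bal_center x s0)).1.
- exact: deformed_integrable N_sol.
- by move=> z w z0; apply: deformed_restrict => //; rewrite N_to.
exact: deformed_formal N_sol O_open.
Qed.
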